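(* Let $N \in \mathbb{N}$, $N\ge 1$, and let $\alpha \in ((N-4)^+, N)$, where $(N-4)^+=\max(N-4,0)$. Then there exists a weak solution $u \in H^1(\mathbb{R}^N)$ of the quadratic Choquard equation $$-\Delta u + u = \bigl(I_\alpha \ast |u|^2\bigr) u \quad \text{in } \mathbb{R}^N$$ such that $u^+ \neq 0 \neq u^-$ and $\mathcal{A}_2(u) = c_{\mathrm{nod},2}$.
   Context: All functions are real-valued. For $\alpha\in(0,N)$ the Riesz potential $I_\alpha:\mathbb{R}^N\to\mathbb{R}$ is defined for $x\in\mathbb{R}^N\setminus\{0\}$ by $$I_\alpha(x)=\frac{A_\alpha}{|x|^{N-\alpha}},\qquad A_\alpha=\frac{\Gamma(\frac{N-\alpha}{2})}{\Gamma(\frac{\alpha}{2})\,\pi^{N/2}\,2^{\alpha}},$$ and $\ast$ denotes convolution on $\mathbb{R}^N$. For a function $u$, $u^+=\max(u,0)$ and $u^-=\max(-u,0)$, so that $u=u^+-u^-$; ''$\neq 0$'' means not almost everywhere zero. The action functional $\mathcal{A}_2$ is defined for $u\in H^1(\mathbb{R}^N)$ by $$\mathcal{A}_2(u)=\frac12\int_{\mathbb{R}^N}\bigl(|\nabla u|^2+|u|^2\bigr)-\frac14\int_{\mathbb{R}^N}\bigl(I_\alpha\ast|u|^2\bigr)|u|^2 .$$ Under the hypothesis on $\alpha$ it is well-defined and continuously differentiable on $H^1(\mathbb{R}^N)$, with $$\langle\mathcal{A}_2'(u),\varphi\rangle=\int_{\mathbb{R}^N}\bigl(\nabla u\cdot\nabla\varphi+u\varphi\bigr)-\int_{\mathbb{R}^N}\bigl(I_\alpha\ast|u|^2\bigr)u\,\varphi\qquad(\varphi\in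 H^1(\mathbb{R}^N)).$$ A weak solution $u\in H^1(\mathbb{R}^N)$ of the equation is a function with $\mathcal{A}_2'(u)=0$. The Nehari nodal set is $$\mathcal{N}_{\mathrm{nod},2}=\bigl\{u\in H^1(\mathbb{R}^N): u^+\neq0\neq u^-,\ \langle\mathcal{A}_2'(u),u^+\rangle=0\text{ and }\langle\mathcal{A}_2'(u),u^-\rangle=0\bigr\},$$ and $$c_{\mathrm{nod},2}=\inf\{\mathcal{A}_2(u): u\in\mathcal{N}_{\mathrm{nod},2}\}.$$ *)

(* Defs.v *)
From HB Require Import structures.
From mathcomp Require Import all_boot all_order all_algebra.
From mathcomp Require Import all_classical all_reals all_analysis.

Set Implicit Arguments.
Unset Strict Implicit.
Unset Printing Implicit Defensive.

Import Order.TTheory GRing.Theory Num.Theory.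
Import numFieldNormedType.Exports.

Local Open Scope classical_set_scope.
Local Open Scope ring_scope.

(* R^N is 'rV[R]_N, whose library topology is the usual one.  It is given here
   the product sigma-algebra (the Borel one when T is the real line), in the
   same way as the library does for n.-tuple T. *)
Section measurable_rV.
Context {d} {T : measurableType d}.
Variable n : nat.

Let coors : 'I_n -> 'rV[T]_n -> T := fun i v => v ord0 i.

Let rV_set0 : g_sigma_preimage coors set0.
Proof. exact: sigma_algebra0. Qed.

Let rV_setC A : g_sigma_preimage coors A -> g_sigma_preimage coors (~` A).
Proof. exact: sigma_algebraC. Qed.

Let rV_bigcup (F : (set 'rV[T]_n)^nat) :
  (forall i, g_sigma_preimage coors (F i)) ->
  g_sigma_preimage coors (\bigcup_i (F i)).
Proof. exact: sigma_algebra_bigcup. Qed.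

HB.instance Definition _ := @isMeasurable.Build (measure_tuple_display d)
  'rV[T]_n (g_sigma_preimage coors) rV_set0 rV_setC rV_bigcup.

End measurable_rV.

Lemma measurable_coord d (T : measurableType d) n (i : 'I_n) :
  measurable_fun [set: 'rV[T]_n] (fun v : 'rV[T]_n => v ord0 i).
Proof.
move=> _ Y mY; rewrite setTI; apply: sub_sigma_algebra => /=.
rewrite -bigcup_seq/=; exists i => /=; first by rewrite mem_index_enum.
by exists Y => //; rewrite setTI.
Qed.

Lemma measurable_fun_rV d1 d2 (T1 : measurableType d1) (T2 : measurableType d2)
    n (f : T1 -> 'rV[T2]_n) :
  (forall i, measurable_fun [set: T1] (fun x => f x ord0 i)) ->
  measurable_fun [set: T1] f.
Proof.
move=> mf _ B mB.
suff : g_sigma_preimage (fun i (v : 'rV[T2]_n) => v ord0 i) `<=`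
    [set A | measurable ([set: T1] `&` f @^-1` A)] by exact.
apply: smallest_sub.
- split.
  + by rewrite /= preimage_set0 setI0.
  + move=> A /= mA; rewrite setTD -preimage_setC setTI.
    by apply: measurableC; move: mA; rewrite setTI.
  + move=> F /= mF; rewrite setTI preimage_bigcup.
    by apply: bigcupT_measurable => k; move: (mF k); rewrite setTI.
- move=> A; rewrite -bigcup_seq => -[i _] [Y mY <-] /=.
  by rewrite setTI; exact: mf.
Qed.

Section lebesgue_rV.
Context {R : realType}.

Definition rV_cons n (p : R * 'rV[R]_n) : 'rV[R]_n.+1 :=
  row_mx (const_mx p.1 : 'rV[R]_1) p.2.

Definition rV_uncons n (v : 'rV[R]_n.+1) : R * 'rV[R]_n :=
  (v ord0 ord0, \row_i v ord0 (lift ord0 i)).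

Lemma rV_consK n : cancel (@rV_cons n) (@rV_uncons n).
Proof.
move=> [x v]; rewrite /rV_uncons /rV_cons /=; congr (_, _).
  have -> : (ord0 : 'I_n.+1) = lshift n (ord0 : 'I_1) by apply: ord_inj.
  by apply: etrans (row_mxEl (const_mx x) v ord0 ord0) _; rewrite mxE.
apply/rowP => i; rewrite mxE.
have -> : lift ord0 i = rshift 1 i by apply: ord_inj.
exact: (row_mxEr (const_mx x : 'rV[R]_1) v ord0 i).
Qed.

Lemma measurable_rV_cons n :
  measurable_fun [set: R * 'rV[R]_n] (@rV_cons n).
Proof.
apply: measurable_fun_rV => i; rewrite /rV_cons.
have [->|[j ->]] : i = lshift n (ord0 : 'I_1) \/ exists j, i = rshift 1 j.
  by case: (split_ordP (i : 'I_(1 + n))) => j ->;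
    [left; rewrite ord1|right; exists j].
- rewrite [X in measurable_fun _ X](_ : _ = fst); first exact: measurable_fst.
  apply: funext => p.
  by apply: etrans (row_mxEl (const_mx p.1) p.2 ord0 ord0) _; rewrite mxE.
- rewrite [X in measurable_fun _ X](_ : _ =
      (fun v : 'rV[R]_n => v ord0 j) \o snd).
    exact: (measurableT_comp (measurable_coord j) measurable_snd).
  apply: funext => p.
  exact: (row_mxEr (const_mx p.1 : 'rV[R]_1) p.2 ord0 j).
Qed.

Lemma measurable_rV_uncons n :
  measurable_fun [set: 'rV[R]_n.+1] (@rV_uncons n).
Proof.
apply/measurable_fun_pair; first exact: measurable_coord.
apply: measurable_fun_rV => i; under eq_fun do rewrite mxE.
exact: measurable_coord.
Qed.

Section step.
Variables (n : nat) (mu : {sigma_finite_measure set 'rV[R]_n -> \bar R}).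

Definition lebesgue_rV_step : set 'rV[R]_n.+1 -> \bar R :=
  pushforward (@lebesgue_measure R \x mu)%E (@rV_cons n).

Let step0 : lebesgue_rV_step set0 = 0%E.
Proof. by rewrite /lebesgue_rV_step /pushforward preimage_set0 measure0. Qed.

Let step_ge0 A : (0 <= lebesgue_rV_step A)%E.
Proof. by rewrite /lebesgue_rV_step /pushforward; exact: measure_ge0. Qed.

Let step_sigma_additive : semi_sigma_additive lebesgue_rV_step.
Proof.
apply: measure_semi_sigma_additive; exact: measurable_rV_cons.
Qed.

HB.instance Definition _ := isMeasure.Build _ _ _ lebesgue_rV_step
  step0 step_ge0 step_sigma_additive.

Let step_sigma_finite : sigma_finite setT lebesgue_rV_step.
Proof.
have /sigma_finiteP[F [TF ndF Foo]] := sigma_finiteT (@lebesgue_measure R).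
have /sigma_finiteP[G [TG ndG Goo]] := sigma_finiteT mu.
exists (fun k => @rV_uncons n @^-1` (F k `*` G k)).
  apply/seteqP; split=> // v _.
  have [i _ Fi] : (\bigcup_i F i) (rV_uncons v).1 by rewrite -TF.
  have [j _ Gj] : (\bigcup_i G i) (rV_uncons v).2 by rewrite -TG.
  exists (maxn i j) => //; split.
  - by move: Fi; exact/subsetPset/ndF/leq_maxl.
  - by move: Gj; exact/subsetPset/ndG/leq_maxr.
move=> k; have [mF Fk] := Foo k; have [mG Gk] := Goo k; split.
  rewrite -[X in measurable X]setTI.
  by apply: measurable_rV_uncons => //; exact: measurableX.
rewrite /lebesgue_rV_step /pushforward -comp_preimage.
rewrite (_ : @rV_uncons n \o @rV_cons n = id); last first.
  by apply: funext => p /=; rewrite rV_consK.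
by rewrite preimage_id product_measure1E// lte_mul_pinfty// ge0_fin_numE.
Qed.

HB.instance Definition _ := Measure_isSigmaFinite.Build _ _ _ lebesgue_rV_step
  step_sigma_finite.

End step.

(* Lebesgue measure on R^n: the n-fold product of the Lebesgue measure on R. *)
Fixpoint lebesgue_rV n : {sigma_finite_measure set 'rV[R]_n -> \bar R} :=
  if n is n'.+1 then lebesgue_rV_step (lebesgue_rV n')
  else \d_(0 : 'rV[R]_0).

Lemma lebesgue_rV_box n (A : 'I_n -> set R) :
  (forall i, measurable (A i : set (measurableTypeR R))) ->
  lebesgue_rV n [set v | forall i, A i (v ord0 i)] =
  (\prod_(i < n) @lebesgue_measure R (A i))%E.
Proof.
elim: n A => [|n IHn] A mA /=.
  rewrite big_ord0 diracE mem_set //=; by case.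
have mB : measurable [set v : 'rV[R]_n | forall i, A (lift ord0 i) (v ord0 i)].
  rewrite (_ : mkset _ = \bigcap_(i in [set: 'I_n])
      ((fun v : 'rV[R]_n => v ord0 i) @^-1` A (lift ord0 i))).
    apply: fin_bigcap_measurable => // i _.
    rewrite -[X in measurable X]setTI.
    by apply: measurable_coord => //; exact: mA.
  by apply/seteqP; split=> v /= h i; [move=> _|]; exact: h.
rewrite big_ord_recl -IHn // /lebesgue_rV_step /pushforward.
have mA0 := mA ord0.
rewrite -product_measure1E //.
congr product_measure1; apply/seteqP; split=> -[x v] /= h.
- have [xE /rowP vE] := rV_consK (x, v); split=> [|i].
    by have := h ord0; rewrite xE.
  by have := h (lift ord0 i); have := vE i; rewrite mxE => ->.
- have [xE /rowP vE] := rV_consK (x, v); have [h0 hS] := h => i.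
  case: (unliftP ord0 i) => [j ->|->]; last by rewrite xE.
  by have := vE j; rewrite mxE => ->; exact: hS.
Qed.

End lebesgue_rV.

Section sobolev.
Context {R : realType} {N : nat}.
Implicit Types (u v f g phi : 'rV[R]_N -> R) (x y : 'rV[R]_N) (i : 'I_N).

Local Notation mu := (@lebesgue_rV R N).

(* The library norm on 'rV[R]_N is the max norm, hence this definition. *)
Definition enorm x : R := Num.sqrt (\sum_(i < N) x ord0 i ^+ 2).

Definition partial i f : 'rV[R]_N -> R := 'D_(delta_mx ord0 i) f.

Definition smooth f := forall s : seq 'I_N,
  let g := foldr partial f s in
  continuous g /\ forall i x, derivable g x (delta_mx ord0 i).

Definition test_function phi :=
  smooth phi /\ compact (closure [set x | phi x != 0]).

(* Elements of L^2 and H^1 are represented by Borel functions, not by classes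
   modulo almost everywhere equality. *)
Definition L2 f := f \in Lfun mu 2%:E.

Definition weak_partial i u g := forall phi, test_function phi ->
  \int[mu]_x (u x * partial i phi x) = - \int[mu]_x (g x * phi x).

Definition H1 u :=
  L2 u /\ forall i, exists g, L2 g /\ weak_partial i u g.

(* A representative of the i-th weak derivative of u; for u in H^1 it is
   determined up to a Lebesgue-null set. *)
Definition wgrad u i : 'rV[R]_N -> R :=
  xget (cst 0) [set g | L2 g /\ weak_partial i u g].

Definition ae_zero f := {ae mu, forall x, f x = 0}.

Definition Euler_Gamma (s : R) : R :=
  \int[@lebesgue_measure R]_(t in `]0, +oo[) (t `^ (s - 1) * expR (- t)).

Definition riesz_const (alpha : R) : R :=
  Euler_Gamma ((N%:R - alpha) / 2) /
  (Euler_Gamma (alpha / 2) * pi `^ (N%:R / 2) * 2 `^ alpha).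

(* Only the values off the origin matter; by convention the value at 0 is 0
   when alpha < N. *)
Definition riesz (alpha : R) x : R :=
  riesz_const alpha / enorm x `^ (N%:R - alpha).

(* For f = riesz alpha with 0 < alpha < N and g integrable, the integral
   converges for almost every x; Rintegral returns 0 at the other points. *)
Definition convolution f g x : R := \int[mu]_y (f (x - y) * g y).

Definition action (alpha : R) u : R :=
  1 / 2 * \int[mu]_x ((\sum_(i < N) wgrad u i x ^+ 2) + `|u x| ^+ 2)
  - 1 / 4 * \int[mu]_x
      (convolution (riesz alpha) (fun y => `|u y| ^+ 2) x * `|u x| ^+ 2).

(* daction alpha u phi is the value <A'(u), phi> of the differential of the
   action A. *)
Definition daction (alpha : R) u phi : R :=
  \int[mu]_x ((\sum_(i < N) wgrad u i x * wgrad phi i x) + u x * phi x)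
  - \int[mu]_x
      (convolution (riesz alpha) (fun y => `|u y| ^+ 2) x * u x * phi x).

Definition weak_solution (alpha : R) u :=
  H1 u /\ forall phi, H1 phi -> daction alpha u phi = 0.

Definition nehari_nod (alpha : R) : set ('rV[R]_N -> R) :=
  [set u | [/\ H1 u, ~ ae_zero u^\+ /\ ~ ae_zero u^\-,
    daction alpha u u^\+ = 0 & daction alpha u u^\- = 0]].

(* Taken in \bar R so that no junk value arises for an empty or unbounded set. *)
Definition c_nod (alpha : R) : \bar R :=
  ereal_inf [set (action alpha u)%:E | u in nehari_nod alpha].

End sobolev.

(* Main.v *)
(* Write g = N - alpha and DD(f, h) for the Riesz energy of two densities, a
   positive semidefinite form.  The energy DD(f, f) is minimized over the
   densities f >= 0 such that |u|_{H^1}^2 <= DD(f, u^2) on a plane of H^1, i.e.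
   the second eigenvalue of - Laplacian + 1 with weight I_alpha * f is at most 1.
   For v in the Nehari nodal set v^2 is such a density, the plane being spanned
   by v^+ and v^-, and DD(v^2, v^2) is 4 times the action of v; so it suffices
   that the minimum is reached at f = U^2 for a sign-changing solution U.
   - By the maximum principle a second eigenfunction changes sign, and f can be
     replaced by a combination of the squares of its positive and negative parts.
   - Let M be the best constant in DD(u^2, u^2) <= M |u|^4 and w an extremal.  The
     infimum is less than 2 / M: take two distant truncated copies of w. Their
     interaction, of order R^-g, beats the truncation error, of order R^-4; this
     is where alpha > N - 4 is used.  Hence a minimizing sequence does not split
     in two parts, each of which would cost at least 1 / M.
   - At a minimizer f with second eigenfunction u, the multipliers obtained by
     moving the nodal set of u show that f and tau u^2 represent the same element
     of the energy space, unless u^+ is itself an eigenfunction, which the maximum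
     principle excludes.  Then U = sqrt(tau) u solves the equation. *)
Require Import Defs.
From HB Require Import structures.
From mathcomp Require Import all_boot all_order all_algebra.
From mathcomp Require Import all_classical all_reals all_analysis measurable_realfun.
From mathcomp Require Import ring lra.
Set Implicit Arguments.
Unset Strict Implicit.
Unset Printing Implicit Defensive.
Import Order.TTheory GRing.Theory Num.Theory.
Import numFieldNormedType.Exports.
Local Open Scope classical_set_scope.
Local Open Scope ring_scope.

Local Notation mfun f := (measurable_fun setT f).

(** Passing from functions to densities makes the objective a convex quadratic form and the
    constraint linear in f. On the Nehari nodal set itself the two parts attract each other: DD(t
    p^2 + s q^2, p^2) = |p|^2 and DD(t p^2 + s q^2, q^2) = |q|^2 may have no positive solution (t,
    s), so a pair p, q cannot always be scaled onto it. With inequalities this becomes a linear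
    complementarity problem that is always solvable, at the price of a multiplier that may vanish;
    equal multipliers are recovered only at the minimizer. No limit is taken in the energy space of
    densities: a density is first replaced by t p^2 + s q^2 with p, q of norm 1, and p, q converge
    weakly in H^1 along an ultrafilter. The constraint speaks of a plane, and not of two disjoint
    functions, because the remainders of p and q, which are not disjoint, must be able to compete.
    The bound g < 4 also gives the finiteness of DD on squares of H^1 functions, by one Hardy
    inequality per variable. *)

Section quadratic.
Context {R : realType}.

(** Evaluated at the vertex or, if [c = 0] and [b] is nonzero, at the point where the affine
    function equals -1. Cauchy-Schwarz, the orthogonality in [si_projection] and the Euler equation
    of [maximizer_eq] all come from it. *)
Lemma quad_ge0 (a b c : R) : 0 <= c ->
  (forall t, 0 <= a + 2 * t * b + t ^+ 2 * c) -> b ^+ 2 <= a * c.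
Proof.
move=> c0 H; have [c1|/eqP c1] := eqVneq c 0.
  rewrite c1 mulr0; have := H (- (a + 1) / (2 * b)); rewrite c1 mulr0 addr0.
  have [->|b0] := eqVneq b 0; first by rewrite expr0n.
  suff -> : a + 2 * (- (a + 1) / (2 * b)) * b = -1 by rewrite oppr_ge0 ler10.
  by field.
have {c1}c0 : 0 < c by rewrite lt_neqAle c0 eq_sym andbT; apply/eqP.
have := H (- b / c).
suff -> : a + 2 * (- b / c) * b + (- b / c) ^+ 2 * c = (a * c - b ^+ 2) / c.
  by rewrite pmulr_lge0 ?invr_gt0// subr_ge0.
by field; rewrite gt_eqF.
Qed.

(** The restriction to [e <= 1] lets errors of higher order in [e] be absorbed into a linear one. *)
Lemma le_eps (a b c : R) : (forall e : R, 0 < e -> e <= 1 -> a <= b + c * e) -> a <= b.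
Proof.
move=> H; apply/ler_addgt0Pr => e e0.
set d := Num.min 1 (e / (`|c| + 1)).
have c1 : 0 < `|c| + 1 by apply: ltr_wpDl.
have d0 : 0 < d by rewrite lt_min ltr01 divr_gt0.
apply: (le_trans (H d d0 _)); first by rewrite ge_min lexx.
rewrite lerD2l; apply: (@le_trans _ _ ((`|c| + 1) * d)).
  by rewrite ler_wpM2r ?(ltW d0)// ler_wpDr// ler_norm.
by rewrite mulrC -ler_pdivlMr// ge_min lexx orbT.
Qed.

End quadratic.

Section elementary_derivatives.
Context {R : realType}.

Lemma is_derive_addr (d s : R) : is_derive s (1 : R) (fun t : R => t + d) (1 : R).
Proof.
by apply: is_derive_eq (is_deriveD (is_derive_id s (1 : R)) (is_derive_cst d s (1 : R))) _; rewrite addr0.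
Qed.

Lemma is_derive_addl (d s : R) : is_derive s (1 : R) (fun t : R => d + t) (1 : R).
Proof.
by apply: is_derive_eq (is_deriveD (is_derive_cst d s (1 : R)) (is_derive_id s (1 : R))) _; rewrite add0r.
Qed.

End elementary_derivatives.

(** * Semi-inner products *)

Section semi_inner.
Context {R : realType} {V : lmodType R}.

(* A symmetric positive semidefinite form on the linear subspace P; it serves
   for L^2, H^1 and the Riesz energy alike. *)
Record semi_inner (P : V -> Prop) (b : V -> V -> R) : Prop := SemiInner {
  si0 : P 0;
  siD : forall u v, P u -> P v -> P (u + v);
  siZ : forall a u, P u -> P (a *: u);
  sibC : forall u v, P u -> P v -> b u v = b v u;
  sibDl : forall u v w, P u -> P v -> P w -> b (u + v) w = b u w + b v w;
  sibZl : forall a u w, P u -> P w -> b (a *: u) w = a * b u w;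
  sib_ge0 : forall u, P u -> 0 <= b u u }.

Variables (P : V -> Prop) (b : V -> V -> R).
Hypothesis H : semi_inner P b.
Implicit Types u v w : V.

Lemma siN u : P u -> P (- u).
Proof. by move=> Pu; rewrite -scaleN1r; exact: (siZ H). Qed.

Lemma siB u v : P u -> P v -> P (u - v).
Proof. by move=> Pu Pv; apply: (siD H) => //; exact: siN. Qed.

Lemma sibDr u v w : P u -> P v -> P w -> b w (u + v) = b w u + b w v.
Proof.
by move=> Pu Pv Pw; have Puv := siD H Pu Pv; rewrite !(sibC H Pw)// (sibDl H).
Qed.

Lemma sibZr a u w : P u -> P w -> b w (a *: u) = a * b w u.
Proof. by move=> Pu Pw; have Pau := siZ H a Pu; rewrite !(sibC H Pw)// (sibZl H). Qed.

Lemma sibNl u w : P u -> P w -> b (- u) w = - b u w.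
Proof. by move=> Pu Pw; rewrite -scaleN1r (sibZl H)// mulN1r. Qed.

Lemma sibNr u w : P u -> P w -> b w (- u) = - b w u.
Proof. by move=> Pu Pw; rewrite -scaleN1r sibZr// mulN1r. Qed.

Lemma sibBl u v w : P u -> P v -> P w -> b (u - v) w = b u w - b v w.
Proof. by move=> Pu Pv Pw; rewrite (sibDl H)// ?sibNl//; exact: siN. Qed.

Lemma sibBr u v w : P u -> P v -> P w -> b w (u - v) = b w u - b w v.
Proof. by move=> Pu Pv Pw; rewrite sibDr// ?sibNr//; exact: siN. Qed.

Lemma sib0l w : P w -> b 0 w = 0.
Proof. by move=> Pw; rewrite -(scale0r w) (sibZl H)// mul0r. Qed.

Lemma sib0r w : P w -> b w 0 = 0.
Proof. by move=> Pw; rewrite (sibC H)//; [exact: sib0l|exact: (si0 H)]. Qed.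

Lemma sib_sqrD u v : P u -> P v ->
  b (u + v) (u + v) = b u u + 2 * b u v + b v v.
Proof.
move=> Pu Pv; have Puv := siD H Pu Pv.
by rewrite (sibDl H)// !sibDr// (sibC H Pv Pu); ring.
Qed.

Lemma sib_sqrZ a u : P u -> b (a *: u) (a *: u) = a ^+ 2 * b u u.
Proof.
by move=> Pu; have Pau := siZ H a Pu; rewrite (sibZl H)// sibZr// mulrA.
Qed.

Lemma sib_sqrB u v : P u -> P v ->
  b (u - v) (u - v) = b u u - 2 * b u v + b v v.
Proof.
move=> Pu Pv; have Pv' := siN Pv.
by rewrite sib_sqrD// sibNr// sibNl// sibNr//; ring.
Qed.

Lemma sib_CS u v : P u -> P v -> b u v ^+ 2 <= b u u * b v v.
Proof.
move=> Pu Pv; apply: quad_ge0 => [|t]; first exact: (sib_ge0 H).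
have Ptv := siZ H t Pv.
have := sib_ge0 H (siD H Pu Ptv).
by rewrite sib_sqrD// sib_sqrZ// sibZr// mulrA.
Qed.

Lemma sib_parallelogram u v : P u -> P v ->
  b (u + v) (u + v) + b (u - v) (u - v) = 2 * b u u + 2 * b v v.
Proof. by move=> Pu Pv; rewrite sib_sqrD// sib_sqrB//; ring. Qed.

Lemma sib_sqrD_le u v : P u -> P v ->
  b (u + v) (u + v) <= 2 * b u u + 2 * b v v.
Proof.
move=> Pu Pv; rewrite -sib_parallelogram// lerDl; apply: (sib_ge0 H).
exact: siB.
Qed.

Definition sinorm u := Num.sqrt (b u u).

Lemma sinorm_ge0 u : 0 <= sinorm u.
Proof. exact: sqrtr_ge0. Qed.

Lemma sinorm_sqr u : P u -> sinorm u ^+ 2 = b u u.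
Proof. by move=> Pu; rewrite sqr_sqrtr//; exact: (sib_ge0 H). Qed.

Lemma sib_CSn u v : P u -> P v -> `|b u v| <= sinorm u * sinorm v.
Proof.
move=> Pu Pv; rewrite -sqrtr_sqr -sqrtrM ?(sib_ge0 H)//.
by apply: ler_wsqrtr; exact: sib_CS.
Qed.

Lemma sinormD u v : P u -> P v -> sinorm (u + v) <= sinorm u + sinorm v.
Proof.
move=> Pu Pv; rewrite -(ler_pXn2r (_ : 0 < 2)%N) ?nnegrE ?addr_ge0 ?sinorm_ge0//.
rewrite sinorm_sqr ?sib_sqrD//; last exact: (siD H).
rewrite sqrrD !sinorm_sqr//.
have := le_trans (ler_norm _) (sib_CSn Pu Pv); lra.
Qed.

Lemma sinormZ a u : P u -> sinorm (a *: u) = `|a| * sinorm u.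
Proof.
by move=> Pu; rewrite /sinorm sib_sqrZ// sqrtrM ?sqr_ge0// sqrtr_sqr.
Qed.

Lemma sinormN u : P u -> sinorm (- u) = sinorm u.
Proof. by move=> Pu; rewrite -scaleN1r sinormZ// normrN1 mul1r. Qed.

Lemma sinormB u v : P u -> P v -> sinorm (u - v) <= sinorm u + sinorm v.
Proof.
move=> Pu Pv; rewrite -[X in _ <= _ + X]sinormN//.
by apply: sinormD => //; exact: siN.
Qed.

Lemma sinorm_triangle u v w : P u -> P v -> P w ->
  sinorm (u - w) <= sinorm (u - v) + sinorm (v - w).
Proof.
move=> Pu Pv Pw; rewrite -[u - w](_ : (u - v) + (v - w) = _).
  by apply: sinormD; exact: siB.
by rewrite addrA subrK.
Qed.

Definition si_complete := forall u : nat -> V, (forall n, P (u n)) ->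
  (forall e : R, 0 < e -> exists N, forall n m, (N <= n)%N -> (N <= m)%N ->
    b (u n - u m) (u n - u m) <= e) ->
  exists2 v, P v & forall e : R, 0 < e -> exists N, forall n, (N <= n)%N ->
    b (u n - v) (u n - v) <= e.

Hypothesis Hc : si_complete.

Section projection.
Variable S : V -> Prop.
Hypotheses (SP : forall u, S u -> P u) (S0 : S 0)
  (SD : forall u v, S u -> S v -> S (u + v)) (SZ : forall a u, S u -> S (a *: u)).

(** [S] may fail to be closed, so the projection of [f] lies only in its closure: [r] is the
    orthogonal component, and [f - r] is approximated by elements of [S]. For test functions in L^2
    this reduces density to [r = 0]; for the kernel of a bounded functional it gives the Riesz
    representation. *)
Lemma si_projection f : P f -> exists r, [/\ P r,
  forall s, S s -> b r s = 0 &
  forall e : R, 0 < e -> exists s, S s /\ b (f - r - s) (f - r - s) <= e].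
Proof.
move=> Pf.
pose D := [set b (f - s) (f - s) | s in S].
have D0 : D !=set0 by exists (b (f - 0) (f - 0)), 0.
have Dlb : lbound D 0.
  by move=> _ [s Ss <-]; apply: (sib_ge0 H); apply: siB => //; exact: SP.
have hD : has_inf D by split=> //; exists 0.
have infD s : S s -> inf D <= b (f - s) (f - s).
  by move=> Ss; apply: ge_inf; [exists 0|exists s].
have /choice[s sP] (n : nat) : exists s, S s /\
    b (f - s) (f - s) <= inf D + n.+1%:R^-1.
  have n0 : 0 < n.+1%:R^-1 :> R by rewrite invr_gt0.
  have [_ [s Ss <-] sn] := inf_adherent n0 hD.
  by exists s; split=> //; exact: ltW.
have sS n : S (s n) by case: (sP n).
have Ps n : P (s n) by exact/SP.
have sn n : b (f - s n) (f - s n) <= inf D + n.+1%:R^-1 by case: (sP n).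
have small (e : R) : 0 < e -> exists N, forall n, (N <= n)%N -> n.+1%:R^-1 <= e :> R.
  move=> e0; have [N _ HN] := near_infty_natSinv_lt (PosNum e0).
  by exists N => n /HN /= /ltW.
have [|v Pv vP] := Hc Ps.
  move=> e e0; have [|N HN] := small (e / 4); first by rewrite divr_gt0.
  exists N => n m Nn Nm.
  pose h := 2^-1 *: (s n + s m).
  have Sh : S h by apply/SZ/SD.
  have Pfn n' : P (f - s n') by exact: siB.
  have := sib_parallelogram (Pfn n) (Pfn m).
  have -> : f - s n - (f - s m) = - (s n - s m).
    by rewrite opprB opprB addrC addrA subrK.
  have -> : f - s n + (f - s m) = 2 *: (f - h).
    rewrite scalerBr /h scalerA mulfV// scale1r scaler_nat mulr2n opprD.
    by rewrite addrACA.
  rewrite sib_sqrZ; last by apply: siB => //; exact: SP.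
  rewrite sibNl ?sibNr ?opprK; try exact: siB; last by apply/siN/siB.
  move: (infD _ Sh) (sn n) (sn m) (HN _ Nn) (HN _ Nm).
  move: n.+1%:R^-1 m.+1%:R^-1 => x y; lra.
exists (f - v); split=> [|t St|e e0]; first exact: siB.
- have Pt := SP St.
  (* [s n] minimizes the distance up to 1/(n+1); the polynomial in [a] obtained by moving it along
     [t] is therefore nonnegative once 1/(n+1) is added. *)
  have key n : b (f - s n) t ^+ 2 <= n.+1%:R^-1 * b t t.
    apply: quad_ge0 => [|a]; first exact: (sib_ge0 H).
    have := infD _ (SD (sS n) (SZ (- a) St)); rewrite scaleNr opprB addrCA addrC.
    rewrite [_ - _ + _](_ : _ = (f - s n) + a *: t); last by rewrite addrC.
    have Pfn : P (f - s n) by exact: siB.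
    have Pat := siZ H a Pt.
    by rewrite sib_sqrD// sib_sqrZ// sibZr//; move: n.+1%:R^-1 (sn n) => x; lra.
  apply/eqP; rewrite -sqrf_eq0 eq_le sqr_ge0 andbT.
  apply: (@le_eps _ _ _ (4 * b t t)) => e e0 _; rewrite add0r.
  have [N1 H1] := small e e0; have [N2 H2] := vP e e0.
  set n := maxn N1 N2.
  have -> : f - v = (f - s n) + (s n - v) by rewrite addrA subrK.
  have Pfn : P (f - s n) by exact: siB.
  have Psv : P (s n - v) by exact: siB.
  rewrite (sibDl H)//.
  have k1 := key n; have k2 := sib_CS Psv Pt.
  have h1 := H1 n (leq_maxl _ _); have h2 := H2 n (leq_maxr _ _).
  have tt := sib_ge0 H Pt.
  have : n.+1%:R^-1 * b t t <= e * b t t by rewrite ler_wpM2r.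
  have : b (s n - v) (s n - v) * b t t <= e * b t t by rewrite ler_wpM2r.
  have := sqr_ge0 (b (f - s n) t - b (s n - v) t).
  move: n.+1%:R^-1 k1 h1 k2 h2 => x; rewrite sqrrB sqrrD; lra.
- have [N HN] := vP e e0; exists (s N); split=> //.
  have -> : f - (f - v) - s N = - (s N - v) by rewrite subKr opprB.
  rewrite sibNl ?sibNr ?opprK; try exact: siB; last by apply/siN/siB.
  exact: HN.
Qed.

End projection.

(** The representative is a multiple of the component [r] of some [f] orthogonal to the kernel of
    [l]. The bound on [l] gives [l (f - r) = 0], as [f - r] is a limit of elements of the kernel;
    hence [l r = l f] is nonzero. *)
Lemma si_riesz (l : V -> R) (M : R) :
  (forall u v, P u -> P v -> l (u + v) = l u + l v) ->
  (forall a u, P u -> l (a *: u) = a * l u) ->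
  (forall u, P u -> `|l u| <= M * sinorm u) ->
  exists2 r, P r & forall v, P v -> l v = b r v.
Proof.
move=> lD lZ lM.
have [[f [Pf lf]]|nf] := pselect (exists f, P f /\ l f != 0); last first.
  exists 0 => [|v Pv]; first exact: (si0 H).
  rewrite sib0l//; apply: contrapT => /eqP lv; apply: nf.
  by exists v.
have l0 : l 0 = 0 by have := lZ 0 _ Pf; rewrite scale0r mul0r.
pose S u := P u /\ l u = 0.
have [r [Pr rS rf]] : exists r, [/\ P r, forall s, S s -> b r s = 0 &
    forall e : R, 0 < e -> exists s, S s /\ b (f - r - s) (f - r - s) <= e].
  apply: (si_projection _ _ _ _ Pf).
  - by move=> u [].
  - by split; [exact: (si0 H)|].
  - by move=> u v [Pu lu] [Pv lv]; split; [exact: (siD H)|rewrite lD// lu lv addr0].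
  - by move=> a u [Pu lu]; split; [exact: (siZ H)|rewrite lZ// lu mulr0].
have Pfr : P (f - r) by exact: siB.
have lNZ u : P u -> l (- u) = - l u by move=> Pu; rewrite -scaleN1r lZ// mulN1r.
have lfr : l (f - r) = 0.
  apply/eqP; rewrite -sqrf_eq0 eq_le sqr_ge0 andbT.
  apply: (@le_eps _ _ _ (M ^+ 2)) => e e0 _; rewrite add0r.
  have [s [[Ps ls] se]] := rf _ e0.
  have Pd : P (f - r - s) by exact: siB.
  have -> : l (f - r) = l (f - r - s).
    by rewrite [in RHS]lD ?lNZ ?ls ?oppr0 ?addr0//; exact: siN.
  rewrite -real_normK ?num_real//; apply: (@le_trans _ _ ((M * sinorm (f - r - s)) ^+ 2)).
    rewrite lerXn2r ?nnegrE//; last exact: lM.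
    exact: le_trans (lM _ Pd).
  by rewrite exprMn sinorm_sqr// ler_wpM2l ?sqr_ge0.
have lr : l r = l f.
  have : l f = l (f - r) + l r by rewrite -lD// subrK.
  by rewrite lfr add0r.
have rr : b r r != 0.
  apply/eqP => rr; move: (lM r Pr); rewrite /sinorm rr sqrtr0 mulr0 normr_le0 lr.
  by rewrite (negbTE lf).
exists ((l r / b r r) *: r) => [|v Pv]; first exact: (siZ H).
rewrite (sibZl H)//.
have Pc : P ((l v / l r) *: r) by exact: (siZ H).
have : b r (v - (l v / l r) *: r) = 0.
  apply: rS; split; first exact: siB.
  rewrite lD ?lNZ ?lZ//; last exact: siN.
  by rewrite divfK ?subrr// lr.
rewrite sibBr// sibZr// => /eqP; rewrite subr_eq0 => /eqP ->.
by rewrite lr; field; rewrite rr lf.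
Qed.

End semi_inner.

(** * Lebesgue integral and square-integrable functions *)

Section real_integrals.
Context d (T : measurableType d) (R : realType) (mu : {measure set T -> \bar R}).
Implicit Types (f g h : T -> R).

Definition intg f := mu.-integrable setT (EFin \o f).

Lemma intg_meas f : intg f -> mfun f.
Proof. by move=> /integrableP[/measurable_EFinP]. Qed.

Lemma intg_le f g : mfun f -> intg g ->
  (forall x, `|f x| <= g x) -> intg f.
Proof.
move=> mf ig fg; apply: (le_integrable measurableT _ _ ig).
  exact/measurable_EFinP.
by move=> x _ /=; rewrite lee_fin (le_trans (fg x))// ler_norm.
Qed.

Lemma intgD f g : intg f -> intg g -> intg (fun x => f x + g x).
Proof. by move=> fi gi; exact: (integrableD measurableT fi gi). Qed.

Lemma intgZ a f : intg f -> intg (fun x => a * f x).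
Proof. by move=> fi; exact: (integrableZl measurableT a fi). Qed.

Lemma intgB f g : intg f -> intg g -> intg (fun x => f x - g x).
Proof. by move=> fi gi; exact: (integrableB measurableT fi gi). Qed.

Lemma intg0 : intg (fun=> 0).
Proof. exact: (integrable0 mu setT). Qed.

Lemma intg_abs f : intg f -> intg (fun x => `|f x|).
Proof. by move=> fi; exact: (integrable_abse fi). Qed.

Lemma intg_sum (I : Type) (r : seq I) (F : I -> T -> R) :
  (forall i, intg (F i)) -> intg (fun x => \sum_(i <- r) F i x).
Proof.
move=> Fi; elim: r => [|i r IH].
  by under eq_fun do rewrite big_nil; exact: intg0.
by under eq_fun do rewrite big_cons; exact: intgD.
Qed.

Lemma ID f g : intg f -> intg g ->
  \int[mu]_x (f x + g x) = \int[mu]_x f x + \int[mu]_x g x.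
Proof. by move=> fi gi; exact: (RintegralD measurableT fi gi). Qed.

Lemma IB f g : intg f -> intg g ->
  \int[mu]_x (f x - g x) = \int[mu]_x f x - \int[mu]_x g x.
Proof. by move=> fi gi; exact: (RintegralB measurableT fi gi). Qed.

Lemma IZ a f : intg f -> \int[mu]_x (a * f x) = a * \int[mu]_x f x.
Proof. by move=> fi; exact: (RintegralZl _ measurableT fi). Qed.

Lemma Isum (I : Type) (r : seq I) (F : I -> T -> R) : (forall i, intg (F i)) ->
  \int[mu]_x (\sum_(i <- r) F i x) = \sum_(i <- r) \int[mu]_x F i x.
Proof.
move=> Fi; elim: r => [|i r IH].
  rewrite big_nil; under eq_Rintegral do rewrite big_nil.
  by rewrite Rintegral_cst// mul0r.
rewrite big_cons -IH -ID//; last exact: intg_sum.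
by apply: eq_Rintegral => x _; rewrite big_cons.
Qed.

Lemma I0 : \int[mu]_x (0 : R) = 0.
Proof. by rewrite Rintegral_cst// mul0r. Qed.

Lemma I_le f g : intg f -> intg g -> (forall x, f x <= g x) ->
  \int[mu]_x f x <= \int[mu]_x g x.
Proof. by move=> fi gi fg; apply: le_Rintegral. Qed.

Lemma I_ge0 f : (forall x, 0 <= f x) -> 0 <= \int[mu]_x f x.
Proof. by move=> f0; apply: Rintegral_ge0. Qed.

Lemma I_ae f g : mfun f -> mfun g ->
  {ae mu, forall x, f x = g x} -> \int[mu]_x f x = \int[mu]_x g x.
Proof.
move=> mf mg fg; rewrite /Rintegral; congr fine.
apply: ae_eq_integral => //; try exact/measurable_EFinP.
by apply: filterS fg => x -> _.
Qed.

Lemma EFin_I f : intg f -> (\int[mu]_x f x)%:E = (\int[mu]_x (f x)%:E)%E.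
Proof. by move=> fi; rewrite /Rintegral fineK// integrable_fin_num. Qed.

Lemma intg_ge0P f : mfun f -> (forall x, 0 <= f x) ->
  (\int[mu]_x (f x)%:E < +oo)%E -> intg f.
Proof.
move=> mf f0 fy; apply/integrableP; split; first exact/measurable_EFinP.
by under eq_integral do rewrite /= ger0_norm//.
Qed.

Lemma intg_ge0_lty f : (forall x, 0 <= f x) -> intg f ->
  (\int[mu]_x (f x)%:E < +oo)%E.
Proof. by move=> f0 fi; rewrite -EFin_I// ltry. Qed.

Lemma I_eq0_ae f : intg f -> (forall x, 0 <= f x) -> \int[mu]_x f x = 0 ->
  {ae mu, forall x, f x = 0}.
Proof.
move=> fi f0 If.
have : (\int[mu]_x `|(f x)%:E| = 0)%E.
  rewrite -[RHS]/(0%:E) -If EFin_I//; apply: eq_integral => x _ /=.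
  by rewrite ger0_norm.
move/(ae_eq_integral_abs mu measurableT (measurable_int _ fi)).
by apply: filterS => x /(_ I) /= [].
Qed.

Lemma intg_ae f g : mfun f -> intg g ->
  {ae mu, forall x, f x = g x} -> intg f.
Proof.
move=> mf gi fg; apply/integrableP; split; first exact/measurable_EFinP.
rewrite (@ae_eq_integral _ _ _ mu setT (fun x => `|(g x)%:E|%E))//.
- by case/integrableP : gi.
- by apply: measurableT_comp => //; exact/measurable_EFinP.
- by apply: measurableT_comp => //; exact: measurable_int gi.
- by apply: filterS fg => x fgx _ /=; rewrite fgx.
Qed.

Lemma ae_pos f : (forall x, 0 <= f x) -> mfun f ->
  (\int[mu]_x (f x)%:E = 0)%E -> {ae mu, forall x, f x = 0}.
Proof.
move=> f0 mf If; apply: I_eq0_ae => //; last by rewrite /Rintegral If.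
by apply: intg_ge0P => //; rewrite If.
Qed.

End real_integrals.

Section L2.
Context d (T : measurableType d) (R : realType) (mu : {measure set T -> \bar R}).
Implicit Types (f g h : T -> R).

Definition sqint f := f \in Lfun mu 2%:E.
Local Notation intg := (intg mu).

Lemma sqintP f : sqint f <-> mfun f /\ intg (fun x => f x ^+ 2).
Proof.
split=> [lf|[mf fi]].
  split; last exact: Lfun2_integrable_sqr lf.
  by move: lf; rewrite /sqint inE => /andP[]; rewrite inE.
rewrite /sqint inE; apply/andP; split; first by rewrite inE.
rewrite inE /= /finite_norm unlock /Lnorm.
apply: poweR_lty.
rewrite (_ : (\int[mu]_x _)%E = (\int[mu]_x ((f x ^+ 2)%:E))%E).
  by apply: intg_ge0_lty => // x; exact: sqr_ge0.
apply: eq_integral => x _ /=.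
by rewrite powR_mulrn// real_normK ?num_real.
Qed.

Lemma sqint_meas f : sqint f -> mfun f.
Proof. by move/sqintP => []. Qed.

Lemma sqint_intg f : sqint f -> intg (fun x => f x ^+ 2).
Proof. by move/sqintP => []. Qed.

Lemma sqint_le f g : mfun f -> sqint g ->
  (forall x, `|f x| <= `|g x|) -> sqint f.
Proof.
move=> mf /sqintP[mg gi] fg; apply/sqintP; split=> //.
apply: (intg_le _ gi); first exact: measurable_funX.
move=> x; rewrite ger0_norm ?sqr_ge0// -real_normK ?num_real//.
by rewrite -[leRHS]real_normK ?num_real// lerXn2r ?nnegrE.
Qed.

Lemma sqintM f g : sqint f -> sqint g -> intg (fun x => f x * g x).
Proof.
move=> /sqintP[mf fi] /sqintP[mg gi].
apply: (intg_le (measurable_funM mf mg) (intgD fi gi)) => x.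
rewrite normrM -real_normK ?num_real// -[g x ^+ 2]real_normK ?num_real//.
have := sqr_ge0 (`|f x| - `|g x|); have := normr_ge0 (f x).
by have := normr_ge0 (g x); nra.
Qed.

Lemma sqintD f g : sqint f -> sqint g -> sqint (f + g).
Proof.
move=> lf lg; have [mf fi] := (sqintP f).1 lf; have [mg gi] := (sqintP g).1 lg.
apply/sqintP; split; first exact: measurable_funD.
apply: (intg_le _ (intgZ 2 (intgD fi gi))).
  exact: measurable_funX (measurable_funD mf mg).
move=> x; rewrite ger0_norm ?sqr_ge0//.
rewrite !fctE.
by have := sqr_ge0 (f x - g x); nra.
Qed.

Lemma sqintZ a f : sqint f -> sqint (a *: f).
Proof.
move=> /sqintP[mf fi]; apply/sqintP; split.
  exact: (measurable_funM (measurable_cst a) mf).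
rewrite [X in intg X](_ : _ = fun x => a ^+ 2 * f x ^+ 2); last first.
    by apply: funext => x; rewrite exprMn.
exact: intgZ.
Qed.

Lemma sqint0 : sqint 0.
Proof.
apply/sqintP; split; first exact: measurable_cst.
by under eq_fun do rewrite expr0n /=; exact: intg0.
Qed.

Definition dotL f g := \int[mu]_x (f x * g x).

Lemma dotL_si : semi_inner sqint dotL.
Proof.
split; [exact: sqint0|exact: sqintD|exact: sqintZ|..].
- by move=> f g _ _; apply: eq_Rintegral => x _; rewrite mulrC.
- move=> f g h lf lg lh; rewrite /dotL -ID; try exact: sqintM.
  by apply: eq_Rintegral => x _; rewrite -mulrDl.
- move=> a f g lf lg; rewrite /dotL -IZ; last exact: sqintM.
  by apply: eq_Rintegral => x _; rewrite mulrA.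
- by move=> f lf; apply: I_ge0 => x; rewrite -expr2 sqr_ge0.
Qed.

Lemma dotLff f : dotL f f = \int[mu]_x (f x ^+ 2).
Proof. by apply: eq_Rintegral => x _; rewrite expr2. Qed.

Lemma EFin_dotL f : sqint f -> (dotL f f)%:E = (\int[mu]_x (f x ^+ 2)%:E)%E.
Proof. by move=> lf; rewrite dotLff EFin_I//; exact: sqint_intg. Qed.

Lemma dotL_eq0 f : sqint f -> dotL f f = 0 -> {ae mu, forall x, f x = 0}.
Proof.
move=> lf; rewrite dotLff => f0.
have := I_eq0_ae (sqint_intg lf) (fun x => sqr_ge0 (f x)) f0.
by apply: filterS => x /eqP; rewrite sqrf_eq0 => /eqP.
Qed.

Lemma sqint_ae f g : mfun f -> sqint g ->
  {ae mu, forall x, f x = g x} -> sqint f.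
Proof.
move=> mf lg fg; apply/sqintP; split=> //.
apply: (intg_ae _ (sqint_intg lg)); first exact: measurable_funX.
by apply: filterS fg => x ->.
Qed.

Lemma eq_dotL f f' g g' : sqint f -> sqint f' -> sqint g -> sqint g' ->
  {ae mu, forall x, f x = f' x} -> {ae mu, forall x, g x = g' x} ->
  dotL f g = dotL f' g'.
Proof.
move=> lf lf' lg lg' ff' gg'; apply: I_ae.
- by apply: measurable_funM; exact: sqint_meas.
- by apply: measurable_funM; exact: sqint_meas.
- by apply: filterS2 ff' gg' => x -> ->.
Qed.

Lemma sqint_bdM (b : T -> R) f (M : R) : mfun b -> (forall x, `|b x| <= M) ->
  sqint f -> sqint (fun x => b x * f x).
Proof.
move=> mb bM lf; apply: (sqint_le _ (sqintZ M lf)).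
  exact: measurable_funM mb (sqint_meas lf).
move=> x; rewrite normrM [leRHS]normrM ler_wpM2r//.
exact: le_trans (bM x) (ler_norm _).
Qed.

Lemma dotL_bdM (b : T -> R) f (M : R) : mfun b -> (forall x, `|b x| <= M) ->
  sqint f -> dotL (fun x => b x * f x) (fun x => b x * f x) <= M ^+ 2 * dotL f f.
Proof.
move=> mb bM lf; have lbf := sqint_bdM mb bM lf.
rewrite !dotLff -IZ; last exact: sqint_intg.
apply: I_le => [||x]; [exact: sqint_intg|exact/intgZ/sqint_intg|].
rewrite exprMn ler_wpM2r ?sqr_ge0// -real_normK ?num_real//.
by rewrite lerXn2r ?nnegrE// (le_trans _ (bM x)).
Qed.

Lemma dotL_le f g : sqint f -> sqint g -> (forall x, `|f x| <= `|g x|) ->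
  dotL f f <= dotL g g.
Proof.
move=> lf lg fg; rewrite !dotLff; apply: I_le; try exact: sqint_intg.
move=> x; rewrite -real_normK ?num_real// -[leRHS]real_normK ?num_real//.
by rewrite lerXn2r ?nnegrE.
Qed.

End L2.

Lemma measurable_limn_einf d (T : measurableType d) (R : realType)
    (f : nat -> T -> \bar R) : (forall k, mfun (f k)) ->
  mfun (fun x => limn_einf (f ^~ x)).
Proof.
move=> mf; rewrite (_ : (fun _ => _) =
    (fun x => (- limn_esup (fun k => - f k x))%E)); last first.
  by apply/funext => x; rewrite (limn_esupN (f ^~ x)) oppeK.
apply: measurableT_comp => //; apply: measurable_fun_limn_esup => k.
exact: measurableT_comp.
Qed.

(** * Completeness of L^2 and dominated convergence *)

Section L2_complete.
Context d (T : measurableType d) (R : realType) (mu : {measure set T -> \bar R}).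
Local Notation sqint := (sqint mu).
Local Notation dotL := (dotL mu).

Lemma nneseries_half_lt (v : nat -> \bar R) :
  (forall k, 0 <= v k)%E -> (forall k, v k <= (2^-1 ^+ k)%:E)%E ->
  (\sum_(0 <= k <oo) v k < +oo)%E.
Proof.
move=> v0 v2.
apply: (@le_lt_trans _ _ (\sum_(0 <= k <oo) (2 / (2 ^ (k + 0.+1))%:R)%:E)%E).
  apply: lee_nneseries => // k _; apply: le_trans (v2 k) _.
  rewrite lee_fin addn1 expnS natrM invfM mulrA mulfV// mul1r natrX exprVn//.
by rewrite (cvg_lim _ (@cvg_geometric_eseries_half R 2 0))// ltry.
Qed.

Lemma cvg_geometric_bound (x : nat -> R) (c : R) :
  (forall k, `|x k.+1 - x k| <= c * 2^-1 ^+ k) -> cvgn x.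
Proof.
move=> xc.
have : cvgn (series (telescope x)).
  apply: normed_cvg; apply: (@series_le_cvg _ _ (geometric c 2^-1)) => [k|k|k|].
  - exact: normr_ge0.
  - have := le_trans (normr_ge0 _) (xc k).
    by rewrite pmulr_lge0// => c0; rewrite mulr_ge0// exprn_ge0.
  - exact: xc.
  - by apply: is_cvg_geometric_series; rewrite ger0_norm// invf_lt1// ltr1n.
rewrite telescopeK => /cvg_ex[l xl]; apply/cvg_ex; exists (x 0%N + l).
have : x 0%N + (x n - x 0%N) @[n --> \oo] --> x 0%N + l.
  by apply: cvgD; [exact: cvg_cst|exact: xl].
rewrite [X in X @ _](_ : _ = x)//.
by apply/funext => n; rewrite addrC subrK.
Qed.

(** Riesz-Fischer: a fast subsequence converges almost everywhere, and Fatou's lemma turns the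
    Cauchy estimate into convergence of the whole sequence to the pointwise limit. *)
Lemma L2_complete : si_complete sqint dotL.
Proof.
move=> u lu uC.
have /choice[N NP] (k : nat) : exists N, forall n m, (N <= n)%N -> (N <= m)%N ->
    dotL (u n - u m) (u n - u m) <= 8^-1 ^+ k.
  by apply: uC; rewrite exprn_gt0.
(* The sum makes [phi] nondecreasing and at least [N k]; the term [k] sends it to infinity. *)
pose phi k := (k + \sum_(i < k.+1) N i)%N.
have phiS k : (phi k <= phi k.+1)%N by rewrite /phi leq_add// [leqRHS]big_ord_recr leq_addr.
have phiN k : (N k <= phi k)%N by rewrite /phi big_ord_recr addnA leq_addl.
have phik k : (k <= phi k)%N by rewrite leq_addr.
have phi_ge k j : (k <= j)%N -> (N k <= phi j)%N.
  move=> /subnK <-; elim: (j - k)%N => [|n IH]; first exact: phiN.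
  by rewrite addSn; exact: leq_trans IH (phiS _).
pose D k := u (phi k.+1) - u (phi k).
have lB n m : sqint (u n - u m) by apply: (siB (dotL_si mu)).
have lD k : sqint (D k) by exact: lB.
(* With squared distances at most 8^-k, the weight 4^k keeps the integral of [S] finite (terms
   2^-k), and finiteness of [S x] bounds the k-th increment by sqrt(S x) 2^-k. *)
pose S x := (\sum_(0 <= k <oo) (4 ^+ k * D k x ^+ 2)%:E)%E.
have term0 k x : (0 <= (4 ^+ k * D k x ^+ 2)%:E)%E.
  by rewrite lee_fin mulr_ge0 ?sqr_ge0 ?exprn_ge0.
have mterm k : mfun (fun x => (4 ^+ k * D k x ^+ 2)%:E).
  apply/measurable_EFinP/measurable_funM => //.
  by apply: measurable_funX; exact: sqint_meas (lD k).
have Sfin : {ae mu, forall x, S x \is a fin_num}.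
  have iS : mu.-integrable setT S.
    apply/integrableP; split.
      by apply: ge0_emeasurable_sum => // k x _ _; exact: term0.
    under eq_integral do rewrite gee0_abs ?nneseries_ge0//.
    rewrite integral_nneseries//; apply: nneseries_half_lt => k.
      by apply: integral_ge0 => x _; exact: term0.
    rewrite (eq_integral (fun x => ((4 ^+ k)%:E * (D k x ^+ 2)%:E)%E))//.
    rewrite ge0_integralZl_EFin ?exprn_ge0//; last first.
    - by apply/measurable_EFinP/measurable_funX/(sqint_meas (lD k)).
    - by move=> x _; rewrite lee_fin sqr_ge0.
    rewrite -EFin_dotL// -EFinM lee_fin.
    apply: (@le_trans _ _ (4 ^+ k * 8^-1 ^+ k)).
      by rewrite ler_wpM2l ?exprn_ge0//; apply: NP; exact: phi_ge.
    rewrite -exprMn lerXn2r ?nnegrE ?divr_ge0//; lra.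
  by have := integrable_ae measurableT iS; apply: filterS => x; exact.
(* The upper limit is measurable and defined everywhere, also on the null set where the subsequence
   diverges. *)
pose f x := fine (limn_esup (fun k => (u (phi k) x)%:E)).
have cvf : {ae mu, forall x, u (phi k) x @[k --> \oo] --> f x}.
  apply: filterS Sfin => x Sx.
  have : cvgn (fun k => u (phi k) x).
    apply: (@cvg_geometric_bound _ (Num.sqrt (fine (S x)))) => k.
    have S0 : (0 <= S x)%E by apply: nneseries_ge0 => k' _ _; exact: term0.
    have Sk : 4 ^+ k * D k x ^+ 2 <= fine (S x).
      rewrite -lee_fin fineK//.
      apply: le_trans (nneseries_lim_ge k.+1 (fun n _ _ => term0 n x)).
      by rewrite big_nat_recr//= leeDr// sume_ge0.
    rewrite -[`|_|]ger0_norm// -sqrtr_sqr.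
    have -> : 2^-1 ^+ k = Num.sqrt ((2^-1 ^+ k) ^+ 2) :> R.
      by rewrite sqrtr_sqr ger0_norm// exprn_ge0.
    rewrite -sqrtrM ?fine_ge0//; apply: ler_wsqrtr.
    rewrite real_normK ?num_real// -exprM mulnC exprM.
    rewrite [2^-1 ^+ 2](_ : _ = 4^-1); last by rewrite exprVn -natrX.
    by rewrite exprVn ler_pdivlMr ?exprn_gt0// mulrC.
  move=> /cvg_ex[l xl]; suff -> : f x = l by [].
  rewrite /f (cvg_limn_einf_sup (_ : _ --> l%:E)).2//.
  by apply: cvg_EFin => //; exact: nearW.
have mf : mfun f.
  apply: measurableT_comp => //; apply: measurable_fun_limn_esup => k.
  by apply/measurable_EFinP; exact: sqint_meas.
have msq m (g : T -> R) : mfun g ->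
    mfun (fun x => ((u m x - g x) ^+ 2)%:E).
  move=> mg; apply/measurable_EFinP/measurable_funX/measurable_funB => //.
  exact: sqint_meas (lu m).
have key (e : R) n : (forall m k, (n <= m)%N -> (n <= k)%N ->
      dotL (u m - u k) (u m - u k) <= e) -> forall m, (n <= m)%N ->
    (\int[mu]_x ((u m x - f x) ^+ 2)%:E <= e%:E)%E.
  move=> ne m nm.
  rewrite (@ae_eq_integral _ _ _ mu setT
    (fun x => limn_einf (fun k => ((u m x - u (phi k) x) ^+ 2)%:E))) //.
  - apply: le_trans (fatou mu measurableT _ _) _ => [k|k x _|].
    + exact: msq (sqint_meas (lu _)).
    + by rewrite lee_fin sqr_ge0.
    + rewrite limn_einf_lim; apply: lime_le; first exact: is_cvg_einfs.
      apply: nearW => k; apply: ge_ereal_inf.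
      exists (\int[mu]_x ((u m x - u (phi (maxn k n)) x) ^+ 2)%:E)%E.
        by exists (maxn k n) => //=; rewrite leq_maxl.
      rewrite -(EFin_dotL (lB _ _)) lee_fin; apply: ne => //.
      exact: leq_trans (leq_maxr _ _) (phik _).
  - exact: msq.
  - apply: measurable_limn_einf => k; exact: msq (sqint_meas (lu _)).
  - apply: filterS cvf => x xf _; apply/esym.
    apply: (cvg_limn_einf_sup _).1; apply: cvg_EFin; first exact: nearW.
    have : (u m x - u (phi k) x) ^+ 2 @[k --> \oo] --> (u m x - f x) ^+ 2.
      rewrite !expr2; apply: cvgM; (apply: cvgB; [exact: cvg_cst|exact: xf]).
    exact.
have lf : sqint f.
  have [M MP] := uC 1 ltr01.
  have k1 := key 1 M MP M (leqnn _).
  have lMf : sqint (u M - f).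
    apply/sqintP; split; first exact: measurable_funB (sqint_meas (lu _)) mf.
    apply: intg_ge0P => [|x|]; last exact: le_lt_trans k1 (ltry _).
    - by apply/measurable_EFinP; exact: msq.
    - exact: sqr_ge0.
  rewrite (_ : f = u M - (u M - f)); last by rewrite subKr.
  exact: (siB (dotL_si mu)).
exists f => // e e0; have [M MP] := uC e e0; exists M => n Mn.
rewrite -lee_fin EFin_dotL; last exact: (siB (dotL_si mu)).
exact: key MP n Mn.
Qed.

(** The square integrability of the limit is part of the conclusion: it inherits the dominating
    function almost everywhere. *)
Lemma L2_dct (u : nat -> T -> R) (f g : T -> R) :
  (forall n, mfun (u n)) -> mfun f -> sqint g ->
  (forall n x, `|u n x| <= g x) ->
  {ae mu, forall x, u n x @[n --> \oo] --> f x} ->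
  (forall n, sqint (u n - f)) /\ dotL (u n - f) (u n - f) @[n --> \oo] --> 0.
Proof.
move=> mu_ mf lg ug uf.
have fg : {ae mu, forall x, `|f x| <= g x}.
  apply: filterS uf => x ufx.
  have : `|u n x| @[n --> \oo] --> `|f x| by exact: cvg_norm.
  move/cvg_lim => <-//; apply: limr_le; last exact: nearW.
  by apply/cvg_ex; exists `|f x|; exact: cvg_norm.
have lun n : sqint (u n).
  by apply: (sqint_le (mu_ n) lg) => x; rewrite (le_trans (ug n x))// ler_norm.
have g0 x : 0 <= g x by apply: le_trans (normr_ge0 _) (ug 0%N x).
have lf : sqint f.
  apply/sqintP; split => //; apply: intg_ge0P => [|x|].
  - exact: measurable_funX.
  - exact: sqr_ge0.
  apply: (@le_lt_trans _ _ (\int[mu]_x (g x ^+ 2)%:E)%E); last first.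
    by apply: intg_ge0_lty (sqint_intg lg) => x; exact: sqr_ge0.
  apply: ae_ge0_le_integral => //.
  - by move=> x _; rewrite lee_fin sqr_ge0.
  - by apply/measurable_EFinP/measurable_funX.
  - by move=> x _; rewrite lee_fin sqr_ge0.
  - by apply/measurable_EFinP/measurable_funX; exact: sqint_meas lg.
  - apply: filterS fg => x fgx _; rewrite lee_fin -real_normK ?num_real//.
    by rewrite lerXn2r ?nnegrE.
have lB n : sqint (u n - f) by apply: (siB (dotL_si mu)).
split=> //.
have mg := sqint_meas lg.
have [] // := @dominated_convergence _ _ _ mu setT measurableT
  (fun n x => ((u n x - f x) ^+ 2)%:E) (cst 0%E) (fun x => (4 * g x ^+ 2)%:E).
- by move=> n; apply/measurable_EFinP/measurable_funX/measurable_funB.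
- apply: filterS uf => x ufx _.
  apply: cvg_EFin; first exact: nearW.
  have -> : 0 = (f x - f x) ^+ 2 :> R by rewrite subrr expr0n.
  by rewrite !expr2; apply: cvgM; (apply: cvgB; [exact: ufx|exact: cvg_cst]).
- exact: intgZ (sqint_intg lg).
- apply: filterS fg => x fgx n _; rewrite lee_fin normrX.
  rewrite (_ : 4 * g x ^+ 2 = (g x + g x) ^+ 2); last by ring.
  rewrite lerXn2r ?nnegrE ?addr_ge0//.
  by rewrite (le_trans (ler_normB _ _))// lerD.
- move=> _ _; rewrite integral0_eq//.
  move/fine_cvgP => [_]; rewrite [X in X @ _](_ : _ =
    (fun n => dotL (u n - f) (u n - f)))//.
Qed.

End L2_complete.

(** * Boxes, the product sigma-algebra and uniqueness of measures *)

Section boxes.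
Context {R : realType} {N : nat}.
Implicit Types (a b x y h : 'rV[R]_N).

Definition box a b := [set v : 'rV[R]_N | forall i, a ord0 i < v ord0 i < b ord0 i].

Lemma measurable_box a b : measurable (box a b).
Proof.
rewrite (_ : box a b = \bigcap_(i in [set: 'I_N])
    ((fun v : 'rV[R]_N => v ord0 i) @^-1` [set` `]a ord0 i, b ord0 i[])).
  apply: fin_bigcap_measurable => // i _.
  by rewrite -[X in measurable X]setTI; apply: measurable_coord.
apply/seteqP; split=> v /= vab i.
  by move=> _; rewrite /= in_itv /=; exact: vab.
by have := vab i I; rewrite /= in_itv.
Qed.

Lemma box_setI a b a' b' : box a b `&` box a' b' =
  box (\row_i Num.max (a ord0 i) (a' ord0 i)) (\row_i Num.min (b ord0 i) (b' ord0 i)).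
Proof.
apply/seteqP; split=> v /=.
  move=> [vab vab'] i; rewrite !mxE gt_max lt_min.
  by have /andP[-> ->] := vab i; have /andP[-> ->] := vab' i.
move=> vab; split=> i; have := vab i; rewrite !mxE gt_max lt_min;
  by move=> /andP[/andP[? ?] /andP[? ?]]; apply/andP.
Qed.

Definition cube (n : R) : set 'rV[R]_N := box (const_mx (- n)) (const_mx n).

Lemma cubeP n x : cube n x <-> forall i, `|x ord0 i| < n.
Proof.
by split=> H i; have := H i; rewrite !mxE ltr_norml.
Qed.

Lemma bigcup_cube : \bigcup_n cube n%:R = setT.
Proof.
apply/seteqP; split=> // x _.
exists (Num.truncn (\sum_i `|x ord0 i|)).+1 => //; apply/cubeP => i.
apply: le_lt_trans (truncnS_gt _); rewrite (bigD1 i)//= lerDl.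
by apply: sumr_ge0.
Qed.

Definition boxes := [set A : set 'rV[R]_N | exists a b, A = box a b].

(** The preimage of an open interval under a coordinate is the increasing union of boxes whose other
    sides are ]-n, n[. *)
Lemma measurable_boxes : @measurable _ 'rV[R]_N = <<s boxes >>.
Proof.
apply/seteqP; split; last first.
  apply: smallest_sub; first exact: sigma_algebra_measurable.
  by move=> _ [a [b ->]]; exact: measurable_box.
apply: smallest_sub; first exact: smallest_sigma_algebra.
rewrite -bigcup_seq => A [i _] [Y mY <-]; rewrite setTI.
suff : measurable `<=` [set Z : set R |
    <<s boxes >> ((fun v : 'rV[R]_N => v ord0 i) @^-1` Z)] by exact.
rewrite [X in X `<=` _](_ : _ = <<s @RGenOpens.G R >>); last first.
  exact: RGenOpens.measurableE.
apply: smallest_sub => [|_ [x [y ->]]].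
  split.
  - by rewrite /= preimage_set0; exact: sigma_algebra0.
  - move=> Z /= mZ; rewrite setTD preimage_setC -setTD.
    exact: sigma_algebraCD.
  - move=> F mF /=; rewrite preimage_bigcup; exact: sigma_algebra_bigcup.
rewrite /= (_ : _ @^-1` _ = \bigcup_n box
   (\row_j if j == i then x else - n%:R) (\row_j if j == i then y else n%:R)).
  apply: sigma_algebra_bigcup => n; apply: sub_sigma_algebra.
  by eexists; eexists.
apply/seteqP; split=> v /=; last first.
  by move=> [n _] /(_ i); rewrite !mxE eqxx /= in_itv.
rewrite in_itv /= => xy; have : setT v by [].
rewrite -bigcup_cube => -[n _] /cubeP vn; exists n => // j; rewrite !mxE.
by case: eqP => [->//|_]; rewrite -ltr_norml.
Qed.

Lemma box_unique (m1 m2 : {measure set 'rV[R]_N -> \bar R}) :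
  (forall a b, m1 (box a b) = m2 (box a b)) ->
  (forall n : nat, m1 (cube n%:R) < +oo)%E ->
  forall A, measurable A -> m1 A = m2 A.
Proof.
move=> m12 m1oo; apply: (measure_unique boxes (fun n => cube n%:R)).
- exact: measurable_boxes.
- by move=> _ _ [a [b ->]] [a' [b' ->]]; rewrite box_setI; eexists; eexists.
- by move=> n; eexists; eexists.
- exact: bigcup_cube.
- by move=> _ [a [b ->]]; exact: m12.
- exact: m1oo.
Qed.

Lemma nbhs_box x (A : set 'rV[R]_N) : nbhs x A ->
  exists2 e : R, 0 < e & box (x - const_mx e) (x + const_mx e) `<=` A.
Proof.
move=> /nbhs_ballP[e /= e0 eA]; exists e => // y yx; apply: eA.
split=> // i j; rewrite (ord1 i) -ball_normE /= distrC ltr_norml.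
by have := yx j; rewrite !mxE => /andP[? ?]; apply/andP; split; lra.
Qed.

(** The sigma-algebra is defined by coordinates and the topology by a norm. They are compared here:
    an open set is the union of the countably many rational boxes that it contains. *)
Lemma open_rV_measurable (U : set 'rV[R]_N) : open U -> measurable U.
Proof.
move=> oU.
pose B (p : {ffun 'I_N -> rat * rat}) : set 'rV[R]_N :=
  box (\row_i ratr (p i).1) (\row_i ratr (p i).2).
have -> : U = \bigcup_(p in [set p | B p `<=` U]) B p.
  apply/seteqP; split=> [x Ux|x [p pU]]; last exact: pU.
  have [e e0 eU] := nbhs_box (open_nbhs_nbhs (conj oU Ux)).
  have /choice[p pP] (i : 'I_N) : exists p : rat * rat,
      [/\ x ord0 i - e < ratr p.1, ratr p.1 < x ord0 i, x ord0 i < ratr p.2 &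
        ratr p.2 < x ord0 i + e].
    have [|q1] := @rat_in_itvoo _ (x ord0 i - e) (x ord0 i); first by rewrite gtrDl oppr_lt0.
    have [|q2] := @rat_in_itvoo _ (x ord0 i) (x ord0 i + e); first by rewrite ltrDl.
    by rewrite !in_itv /= => /andP[? ?] /andP[? ?]; exists (q1, q2).
  exists [ffun i => p i].
    move=> y yB; apply: eU => i; have := yB i; rewrite !mxE ffunE.
    by have [p1 p2 p3 p4] := pP i => /andP[y1 y2]; rewrite (lt_trans p1)// (lt_trans y2).
  by move=> i; rewrite !mxE ffunE; have [_ -> ->] := pP i.
rewrite bigcup_mkcond; apply: countable_bigcupT_measurable; first exact: countableP.
by move=> p; case: ifP => // _; exact: measurable_box.
Qed.

Lemma continuous_rV_measurable (f : 'rV[R]_N -> R) : continuous f ->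
  mfun f.
Proof.
move=> cf; apply: (measurability (@RGenOpens.G R)); first exact: RGenOpens.measurableE.
move=> _ [_ [x [y ->] <-]].
rewrite setTI; apply: open_rV_measurable.
by move/continuousP : cf; apply; exact: interval_open.
Qed.

End boxes.

Section measure_preserving.
Context d (T : measurableType d) (R : realType) (mu : {measure set T -> \bar R}).
Variable phi : T -> T.
Hypothesis mphi : mfun phi.
Hypothesis phimu : forall A, measurable A -> mu (phi @^-1` A) = mu A.

Lemma mp_ge0_integral (f : T -> \bar R) : mfun f ->
  (forall x, 0 <= f x)%E -> (\int[mu]_x f (phi x) = \int[mu]_x f x)%E.
Proof.
move=> mf f0.
have := ge0_integral_pushforward mphi mu measurableT mf (fun y _ => f0 y).
rewrite preimage_setT => <-; apply: eq_measure_integral => A mA _; exact: phimu.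
Qed.

Lemma mp_integral (f : T -> \bar R) : mfun f ->
  (\int[mu]_x f (phi x) = \int[mu]_x f x)%E.
Proof.
move=> mf; rewrite [LHS]integralE [RHS]integralE; congr (_ - _)%E.
- rewrite -(mp_ge0_integral (measurable_funepos mf) (funepos_ge0 f)).
  by apply: eq_integral => x _; rewrite !funeposE.
- rewrite -(mp_ge0_integral (measurable_funeneg mf) (funeneg_ge0 f)).
  by apply: eq_integral => x _; rewrite !funenegE.
Qed.

Lemma mp_Rintegral (f : T -> R) : mfun f ->
  \int[mu]_x f (phi x) = \int[mu]_x f x.
Proof.
by move=> mf; congr fine; apply: (mp_integral (f := EFin \o f)); exact/measurable_EFinP.
Qed.

Lemma mp_intg (f : T -> R) : intg mu f -> intg mu (fun x => f (phi x)).
Proof.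
move=> fi; have mf := intg_meas fi; apply/integrableP; split.
  by apply/measurable_EFinP/(measurableT_comp mf mphi).
rewrite (mp_ge0_integral (f := fun x => `|(f x)%:E|%E))//; last first.
  by apply: measurableT_comp => //; exact/measurable_EFinP.
by case/integrableP : fi.
Qed.

Lemma mp_sqint (f : T -> R) : sqint mu f -> sqint mu (fun x => f (phi x)).
Proof.
move=> /sqintP[mf fi]; apply/sqintP; split; first exact: measurableT_comp.
exact: (mp_intg fi).
Qed.

Lemma mp_dotL (f g : T -> R) : sqint mu f -> sqint mu g ->
  dotL mu (fun x => f (phi x)) (fun x => g (phi x)) = dotL mu f g.
Proof.
move=> lf lg; apply: (mp_Rintegral (f := fun x => f x * g x)).
exact: measurable_funM (sqint_meas lf) (sqint_meas lg).
Qed.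

Lemma mp_ae (P : T -> Prop) : {ae mu, forall x, P x} -> {ae mu, forall x, P (phi x)}.
Proof.
move=> [A [mA A0 PA]]; exists (phi @^-1` A); split.
- by rewrite -[X in measurable X]setTI; exact: mphi.
- by rewrite phimu.
- by move=> x /= Px; apply: PA.
Qed.

End measure_preserving.

Section density.
Context d (T : measurableType d) (R : realType) (mu : {measure set T -> \bar R}).
Variables (f : T -> \bar R) (mf : mfun f) (f0 : forall x, (0 <= f x)%E).

Definition density (A : set T) := (\int[mu]_(x in A) f x)%E.

Let density0 : density set0 = 0%E. Proof. exact: integral_set0. Qed.
Let density_ge0 A : (0 <= density A)%E.
Proof. by apply: integral_ge0 => x _; exact: f0. Qed.
Let density_sigma : semi_sigma_additive density.
Proof.
move=> F mF tF mUF; rewrite /density ge0_integral_bigcup//.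
- by apply: is_cvg_ereal_nneg_natsum => n _; exact: density_ge0.
- exact: measurable_funTS.
Qed.

HB.instance Definition _ := isMeasure.Build _ _ _ density density0 density_ge0 density_sigma.

End density.

Section lebesgue_rV_theory.
Context {R : realType} {N : nat}.
Implicit Types (a b x y h : 'rV[R]_N).
Local Notation mu := (@lebesgue_rV R N).

Lemma box_measure a b : mu (box a b) =
  (\prod_(i < N) (Num.max 0 (b ord0 i - a ord0 i))%:E)%E.
Proof.
rewrite (_ : box a b = [set v | forall i, [set` `]a ord0 i, b ord0 i[] (v ord0 i)]).
  rewrite (lebesgue_rV_box (A := fun i => [set` `]a ord0 i, b ord0 i[])); last first.
    by move=> i; exact: measurable_itv.
  apply: eq_bigr => i _; rewrite lebesgue_measure_itv /= lte_fin.
  case: ltP => ab; first by rewrite -EFinB max_r// subr_ge0 ltW.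
  by rewrite max_l// subr_le0.
by apply/seteqP; split=> v /= vab i; have := vab i; rewrite /= in_itv.
Qed.

Lemma prod_fin (F : 'I_N -> R) : (\prod_(i < N) (F i)%:E)%E = (\prod_(i < N) F i)%:E.
Proof. by elim/big_rec2 : _ => // i y1 y2 _ ->; rewrite EFinM. Qed.

Lemma box_measure_shift h a b : mu (box (a - h) (b - h)) = mu (box a b).
Proof.
rewrite !box_measure; apply: eq_bigr => i _; congr (Num.max _ _)%:E.
by rewrite !mxE; lra.
Qed.

Lemma box_lty a b : (mu (box a b) < +oo)%E.
Proof. by rewrite box_measure prod_fin ltry. Qed.

Lemma box_gt0 a b : (forall i, a ord0 i < b ord0 i) -> (0 < mu (box a b))%E.
Proof.
move=> ab; rewrite box_measure prod_fin lte_fin; apply: prodr_gt0 => i _.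
by rewrite lt_max subr_gt0 ab orbT.
Qed.

Lemma measurable_shift h : mfun (fun x => x + h).
Proof.
apply: measurable_fun_rV => i; under eq_fun do rewrite mxE.
by apply: measurable_funD => //; exact: measurable_coord.
Qed.

Lemma measurable_reflect : mfun (fun x : 'rV[R]_N => - x).
Proof.
apply: measurable_fun_rV => i; under eq_fun do rewrite mxE.
by apply: measurableT_comp => //; exact: measurable_coord.
Qed.

Lemma shift_measure h A : measurable A -> mu ((fun x => x + h) @^-1` A) = mu A.
Proof.
apply: (@box_unique _ _ (pushforward mu (fun x => x + h)) mu).
- exact: measurable_shift.
- move=> mh a b.
  rewrite [LHS](_ : _ = mu (box (a - h) (b - h))).
    exact: box_measure_shift.
  congr (mu _); apply/seteqP; split=> v /= vab i; have := vab i; rewrite !mxE;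
    by rewrite ltrBlDr ltrBrDr.
- move=> mh n.
  rewrite [X in (X < _)%E](_ : _ = mu (box (const_mx (- n%:R) - h) (const_mx n%:R - h))).
    exact: box_lty.
  congr (mu _); apply/seteqP; split=> v /= vab i; have := vab i; rewrite !mxE;
    by rewrite ltrBlDr ltrBrDr.
Qed.

(** On a cube, the positive and the negative part of [f] are densities of two finite measures that
    agree on boxes, hence on all measurable sets. Evaluating them on the set where one of the parts
    is positive, and so the other vanishes, shows that both parts are null. *)
Lemma boxes_eq0 (f : 'rV[R]_N -> R) : sqint mu f ->
  (forall a b, \int[mu]_(x in box a b) f x = 0) -> {ae mu, forall x, f x = 0}.
Proof.
move=> lf f0; have mf := sqint_meas lf.
have mfE : mfun (EFin \o f) by exact/measurable_EFinP.
have fib a b : mu.-integrable (box a b) (EFin \o f).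
  apply: (le_integrable (measurable_box a b) (f := EFin \o f)
    (g := fun x => (1 + f x ^+ 2)%:E)).
  - exact: measurable_funS mfE.
  - move=> x _ /=; rewrite lee_fin [leRHS]ger0_norm ?addr_ge0 ?sqr_ge0//.
    have := sqr_ge0 (`|f x| - 1); rewrite -(real_normK (num_real (f x))); nra.
  - rewrite (_ : (fun x => _) = (cst 1%:E \+ (fun x => (f x ^+ 2)%:E))%E)//.
    apply: (integrableD (measurable_box a b)).
      apply/integrableP; split => //.
      rewrite (_ : (fun x => _) = cst 1%:E).
        rewrite integral_cst ?mul1e; first exact: box_lty.
        exact: measurable_box.
      by apply/funext => x /=; rewrite normr1.
    by apply: integrableS (sqint_intg lf) => //; exact: measurable_box.
suff H (n : nat) : {ae mu, forall x, cube n%:R x -> f x = 0}.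
  have : {ae mu, forall x (n : nat), cube n%:R x -> f x = 0} by exact: ae_foralln.
  apply: filterS => x H'; have : setT x by [].
  by rewrite -bigcup_cube => -[n _]; exact: H'.
pose Q := @cube R N n%:R; have mQ : measurable Q by exact: measurable_box.
pose F := f \_ Q.
have iF : mu.-integrable setT (EFin \o F).
  have := (integrable_mkcond (EFin \o f) mQ).1 (fib _ _).
  by rewrite restrict_EFin.
have mFE := measurable_int _ iF.
have mF : mfun F by exact: intg_meas iF.
have p0 x := funepos_ge0 (EFin \o F) x; have n0 x := funeneg_ge0 (EFin \o F) x.
have eqpn A : measurable A ->
    density mu ((EFin \o F)^\+)%E A = density mu ((EFin \o F)^\-)%E A.
  apply: (@box_unique _ _ (density mu ((EFin \o F)^\+)%E) (density mu ((EFin \o F)^\-)%E)).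
  - exact: measurable_funepos.
  - exact: measurable_funeneg.
  - move=> ? ? a b.
    have iFab : mu.-integrable (box a b) (EFin \o F).
      by apply: integrableS iF => //; exact: measurable_box.
    have : (\int[mu]_(x in box a b) (EFin \o F) x = 0)%E.
      rewrite -restrict_EFin -integral_mkcondr setIC /Q /cube box_setI.
      set A0 := \row_i _; set B0 := \row_i _; have := f0 A0 B0.
      rewrite /Rintegral => /eqP; rewrite fine_eq0 ?integrable_fin_num//.
        by move/eqP.
      exact: measurable_box.
    have pf := integrable_pos_fin_num (measurable_box a b) iFab.
    have nf := integrable_neg_fin_num (measurable_box a b) iFab.
    rewrite integralE /density => /eqP; rewrite sube_eq//.
    by rewrite add0e => /eqP.
  - move=> ? k; apply: le_lt_trans (integrable_lty measurableT (integrable_funepos measurableT iF)).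
    by apply: ge0_subset_integral => //; exact: measurable_box.
have pn0 (u : 'rV[R]_N -> \bar R) : mfun u ->
    (forall x, 0 <= u x)%E -> density mu u [set x | 0 < u x]%E = 0%E ->
    {ae mu, forall x, u x = 0%E}.
  move=> mu_ u0 uP.
  have : (\int[mu]_x `|u x| = 0)%E.
    rewrite -uP /density [RHS]integral_mkcond /=.
    apply: eq_integral => x _; rewrite patchE gee0_abs//.
    case: ifPn => // /negP; rewrite inE /= => /negP; rewrite -leNgt => ux.
    by apply/eqP; rewrite eq_le ux u0.
  move/(ae_eq_integral_abs mu measurableT mu_).
  by apply: filterS => x; exact.
have mpos (u : 'rV[R]_N -> \bar R) : mfun u -> measurable [set x | 0 < u x]%E.
  by move=> mu_; rewrite -[X in measurable X]setTI; exact: emeasurable_fun_o_infty.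
have mFp := measurable_funepos mFE; have mFn := measurable_funeneg mFE.
have Fp : {ae mu, forall x, ((EFin \o F)^\+ x = 0)%E}.
  apply: pn0 => //; apply: etrans (eqpn _ (mpos _ mFp)) _.
  apply: integral0_eq => x /=; rewrite funeposE funenegE /= => Fx.
  apply/max_idPr; rewrite lee_fin oppr_le0.
  by move: Fx; rewrite lt_max ltxx orbF lte_fin => /ltW.
have Fn : {ae mu, forall x, ((EFin \o F)^\- x = 0)%E}.
  apply: pn0 => //; apply: etrans (esym (eqpn _ (mpos _ mFn))) _.
  apply: integral0_eq => x /=; rewrite funeposE funenegE /= => Fx.
  apply/max_idPr; rewrite lee_fin.
  by move: Fx; rewrite lt_max ltxx orbF lte_fin oppr_gt0 => /ltW.
apply: filterS2 Fp Fn => x; rewrite funeposE funenegE /= => Fp Fn Qx.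
have -> : f x = F x by rewrite /F patchE mem_set.
apply/eqP; rewrite eq_le; apply/andP; split.
  by move/max_idPr : Fp; rewrite lee_fin.
by move/max_idPr : Fn; rewrite lee_fin oppr_le0.
Qed.

End lebesgue_rV_theory.

(** * Smooth bump functions of one variable *)

Section smooth_bumps.
Context {R : realType}.
Implicit Types (f g : R -> R) (p : {poly R}).

Lemma is_derive_quadratic f (C : R) : (forall h, `|f h| <= C * h ^+ 2) ->
  is_derive (0 : R) (1 : R) f (0 : R).
Proof.
move=> fC; have f0 : f 0 = 0.
  by apply/eqP; rewrite -normr_le0; have := fC 0; rewrite expr0n mulr0.
apply/is_derive1_caratheodory; exists (fun z => f z / z); split.
- move=> z; rewrite f0 !subr0; have [->|z0] := eqVneq z 0; first by rewrite f0 !mulr0.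
  by rewrite divfK.
- apply/cvgrPdist_le => e e0.
  have C1 : 0 < `|C| + 1 by rewrite ltr_wpDl.
  have d0 : 0 < e / (`|C| + 1) by rewrite divr_gt0.
  near=> z; rewrite f0 mul0r sub0r normrN normrM.
  have [->|z0] := eqVneq z 0; first by rewrite invr0 normr0 mulr0 ltW.
  rewrite normfV ler_pdivrMr ?normr_gt0//; apply: le_trans (fC z) _.
  rewrite -(real_normK (num_real z)) expr2 mulrA ler_wpM2r//.
  apply: (@le_trans _ _ ((`|C| + 1) * `|z|)).
    by rewrite ler_wpM2r// ler_wpDr// ler_norm.
  rewrite mulrC -ler_pdivlMr//; near: z.
- by rewrite f0 mul0r.
Unshelve. all: end_near. Qed.

(** The flat function exp(-1/s), extended by 0, times a polynomial in 1/s. The family is closed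
    under derivation, [p] becoming X^2 (p - p'), which gives smoothness without computing higher
    derivatives. *)
Definition expinv p (s : R) : R := if 0 < s then p.[s^-1] * expR (- s^-1) else 0.

Lemma horner_le p (t : R) : 0 <= t ->
  `|p.[t]| <= (\sum_(i < size p) `|p`_i|) * (1 + t ^+ size p).
Proof.
move=> t0; rewrite horner_coef (le_trans (ler_norm_sum _ _ _))// big_distrl /=.
apply: ler_sum => i _; rewrite normrM ler_wpM2l// normrX ger0_norm//.
have [t1|t1] := leP t 1; first by rewrite (le_trans (exprn_ile1 _ t0 t1))// lerDl exprn_ge0.
by rewrite ler_wpDl//; apply: ler_weXn2l; [exact: ltW|exact: ltnW].
Qed.

(** The exponential series gives t^(n+2) / (n+2)! <= exp t; with t = 1/s this is t^n exp(-t) <=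
    (n+2)! s^2, used for the degrees 0 and [size p]. A quadratic bound is what differentiability at
    0 asks for. *)
Lemma expinv_quadratic p : exists C : R, forall s, `|expinv p s| <= C * s ^+ 2.
Proof.
set A := \sum_(i < size p) `|p`_i|.
have A0 : 0 <= A by apply: sumr_ge0.
exists (A * (2`!%:R + (size p).+2`!%:R)) => s; rewrite /expinv; case: ifPn => s0; last first.
  by rewrite normr0 mulr_ge0 ?sqr_ge0// mulr_ge0// addr_ge0.
have t0 : 0 < s^-1 by rewrite invr_gt0.
have key n : s^-1 ^+ n * expR (- s^-1) <= n.+2`!%:R * s ^+ 2.
  have := expR_ge1Dxn n.+1 (ltW t0) => H.
  have {}H : s^-1 ^+ n.+2 / n.+2`!%:R <= expR s^-1 by apply: le_trans H; rewrite lerDr.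
  rewrite expRN ler_pdivrMr ?expR_gt0// mulrAC -ler_pdivrMr; last first.
    by rewrite exprn_gt0.
  rewrite -ler_pdivrMl ?ltr0n ?fact_gt0//; apply: le_trans H.
  rewrite [leLHS]mulrC ler_wpM2r ?invr_ge0//.
  by rewrite -exprVn -exprD addn2.
rewrite normrM [`|expR _|]ger0_norm ?expR_ge0//.
apply: (le_trans (ler_wpM2r (expR_ge0 _) (horner_le p (ltW t0)))).
rewrite -!mulrA ler_wpM2l// mulrDl mulrDl lerD//.
by have := key 0%N; rewrite expr0.
Qed.

Lemma expinv_derive p (x : R) :
  is_derive x (1 : R) (expinv p) (expinv ('X^2 * (p - p^`())) x).
Proof.
have [x0|x0|->] := ltgtP x 0; last first.
- have [C HC] := expinv_quadratic p.
  by rewrite {2}/expinv ltxx; apply: (is_derive_quadratic (C := C)).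
- rewrite {2}/expinv x0.
  apply: (@near_eq_is_derive R R^o R^o (fun s => p.[s^-1] * expR (- s^-1))).
    near=> z; rewrite /expinv ifT//; near: z.
    by apply: lt_nbhsr.
  have xn0 : x != 0 by rewrite gt_eqF.
  have dV : is_derive x 1 (fun s : R => s^-1) (- x ^- 2).
    have := @is_deriveV _ _ x 1 1 xn0 (is_derive_id x 1).
    by move=> H; apply: is_derive_eq; rewrite scaler1 -exprVn.
  have dp : is_derive x 1 (fun s => p.[s^-1]) (p^`().[x^-1] * - x ^- 2).
    exact: (@is_derive1_comp _ (horner p) (fun s => s^-1)).
  have de : is_derive x 1 (fun s => expR (- s^-1)) (expR (- x^-1) * x ^- 2).
    have dN : is_derive x 1 (fun s : R => - s^-1) (x ^- 2).
      by apply: is_derive_eq; rewrite opprK.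
    exact: (@is_derive1_comp _ expR (fun s => - s^-1)).
  apply: is_derive_eq; rewrite hornerM hornerXn hornerD hornerN /=.
  rewrite -[_ *: _]/(_ * _) -[X in _ + X]/(_ * _) exprVn; ring.
- rewrite {2}/expinv ltNge (ltW x0) /=.
  apply: (@near_eq_is_derive R R^o R^o (cst 0)).
  near=> z; rewrite /expinv ifF//; apply/negbTE; rewrite -leNgt; near: z.
  by apply: lt_le_nbhsl.
Unshelve. all: end_near. Qed.

(** A class of functions that contains the bumps and is stable under derivation, so that a single
    derivation step proves smoothness of every order. *)
Inductive bumpy : (R -> R) -> Prop :=
| bumpy_exp p : bumpy (expinv p)
| bumpy_aff f a b : bumpy f -> bumpy (fun s => f (a * s + b))
| bumpy_scale c f : bumpy f -> bumpy (fun s => c * f s)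
| bumpy_add f g : bumpy f -> bumpy g -> bumpy (fun s => f s + g s)
| bumpy_mul f g : bumpy f -> bumpy g -> bumpy (fun s => f s * g s).

Lemma bumpy_derive f : bumpy f ->
  exists2 g, bumpy g & forall x : R, is_derive x (1 : R) f (g x).
Proof.
elim=> {f} [p|f a b _ [g bg fg]|c f _ [g bg fg]|f1 f2 b1 [g1 bg1 fg1] b2 [g2 bg2 fg2]
  |f1 f2 b1 [g1 bg1 fg1] b2 [g2 bg2 fg2]].
- by exists (expinv ('X^2 * (p - p^`()))); [exact: bumpy_exp|exact: expinv_derive].
- exists (fun s => a * g (a * s + b)); first exact/bumpy_scale/bumpy_aff.
  move=> x; have dl : is_derive x 1 (fun s : R => a * s + b) a.
    have dl : is_derive x 1 (a *: id + cst b : R -> R) a.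
      by apply: is_derive_eq; rewrite addr0 -[LHS]/(a * 1) mulr1.
    exact: dl.
  by rewrite mulrC; exact: (@is_derive1_comp _ f (fun s => a * s + b)).
- exists (fun s => c * g s); first exact: bumpy_scale.
  by move=> x; exact: (@is_deriveZ _ _ _ f c x 1 (g x)).
- exists (fun s => g1 s + g2 s); first exact: bumpy_add.
  by move=> x; exact: (@is_deriveD _ _ _ f1 f2).
- exists (fun s => f1 s * g2 s + f2 s * g1 s).
    by apply: bumpy_add; exact: bumpy_mul.
  by move=> x; exact: (@is_deriveM _ _ f1 f2).
Qed.

Lemma bumpy_continuous f : bumpy f -> continuous f.
Proof.
move=> /bumpy_derive[g _ fg] x.
apply: differentiable_continuous; apply/derivable1_diffP.
by have [] := fg x.
Qed.

(** Supported in [a, b]. The factor [k] stretches the argument of exp(-1/s), so that the bumps tend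
    to the indicator of ]a, b[ as [k] tends to infinity. *)
Definition bumpf (a b k s : R) : R :=
  expinv 1 (k * s - k * a) * expinv 1 (k * b - k * s).

Lemma bump_bumpy a b k : bumpy (bumpf a b k).
Proof.
apply: bumpy_mul; first exact: (@bumpy_aff _ k (- (k * a)) (bumpy_exp 1)).
rewrite (_ : (fun s => _) = fun s => expinv 1 ((- k) * s + k * b)).
  exact: bumpy_aff (bumpy_exp 1).
by apply/funext => s; rewrite mulNr addrC.
Qed.

Lemma expinv1_itv s : 0 <= expinv 1 s <= 1.
Proof.
rewrite /expinv; case: ifPn => s0; last by rewrite lexx ler01.
rewrite hornerC mul1r expR_ge0 -[leRHS]expR0 ler_expR oppr_le0.
by rewrite invr_ge0 ltW.
Qed.

Lemma bump_itv a b k s : 0 <= bumpf a b k s <= 1.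
Proof.
have /andP[h1 h2] := expinv1_itv (k * s - k * a).
have /andP[h3 h4] := expinv1_itv (k * b - k * s).
by rewrite mulr_ge0//= mulr_ile1.
Qed.

Lemma bump_out a b k s : 0 < k -> ~~ (a < s < b) -> bumpf a b k s = 0.
Proof.
move=> k0; rewrite negb_and -!leNgt /bumpf /expinv => /orP[sa|bs].
  by rewrite ifF ?mul0r// -mulrBr pmulr_rgt0// subr_gt0 ltNge sa.
by rewrite [X in _ * X]ifF ?mulr0// -mulrBr pmulr_rgt0// subr_gt0 ltNge bs.
Qed.

Lemma bump_cvg a b s : a < s < b -> bumpf a b k.+1%:R s @[k --> \oo] --> (1 : R).
Proof.
move=> /andP[sa sb].
have key (t : R) : 0 < t -> expinv 1 (k.+1%:R * t) @[k --> \oo] --> (1 : R).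
  move=> t0; rewrite (_ : (fun k => _) = fun k : nat => expR (- (k.+1%:R^-1 * t^-1))).
    have h : - (k.+1%:R^-1 * t^-1) @[k --> \oo] --> (0 : R).
      rewrite -[X in _ --> X]oppr0 -[X in _ --> - X](mul0r t^-1).
      by apply: cvgN; apply: cvgMl; exact: (@cvg_harmonic R).
    rewrite -[X in _ --> X]expR0; apply: continuous_cvg h.
    exact: continuous_expR.
  apply/funext => k; rewrite /expinv ifT ?mulr_gt0// hornerC mul1r invfM//.
rewrite -[X in _ --> X](mulr1 (1 : R)) /bumpf; apply: cvgM.
  by under eq_fun do rewrite -mulrBr; apply: key; rewrite subr_gt0.
by under eq_fun do rewrite -mulrBr; apply: key; rewrite subr_gt0.
Qed.

End smooth_bumps.

(** * Test functions and strong derivatives *)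

Section test_functions.
Context {R : realType} {N : nat}.
Implicit Types (x v : 'rV[R]_N) (f u g phi : 'rV[R]_N -> R) (i j : 'I_N).
Local Notation mu := (@lebesgue_rV R N).
Local Notation sqint := (sqint mu).
Local Notation dotL := (dotL mu).

Definition dirv i : 'rV[R]_N := delta_mx ord0 i.

(** Turns directional derivatives into ordinary ones, to which the chain rule and the mean value
    theorem on the line apply. *)
Lemma is_derive_line f x v (t d : R) :
  is_derive t (1 : R) (fun s : R => f (x + s *: v)) d <-> is_derive (x + t *: v) v f d.
Proof.
pose F (h : R) := h^-1 *: ((f \o shift (x + t *: v)) (h *: v) - f (x + t *: v)).
have E : (fun h : R => h^-1 *: (((fun s : R => f (x + s *: v)) \o shift t) (h *: (1 : R)) -
    (fun s : R => f (x + s *: v)) t)) = F.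
  apply/funext => h; rewrite /F /=; congr (_ *: (f _ - _)).
  by rewrite -[h *: 1]/(h * 1) mulr1 scalerDl addrCA.
split=> -[H1 H2]; apply: DeriveDef.
- by move: H1; rewrite /derivable E.
- by move: H2; rewrite /derive E.
- by rewrite /derivable E.
- by rewrite /derive E.
Qed.

Lemma foldr_partial_rcons phi s i :
  foldr partial (partial i phi) s = foldr partial phi (rcons s i).
Proof. by rewrite foldr_rcons. Qed.

Lemma smooth_partial phi i : smooth phi -> smooth (partial i phi).
Proof. by move=> sphi s; rewrite foldr_partial_rcons; exact: sphi. Qed.

Lemma smooth_continuous phi : smooth phi -> continuous phi.
Proof. by move=> sphi; exact: (sphi [::]).1. Qed.

Lemma smooth_derive phi i x : smooth phi -> is_derive x (dirv i) phi (partial i phi x).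
Proof. by move=> sphi; apply/derivableP; exact: (sphi [::]).2. Qed.

Lemma partial_out phi i : closure [set x | partial i phi x != 0] `<=`
  closure [set x | phi x != 0].
Proof.
set B := closure [set x | phi x != 0].
have cB : closed B by exact: closed_closure.
rewrite [X in _ `<=` X]((closure_id B).1 cB).
apply: closureS => x /=; apply: contraPP => nx; apply/negP; rewrite negbK.
have : \forall y \near x, phi y = cst 0 y.
  have : nbhs x (~` B) by apply: open_nbhs_nbhs; split => //; exact/closed_openC.
  apply: filterS => y yB; apply/eqP; apply: contrapT => /negP yn.
  by apply: yB; exact: subset_closure.
move=> E; have := @near_eq_is_derive _ _ _ (cst 0) phi x (dirv i) 0.
have E' : \forall y \near x, cst 0 y = phi y by apply: filterS E => y ->.
by move=> /(_ E' (is_derive_cst _ _ _))[_]; rewrite /partial /dirv => ->.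
Qed.

Lemma test_partial phi i : test_function phi -> test_function (partial i phi).
Proof.
move=> [sphi cphi]; split; first exact: smooth_partial.
apply: (subclosed_compact _ cphi); [exact: closed_closure|exact: partial_out].
Qed.

Lemma test_meas phi : test_function phi -> mfun phi.
Proof. by move=> [/smooth_continuous cphi _]; exact: continuous_rV_measurable. Qed.

Lemma rV_norm_coord x i : `|x ord0 i| <= `|x|.
Proof.
have /mapP[j Hj ->] : `|x ord0 i| \in [seq `|x y.1 y.2| | y : 'I_1 * 'I_N].
  by apply/mapP; exists (ord0, i) => //=; rewrite mem_enum.
by rewrite [leRHS]/Num.norm /= mx_normrE; apply/bigmax_geP; right => /=; exists j.
Qed.

Lemma rV_norm_le x (M : R) : 0 <= M -> (forall i, `|x ord0 i| <= M) -> `|x| <= M.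
Proof.
move=> M0 xM; rewrite [leLHS]/Num.norm /= mx_normrE; apply/bigmax_leP; split=> //.
by move=> [i j] _ /=; rewrite (ord1 i).
Qed.

Lemma testP phi : test_function phi <->
  smooth phi /\ exists2 r : R, 0 < r & forall x, phi x != 0 -> cube r x.
Proof.
split=> [[sphi /compact_bounded[M [_ HM]]]|[sphi [r r0 Hr]]]; split=> //.
- exists (Num.max 1 (M + 2)); first by rewrite lt_max ltr01.
  move=> x nx; apply/cubeP => i; apply: le_lt_trans (rV_norm_coord _ _) _.
  have : `|x| <= M + 1 by apply: HM; [rewrite ltrDl|exact: subset_closure].
  by rewrite lt_max => xM; apply/orP; right; apply: le_lt_trans xM _; rewrite ltrD2l ltr1n.
- apply: bounded_closed_compact; last exact: closed_closure.
  have cb : closed [set x : 'rV[R]_N | `|x| <= r].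
    apply: (@closed_comp _ _ (fun x : 'rV[R]_N => `|x|) [set y | y <= r]).
      by move=> x _; exact: norm_continuous.
    exact: closed_le.
  exists r; split; first exact: num_real.
  move=> M rM x xB; apply: le_trans (ltW rM).
  suff : [set x : 'rV[R]_N | `|x| <= r] x by [].
  rewrite ((closure_id _).1 cb); apply: closureS xB => y /= /Hr /cubeP yr.
  by apply: rV_norm_le => [|i]; exact: ltW.
Qed.

Lemma test_supp phi : test_function phi ->
  exists2 r : R, 0 < r & forall x, phi x != 0 -> cube r x.
Proof. by move=> /testP[]. Qed.

Lemma test_bounded phi : test_function phi ->
  exists2 M : R, 0 < M & forall x, `|phi x| <= M.
Proof.
move=> [/smooth_continuous cphi sphi].
have : compact [set phi x | x in closure [set x | phi x != 0]].
  by apply: continuous_compact => //; exact: continuous_subspaceT.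
move=> /compact_bounded[M [_ HM]].
exists (Num.max 1 (M + 1)); first by rewrite lt_max ltr01.
move=> x; have [->|nx] := eqVneq (phi x) 0; first by rewrite normr0 le_max ler01.
rewrite le_max (HM (M + 1)) ?orbT ?ltrDl//=; exists x => //.
exact: subset_closure.
Qed.

Lemma sqint_cube (r : R) : sqint (\1_(cube r)).
Proof.
have mc : measurable (cube r : set 'rV[R]_N) by exact: measurable_box.
have m1 : mfun (\1_(cube r) : 'rV[R]_N -> R) by exact: measurable_indic.
apply/sqintP; split => //; apply: intg_ge0P => [|x|].
- exact: measurable_funX.
- exact: sqr_ge0.
rewrite (eq_integral (fun x => (\1_(cube r) x)%:E)); last first.
  by move=> x _; rewrite indicE; case: (_ \in _); rewrite ?expr1n ?expr0n.
by rewrite integral_indic// setIT; exact: box_lty.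
Qed.

Lemma sqint_bounded_supp f (M r : R) : mfun f ->
  (forall x, `|f x| <= M) -> (forall x, f x != 0 -> cube r x) -> sqint f.
Proof.
move=> mf fM fr; apply: (sqint_le mf (sqintZ M (sqint_cube r))) => x.
have M0 : 0 <= M by apply: le_trans (fM x).
have [->|/fr xr] := eqVneq (f x) 0; first by rewrite normr0.
by rewrite [leRHS]normrM indicE mem_set// normr1 mulr1 (ger0_norm M0).
Qed.

Lemma test_sqint phi : test_function phi -> sqint phi.
Proof.
move=> tphi; have [M _ HM] := test_bounded tphi; have [r _ Hr] := test_supp tphi.
exact: sqint_bounded_supp (test_meas tphi) HM Hr.
Qed.

Lemma is_derive_shiftr f v i x d :
  is_derive (x + v) (dirv i) f d -> is_derive x (dirv i) (fun y => f (y + v)) d.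
Proof.
move=> /= fd; have := @is_derive_line (fun y => f (y + v)) x (dirv i) 0 d.
rewrite scale0r addr0 => <-.
have := @is_derive_line f (x + v) (dirv i) 0 d; rewrite scale0r addr0 => /iffRL /(_ fd).
by congr is_derive; apply/funext => s; rewrite addrAC.
Qed.

Lemma partial_shift f v i : (forall x, derivable f x (dirv i)) ->
  partial i (fun y => f (y + v)) = fun y => partial i f (y + v).
Proof.
move=> df; apply/funext => x.
have /derivableP fd := df (x + v).
by have [] := is_derive_shiftr fd.
Qed.

Lemma smooth_shift phi v : smooth phi -> smooth (fun x => phi (x + v)).
Proof.
move=> sphi s.
have -> : foldr partial (fun x => phi (x + v)) s = fun x => foldr partial phi s (x + v).
  elim: s => //= i s ->; rewrite partial_shift// => x.
  exact: (sphi s).2.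
split=> [x|i x].
  apply: (@continuous_comp _ _ _ (fun y : 'rV[R]_N => y + v) (foldr partial phi s)).
    rewrite /prop_for /continuous_at; exact: (cvgD cvg_id (cvg_cst v)).
  exact: (sphi s).1.
have /derivableP fd := (sphi s).2 i (x + v).
by have [] := is_derive_shiftr fd.
Qed.

Lemma cube_shift (r : R) x v : cube r (x + v) -> cube (r + `|v|) x.
Proof.
move=> /cubeP xr; apply/cubeP => i.
have := xr i; have := rV_norm_coord v i; rewrite !mxE.
have := ler_normB (x ord0 i + v ord0 i) (v ord0 i); rewrite addrK; lra.
Qed.

Lemma test_shift phi v : test_function phi -> test_function (fun x => phi (x + v)).
Proof.
move=> /testP[sphi [r r0 Hr]]; apply/testP; split; first exact: smooth_shift.
exists (r + `|v|); first by rewrite ltr_wpDr.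
by move=> x /Hr /cube_shift.
Qed.

Lemma sqint_shift u v : sqint u -> sqint (fun x => u (x + v)).
Proof. exact: (mp_sqint (measurable_shift v) (shift_measure v)). Qed.

Lemma dotL_shift u g v : sqint u -> sqint g ->
  dotL (fun x => u (x + v)) (fun x => g (x + v)) = dotL u g.
Proof. exact: (mp_dotL (measurable_shift v) (shift_measure v)). Qed.

Lemma dotL_shift_adj u g v : sqint u -> sqint g ->
  dotL (fun x => u (x + v)) g = dotL u (fun x => g (x - v)).
Proof.
move=> lu lg; rewrite -(dotL_shift v lu (sqint_shift (- v) lg)).
by congr dotL; apply/funext => x; rewrite addrK.
Qed.

Definition dq i (h : R) u : 'rV[R]_N -> R := fun x => h^-1 * (u (x + h *: dirv i) - u x).

Lemma sqint_dq i h u : sqint u -> sqint (dq i h u).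
Proof.
move=> lu; apply: (sqintZ h^-1); apply: (siB (dotL_si mu)) => //.
exact: sqint_shift.
Qed.

Lemma dotL_dq i (h : R) u (v : 'rV[R]_N -> R) : sqint u -> sqint v ->
  dotL (dq i h u) v = - dotL u (dq i (- h) v).
Proof.
move=> lu lv; have S := dotL_si mu.
rewrite [LHS](sibZl S) //; last first.
  by apply: (siB S) => //; exact: sqint_shift.
have -> : dq i (- h) v = (- h)^-1 *: ((fun x => v (x - h *: dirv i)) - v).
  by apply/funext => x; rewrite /dq scaleNr.
rewrite (sibZr S) //; last by apply: (siB S) => //; exact: sqint_shift.
rewrite (sibBl S) ?(sibBr S) ?dotL_shift_adj//; try exact: sqint_shift.
by rewrite invrN mulNr opprK.
Qed.

(** The strong derivative: the difference quotients converge to [g] in L^2. By [weak_sderiv] and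
    [sderiv_weak] it is equivalent to the weak derivative, but chain rules, products and translation
    estimates can be proved directly on difference quotients, without mollification. *)
Definition sderiv i u g := [/\ sqint u, sqint g &
  dotL (dq i h u - g) (dq i h u - g) @[h --> (0 : R)^'] --> (0 : R)].

Lemma mvt0 (F dF : R -> R) (k : R) :
  (forall t : R, is_derive t (1 : R) F (dF t)) ->
  exists2 c, `|c| <= `|k| & F k - F 0 = dF c * k.
Proof.
move=> FD; have cF : continuous F.
  move=> t; apply: differentiable_continuous; apply/derivable1_diffP.
  by have [] := FD t.
have [k0|k0] := leP 0 k.
  have [c|c] := @MVT_segment _ F dF 0 k k0 (fun t _ => FD t).
    exact: continuous_subspaceT.
  rewrite in_itv /= subr0 => /andP[c0 ck] E; exists c => //.
  by rewrite !ger0_norm.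
have [c|c] := @MVT_segment _ F dF k 0 (ltW k0) (fun t _ => FD t).
  exact: continuous_subspaceT.
rewrite in_itv /= sub0r => /andP[c0 ck] E; exists c.
  by rewrite (ler0_norm ck) (ltr0_norm k0) lerN2.
by rewrite -opprB E mulrN opprK.
Qed.

Lemma dirv_norm i : `|dirv i| <= 1.
Proof.
apply: rV_norm_le => // j; rewrite mxE eqxx /=.
by case: (_ == _); rewrite ?normr1 ?normr0.
Qed.

Lemma test_sderiv phi i : test_function phi -> sderiv i phi (partial i phi).
Proof.
move=> tphi; have tp := test_partial i tphi.
have lphi := test_sqint tphi; have lp := test_sqint tp.
split=> //; apply/cvgr_dnbhsP => h [h0 hh].
have [M M0 HM] := test_bounded tp; have [r r0 Hr] := test_supp tp.
have derl x t : is_derive t (1 : R) (fun s : R => phi (x + s *: dirv i))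
    (partial i phi (x + t *: dirv i)).
  by apply/is_derive_line; exact: smooth_derive tphi.1.
have dom (k : R) x : k != 0 -> `|k| <= 1 ->
    `|dq i k phi x| <= M * \1_(cube (r + 1)) x.
  move=> k0 k1; have [c ck E] := mvt0 k (derl x); rewrite scale0r addr0 in E.
  rewrite /dq E mulrC mulfK//.
  have [->|/Hr/cube_shift xr] := eqVneq (partial i phi (x + c *: dirv i)) 0.
    by rewrite normr0 mulr_ge0// ltW.
  rewrite indicE mem_set ?mulr1//; apply/cubeP => j; move/cubeP : xr => /(_ j) xr.
  apply: lt_le_trans xr _; rewrite lerD2l normrZ.
  apply: (@le_trans _ _ (`|c| * 1)); last by rewrite mulr1 (le_trans ck).
  by rewrite ler_wpM2l//; exact: dirv_norm.
(* Domination by one fixed cube is required for every index; [k] agrees with [h] eventually and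
   never leaves [-1, 1]. *)
pose k n := if `|h n| <= 1 then h n else 1.
have kn0 n : k n != 0 by rewrite /k; case: ifP => // _; exact: oner_neq0.
have kn1 n : `|k n| <= 1 by rewrite /k; case: ifP => //; rewrite normr1.
have near_k : \forall n \near \oo, h n = k n.
  have H : \forall n \near \oo, `|h n| <= 1 by exact: (cvgr0_norm_le (fun n => h n) hh 1 ltr01).
  by apply: filterS H => n hn; rewrite /k hn.
have kk : k n @[n --> \oo] --> 0 by apply: cvg_trans hh; exact: near_eq_cvg.
have [] := @L2_dct _ _ _ mu (fun n => dq i (k n) phi) (partial i phi)
  (fun x => M * \1_(cube (r + 1)) x).
- by move=> n; exact: sqint_meas (sqint_dq _ _ lphi).
- exact: sqint_meas lp.
- exact: (sqintZ M (sqint_cube (r + 1))).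
- by move=> n x; exact: dom.
- apply: aeW => x.
  have [H1 H2] := derl x 0.
  have : dq i h0 phi x @[h0 --> (0 : R)^'] --> partial i phi x.
    rewrite scale0r addr0 in H2; rewrite -H2.
    rewrite (_ : (fun h0 => _) = fun h0 : R => h0^-1 *:
      (((fun s : R => phi (x + s *: dirv i)) \o shift 0) (h0 *: (1 : R)) -
      (fun s : R => phi (x + s *: dirv i)) 0)); first exact: H1.
    apply/funext => t /=; rewrite addr0 scale0r addr0 -[t *: 1]/(t * 1) mulr1.
    by [].
  by move/cvgr_dnbhsP; apply.
move=> _; apply: cvg_trans; apply: near_eq_cvg.
by apply: filterS near_k => n ->.
Qed.

Lemma cvg0_CS (T : Type) (F : set_system T) {FF : Filter F} (a b : T -> R) (C : R) :
  (forall t, `|b t| <= Num.sqrt (a t) * C) -> a t @[t --> F] --> (0 : R) ->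
  b t @[t --> F] --> (0 : R).
Proof.
move=> bC a0; apply/norm_cvg0P; apply: (@squeeze_cvgr _ _ _ _ (cst 0) (fun t => Num.sqrt (a t) * C)).
- by apply: nearW => t; rewrite normr_ge0 bC.
- exact: cvg_cst.
- rewrite -(mul0r C); apply: cvgMl; rewrite -sqrtr0.
  by apply: continuous_cvg a0; exact: sqrt_continuous.
Qed.

Lemma sderiv_dq_cvg i u g (w : 'rV[R]_N -> R) (h : nat -> R) : sderiv i u g -> sqint w ->
  (forall n, h n != 0) -> h n @[n --> \oo] --> (0 : R) ->
  dotL (dq i (h n) u) w @[n --> \oo] --> dotL g w.
Proof.
move=> [lu lg ug] lw h0 hh; have S := dotL_si mu.
move/cvgr_dnbhsP : ug => /(_ h (conj h0 hh)) ug.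
apply/subr_cvg0; apply: (cvg0_CS (C := sinorm dotL w) _ ug) => n.
have lB : sqint (dq i (h n) u - g) by apply: (siB S) => //; exact: sqint_dq.
rewrite -(sibBl S)//; last exact: sqint_dq.
exact: (sib_CSn S).
Qed.

Lemma harm_cvg : n.+1%:R^-1 @[n --> \oo] --> (0 : R).
Proof. exact: (@cvg_harmonic R). Qed.

(** Translation invariance moves the difference quotient from [u] to [v] with the step reversed
    ([dotL_dq]); both sides are then limits of the same sequence. *)
Lemma sderiv_ibp i u g (v k : 'rV[R]_N -> R) :
  sderiv i u g -> sderiv i v k -> dotL g v = - dotL u k.
Proof.
move=> ug vk; have [lu lg _] := ug; have [lv lk _] := vk; have S := dotL_si mu.
have n0 (n : nat) : n.+1%:R^-1 != 0 :> R by rewrite invr_eq0.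
have H1 := sderiv_dq_cvg ug lv n0 harm_cvg.
have nn0 (n : nat) : - n.+1%:R^-1 != 0 :> R by rewrite oppr_eq0.
have hN : - n.+1%:R^-1 @[n --> \oo] --> (0 : R).
  by rewrite -oppr0; apply: cvgN; exact: harm_cvg.
have H2 := sderiv_dq_cvg vk lu nn0 hN.
apply: (cvg_unique _ H1) => //.
rewrite (sibC S)//.
rewrite (_ : (fun n => _) = fun n : nat => - dotL (dq i (- n.+1%:R^-1) v) u).
  exact: cvgN.
apply/funext => n; rewrite dotL_dq// [in RHS](sibC S)//.
exact: sqint_dq.
Qed.

Lemma sderiv_shift_le i u g : sderiv i u g -> exists2 C : R, 0 <= C &
  exists2 d : R, 0 < d & forall h : R, `|h| <= d ->
  dotL ((fun x => u (x + h *: dirv i)) - u) ((fun x => u (x + h *: dirv i)) - u) <= C * h ^+ 2.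
Proof.
move=> [lu lg /cvgr0_norm_le/(_ 1 ltr01) ug]; have S := dotL_si mu.
exists (2 + 2 * dotL g g); first by rewrite addr_ge0// mulr_ge0// (sib_ge0 S).
move/nbhs_ballP : ug => [d /= d0 ug].
exists (d / 2) => [|h hd]; first by rewrite divr_gt0.
have [->|h0] := eqVneq h 0.
  rewrite (_ : _ - _ = 0) ?(sib0l S) ?expr0n ?mulr0//; first exact: (si0 S).
  by apply/funext => x; rewrite !fctE scale0r addr0 subrr.
have lB : sqint (dq i h u - g) by apply: (siB S) => //; exact: sqint_dq.
have -> : (fun x => u (x + h *: dirv i)) - u = h *: ((dq i h u - g) + g).
  apply/funext => x; rewrite -[RHS]/(h * (dq i h u x - g x + g x)) subrK.
  by rewrite /dq mulVKf.
rewrite (sib_sqrZ S); last exact: (siD S).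
rewrite mulrC ler_wpM2r ?sqr_ge0//.
apply: le_trans (sib_sqrD_le S lB lg) _; rewrite lerD2r.
have : `|dotL (dq i h u - g) (dq i h u - g)| <= 1.
  apply: ug => //; rewrite -ball_normE /= sub0r normrN.
  by apply: le_lt_trans hd _; rewrite ltr_pdivrMr// ltr_pMr// ltr1n.
by move=> /(le_trans (ler_norm _)); lra.
Qed.

Lemma smooth_derivable phi i x : smooth phi -> derivable phi x (dirv i).
Proof. by move=> sphi; exact: (sphi [::]).2. Qed.

Lemma foldr_partialD f g s : smooth f -> smooth g ->
  foldr partial (f + g) s = foldr partial f s + foldr partial g s.
Proof.
move=> sf sg; elim: s => //= i s ->; apply/funext => x.
by rewrite /partial deriveD//; [exact: (sf s).2|exact: (sg s).2].
Qed.

Lemma foldr_partialZ a f s : smooth f ->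
  foldr partial (a *: f) s = a *: foldr partial f s.
Proof.
move=> sf; elim: s => //= i s ->; apply/funext => x.
by rewrite /partial deriveZ//; exact: (sf s).2.
Qed.

Lemma testD f g : test_function f -> test_function g -> test_function (f + g).
Proof.
move=> /testP[sf [r r0 Hr]] /testP[sg [q q0 Hq]]; apply/testP; split.
  move=> s; rewrite foldr_partialD//; split=> [x|i x].
    exact: (cvgD ((sf s).1 x) ((sg s).1 x)).
  by apply: derivableD; [exact: (sf s).2|exact: (sg s).2].
exists (Num.max r q); first by rewrite lt_max r0.
move=> x fgx; apply/cubeP => i; rewrite lt_max.
have [fx|/Hr/cubeP ->//] := eqVneq (f x) 0.
have [gx|/Hq/cubeP ->//] := eqVneq (g x) 0; last by rewrite orbT.
by move: fgx; rewrite fctE fx gx addr0 eqxx.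
Qed.

Lemma testZ a f : test_function f -> test_function (a *: f).
Proof.
move=> /testP[sf [r r0 Hr]]; apply/testP; split.
  move=> s; rewrite foldr_partialZ//; split=> [x|i x].
    exact: (cvgM (cvg_cst a) ((sf s).1 x)).
  by apply: derivableZ; exact: (sf s).2.
by exists r => // x afx; apply: Hr; apply: contraNneq afx => fx; rewrite fctE fx scaler0.
Qed.

Lemma test0 : test_function (0 : 'rV[R]_N -> R).
Proof.
apply/testP; split; last by exists 1 => // x; rewrite eqxx.
move=> s; have -> : foldr partial (0 : 'rV[R]_N -> R) s = cst 0.
  elim: s => //= i s ->; apply/funext => x.
  by rewrite /partial derive_cst.
split=> [x|i x]; [exact: cst_continuous|exact: derivable_cst].
Qed.

Definition coord_prod (th : 'I_N -> R -> R) x := \prod_(i < N) th i (x ord0 i).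

Lemma coord_prod_derive th j : (forall i, bumpy (th i)) ->
  exists2 th', (forall i, bumpy (th' i)) &
  forall x, is_derive x (dirv j) (coord_prod th) (coord_prod th' x).
Proof.
move=> bth; have [d bd dd] := bumpy_derive (bth j).
exists (fun i => if i == j then d else th i); first by move=> i; case: eqP.
move=> x; have := @is_derive_line (coord_prod th) x (dirv j) 0 
  (coord_prod (fun i => if i == j then d else th i) x).
rewrite scale0r addr0 => <-.
pose C := \prod_(i < N | i != j) th i (x ord0 i).
rewrite (_ : (fun s => _) = C *: (fun s => th j (s + x ord0 j))); last first.
  apply/funext => s; rewrite /coord_prod (bigD1 j)//= !mxE !eqxx /= mulr1 mulrC.
  rewrite -[RHS]/(C * _) [_ + s]addrC; congr (_ * _).
  by apply: eq_bigr => i ij; rewrite !mxE (negbTE ij) mulr0 addr0.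
have -> : coord_prod (fun i => if i == j then d else th i) x = C *: d (x ord0 j).
  rewrite /coord_prod (bigD1 j)//= eqxx mulrC; congr (_ * _).
  by apply: eq_bigr => i /negbTE ->.
apply: is_deriveZ; rewrite -[d _]mulr1.
apply: (@is_derive1_comp _ (th j) (fun s => s + x ord0 j)); first by rewrite add0r.
exact: is_derive_shift.
Qed.

Lemma continuous_coord i : continuous (fun x : 'rV[R]_N => x ord0 i).
Proof. exact: coord_continuous. Qed.

Lemma coord_prod_continuous th : (forall i, continuous (th i)) -> continuous (coord_prod th).
Proof.
move=> cth x; rewrite /coord_prod; apply: cvg_big; [by move=> z; exact: mul_continuous|exact: nbhs_filter|move=> i _].
by apply: (continuous_comp (@continuous_coord i x)); exact: cth.
Qed.

Lemma coord_prod_smooth th : (forall i, bumpy (th i)) -> smooth (coord_prod th).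
Proof.
move=> bth s; have [th' bth' ->] : exists2 th', (forall i, bumpy (th' i)) &
    foldr partial (coord_prod th) s = coord_prod th'.
  elim: s => /= [|i s [th' bth' ->]]; first by exists th.
  have [th2 bth2 H] := coord_prod_derive i bth'; exists th2 => //.
  by apply/funext => x; have [] := H x.
split=> [|i x]; first by apply: coord_prod_continuous => i; exact: bumpy_continuous.
by have [th2 _ H] := coord_prod_derive i bth'; have [] := H x.
Qed.

Definition box_bump (a b : 'rV[R]_N) (k : nat) :=
  coord_prod (fun i => bumpf (a ord0 i) (b ord0 i) k.+1%:R).

Lemma box_bump_out a b k x : ~ box a b x -> box_bump a b k x = 0.
Proof.
move=> /existsNP[i /negP xi]; rewrite /box_bump /coord_prod (bigD1 i)//=.
by rewrite bump_out// mul0r.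
Qed.

Lemma box_bump_itv a b k x : 0 <= box_bump a b k x <= 1.
Proof.
rewrite /box_bump /coord_prod; apply/andP; split.
  by apply: prodr_ge0 => i _; have /andP[] := bump_itv (a ord0 i) (b ord0 i) k.+1%:R (x ord0 i).
by apply: prodr_ile1 => i _; exact: bump_itv.
Qed.

Lemma box_cube (a b : 'rV[R]_N) x : box a b x -> cube (`|a| + `|b| + 1) x.
Proof.
move=> xb; apply/cubeP => i; have /andP[h1 h2] := xb i.
have ha := rV_norm_coord a i; have hb := rV_norm_coord b i.
rewrite ltr_norml; move: ha hb; rewrite !ler_norml => /andP[? ?] /andP[? ?].
have := normr_ge0 a; have := normr_ge0 b.
by move=> *; apply/andP; split; lra.
Qed.

Lemma test_box_bump a b k : test_function (box_bump a b k).
Proof.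
apply/testP; split; first by apply: coord_prod_smooth => i; exact: bump_bumpy.
exists (`|a| + `|b| + 1); first by rewrite ltr_wpDl// addr_ge0.
move=> x nx; apply: box_cube; apply: contrapT => /(box_bump_out k) E.
by rewrite E eqxx in nx.
Qed.

Lemma box_bump_cvg a b x : box_bump a b k x @[k --> \oo] --> (\1_(box a b) x : R).
Proof.
rewrite indicE; case: (pselect (box a b x)) => [xb|xb]; last first.
  rewrite memNset// (_ : (fun k => _) = cst 0); first exact: cvg_cst.
  by apply/funext => k; exact: box_bump_out.
rewrite mem_set//= -[X in _ --> X](@big1_eq _ 1%R *%R 'I_N (index_enum _) xpredT).
apply: cvg_big; [by move=> z; exact: mul_continuous|move=> i _].
by apply: bump_cvg; exact: xb.
Qed.

(** Products of one-dimensional bumps are test functions that increase to nothing more than the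
    indicator of a box; by dominated convergence all integrals over boxes vanish. *)
Lemma duBoisReymond f : sqint f ->
  (forall phi, test_function phi -> \int[mu]_x (f x * phi x) = 0) ->
  {ae mu, forall x, f x = 0}.
Proof.
move=> lf f0; apply: boxes_eq0 => // a b.
have mf := sqint_meas lf.
have lb : sqint (\1_(box a b)).
  apply: (@sqint_bounded_supp _ 1 (`|a| + `|b| + 1)).
  - by apply: measurable_indic; exact: measurable_box.
  - by move=> x; rewrite indicE; case: (_ \in _); rewrite ?normr1 ?normr0.
  - move=> x; rewrite indicE; case: (boolP (x \in _)) => [/set_mem xb _|_]; last by rewrite eqxx.
    exact: box_cube xb.
have [] // := @dominated_convergence _ _ _ mu setT measurableT
  (fun k x => (f x * box_bump a b k x)%:E) (fun x => (f x * \1_(box a b) x)%:E)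
  (fun x => `|f x * \1_(box a b) x|%:E).
- move=> k; apply/measurable_EFinP/measurable_funM => //.
  exact: test_meas (test_box_bump a b k).
- by apply/measurable_EFinP/measurable_funM => //; exact: sqint_meas lb.
- apply: aeW => x _; apply: cvg_EFin; first exact: nearW.
  by apply: cvgMr; exact: box_bump_cvg.
- by apply: intg_abs; exact: sqintM.
- apply: aeW => x k _; rewrite lee_fin !normrM ler_wpM2l//.
  case: (pselect (box a b x)) => [xb|xb]; last by rewrite box_bump_out// normr0.
  by rewrite indicE mem_set// normr1 ger0_norm; case/andP: (box_bump_itv a b k x).
move=> _ _; rewrite (_ : (fun n => _) = cst 0%E).
  move/(cvg_lim (@ereal_hausdorff R)); rewrite lim_cst// => E.
  rewrite Rintegral_mkcond (_ : 0 = fine 0%E)// E /Rintegral; congr fine.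
  apply: eq_integral => x _; congr EFin.
  by rewrite patchE indicE; case: (_ \in _); rewrite ?mulr1 ?mulr0.
apply/funext => k /=; rewrite -EFin_I; last exact: sqintM (test_sqint (test_box_bump a b k)).
by rewrite f0//; exact: test_box_bump.
Qed.

(** The component of [f] orthogonal to all test functions vanishes by [duBoisReymond]. *)
Lemma test_dense f : sqint f -> forall e : R, 0 < e ->
  exists2 phi, test_function phi & dotL (f - phi) (f - phi) <= e.
Proof.
move=> lf; have S := dotL_si mu.
have [r [lr rS rf]] := @si_projection _ _ _ _ S (@L2_complete _ _ _ mu)
  (@test_function R N) (@test_sqint) test0 testD testZ f lf.
move=> e e0; have [phi [tphi He]] := rf e e0; exists phi => //.
apply: le_trans He; have r0 : {ae mu, forall x, r x = 0}.
  by apply: duBoisReymond => // phi'; exact: rS.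
rewrite le_eqVlt; apply/orP; left; apply/eqP.
have lphi := test_sqint tphi.
by apply: eq_dotL; rewrite ?(siB S)//; try (do 2 apply: (siB S) => //);
  apply: filterS r0 => x rx; rewrite !fctE rx subr0.
Qed.

Lemma test_duality f (M : R) : sqint f -> 0 <= M ->
  (forall phi, test_function phi -> `|dotL f phi| <= M * sinorm dotL phi) ->
  dotL f f <= M ^+ 2.
Proof.
move=> lf M0 HM; have S := dotL_si mu.
set n := sinorm dotL f; have n0 : 0 <= n by exact: sinorm_ge0.
rewrite -(sinorm_sqr S lf) -/n ler_sqr ?nnegrE//.
have [->//|nn] := eqVneq n 0.
have {}n0 : 0 < n by rewrite lt_neqAle eq_sym nn.
rewrite -(ler_pM2r n0) -expr2; apply: (@le_eps _ _ _ (M + n)) => d d0 _.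
have d20 : 0 < d ^+ 2 by rewrite exprn_gt0.
have [phi tphi Hphi] := test_dense lf d20; have lphi := test_sqint tphi.
have fp : sinorm dotL (f - phi) <= d.
  by rewrite -(ger0_norm (ltW d0)) -sqrtr_sqr; exact: ler_wsqrtr.
have lB : sqint (f - phi) by exact: (siB S).
have E : n ^+ 2 = dotL f (f - phi) + dotL f phi.
  by rewrite /n (sinorm_sqr S lf) (sibBr S)// subrK.
have h1 := sib_CSn S lf lB; have h2 := HM _ tphi.
have h3 : sinorm dotL phi <= n + d.
  rewrite -[phi](_ : f - (f - phi) = phi); last by rewrite subKr.
  by apply: le_trans (sinormB S lf lB) _; rewrite lerD2l.
have h4 : n * sinorm dotL (f - phi) <= n * d by rewrite ler_wpM2l// ltW.
have h5 : M * sinorm dotL phi <= M * (n + d) by rewrite ler_wpM2l.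
have := ler_norm (dotL f (f - phi)); have := ler_norm (dotL f phi).
rewrite E -/n in h1 *; lra.
Qed.

(** For a test function the squared error is O(h^2) by [sderiv_shift_le]; for general [g] a test
    function is subtracted, translations being isometries. *)
Lemma shift_continuous_L2 i g : sqint g ->
  dotL ((fun x => g (x + h *: dirv i)) - g) ((fun x => g (x + h *: dirv i)) - g)
    @[h --> (0 : R)] --> (0 : R).
Proof.
move=> lg; have S := dotL_si mu.
apply/cvgrPdist_le => e e0.
have e9 : 0 < e / 10 by rewrite divr_gt0.
have [phi tphi Hphi] := test_dense lg e9.
have lphi := test_sqint tphi.
have [C C0 [d d0 HC]] := sderiv_shift_le (test_sderiv i tphi).
have q0 : 0 < Num.min d (Num.min 1 (e / (10 * (C + 1)))).
  by rewrite !lt_min d0 ltr01 divr_gt0// mulr_gt0// ltr_wpDl.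
near=> h.
have : `|h| <= Num.min d (Num.min 1 (e / (10 * (C + 1)))).
  near: h; exists (Num.min d (Num.min 1 (e / (10 * (C + 1))))) => //= t.
  by rewrite /ball_ /= sub0r normrN => /ltW.
rewrite !le_min => /and3P[hd h1 hC]; rewrite sub0r normrN.
have lsg := sqint_shift (h *: dirv i) lg; have lsp := sqint_shift (h *: dirv i) lphi.
have lB : sqint (g - phi) by exact: (siB S).
rewrite ger0_norm; last by apply: (sib_ge0 S); exact: (siB S).
have -> : (fun x => g (x + h *: dirv i)) - g =
   ((fun x => (g - phi) (x + h *: dirv i)) - (g - phi)) +
   ((fun x => phi (x + h *: dirv i)) - phi).
  by apply/funext => x; rewrite !fctE; ring.
have lsB := sqint_shift (h *: dirv i) lB.
have l1 : sqint ((fun x => (g - phi) (x + h *: dirv i)) - (g - phi)) by exact: (siB S).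
have l2 : sqint ((fun x => phi (x + h *: dirv i)) - phi) by exact: (siB S).
apply: le_trans (sib_sqrD_le S l1 l2) _.
have k2 := HC h hd.
have k1 : dotL ((fun x => (g - phi) (x + h *: dirv i)) - (g - phi))
    ((fun x => (g - phi) (x + h *: dirv i)) - (g - phi)) <= 4 * (e / 10).
  rewrite -[leLHS]/(dotL (_ + - _) _); apply: le_trans (sib_sqrD_le S lsB (siN S lB)) _.
  rewrite (sibNl S) ?(sibNr S) ?opprK//; last exact: (siN S).
  by rewrite dotL_shift//; lra.
have k3 : C * h ^+ 2 <= e / 10.
  rewrite -(real_normK (num_real h)); apply: (@le_trans _ _ ((C + 1) * `|h|)).
    by apply: ler_pM; rewrite ?sqr_ge0 ?lerDl// expr2 ler_piMr.
  by rewrite -ler_pdivlMl ?ltr_wpDl// mulrC -mulrA -invfM.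
lra.
Unshelve. all: end_near. Qed.

Lemma is_derive_cvg (a : R -> R) (s L : R) :
  h^-1 * (a (s + h) - a s) @[h --> (0 : R)^'] --> L -> is_derive s (1 : R) a L.
Proof.
move=> aL.
have E : (fun h : R => h^-1 *: ((a \o shift s) (h *: (1 : R)) - a s)) =
    (fun h => h^-1 * (a (s + h) - a s)).
  apply/funext => h /=; congr (_ * (a _ - _)).
  by rewrite -[h *: 1]/(h * 1) mulr1 addrC.
apply: DeriveDef; first by rewrite /derivable E; exact: cvgP aL.
by rewrite /derive E; exact: cvg_lim aL.
Qed.

(** Against a test function, the difference quotient of [u] is by the mean value theorem a translate
    of [g] by some [c] with |c| <= |h|. Hence its distance to [g], computed by duality, is
    controlled by the continuity of translations in L^2. *)
Lemma weak_sderiv i u g : sqint u -> sqint g -> weak_partial i u g -> sderiv i u g.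
Proof.
move=> lu lg ug; have S := dotL_si mu.
split=> //; apply/cvgrPdist_le => e e0.
have /cvgr0_norm_le/(_ _ e0)/nbhs_ballP[d /= d0 Hd] := shift_continuous_L2 i lg.
near=> h.
have hd : `|h| < d.
  near: h; exists d => //= t.
  by rewrite /ball_ /= sub0r normrN.
have h0 : h != 0 by near: h; exact: nbhs_dnbhs_neq.
have lq := sqint_dq i h lu.
have lB : sqint (dq i h u - g) by exact: (siB S).
rewrite sub0r normrN ger0_norm; last exact: (sib_ge0 S).
rewrite -[e]sqr_sqrtr ?(ltW e0)//; apply: test_duality => // phi tphi.
have lphi := test_sqint tphi.
pose a (s : R) := dotL (fun x => u (x + s *: dirv i)) phi.
(* Moving the translation onto the test function turns the derivative in [s] into a partial
   derivative of the translated test function, to which the weak derivative of [u] applies. *)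
have da (s : R) : is_derive s (1 : R) a (dotL (fun x => g (x + s *: dirv i)) phi).
  apply: is_derive_cvg.
  pose psi := fun x => phi (x - s *: dirv i).
  have tpsi : test_function psi by exact: test_shift.
  have lpsi := test_sqint tpsi.
  have -> : dotL (fun x => g (x + s *: dirv i)) phi = - dotL u (partial i psi).
    by rewrite dotL_shift_adj// /dotL (ug _ tpsi) opprK.
  rewrite (_ : (fun k => _) = fun k : R => - dotL (dq i (- k) psi) u); last first.
    apply/funext => k; have lk := sqint_shift (- k *: dirv i) lpsi.
    have -> : a (s + k) = dotL u (fun x => psi (x + - k *: dirv i)).
      rewrite /a (dotL_shift_adj _ lu lphi); congr dotL; apply/funext => x.
      by rewrite /psi scalerDl opprD scaleNr addrA addrAC.
    have -> : a s = dotL u psi by rewrite /a dotL_shift_adj.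
    rewrite [in RHS](sibC S)//; last exact: sqint_dq.
    rewrite [X in _ = - X](sibZr S)//; last exact: (siB S).
    by rewrite (sibBr S)// invrN mulNr opprK.
  apply: cvgN; apply/cvgr_dnbhsP => k [k0 kk].
  rewrite (sibC S)//; last by apply: test_sqint; exact: test_partial.
  apply: (sderiv_dq_cvg (test_sderiv i tpsi) lu) => [n|].
    by rewrite oppr_eq0.
  by rewrite -oppr0; exact: cvgN.
have [c ch E] := mvt0 h da.
have lsg := sqint_shift (c *: dirv i) lg.
have -> : dotL (dq i h u - g) phi = dotL ((fun x => g (x + c *: dirv i)) - g) phi.
  rewrite !(sibBl S)//; congr (_ - _).
  have lsu := sqint_shift (h *: dirv i) lu.
  have -> : dotL (dq i h u) phi = h^-1 * (a h - a 0).
    have a0 : a 0 = dotL u phi.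
      by rewrite /a; congr (dotL _ _); apply/funext => x; rewrite scale0r addr0.
    by rewrite a0 [LHS](sibZl S _ (siB S lsu lu) lphi) (sibBl S lsu lu lphi).
  by rewrite E mulrC mulfK.
have lsB : sqint ((fun x => g (x + c *: dirv i)) - g) by exact: (siB S).
apply: le_trans (sib_CSn S lsB lphi) _; rewrite ler_wpM2r ?sinorm_ge0//.
apply: ler_wsqrtr; apply: le_trans (ler_norm _) _; apply: Hd.
by rewrite -ball_normE /= sub0r normrN (le_lt_trans ch).
Unshelve. all: end_near. Qed.

Lemma sderiv_weak i u g : sderiv i u g -> weak_partial i u g.
Proof.
move=> ug phi tphi; have := sderiv_ibp ug (test_sderiv i tphi).
by rewrite /dotL => ->; rewrite opprK.
Qed.

Lemma weak_unique i u g g' : sqint u -> sqint g -> sqint g' ->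
  weak_partial i u g -> weak_partial i u g' -> {ae mu, forall x, g x = g' x}.
Proof.
move=> lu lg lg' ug ug'; have S := dotL_si mu.
have : {ae mu, forall x, (g - g') x = 0}.
  apply: duBoisReymond => [|phi tphi]; first exact: (siB S).
  have lphi := test_sqint tphi.
  rewrite -[LHS]/(dotL (g - g') phi) (sibBl S)//.
  by apply/eqP; rewrite subr_eq0 -eqr_opp /dotL -(ug _ tphi) -(ug' _ tphi).
by apply: filterS => x; rewrite fctE => /eqP; rewrite subr_eq0 => /eqP.
Qed.

Lemma sderiv_unique i u g g' : sderiv i u g -> sderiv i u g' ->
  {ae mu, forall x, g x = g' x}.
Proof.
move=> ug ug'; have [lu lg _] := ug; have [_ lg' _] := ug'.
exact: (weak_unique lu lg lg' (sderiv_weak ug) (sderiv_weak ug')).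
Qed.

Lemma H1P u : H1 u <-> sqint u /\ forall i, exists g, sderiv i u g.
Proof.
split=> -[lu ug]; split=> // i; have [g] := ug i.
  by case=> lg wg; exists g; exact: weak_sderiv.
by move=> sg; exists g; have [_ lg _] := sg; split=> //; exact: sderiv_weak.
Qed.

Lemma H1_sqint u : H1 u -> sqint u. Proof. by case. Qed.

Lemma wgrad_sderiv u i : H1 u -> sderiv i u (wgrad u i).
Proof.
move=> [lu ug]; have [g [lg wg]] := ug i.
have : [set g | L2 g /\ weak_partial i u g] (wgrad u i) by apply: xgetPex; exists g.
by move=> [lw ww]; exact: weak_sderiv.
Qed.

Lemma sqint_wgrad u i : H1 u -> sqint (wgrad u i).
Proof. by move=> /(wgrad_sderiv i)[]. Qed.

Lemma wgrad_ae u i g : H1 u -> sderiv i u g -> {ae mu, forall x, wgrad u i x = g x}.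
Proof. by move=> hu ug; apply: sderiv_unique ug; exact: wgrad_sderiv. Qed.

Lemma sderivD i u g (v k : 'rV[R]_N -> R) : sderiv i u g -> sderiv i v k -> sderiv i (u + v) (g + k).
Proof.
move=> ug vk; have [lu lg _] := ug; have [lv lk _] := vk; have S := dotL_si mu.
have luv := siD S lu lv; have lgk := siD S lg lk.
apply: weak_sderiv => // phi tphi.
have lphi := test_sqint tphi; have lp := test_sqint (test_partial i tphi).
rewrite -[LHS]/(dotL (u + v) (partial i phi)) -[X in _ = - X]/(dotL (g + k) phi).
rewrite !(sibDl S)// opprD /dotL.
by rewrite (sderiv_weak ug tphi) (sderiv_weak vk tphi).
Qed.

Lemma sderivZ i a u g : sderiv i u g -> sderiv i (a *: u) (a *: g).
Proof.
move=> ug; have [lu lg _] := ug; have S := dotL_si mu.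
have lau := siZ S a lu; have lag := siZ S a lg.
apply: weak_sderiv => // phi tphi.
have lphi := test_sqint tphi; have lp := test_sqint (test_partial i tphi).
rewrite -[LHS]/(dotL (a *: u) (partial i phi)) -[X in _ = - X]/(dotL (a *: g) phi).
by rewrite !(sibZl S)// /dotL (sderiv_weak ug tphi) mulrN.
Qed.

Lemma sderiv0 i : sderiv i (0 : 'rV[R]_N -> R) (0 : 'rV[R]_N -> R).
Proof.
apply: weak_sderiv; [exact: sqint0|exact: sqint0|move=> phi _].
have z (w : 'rV[R]_N -> R) : \int[mu]_x ((0 : 'rV[R]_N -> R) x * w x) = 0.
  by rewrite -[RHS](I0 mu); apply: eq_Rintegral => x _; rewrite mul0r.
by rewrite !z oppr0.
Qed.

Lemma sderiv_shift i v u g : sderiv i u g ->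
  sderiv i (fun x => u (x + v)) (fun x => g (x + v)).
Proof.
move=> ug; have [lu lg _] := ug; have S := dotL_si mu.
apply: weak_sderiv; try exact: sqint_shift; move=> phi tphi.
have tpsi := test_shift (- v) tphi.
have := sderiv_weak ug tpsi; rewrite partial_shift => [E|x]; last exact: smooth_derivable tphi.1.
have lphi := test_sqint tphi; have lp := test_sqint (test_partial i tphi).
rewrite -[LHS]/(dotL (fun x => u (x + v)) (partial i phi)).
rewrite -[X in _ = - X]/(dotL (fun x => g (x + v)) phi).
by rewrite !dotL_shift_adj.
Qed.

Lemma weak_limit_sderiv (T : Type) (F : set_system T) {FF : ProperFilter F}
    i (u g : T -> 'rV[R]_N -> R) u0 g0 :
  (\forall t \near F, sderiv i (u t) (g t)) -> sqint u0 -> sqint g0 ->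
  (forall w, sqint w -> dotL (u t) w @[t --> F] --> dotL u0 w) ->
  (forall w, sqint w -> dotL (g t) w @[t --> F] --> dotL g0 w) -> sderiv i u0 g0.
Proof.
move=> ug l0 lg0 uw gw; apply: weak_sderiv => // phi tphi.
have lphi := test_sqint tphi; have lp := test_sqint (test_partial i tphi).
have H1 := uw _ lp.
have H2 : - dotL (g t) phi @[t --> F] --> - dotL g0 phi by apply: cvgN; exact: gw.
apply: (cvg_unique _ H1) => //.
apply: cvg_trans H2; apply: near_eq_cvg; apply: filterS ug => t /sderiv_weak H.
by rewrite /dotL (H _ tphi).
Qed.

Lemma sderiv_intro i u g : sqint u -> sqint g ->
  (forall h : nat -> R, (forall n, h n != 0) -> h n @[n --> \oo] --> (0 : R) ->
     dotL (dq i (h n) u - g) (dq i (h n) u - g) @[n --> \oo] --> (0 : R)) -> sderiv i u g.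
Proof. by move=> lu lg H; split=> //; apply/cvgr_dnbhsP => h [h0 hh]; exact: H. Qed.

Lemma sderiv_seq i u g (h : nat -> R) : sderiv i u g -> (forall n, h n != 0) ->
  h n @[n --> \oo] --> (0 : R) ->
  dotL (dq i (h n) u - g) (dq i (h n) u - g) @[n --> \oo] --> (0 : R).
Proof. by move=> [_ _ /cvgr_dnbhsP H] h0 hh; exact: H. Qed.

Lemma shift_seq_cvg i g (h : nat -> R) : sqint g -> h n @[n --> \oo] --> (0 : R) ->
  dotL ((fun x => g (x + h n *: dirv i)) - g) ((fun x => g (x + h n *: dirv i)) - g)
    @[n --> \oo] --> (0 : R).
Proof. by move=> lg hh; exact: (cvg_comp _ _ hh (shift_continuous_L2 i lg)). Qed.

Lemma sqint_truncation g : sqint g -> exists t : nat -> 'rV[R]_N -> R,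
  [/\ forall n, mfun (t n), forall n x, `|t n x| <= n%:R,
      forall n x, `|t n x| <= `|g x|, forall n, sqint (t n) &
      dotL (t n - g) (t n - g) @[n --> \oo] --> (0 : R)].
Proof.
move=> lg; have mg := sqint_meas lg.
pose t (n : nat) x : R := Num.max (- n%:R) (Num.min (g x) n%:R).
have mt n : mfun (t n).
  by apply: measurable_maxr => //; apply: measurable_minr.
have tn n x : `|t n x| <= n%:R.
  rewrite ler_norml /t le_max lexx /= ge_max ge_min lexx orbT andbT.
  by apply: (@le_trans _ _ 0) => //; rewrite oppr_le0.
have tg n x : `|t n x| <= `|g x|.
  rewrite ler_norml /t le_max ge_max ge_min le_min.
  have n0 : (0 : R) <= n%:R by [].
  have [g0|g0] := leP 0 (g x).
    by rewrite (ger0_norm g0) lexx /=; apply/andP; split; [apply/orP; right; apply/andP; split|];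
      lra.
  rewrite (ltr0_norm g0) opprK lexx /=.
  by apply/andP; split; [|apply/andP; split; [|apply/orP; left]]; try (apply/orP; right);
    try (apply/andP; split); lra.
exists t; split=> //.
  by move=> n; apply: sqint_le lg _.
have [] // := @L2_dct _ _ _ mu t g (fun x => `|g x|) mt mg.
- by apply: (sqint_le _ lg) => [|x]; [exact: measurableT_comp|rewrite normr_id].
- apply: aeW => x; apply: cvg_near_cst; exists (Num.truncn `|g x|).+1 => // n /= gn.
  have {}gn : `|g x| <= n%:R.
    by apply: le_trans (ltW (truncnS_gt _)) _; rewrite ler_nat.
  move: gn; rewrite ler_norml => /andP[g1 g2].
  by rewrite /t min_l// max_r.
Qed.

Lemma dotL_le3 (a b c : R) (A p q r : 'rV[R]_N -> R) : 0 <= a -> 0 <= b -> 0 <= c ->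
  sqint A -> sqint p -> sqint q -> sqint r ->
  (forall x, `|A x| <= a * `|p x| + b * `|q x| + c * `|r x|) ->
  dotL A A <= 3 * a ^+ 2 * dotL p p + 3 * b ^+ 2 * dotL q q + 3 * c ^+ 2 * dotL r r.
Proof.
move=> a0 b0 c0 lA lp lq lr H.
have ip := sqint_intg lp; have iq := sqint_intg lq; have ir := sqint_intg lr.
rewrite !dotLff -!IZ// -!ID; try (apply: intgZ || apply: intgD) => //; try exact: intgZ.
apply: I_le => [||x]; first exact: sqint_intg.
  by do 2 (apply: intgD; last exact: intgZ); exact: intgZ.
rewrite -(real_normK (num_real (A x))) -(real_normK (num_real (p x))).
rewrite -(real_normK (num_real (q x))) -(real_normK (num_real (r x))).
have := H x; have := normr_ge0 (A x); move: (`|A x|) (`|p x|) (`|q x|) (`|r x|) => A' p' q' r' A0 H'.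
apply: (@le_trans _ _ ((a * p' + b * q' + c * r') ^+ 2)).
  by rewrite lerXn2r ?nnegrE// (le_trans A0).
have := sqr_ge0 (a * p' - b * q'); have := sqr_ge0 (a * p' - c * r').
have := sqr_ge0 (b * q' - c * r'); nra.
Qed.

(* The domain D allows chain rules for functions such as the logarithm, applied
   to functions with values in D. *)
Lemma sderiv_chain (D : R -> Prop) (f df ddf : R -> R) (L L' : R) i u g :
  (forall a b c, D a -> D b -> a <= c <= b -> D c) -> D 0 -> f 0 = 0 ->
  (forall s : R, D s -> is_derive s (1 : R) f (df s)) ->
  (forall s : R, D s -> is_derive s (1 : R) df (ddf s)) ->
  (forall s, D s -> `|df s| <= L) -> (forall s, D s -> `|ddf s| <= L') ->
  (forall x, D (u x)) -> mfun (fun x => f (u x)) ->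
  mfun (fun x => df (u x)) ->
  sderiv i u g -> sderiv i (fun x => f (u x)) (fun x => df (u x) * g x).
Proof.
move=> Dc D0 f0 fd dfd dfL ddfL Du mfu mdfu ug.
have [lu lg _] := ug; have S := dotL_si mu.
have L0 : 0 <= L by apply: le_trans (dfL 0 D0).
have L'0 : 0 <= L' by apply: le_trans (ddfL 0 D0).
have mvt (F dF : R -> R) a b : (forall s : R, D s -> is_derive s (1 : R) F (dF s)) ->
    D a -> D b -> exists2 c, D c /\ `|c - a| <= `|b - a| & F b - F a = dF c * (b - a).
  move=> Fd Da Db.
  have cF (s : R) : D s -> {for s, continuous F}.
    move=> Ds; apply: differentiable_continuous; apply/derivable1_diffP.
    by have [] := Fd s Ds.
  have [ab|ba] := leP a b.
    have Dab c : c \in `[a, b] -> D c by rewrite in_itv /= => ?; exact: Dc Da Db _.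
    have [|c|c ci E] := @MVT_segment _ F dF a b ab.
    - by move=> c ci; apply: Fd; apply: Dab; apply: subset_itv_oo_cc ci.
    - apply: continuous_in_subspaceT => z; rewrite inE => zi; exact/cF/Dab.
    exists c => //; split; first exact: Dab.
    move: ci; rewrite in_itv /= => /andP[? ?].
    by rewrite !ger0_norm ?subr_ge0// lerB.
  have Dab c : c \in `[b, a] -> D c by rewrite in_itv /= => ?; exact: Dc Db Da _.
  have [|c|c ci E] := @MVT_segment _ F dF b a (ltW ba).
  - by move=> c ci; apply: Fd; apply: Dab; apply: subset_itv_oo_cc ci.
  - apply: continuous_in_subspaceT => z; rewrite inE => zi; exact/cF/Dab.
  exists c; last by rewrite -opprB E; ring.
  split; first exact: Dab.
  move: ci; rewrite in_itv /= => /andP[? ?].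
  by rewrite !ler0_norm ?subr_le0// ?(ltW ba)// lerN2 lerB.
have lfu : sqint (fun x => f (u x)).
  apply: (sqint_le mfu (sqintZ L lu)) => x.
  have [c [Dcc _]] := mvt f df 0 (u x) fd D0 (Du x).
  rewrite f0 !subr0 => ->; rewrite normrM [leRHS]normrM (ger0_norm L0).
  by rewrite ler_wpM2r// dfL.
have lfg : sqint (fun x => df (u x) * g x).
  by apply: (sqint_bdM (M := L)) => // x; exact: dfL.
apply: sderiv_intro => // h h0 hh.
have [t [mt tn tg lt tcvg]] := sqint_truncation lg.
have hu := sderiv_seq ug h0 hh; have hs := shift_seq_cvg i lu hh.
have lB n : sqint (dq i (h n) u - g) by apply: (siB S) => //; exact: sqint_dq.
have lBt n : sqint (t n - g) by exact: (siB S).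
have ls n : sqint (fun x => u (x + h n *: dirv i)) by exact: sqint_shift.
have lsB n : sqint ((fun x => u (x + h n *: dirv i)) - u) by exact: (siB S).
(* [g] is split into its truncation [t k] and the rest. On the bounded part the oscillation of [df]
   is at most [L'] times the increment of [u], which tends to 0 in L^2 for fixed [k]; on the rest
   only the bound 2 L is available, but the rest is small in L^2. *)
have key n k x : `|(dq i (h n) (fun x => f (u x)) - (fun x => df (u x) * g x)) x| <=
    L * `|(dq i (h n) u - g) x| + 2 * L * `|(t k - g) x| +
    L' * k%:R * `|((fun x => u (x + h n *: dirv i)) - u) x|.
  rewrite !fctE /dq; have [c [Dcc cu] E] := mvt f df (u x) (u (x + h n *: dirv i)) fd (Du _) (Du _).
  have [c' [Dc' _] E'] := mvt df ddf (u x) c dfd (Du _) Dcc.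
  rewrite E mulrCA.
  set q := _^-1 * _; set w := u (_ + _) - u x in cu *.
  have -> : df c * q - df (u x) * g x =
    df c * (q - g x) + (df c - df (u x)) * (g x - t k x) + (df c - df (u x)) * t k x by ring.
  apply: le_trans (ler_normD _ _) _; apply: lerD; first apply: le_trans (ler_normD _ _) _; first apply: lerD.
  - by rewrite normrM ler_wpM2r// dfL.
  - rewrite normrM distrC -[_ - g x]opprB normrN; apply: ler_wpM2r => //.
    apply: le_trans (ler_normB _ _) _; have := dfL _ (Du x); have := dfL _ Dcc; lra.
  - rewrite normrM E' normrM -!mulrA; apply: ler_pM => //; first exact: ddfL.
    by rewrite mulrC; apply: ler_pM.
have lfq n : sqint (dq i (h n) (fun x => f (u x)) - (fun x => df (u x) * g x)).
  by apply: (siB S) => //; exact: sqint_dq.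
apply/cvgrPdist_le => e e0.
have [k Hk] : exists k, 12 * L ^+ 2 * dotL (t k - g) (t k - g) <= e / 2.
  have : 12 * L ^+ 2 * dotL (t k - g) (t k - g) @[k --> \oo] --> 12 * L ^+ 2 * (0 : R).
    exact: cvgMr.
  rewrite mulr0 => H; have e20 : 0 < e / 2 by rewrite divr_gt0.
  have [K _ HK] := cvgr0_norm_le _ H _ e20.
  by exists K; apply: le_trans (ler_norm _) (HK K _) => /=.
have H : 3 * L ^+ 2 * dotL (dq i (h n) u - g) (dq i (h n) u - g) +
    3 * (L' * k%:R) ^+ 2 * dotL ((fun x => u (x + h n *: dirv i)) - u)
      ((fun x => u (x + h n *: dirv i)) - u) @[n --> \oo] --> (0 : R).
  rewrite -(addr0 0) -[X in X + _](mulr0 (3 * L ^+ 2)).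
  by rewrite -[X in _ + X](mulr0 (3 * (L' * k%:R) ^+ 2)); apply: cvgD; exact: cvgMr.
have e20 : 0 < e / 2 by rewrite divr_gt0.
have HH : \forall n \near \oo,
    `|3 * L ^+ 2 * dotL (dq i (h n) u - g) (dq i (h n) u - g) +
    3 * (L' * k%:R) ^+ 2 * dotL ((fun x => u (x + h n *: dirv i)) - u)
      ((fun x => u (x + h n *: dirv i)) - u)| <= e / 2 by exact: (cvgr0_norm_le _ H _ e20).
apply: filterS HH => n Hn.
rewrite sub0r normrN ger0_norm ?(sib_ge0 S)//.
apply: (le_trans (dotL_le3 _ _ _ (lfq n) (lB n) (lBt k) (lsB n) (key n k))) => //.
- by rewrite mulr_ge0.
- by rewrite mulr_ge0.
have {}Hn := le_trans (ler_norm _) Hn; move: Hk Hn.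
rewrite (_ : 3 * (2 * L) ^+ 2 = 12 * L ^+ 2); last by ring.
lra.
Qed.

(** The only term that is not a plain L^2 perturbation is the difference quotient of [X] times [u];
    the Lipschitz bound dominates it, so pointwise differentiability suffices. *)
Lemma sderiv_mul (X dX : 'rV[R]_N -> R) (M L : R) i u g :
  mfun X -> mfun dX -> (forall x, `|X x| <= M) ->
  (forall x, `|dX x| <= L) ->
  (forall x (h : R), `|X (x + h *: dirv i) - X x| <= L * `|h|) ->
  (forall x, is_derive x (dirv i) X (dX x)) ->
  sderiv i u g -> sderiv i (fun x => X x * u x) (fun x => X x * g x + dX x * u x).
Proof.
move=> mX mdX XM dXL XL Xd ug; have [lu lg _] := ug; have S := dotL_si mu.
have M0 : 0 <= M by apply: le_trans (XM 0).
have L0 : 0 <= L by apply: le_trans (dXL 0).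
have lXu : sqint (fun x => X x * u x) by exact: sqint_bdM XM lu.
have lXg : sqint (fun x => X x * g x) by exact: sqint_bdM XM lg.
have ldX : sqint (fun x => dX x * u x) by exact: sqint_bdM dXL lu.
have lG : sqint (fun x => X x * g x + dX x * u x) by exact: (siD S lXg ldX).
apply: sderiv_intro => // h h0 hh.
have mXs (v : 'rV[R]_N) : mfun (fun x => X (x + v)).
  exact: measurableT_comp mX (measurable_shift v).
have mdq n : mfun (dq i (h n) X).
  by apply: measurable_funM => //; apply: measurable_funB.
have lau : sqint (fun x => L * `|u x|).
  apply: (sqintZ L); apply: (sqint_le _ lu) => [|x]; last by rewrite normr_id.
  by apply: measurableT_comp => //; exact: sqint_meas lu.
have dqL n x : `|dq i (h n) X x| <= L.
  by rewrite /dq normrM normfV ler_pdivrMl ?normr_gt0 ?h0// mulrC; exact: XL.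
have [lr rcvg] : (forall n, sqint ((fun x => dq i (h n) X x * u x) - (fun x => dX x * u x))) /\
   dotL ((fun x => dq i (h n) X x * u x) - (fun x => dX x * u x))
     ((fun x => dq i (h n) X x * u x) - (fun x => dX x * u x)) @[n --> \oo] --> (0 : R).
  apply: (L2_dct (g := fun x => L * `|u x|)) => //.
  - by move=> n; apply: measurable_funM (mdq n) (sqint_meas lu).
  - exact: measurable_funM mdX (sqint_meas lu).
  - by move=> n x; rewrite normrM; apply: ler_wpM2r.
  - apply: aeW => x; apply: cvgMl; have [Dx Ex] := Xd x.
    have H : h^-1 * (X (x + h *: dirv i) - X x) @[h --> (0 : R)^'] --> dX x.
      rewrite -Ex; move: Dx; rewrite /derivable /derive => Dx.
      apply: cvg_trans Dx; apply: near_eq_cvg; apply: nearW => t /=.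
      by rewrite [t *: _ + x]addrC.
    by have /cvgr_dnbhsP := H; apply.
have hu := sderiv_seq ug h0 hh; have hs := shift_seq_cvg i lg hh.
have lB n : sqint (dq i (h n) u - g) by apply: (siB S) => //; exact: sqint_dq.
have lfq n : sqint (dq i (h n) (fun x => X x * u x) - (fun x => X x * g x + dX x * u x)).
  by apply: (siB S) => //; exact: sqint_dq.
have key n x : `|(dq i (h n) (fun x => X x * u x) - (fun x => X x * g x + dX x * u x)) x| <=
    M * `|(dq i (h n) u - g) x| +
    L * `|h n| * `|((fun x => dq i (h n) u x)) x| +
    1 * `|((fun x => dq i (h n) X x * u x) - (fun x => dX x * u x)) x|.
  rewrite !fctE.
  have -> : dq i (h n) (fun x => X x * u x) x - (X x * g x + dX x * u x) =
     X x * (dq i (h n) u x - g x) + (X (x + h n *: dirv i) - X x) * dq i (h n) u x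
      + (dq i (h n) X x * u x - dX x * u x) by rewrite /dq; ring.
  apply: le_trans (ler_normD _ _) _; apply: lerD; last by rewrite mul1r.
  by apply: le_trans (ler_normD _ _) _; apply: lerD; rewrite normrM; apply: ler_wpM2r.
have c3 : dotL (dq i (h n) u) (dq i (h n) u) * h n ^+ 2 @[n --> \oo] --> (0 : R).
  have H : (2 * dotL (dq i (h n) u - g) (dq i (h n) u - g) + 2 * dotL g g) * h n ^+ 2
      @[n --> \oo] --> (2 * 0 + 2 * dotL g g) * (0 : R) ^+ 2.
    by apply: cvgM; [apply: cvgD; [exact: cvgMr|exact: cvg_cst]|exact: cvgM].
  rewrite expr0n mulr0 in H; apply: squeeze_cvgr H; last exact: cvg_cst.
  apply: nearW => n; have ldq := sqint_dq i (h n) lu.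
  rewrite mulr_ge0 ?sqr_ge0 ?(sib_ge0 S)//= ler_wpM2r ?sqr_ge0//.
  by have := sib_sqrD_le S (lB n) lg; rewrite subrK.
have H : 3 * M ^+ 2 * dotL (dq i (h n) u - g) (dq i (h n) u - g) +
    3 * L ^+ 2 * (dotL (dq i (h n) u) (dq i (h n) u) * h n ^+ 2) +
    3 * 1 ^+ 2 * dotL ((fun x => dq i (h n) X x * u x) - (fun x => dX x * u x))
     ((fun x => dq i (h n) X x * u x) - (fun x => dX x * u x)) @[n --> \oo] -->
    3 * M ^+ 2 * 0 + 3 * L ^+ 2 * 0 + 3 * 1 ^+ 2 * (0 : R).
  by apply: cvgD; [apply: cvgD|]; exact: cvgMr.
rewrite !mulr0 !addr0 in H; apply: squeeze_cvgr H; last exact: cvg_cst.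
apply: nearW => n; rewrite (sib_ge0 S)//=.
have := dotL_le3 M0 (mulr_ge0 L0 (normr_ge0 (h n))) ler01 (lfq n) (lB n) (sqint_dq i (h n) lu) (lr n) (key n).
by rewrite exprMn real_normK ?num_real//; lra.
Qed.

Lemma strong_weak_cvg (u : nat -> 'rV[R]_N -> R) u0 (w : 'rV[R]_N -> R) :
  (forall n, sqint (u n)) -> sqint u0 -> sqint w ->
  dotL (u n - u0) (u n - u0) @[n --> \oo] --> (0 : R) ->
  dotL (u n) w @[n --> \oo] --> dotL u0 w.
Proof.
move=> lu lu0 lw H; have S := dotL_si mu.
have H1 : dotL (u n - u0) w @[n --> \oo] --> (0 : R).
  apply: cvg0_CS H => n; first exact: (sib_CSn S (siB S (lu n) lu0) lw).
have H2 : dotL (u n - u0) w + dotL u0 w @[n --> \oo] --> 0 + dotL u0 w.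
  by apply: cvgD => //; exact: cvg_cst.
rewrite add0r in H2; apply: cvg_trans H2; apply: near_eq_cvg; apply: nearW => n.
by rewrite /= (sibBl S)// subrK.
Qed.

Lemma sderiv_lim i (u g : nat -> 'rV[R]_N -> R) u0 g0 :
  (forall n, sderiv i (u n) (g n)) -> sqint u0 -> sqint g0 ->
  dotL (u n - u0) (u n - u0) @[n --> \oo] --> (0 : R) ->
  dotL (g n - g0) (g n - g0) @[n --> \oo] --> (0 : R) -> sderiv i u0 g0.
Proof.
move=> ug lu0 lg0 cu cg; apply: (weak_limit_sderiv (F := \oo) (u := u) (g := g)) => //.
- exact: nearW.
- by move=> w lw; apply: strong_weak_cvg => // n; case: (ug n).
- by move=> w lw; apply: strong_weak_cvg => // n; case: (ug n).
Qed.

(** A smooth approximation of |s|. The subtraction of [e] makes it vanish at 0, as the chain rule in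
    L^2 demands. *)
Definition sabs (e s : R) := Num.sqrt (s ^+ 2 + e ^+ 2) - e.
Definition dsabs (e s : R) := s / Num.sqrt (s ^+ 2 + e ^+ 2).

Lemma sabs_sqrt_ge (e s : R) : 0 < e ->
  e <= Num.sqrt (s ^+ 2 + e ^+ 2) /\ `|s| <= Num.sqrt (s ^+ 2 + e ^+ 2).
Proof.
move=> e0; split.
  by rewrite -[leLHS](ger0_norm (ltW e0)) -sqrtr_sqr ler_wsqrtr// lerDr sqr_ge0.
by rewrite -sqrtr_sqr ler_wsqrtr// lerDl sqr_ge0.
Qed.

Lemma sabs_derive (e s : R) : 0 < e -> is_derive s (1 : R) (sabs e) (dsabs e s).
Proof.
move=> e0; have q0 : 0 < s ^+ 2 + e ^+ 2 by rewrite ltr_wpDl ?sqr_ge0// exprn_gt0.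
have H1 : is_derive s (1 : R) (fun t : R => t ^+ 2 + e ^+ 2) (2 * s).
  have H0 := is_deriveD (is_deriveM (is_derive_id s (1 : R)) (is_derive_id s (1 : R)))
    (is_derive_cst (e ^+ 2) s (1 : R)).
  apply: is_derive_eq H0 _.
  by rewrite addr0 -[LHS]/(s * 1 + s * 1) mulr1; ring.
have H2 := @is_derive1_comp _ (@Num.sqrt R) (fun t : R => t ^+ 2 + e ^+ 2) _ _ _
  (is_derive1_sqrt q0) H1.
have H3 : is_derive s (1 : R) (sabs e) ((2 * Num.sqrt (s ^+ 2 + e ^+ 2))^-1 * (2 * s) - 0).
  exact: is_deriveB H2 (is_derive_cst _ _ _).
apply: is_derive_eq H3 _; rewrite /dsabs subr0 invfM.
by rewrite mulrACA mulVf ?mul1r 1?mulrC.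
Qed.

Lemma dsabs_derive (e s : R) : 0 < e -> is_derive s (1 : R) (dsabs e)
  (e ^+ 2 / Num.sqrt (s ^+ 2 + e ^+ 2) ^+ 3).
Proof.
move=> e0; have [r1 _] := sabs_sqrt_ge s e0; have r0 := lt_le_trans e0 r1.
have q0 : 0 <= s ^+ 2 + e ^+ 2 by rewrite addr_ge0// sqr_ge0.
have H1 : is_derive s (1 : R) (fun t => Num.sqrt (t ^+ 2 + e ^+ 2)) (dsabs e s).
  have := is_deriveD (sabs_derive s e0) (is_derive_cst e s (1 : R)).
  rewrite addr0 (_ : sabs e + cst e = fun t => Num.sqrt (t ^+ 2 + e ^+ 2))//.
  by apply/funext => t; rewrite /sabs !fctE subrK.
have H2 := is_deriveV (f := fun t => Num.sqrt (t ^+ 2 + e ^+ 2)) (lt0r_neq0 r0) H1.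
have H3 := is_deriveM (is_derive_id s (1 : R)) H2.
apply: is_derive_eq H3 _; rewrite /dsabs.
have /esym := sqr_sqrtr q0; move: r0 {r1 H1 H2}; set r := Num.sqrt _ => r0 E.
have -> : e ^+ 2 = r ^+ 2 - s ^+ 2 by rewrite -E; ring.
rewrite /= -[X in X + _]/(s * _) -[X in _ + X]/(_ * 1).
by rewrite -[(_ *: _) in LHS]/(_ * _); field; rewrite gt_eqF.
Qed.

(** Limit of the chain rule for [sabs (e n)]: the derivatives [dsabs (e n)] converge pointwise to
    the sign, including the value 0 at 0, and stay bounded by 1. *)
Lemma sderiv_abs i u g : sderiv i u g ->
  sderiv i (fun x => `|u x|) (fun x => Num.sg (u x) * g x).
Proof.
move=> ug; have [lu lg _] := ug; have mu_ := sqint_meas lu; have mg := sqint_meas lg.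
have lau : sqint (fun x => `|u x|).
  by apply: (sqint_le _ lu) => [|x]; [exact: measurableT_comp|rewrite normr_id].
have lag : sqint (fun x => `|g x|).
  by apply: (sqint_le _ lg) => [|x]; [exact: measurableT_comp|rewrite normr_id].
pose e n : R := n.+1%:R^-1; have e0 n : 0 < e n by rewrite invr_gt0.
have msq n : mfun (fun x => Num.sqrt (u x ^+ 2 + e n ^+ 2)).
  apply: measurableT_comp; first by apply: continuous_measurable_fun; exact: sqrt_continuous.
  by apply: measurable_funD => //; exact: measurable_funX.
have mf n : mfun (fun x => sabs (e n) (u x)) by exact: measurable_funB.
have mdf n : mfun (fun x => dsabs (e n) (u x)).
  apply: (@measurableT_comp _ _ _ _ _ _ (dsabs (e n))) => //.
  apply: continuous_measurable_fun => t; apply: differentiable_continuous.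
  by apply/derivable1_diffP; have [] := dsabs_derive t (e0 n).
have cdf s : dsabs (e n) s @[n --> \oo] --> Num.sg s.
  have [->|s0] := eqVneq s 0.
    by rewrite sgr0 [X in X @ _](_ : _ = cst 0); [exact: cvg_cst|apply/funext => n; rewrite /dsabs mul0r].
  rewrite (_ : Num.sg s = s * (Num.sqrt (s ^+ 2 + 0 ^+ 2))^-1); last first.
    by rewrite expr0n addr0 sqrtr_sqr {2}[s]numEsg mulfK// normr_eq0.
  apply: cvgMr; apply: cvgV.
    by rewrite expr0n addr0 sqrtr_sqr normr_eq0.
  apply: continuous_cvg; first exact: sqrt_continuous.
  by apply: cvgD; [exact: cvg_cst|apply: cvgM; exact: harm_cvg].
have sg s n : `|sabs (e n) s - `|s| | <= e n /\ `|sabs (e n) s| <= `|s|.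
  have [r1 r2] := sabs_sqrt_ge s (e0 n).
  have r3 : Num.sqrt (s ^+ 2 + e n ^+ 2) <= `|s| + e n.
    have p0 : 0 <= `|s| + e n by rewrite addr_ge0 // ltW.
    rewrite -[leRHS](ger0_norm p0) -sqrtr_sqr ler_wsqrtr//.
    rewrite sqrrD real_normK ?num_real// addrAC lerDl mulrn_wge0// mulr_ge0// ltW//.
  by rewrite /sabs !ler_norml; split; apply/andP; split; lra.
have sg0 : mfun (fun x => Num.sg (u x) * g x).
  apply: measurable_funM => //.
  apply: (@measurable_fun_cvg _ _ _ _ (fun n x => dsabs (e n) (u x))) => // x _; exact: cdf.
apply: (sderiv_lim (u := fun n x => sabs (e n) (u x)) (g := fun n x => dsabs (e n) (u x) * g x)).
- move=> n; apply: (@sderiv_chain (fun=> True) (sabs (e n)) (dsabs (e n))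
    (fun s => e n ^+ 2 / Num.sqrt (s ^+ 2 + e n ^+ 2) ^+ 3) 1 (e n)^-1) => //.
  + by rewrite /sabs expr0n add0r sqrtr_sqr ger0_norm ?subrr// ltW.
  + by move=> s _; exact: sabs_derive.
  + by move=> s _; exact: dsabs_derive.
  + move=> s _; have [r1 r2] := sabs_sqrt_ge s (e0 n); have r0 := lt_le_trans (e0 n) r1.
    by rewrite /dsabs normrM normfV (gtr0_norm r0) ler_pdivrMr// mul1r.
  + move=> s _; have [r1 r2] := sabs_sqrt_ge s (e0 n); have r0 := lt_le_trans (e0 n) r1.
    have p0 : 0 <= e n ^+ 2 / Num.sqrt (s ^+ 2 + e n ^+ 2) ^+ 3.
      by rewrite divr_ge0 ?sqr_ge0 ?exprn_ge0 ?sqrtr_ge0.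
    rewrite (ger0_norm p0) ler_pdivrMr ?exprn_gt0// mulrC ler_pdivlMr//.
    by rewrite -exprSr lerXn2r ?nnegrE// ltW.
- exact: lau.
- apply: (sqint_le _ lg) => // x; rewrite normrM normr_sg.
  by rewrite ler_piMl//; case: (_ != 0).
- apply: (L2_dct (g := fun x => `|u x|) _ _ _ _ _).2 => //.
  + by exact: measurableT_comp.
  + by move=> n x; case: (sg (u x) n).
  + apply: aeW => x; apply/cvgrPdist_le => d d0.
    have HH : \forall n \near \oo, `|e n| <= d by exact: (cvgr0_norm_le _ harm_cvg _ d0).
    apply: filterS HH => n; rewrite gtr0_norm// distrC => H.
    by apply: le_trans H; case: (sg (u x) n).
- apply: (L2_dct (g := fun x => `|g x|) _ _ _ _ _).2 => //.
  + by move=> n; exact: measurable_funM.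
  + move=> n x; have [r1 r2] := sabs_sqrt_ge (u x) (e0 n); have r0 := lt_le_trans (e0 n) r1.
    rewrite normrM; apply: ler_piMl => //.
    by rewrite /dsabs normrM normfV (gtr0_norm r0) ler_pdivrMr// mul1r.
  + by apply: aeW => x; apply: cvgMl; exact: cdf.
Qed.

End test_functions.

(** * The Hilbert space H^1 *)

Section ultra.
Context {R : realType}.

Lemma ultra_map (T U : Type) (f : T -> U) (F : set_system T) :
  UltraFilter F -> UltraFilter (f @ F).
Proof.
move=> UF; have PF := @ultra_proper _ _ UF; split=> [|G PG sG]; first exact: fmap_proper_filter.
apply/seteqP; split=> A; last exact: sG.
move=> GA; have [//|FnA] := in_ultra_setVsetC (f @^-1` A) UF.
have GnA : G (~` A) by exact: sG.
have GI : G (A `&` ~` A) by exact: filterI.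
by exfalso; move: GI; rewrite setICr; exact: filter_not_empty.
Qed.

Lemma ultra_cvg_bounded (T : Type) (F : set_system T) (a : T -> R) (M : R) :
  UltraFilter F -> (forall t, `|a t| <= M) -> exists l : R, a t @[t --> F] --> l.
Proof.
move=> UF aM; have := @segment_compact R (- M) M; rewrite compact_ultra => /= H.
have [||l [_ Hl]] := H (a @ F); last by exists l.
  exact: ultra_map.
apply: (@filterS _ F _ setT); last exact: filterT.
by move=> t _; rewrite /= in_itv /= -ler_norml.
Qed.

(** Along an ultrafilter every bounded real family converges, so the limit functional exists on all
    vectors at once, with neither separability nor a diagonal extraction; the Riesz theorem
    represents it. *)
Lemma si_weak_compact (V : lmodType R) (P : V -> Prop) (b : V -> V -> R)
    (T : Type) (F : set_system T) (u : T -> V) (M : R) :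
  semi_inner P b -> si_complete P b -> UltraFilter F ->
  (forall t, P (u t)) -> (forall t, b (u t) (u t) <= M) ->
  exists2 u0, P u0 & forall w, P w -> b (u t) w @[t --> F] --> b u0 w.
Proof.
move=> S C UF Pu uM; have PF := @ultra_proper _ _ UF.
have bd w t : P w -> `|b (u t) w| <= Num.sqrt M * sinorm b w.
  move=> Pw; apply: le_trans (sib_CSn S (Pu t) Pw) _.
  by rewrite ler_wpM2r ?sinorm_ge0// ler_wsqrtr.
have ex w : exists l : R, P w -> b (u t) w @[t --> F] --> l.
  have [Pw|nPw] := pselect (P w); last by exists 0.
  by have [l Hl] := ultra_cvg_bounded UF (fun t => bd w t Pw); exists l.
have [l Hl] := choice ex.
have [||w Pw|u0 Pu0 E] := @si_riesz _ _ P b S C l (Num.sqrt M).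
- move=> v w Pv Pw; apply: (@cvg_unique _ _ (b (u t) (v + w) @[t --> F])).
  + exact: @Rhausdorff R.
  + exact/Hl/(siD S).
  + rewrite (_ : (fun t => b (u t) (v + w)) = fun t => b (u t) v + b (u t) w).
      by apply: cvgD; exact: Hl.
    by apply/funext => t; rewrite (sibDr S).
- move=> a w Pw; apply: (@cvg_unique _ _ (b (u t) (a *: w) @[t --> F])).
  + exact: @Rhausdorff R.
  + exact/Hl/(siZ S).
  + rewrite (_ : (fun t => b (u t) (a *: w)) = fun t => a * b (u t) w).
      by apply: cvgMr; exact: Hl.
    by apply/funext => t; rewrite (sibZr S).
- have H : `|b (u t) w| @[t --> F] --> `|l w| by apply: cvg_norm; exact: Hl.
  rewrite -(cvg_lim (@Rhausdorff R) H); apply: limr_le; first by apply/cvg_ex; exists `|l w|.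
  by apply: nearW => t; exact: bd.
by exists u0 => // w Pw; rewrite -E//; exact: Hl.
Qed.

End ultra.

Section H1_space.
Context {R : realType} {N : nat}.
Implicit Types (x v : 'rV[R]_N) (i j : 'I_N).
Local Notation mu := (@lebesgue_rV R N).
Local Notation sqint := (sqint mu).
Local Notation dotL := (dotL mu).
Local Notation fn := ('rV[R]_N -> R).

Definition ip (u v : fn) : R :=
  \int[mu]_x ((\sum_(i < N) wgrad u i x * wgrad v i x) + u x * v x).

Lemma ipE (u v : fn) : H1 u -> H1 v ->
  ip u v = \sum_(i < N) dotL (wgrad u i) (wgrad v i) + dotL u v.
Proof.
move=> Hu Hv; rewrite /ip ID ?Isum//.
- by move=> i; apply: sqintM; exact: sqint_wgrad.
- by apply: intg_sum => i; apply: sqintM; exact: sqint_wgrad.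
- by apply: sqintM; exact: H1_sqint.
Qed.

Lemma H1_intro (u : fn) (g : 'I_N -> fn) : sqint u -> (forall i, sderiv i u (g i)) -> H1 u.
Proof. by move=> lu H; apply/H1P; split=> // i; exists (g i). Qed.

(** [wgrad] is an arbitrary choice of representative and is linear only almost everywhere; this
    allows [ip] to be computed with any derivatives at hand. *)
Lemma ip_sderiv (u v : fn) (g k : 'I_N -> fn) : sqint u -> sqint v ->
  (forall i, sderiv i u (g i)) -> (forall i, sderiv i v (k i)) ->
  ip u v = \sum_(i < N) dotL (g i) (k i) + dotL u v.
Proof.
move=> lu lv Hg Hk; have Hu := H1_intro lu Hg; have Hv := H1_intro lv Hk.
rewrite ipE//; congr (_ + _); apply: eq_bigr => i _.
have [_ lg _] := Hg i; have [_ lk _] := Hk i.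
by apply: eq_dotL => //; try exact: sqint_wgrad; exact: wgrad_ae.
Qed.

Lemma sderivN i (u g : fn) : sderiv i u g -> sderiv i (- u) (- g).
Proof. by move=> /(sderivZ (-1)); rewrite !scaleN1r. Qed.

Lemma sderivB i (u v g k : fn) : sderiv i u g -> sderiv i v k -> sderiv i (u - v) (g - k).
Proof. by move=> ug /sderivN; exact: sderivD. Qed.

Lemma ip_si : semi_inner H1 ip.
Proof.
have S := dotL_si mu; have ws := @wgrad_sderiv R N; have hs := @H1_sqint R N.
have lw := @sqint_wgrad R N.
have H10 : H1 (0 : fn) by exact: (H1_intro (sqint0 _) (@sderiv0 R N)).
have H1D (u v : fn) : H1 u -> H1 v -> H1 (u + v).
  move=> Hu Hv; apply: (H1_intro (siD S (hs _ Hu) (hs _ Hv)) (g := fun i => wgrad u i + wgrad v i)).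
  by move=> i; apply: sderivD; exact: ws.
have H1Z a (u : fn) : H1 u -> H1 (a *: u).
  move=> Hu; apply: (H1_intro (siZ S a (hs _ Hu)) (g := fun i => a *: wgrad u i)).
  by move=> i; apply: sderivZ; exact: ws.
split=> //.
- move=> u v Hu Hv; rewrite /ip; congr (Rintegral _ _ _); apply/funext => x.
  by rewrite mulrC; congr (_ + _); apply: eq_bigr => i _; rewrite mulrC.
- move=> u v w Hu Hv Hw.
  rewrite (@ip_sderiv (u + v) w (fun i => wgrad u i + wgrad v i) (wgrad w)).
  + rewrite !ipE// (sibDl S) ?hs//.
    rewrite (eq_bigr (fun i => dotL (wgrad u i) (wgrad w i) + dotL (wgrad v i) (wgrad w i))).
      by rewrite big_split /= addrACA.
    by move=> i _; rewrite (sibDl S)// lw.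
  + exact/hs/H1D.
  + exact: hs.
  + by move=> i; apply: sderivD; exact: ws.
  + by move=> i; exact: ws.
- move=> a u w Hu Hw.
  rewrite (@ip_sderiv (a *: u) w (fun i => a *: wgrad u i) (wgrad w)).
  + rewrite !ipE// (sibZl S) ?hs// mulrDr mulr_sumr; congr (_ + _); apply: eq_bigr => i _.
    by rewrite (sibZl S)// lw.
  + exact/hs/H1Z.
  + exact: hs.
  + by move=> i; apply: sderivZ; exact: ws.
  + by move=> i; exact: ws.
- move=> u Hu; rewrite ipE// addr_ge0 ?(sib_ge0 S) ?hs// sumr_ge0// => i _.
  by rewrite (sib_ge0 S)// lw.
Qed.

Lemma dotL_ip_le (u : fn) : H1 u -> dotL u u <= ip u u.
Proof.
move=> Hu; rewrite ipE// lerDr sumr_ge0// => i _.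
by apply: (sib_ge0 (dotL_si mu)); exact: sqint_wgrad.
Qed.

Lemma dotL_wgrad_le (u : fn) i : H1 u -> dotL (wgrad u i) (wgrad u i) <= ip u u.
Proof.
move=> Hu; have S := dotL_si mu; rewrite ipE// (bigD1 i)//= -addrA lerDl addr_ge0//.
  by rewrite sumr_ge0// => j _; apply: (sib_ge0 S); exact: sqint_wgrad.
by apply: (sib_ge0 S); exact: H1_sqint.
Qed.

Lemma ip_eq0_ae (u : fn) : H1 u -> ip u u = 0 -> ae_zero u.
Proof.
move=> Hu u0; apply: dotL_eq0; first exact: H1_sqint.
by apply/eqP; rewrite eq_le -{1}u0 dotL_ip_le// (sib_ge0 (dotL_si mu))// H1_sqint.
Qed.

Lemma H1_ae (u u' : fn) : H1 u -> mfun u' -> {ae mu, forall x, u x = u' x} ->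
  H1 u' /\ forall i, sderiv i u' (wgrad u i).
Proof.
move=> Hu mu' uu'; have lu' : sqint u'.
  by apply: (sqint_ae mu' (H1_sqint Hu)); apply: filterS uu' => x ->.
have H i : sderiv i u' (wgrad u i).
  apply: weak_sderiv => //; first exact: sqint_wgrad.
  have := sderiv_weak (wgrad_sderiv i Hu) => W phi tp; rewrite -(W _ tp).
  apply: I_ae.
  - exact: measurable_funM (sqint_meas lu') (test_meas (test_partial i tp)).
  - exact: measurable_funM (sqint_meas (H1_sqint Hu)) (test_meas (test_partial i tp)).
  - by apply: filterS uu' => x ->.
by split=> //; exact: (H1_intro lu' H).
Qed.

Lemma ip_ae (u u' v : fn) : H1 u -> H1 u' -> H1 v -> {ae mu, forall x, u x = u' x} ->
  ip u v = ip u' v.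
Proof.
move=> Hu Hu' Hv uu'; have [_ H] := H1_ae Hu (sqint_meas (H1_sqint Hu')) uu'.
rewrite (ip_sderiv (H1_sqint Hu') (H1_sqint Hv) H (fun i => wgrad_sderiv i Hv)) ipE//.
congr (_ + _); apply: eq_dotL => //; try exact: H1_sqint.
exact: aeW.
Qed.

Lemma wgradB_ae (u v : fn) i : H1 u -> H1 v ->
  {ae mu, forall x, wgrad (u - v) i x = (wgrad u i - wgrad v i) x}.
Proof.
move=> Hu Hv; have S := ip_si; apply: wgrad_ae; first exact: (siB S).
by apply: sderivB; exact: wgrad_sderiv.
Qed.

Lemma dotL_wgradB (u v : fn) i : H1 u -> H1 v ->
  dotL (wgrad u i - wgrad v i) (wgrad u i - wgrad v i) <= ip (u - v) (u - v).
Proof.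
move=> Hu Hv; have S := ip_si; have SL := dotL_si mu.
have Huv := siB S Hu Hv.
have lB := siB SL (sqint_wgrad i Hu) (sqint_wgrad i Hv).
apply: le_trans (dotL_wgrad_le i Huv); rewrite le_eqVlt; apply/orP; left; apply/eqP.
by apply: eq_dotL => //; try exact: sqint_wgrad; apply: filterS (wgradB_ae i Hu Hv) => x ->.
Qed.

Lemma H1_complete : si_complete H1 ip.
Proof.
move=> u Hu Cu; have S := ip_si; have SL := dotL_si mu.
have [] := @L2_complete _ _ _ mu u.
- by move=> n; exact: H1_sqint.
- move=> e /Cu[K HK]; exists K => n m Kn Km; apply: le_trans (HK n m Kn Km).
  by apply: dotL_ip_le; exact: (siB S).
move=> u0 lu0 cu.
have /choice[g Hg] : forall i, exists g, sqint g /\ forall e : R, 0 < e ->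
    exists K, forall n, (K <= n)%N -> dotL (wgrad (u n) i - g) (wgrad (u n) i - g) <= e.
  move=> i; have [] := @L2_complete _ _ _ mu (fun n => wgrad (u n) i).
  - by move=> n; exact: sqint_wgrad.
  - move=> e /Cu[K HK]; exists K => n m Kn Km; apply: le_trans (HK n m Kn Km).
    exact: dotL_wgradB.
  by move=> g lg cg; exists g.
have tocvg (a : nat -> fn) a0 : (forall n, sqint (a n)) -> sqint a0 ->
    (forall e : R, 0 < e -> exists K, forall n, (K <= n)%N -> dotL (a n - a0) (a n - a0) <= e) ->
    dotL (a n - a0) (a n - a0) @[n --> \oo] --> (0 : R).
  move=> la la0 H; apply/cvgrPdist_le => e /H[K HK]; exists K => // n /= Kn.
  by rewrite sub0r normrN ger0_norm ?HK// (sib_ge0 SL)//; exact: (siB SL).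
have Hs i : sderiv i u0 (g i).
  have [lg cg] := Hg i; apply: (sderiv_lim (u := u) (g := fun n => wgrad (u n) i)) => //.
  - by move=> n; exact: wgrad_sderiv.
  - by apply: tocvg => // n; exact: H1_sqint.
  - by apply: tocvg => // n; exact: sqint_wgrad.
have Hu0 := H1_intro lu0 Hs; exists u0 => // e e0.
have ip_cvg : ip (u n - u0) (u n - u0) @[n --> \oo] --> (0 : R).
  have E n : ip (u n - u0) (u n - u0) = \sum_(i < N) dotL (wgrad (u n) i - g i) (wgrad (u n) i - g i)
      + dotL (u n - u0) (u n - u0).
    have lB : sqint (u n - u0) by apply: (siB SL) => //; exact: H1_sqint.
    have HB i : sderiv i (u n - u0) (wgrad (u n) i - g i).
      by apply: sderivB => //; exact: wgrad_sderiv.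
    exact: ip_sderiv.
  rewrite (funext E) -[X in _ --> X]addr0; apply: cvgD.
    rewrite -[X in _ --> X](big1 (idx := 0) (op := +%R) (index_enum 'I_N) xpredT (fun=> 0))//.
    apply: cvg_big; [exact: add_continuous|move=> i _].
    by have [lg cg] := Hg i; apply: tocvg => // n; exact: sqint_wgrad.
  by apply: tocvg => // n; exact: H1_sqint.
have HH : \forall n \near \oo, `|ip (u n - u0) (u n - u0)| <= e by exact: (cvgr0_norm_le _ ip_cvg _ e0).
have [K _ HK] := HH; exists K => n Kn; exact: le_trans (ler_norm _) (HK n Kn).
Qed.

Lemma H1_weak_compact (T : Type) (F : set_system T) (u : T -> fn) (M : R) :
  UltraFilter F -> (forall t, H1 (u t)) -> (forall t, ip (u t) (u t) <= M) ->
  exists2 u0, H1 u0 & forall w, H1 w -> ip (u t) w @[t --> F] --> ip u0 w.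
Proof. move=> UF; apply: si_weak_compact UF; [exact: ip_si|exact: H1_complete]. Qed.

(** Pairing with [w] in L^2 is a bounded functional on H^1, hence of the form ip(., k). *)
Lemma ip_weak_dotL (T : Type) (F : set_system T) {FF : Filter F} (u : T -> fn) (u0 : fn) :
  (forall t, H1 (u t)) -> H1 u0 ->
  (forall w, H1 w -> ip (u t) w @[t --> F] --> ip u0 w) ->
  forall w, sqint w -> dotL (u t) w @[t --> F] --> dotL u0 w.
Proof.
move=> Hu Hu0 cu w lw; have S := ip_si; have SL := dotL_si mu.
have [||v Hv|k Hk E] := @si_riesz _ _ _ _ S H1_complete (fun v : fn => dotL v w) (sinorm dotL w).
- by move=> v v' Hv Hv'; rewrite (sibDl SL)//; exact: H1_sqint.
- by move=> a v Hv; rewrite (sibZl SL)//; exact: H1_sqint.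
- apply: le_trans (sib_CSn SL (H1_sqint Hv) lw) _; rewrite mulrC ler_wpM2l ?sinorm_ge0//.
  by rewrite ler_wsqrtr// dotL_ip_le.
have E' (v : fn) : H1 v -> dotL v w = ip v k by move=> Hv; rewrite (E v Hv) (sibC S).
rewrite E'// (_ : (fun t => dotL (u t) w) = fun t => ip (u t) k); first exact: cu.
by apply/funext => t; exact: E'.
Qed.

Lemma H1_abs (u : fn) : H1 u -> H1 (fun x => `|u x|) /\
  ip (fun x => `|u x|) (fun x => `|u x|) <= ip u u.
Proof.
move=> Hu; have lu := H1_sqint Hu.
have lau : sqint (fun x => `|u x|).
  apply: (sqint_le _ lu) => [|x]; last by rewrite normr_id.
  by apply: measurableT_comp => //; exact: sqint_meas lu.
have H i := sderiv_abs (wgrad_sderiv i Hu).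
split; first exact: (H1_intro lau H).
rewrite (ip_sderiv lau lau H H) ipE//; apply: lerD.
  apply: ler_sum => i _; apply: dotL_le; [by case: (H i)|exact: sqint_wgrad|move=> x].
  by rewrite normrM normr_sg ler_piMl//; case: (_ != 0).
by apply: dotL_le => // x; rewrite normr_id.
Qed.

Lemma pos_absE (u : fn) : u^\+ = 2^-1 *: ((fun x => `|u x|) + u).
Proof.
apply/funext => x; rewrite /funrpos !fctE -[RHS]/(2^-1 * (`|u x| + u x)).
by rewrite maxr_absE subr0 addr0 addrC mulrC.
Qed.

Lemma neg_absE (u : fn) : u^\- = 2^-1 *: ((fun x => `|u x|) - u).
Proof.
apply/funext => x; rewrite /funrneg !fctE -[RHS]/(2^-1 * (`|u x| - u x)).
by rewrite maxr_absE subr0 addr0 normrN addrC mulrC.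
Qed.

Lemma H1_pos (u : fn) : H1 u -> H1 u^\+.
Proof.
move=> Hu; have S := ip_si; have [Ha _] := H1_abs Hu.
by rewrite pos_absE; apply: (siZ S); exact: (siD S).
Qed.

Lemma H1_neg (u : fn) : H1 u -> H1 u^\-.
Proof.
move=> Hu; have S := ip_si; have [Ha _] := H1_abs Hu.
by rewrite neg_absE; apply: (siZ S); exact: (siB S).
Qed.

Lemma posneg_eq (u : fn) : u^\+ - u^\- = u.
Proof.
apply/funext => x; rewrite pos_absE neg_absE !fctE.
rewrite -[LHS]/(2^-1 * (`|u x| + u x) - 2^-1 * (`|u x| - u x)); lra.
Qed.

Lemma H1_shift (u : fn) v : H1 u -> H1 (fun x => u (x + v)).
Proof.
move=> Hu; apply: (H1_intro (sqint_shift v (H1_sqint Hu)) (g := fun i x => wgrad u i (x + v))).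
by move=> i; apply: sderiv_shift; exact: wgrad_sderiv.
Qed.

Lemma ip_shift (u w : fn) v : H1 u -> H1 w ->
  ip (fun x => u (x + v)) (fun x => w (x + v)) = ip u w.
Proof.
move=> Hu Hw.
rewrite (ip_sderiv (sqint_shift v (H1_sqint Hu)) (sqint_shift v (H1_sqint Hw))
  (fun i => sderiv_shift v (wgrad_sderiv i Hu)) (fun i => sderiv_shift v (wgrad_sderiv i Hw))).
rewrite ipE// dotL_shift ?H1_sqint//; congr (_ + _); apply: eq_bigr => i _.
by rewrite dotL_shift// sqint_wgrad.
Qed.

Lemma H1_test (phi : fn) : test_function phi -> H1 phi.
Proof.
move=> tp; apply: (H1_intro (test_sqint tp) (g := fun i => partial i phi)) => i.
exact: test_sderiv.
Qed.

End H1_space.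

(** * Hardy inequality and Riesz energy *)

Section regularized_kernel.
Context {R : realType}.
Implicit Types e g q s : R.

(** With q = |z|^2 this is (e + q)^(-g/2) / (1 + q): [e] removes the singularity of |z|^-g, and the
    extra decay makes the field x [kreg] and its divergence bounded, so that integration by parts
    needs no cutoff. The exponential form shortens derivatives and comparisons. *)
Definition kreg e g q : R := expR (- (g / 2) * ln (e + q) - ln (1 + q)).

Lemma kreg_gt0 e g q : 0 < kreg e g q. Proof. exact: expR_gt0. Qed.

Lemma measurable_kreg e g : mfun (kreg e g).
Proof.
apply: measurableT_comp; first exact: measurable_expR.
apply: measurable_funB.
  apply: measurable_funM; first exact: measurable_cst.
  by apply: measurableT_comp (@measurable_ln R) _; apply: measurable_funD.
by apply: measurableT_comp (@measurable_ln R) _; apply: measurable_funD.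
Qed.

Lemma kreg_derive e g q : 0 < e -> 0 <= q ->
  is_derive q (1 : R) (kreg e g) (- kreg e g q * (g / 2 / (e + q) + (1 + q)^-1)).
Proof.
move=> e0 q0; have eq0 : 0 < e + q by rewrite ltr_pwDl.
have q1 : 0 < 1 + q by rewrite ltr_pwDl.
have da (a : R) : 0 < a + q -> is_derive q (1 : R) (fun t : R => ln (a + t)) (a + q)^-1.
  move=> aq; have H := is_deriveD (is_derive_cst a q (1 : R)) (is_derive_id q (1 : R)).
  have := @is_derive1_comp _ (@ln R) (cst a + id) _ _ _ (is_derive1_ln aq) H.
  by rewrite add0r mulr1.
have H1 := is_deriveB (is_deriveZ (- (g / 2)) (da e eq0)) (da 1 q1).
have := @is_derive1_comp _ (@expR R) _ _ _ _ (is_derive_expR _) H1.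
move=> H2; apply: is_derive_eq H2 _; rewrite /kreg.
rewrite -[(- (g / 2) *: (fun t : R => ln (e + t)) - (fun t : R => ln (1 + t))) q]/(- (g/2) * ln (e + q) - ln (1 + q)).
by rewrite -[_ *: _ ]/(_ * _); ring.
Qed.

Lemma kreg_le e g q : 0 < e -> 0 <= g -> 0 <= q ->
  (1 + q) * kreg e g q <= expR (- (g / 2) * ln e).
Proof.
move=> e0 g0 q0; have q1 : 0 < 1 + q by rewrite ltr_pwDl.
rewrite -{1}[1 + q](lnK q1) -expRD ler_expR addrC subrK.
by rewrite !mulNr lerN2 ler_wpM2l ?divr_ge0// ler_ln ?posrE ?lerDl// ltr_pwDl.
Qed.

(* Raising the exponent by 2 is compensated by a factor q. *)
Lemma kreg_shift e g q : 0 < e -> 0 <= q -> q * kreg e g q <= kreg e (g - 2) q.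
Proof.
move=> e0 q0; have eq0 : 0 < e + q by rewrite ltr_pwDl.
apply: (@le_trans _ _ ((e + q) * kreg e g q)).
  by rewrite ler_wpM2r ?lerDr ?(ltW e0)// ltW// kreg_gt0.
rewrite -{1}[e + q](lnK eq0) -expRD ler_expR; lra.
Qed.

Lemma kreg_small e g q : 0 < e <= 1 -> -2 <= g <= 0 -> 0 <= q -> kreg e g q <= 1.
Proof.
move=> /andP[e0 e1] /andP[g1 g2] q0; have eq0 : 0 < e + q by rewrite ltr_pwDl.
rewrite -expR0 ler_expR subr_le0.
have H0 : 0 <= ln (1 + q) by rewrite ln_ge0// lerDl.
have H1 : ln (e + q) <= ln (1 + q) by rewrite ler_ln ?posrE ?lerD2r// ltr_pwDl.
have H2 : 0 <= - (g / 2) <= 1 by apply/andP; split; lra.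
by move: H2 => /andP[? ?]; nra.
Qed.

End regularized_kernel.

Section hardy.
Context {R : realType} {N : nat}.
Implicit Types (x y z v : 'rV[R]_N) (i j : 'I_N).
Local Notation mu := (@lebesgue_rV R N).
Local Notation sqint := (sqint mu).
Local Notation dotL := (dotL mu).
Local Notation fn := ('rV[R]_N -> R).

Definition sqn x : R := \sum_(i < N) x ord0 i ^+ 2.

Lemma sqn_ge0 x : 0 <= sqn x. Proof. by rewrite sumr_ge0// => i _; rewrite sqr_ge0. Qed.

Lemma sqnN x : sqn (- x) = sqn x.
Proof. by apply: eq_bigr => i _; rewrite mxE sqrrN. Qed.

Lemma sqnB x y : sqn (x - y) = sqn (y - x). Proof. by rewrite -sqnN opprB. Qed.

Lemma sqn_coord x i : x ord0 i ^+ 2 <= sqn x.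
Proof. by rewrite /sqn (bigD1 i)//= lerDl sumr_ge0// => j _; rewrite sqr_ge0. Qed.

Lemma measurable_sqn : mfun sqn.
Proof.
by apply: measurable_sum => i; apply: measurable_funX; exact: measurable_coord.
Qed.

Lemma sqn_line x i (t : R) : sqn (x + t *: dirv i) = sqn x + 2 * t * x ord0 i + t ^+ 2.
Proof.
rewrite /sqn (bigD1 i)//= [in RHS](bigD1 i)//= !mxE !eqxx mulr1.
rewrite (eq_bigr (fun j => x ord0 j ^+ 2)); first by ring.
by move=> j ji; rewrite !mxE eqxx (negPf ji) mulr0 addr0.
Qed.

(** The i-th component of the radial field whose divergence is integrated against u^2 in the Hardy
    inequality; [dhfield] is its i-th partial derivative. *)
Definition hfield (e g : R) i x : R := x ord0 i * kreg e g (sqn x).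
Definition dhfield (e g : R) i x : R := kreg e g (sqn x) -
  2 * x ord0 i ^+ 2 * (kreg e g (sqn x) * (g / 2 / (e + sqn x) + (1 + sqn x)^-1)).

Lemma hfield_derive e g i x : 0 < e -> is_derive x (dirv i) (hfield e g i) (dhfield e g i x).
Proof.
move=> e0; rewrite -{1}[x]addr0 -(scale0r (dirv i)); apply/is_derive_line.
have Hs : is_derive (0 : R) (1 : R) (fun t : R => sqn (x + t *: dirv i)) (2 * x ord0 i).
  rewrite (_ : (fun t : R => _) = (fun t : R => sqn x + 2 * t * x ord0 i + t ^+ 2)); last first.
    by apply/funext => t; rewrite sqn_line.
  have H1 := is_deriveD (is_deriveD (is_derive_cst (sqn x) (0 : R) (1 : R))
    (is_deriveM (is_deriveM (is_derive_cst (2 : R) (0 : R) (1 : R)) (is_derive_id (0 : R) (1 : R)))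
      (is_derive_cst (x ord0 i) (0 : R) (1 : R))))
    (is_deriveM (is_derive_id (0 : R) (1 : R)) (is_derive_id (0 : R) (1 : R))).
  apply: is_derive_eq H1 _ => /=; rewrite /cst /=.
  rewrite -![_ *: _]/(_ * _); ring.
have Hk := @is_derive1_comp _ (kreg e g) (fun t : R => sqn (x + t *: dirv i)) _ _ _
  (kreg_derive g e0 (sqn_ge0 _)) Hs.
have Hc : is_derive (0 : R) (1 : R) (fun t : R => (x + t *: dirv i) ord0 i) 1.
  rewrite (_ : (fun t : R => _) = (fun t : R => x ord0 i + t)); last first.
    by apply/funext => t; rewrite !mxE !eqxx mulr1.
  apply: is_derive_eq (is_deriveD (is_derive_cst (x ord0 i) (0 : R) (1 : R)) (is_derive_id (0 : R) (1 : R))) _.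
  by rewrite add0r.
apply: is_derive_eq (is_deriveM Hc Hk) _.
rewrite /= scale0r addr0 /dhfield -![_ *: _]/(_ * _); ring.
Qed.

Lemma measurable_ksqn e g : mfun (fun x => kreg e g (sqn x)).
Proof. exact: measurableT_comp (measurable_kreg e g) measurable_sqn. Qed.

Lemma measurable_hfield e g i : mfun (hfield e g i).
Proof. by apply: measurable_funM; [exact: measurable_coord|exact: measurable_ksqn]. Qed.

Lemma measurable_dhfield e g i : 0 < e -> mfun (dhfield e g i).
Proof.
move=> e0; have mi (a : R) : 0 < a -> mfun (fun x => (a + sqn x)^-1).
  move=> a0; rewrite (_ : (fun x => _) = (fun x => (a + sqn x) `^ (-1))).
    apply: (@measurableT_comp _ _ _ _ _ _ (fun t : R => t `^ (-1))).
      exact: measurable_powR.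
    by apply: measurable_funD => //; exact: measurable_sqn.
  by apply/funext => x; rewrite powR_inv1// addr_ge0 ?sqn_ge0// ltW.
apply: measurable_funB; first exact: measurable_ksqn.
apply: measurable_funM.
  by apply: measurable_funM => //; apply: measurable_funX; exact: measurable_coord.
apply: measurable_funM; first exact: measurable_ksqn.
by apply: measurable_funD; [apply: measurable_funM => //; exact: mi|exact: mi].
Qed.

Lemma coord_abs_le x i : `|x ord0 i| <= 1 + sqn x.
Proof.
have := sqn_coord x i; rewrite -(real_normK (num_real (x ord0 i))).
by move: (sqn x) `|x ord0 i| => q a; have := sqr_ge0 (a - 1); nra.
Qed.

Lemma hfield_bound e g i x : 0 < e -> 0 <= g ->
  `|hfield e g i x| <= expR (- (g / 2) * ln e) /\
  `|dhfield e g i x| <= (3 + g) * expR (- (g / 2) * ln e).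
Proof.
move=> e0 g0; have q0 := sqn_ge0 x; have := kreg_le e0 g0 q0; have := kreg_gt0 e g (sqn x).
set k := kreg _ _ _; set M := expR _ => k0 kM; split.
  rewrite normrM (gtr0_norm k0); apply: le_trans kM.
  by rewrite ler_wpM2r ?(ltW k0)// coord_abs_le.
have xq := sqn_coord x i; rewrite /dhfield -/k.
have eq0 : 0 < e + sqn x by rewrite ltr_pwDl.
have q1 : 0 < 1 + sqn x by rewrite ltr_pwDl.
have a1 : 0 <= 2 * x ord0 i ^+ 2 * (g / 2 / (e + sqn x) + (1 + sqn x)^-1) <= g + 2.
  apply/andP; split.
    apply: mulr_ge0; first by rewrite mulr_ge0 ?sqr_ge0.
    by apply: addr_ge0; [apply: divr_ge0; [exact: divr_ge0|exact: ltW]|rewrite invr_ge0 ltW].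
  have : x ord0 i ^+ 2 / (e + sqn x) <= 1 by rewrite ler_pdivrMr// mul1r; lra.
  have : x ord0 i ^+ 2 / (1 + sqn x) <= 1 by rewrite ler_pdivrMr// mul1r; lra.
  rewrite mulrDr.
  have -> : 2 * x ord0 i ^+ 2 * (g / 2 / (e + sqn x)) = g * (x ord0 i ^+ 2 / (e + sqn x)).
    by field; rewrite gt_eqF.
  by nra.
have kM' : k <= M by apply: le_trans kM; rewrite ler_peMl ?(ltW k0)// lerDl.
have -> : k - 2 * x ord0 i ^+ 2 * (k * (g / 2 / (e + sqn x) + (1 + sqn x)^-1)) =
  k * (1 - 2 * x ord0 i ^+ 2 * (g / 2 / (e + sqn x) + (1 + sqn x)^-1)) by ring.
rewrite normrM (gtr0_norm k0) mulrC; apply: ler_pM => //; first exact: ltW.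
move: a1 => /andP[]; move: (_ * (_ + _)) => a a0 ag; rewrite ler_norml; apply/andP; split; lra.
Qed.

Lemma sderiv_hfield e g i (u gu : fn) : 0 < e -> 0 <= g -> sderiv i u gu ->
  sderiv i (fun x => hfield e g i x * u x)
    (fun x => hfield e g i x * gu x + dhfield e g i x * u x).
Proof.
move=> e0 g0; pose M := expR (- (g / 2) * ln e).
apply: (@sderiv_mul _ _ _ _ M ((3 + g) * M)).
- exact: measurable_hfield.
- exact: measurable_dhfield.
- by move=> x; case: (hfield_bound i x e0 g0).
- by move=> x; case: (hfield_bound i x e0 g0).
- move=> x h.
  have [|c _ E] := mvt0 (F := fun t => hfield e g i (x + t *: dirv i))
    (dF := fun t => dhfield e g i (x + t *: dirv i)) h.
    by move=> t; apply/is_derive_line; exact: hfield_derive.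
  rewrite scale0r addr0 in E; rewrite E normrM ler_wpM2r//.
  by case: (hfield_bound i (x + c *: dirv i) e0 g0).
- by move=> x; exact: hfield_derive.
Qed.

Definition edens (u : fn) x : R := (\sum_(i < N) wgrad u i x ^+ 2) + u x ^+ 2.

Lemma intg_edens (u : fn) : H1 u -> intg mu (edens u).
Proof.
move=> Hu; apply: intgD; last exact: sqint_intg (H1_sqint Hu).
by apply: intg_sum => i; exact: sqint_intg (sqint_wgrad i Hu).
Qed.

Lemma I_edens (u : fn) : \int[mu]_x edens u x = ip u u.
Proof.
by congr (Rintegral _ _ _); apply/funext => x; rewrite /edens expr2; congr (_ + _);
  apply: eq_bigr => i _; rewrite expr2.
Qed.

Lemma edens_ge0 (u : fn) x : 0 <= edens u x.
Proof. by rewrite addr_ge0 ?sqr_ge0// sumr_ge0// => i _; rewrite sqr_ge0. Qed.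

Lemma intg_bdM (b f : fn) (M : R) : mfun b -> (forall x, `|b x| <= M) ->
  intg mu f -> intg mu (fun x => b x * f x).
Proof.
move=> mb bM If; apply: (@intg_le _ _ _ mu _ (fun x => M * `|f x|)).
- exact: measurable_funM mb (intg_meas If).
- exact: intgZ (intg_abs If).
- by move=> x; rewrite normrM ler_wpM2r.
Qed.

Lemma kreg_bound e g x : 0 < e -> 0 <= g ->
  `|kreg e g (sqn x)| <= expR (- (g / 2) * ln e) /\
  `|sqn x * kreg e g (sqn x)| <= expR (- (g / 2) * ln e).
Proof.
move=> e0 g0; have q0 := sqn_ge0 x; have := kreg_le e0 g0 q0; have := kreg_gt0 e g (sqn x).
move=> k0 kM; rewrite ger0_norm ?(ltW k0)// ger0_norm ?mulr_ge0 ?(ltW k0)//.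
split; apply: le_trans kM; [rewrite ler_peMl ?(ltW k0)// lerDl//|].
by rewrite ler_wpM2r ?(ltW k0)// lerDr.
Qed.

(** The integral of div(u^2 X) vanishes. With k the kernel and q = |x|^2, div X is at least (N - g)
    k - 2 q k, the last term coming from the factor 1/(1 + q). The cross term 2 u X . grad u is
    absorbed by half of (N - g) k u^2, and what is left carries the factor q k, that is, an exponent
    lowered by 2. *)
Lemma hardy e g (u : fn) : 0 < e -> 0 <= g -> g < N%:R -> H1 u ->
  \int[mu]_x (kreg e g (sqn x) * u x ^+ 2) <=
  (4 / (N%:R - g) + 4 * N%:R / (N%:R - g) ^+ 2) *
    \int[mu]_x ((sqn x * kreg e g (sqn x)) * edens u x).
Proof.
move=> e0 g0 gN Hu; set c := N%:R - g; have c0 : 0 < c by rewrite subr_gt0.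
have lu := H1_sqint Hu; have iu := sqint_intg lu; have ie := intg_edens Hu.
have Np : 0 < (N%:R : R) by apply: le_lt_trans gN.
have mk := measurable_ksqn e g.
have mqk : mfun (fun x => sqn x * kreg e g (sqn x)).
  by apply: measurable_funM => //; exact: measurable_sqn.
have I1 : intg mu (fun x => kreg e g (sqn x) * u x ^+ 2).
  exact: (intg_bdM mk (fun x => (kreg_bound x e0 g0).1) iu).
have I2 : intg mu (fun x => (sqn x * kreg e g (sqn x)) * edens u x).
  exact: (intg_bdM mqk (fun x => (kreg_bound x e0 g0).2) ie).
have Xs i := sderiv_hfield e0 g0 (wgrad_sderiv i Hu).
pose E i x := 2 * (wgrad u i x * (hfield e g i x * u x)) + dhfield e g i x * u x ^+ 2.
have iE i : intg mu (E i).
  apply: intgD.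
    by apply: intgZ; apply: sqintM; [exact: sqint_wgrad|case: (Xs i)].
  exact: (intg_bdM (measurable_dhfield g i e0) (fun x => (hfield_bound i x e0 g0).2) iu).
have E0 i : \int[mu]_x E i x = 0.
  have lX : sqint (fun x => hfield e g i x * u x) by case: (Xs i).
  have := sderiv_ibp (wgrad_sderiv i Hu) (Xs i).
  have IdX : intg mu (fun x => dhfield e g i x * u x ^+ 2).
    exact: (intg_bdM (measurable_dhfield g i e0) (fun x => (hfield_bound i x e0 g0).2) iu).
  have IX : intg mu (fun x => wgrad u i x * (hfield e g i x * u x)).
    exact: sqintM (sqint_wgrad i Hu) lX.
  rewrite /dotL.
  have -> : \int[mu]_x (u x * (hfield e g i x * wgrad u i x + dhfield e g i x * u x)) =
     \int[mu]_x (wgrad u i x * (hfield e g i x * u x)) + \int[mu]_x (dhfield e g i x * u x ^+ 2).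
    by rewrite -ID//; congr (Rintegral _ _ _); apply/funext => x; ring.
  rewrite /E ID ?IZ//; last exact: intgZ.
  lra.
have low x : c / 2 * (kreg e g (sqn x) * u x ^+ 2) -
    (2 + 2 * N%:R / c) * ((sqn x * kreg e g (sqn x)) * edens u x) <= \sum_(i < N) E i x.
  have := kreg_gt0 e g (sqn x); have q0 := sqn_ge0 x; set k := kreg _ _ _ => k0.
  pose a := g / 2 / (e + sqn x) + (1 + sqn x)^-1.
  have aq : 2 * sqn x * a <= g + 2 * sqn x.
    have eq0 : 0 < e + sqn x by rewrite ltr_pwDl.
    have q1 : 0 < 1 + sqn x by rewrite ltr_pwDl.
    have H1 : sqn x / (e + sqn x) <= 1 by rewrite ler_pdivrMr// mul1r lerDr ltW.
    have H2 : sqn x / (1 + sqn x) <= sqn x by rewrite ler_pdivrMr//; nra.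
    have -> : 2 * sqn x * a = g * (sqn x / (e + sqn x)) + 2 * (sqn x / (1 + sqn x)).
      by rewrite /a; field; rewrite !gt_eqF.
    by nra.
  (* Young's inequality with the weight c / (2 N) for each coordinate, so that the N coordinates
     together consume half of [c]. *)
  have Ei i : (k - 2 * x ord0 i ^+ 2 * (k * a)) * u x ^+ 2
      - c / (2 * N%:R) * k * u x ^+ 2 - 2 * N%:R / c * (sqn x * k) * wgrad u i x ^+ 2 <= E i x.
    rewrite /E /dhfield /hfield -/k -/a.
    set w := wgrad u i x; set z := x ord0 i.
    have zq : z ^+ 2 <= sqn x := sqn_coord x i.
    have : 0 <= k * (c / (2 * N%:R)) * (u x + (2 * N%:R / c) * (z * w)) ^+ 2.
      by rewrite mulr_ge0 ?sqr_ge0// mulr_ge0 ?divr_ge0 ?(ltW k0) ?(ltW c0)// mulr_ge0.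
    have -> : k * (c / (2 * N%:R)) * (u x + (2 * N%:R / c) * (z * w)) ^+ 2 =
      k * (c / (2 * N%:R)) * u x ^+ 2 + 2 * k * u x * (z * w) + 2 * N%:R / c * k * (z ^+ 2 * w ^+ 2).
      by field; rewrite !gt_eqF.
    have : 2 * N%:R / c * k * (z ^+ 2 * w ^+ 2) <= 2 * N%:R / c * (sqn x * k) * w ^+ 2.
      rewrite [leRHS](_ : _ = 2 * N%:R / c * k * (sqn x * w ^+ 2)); last by ring.
      rewrite ler_wpM2l ?ler_wpM2r ?sqr_ge0// mulr_ge0 ?(ltW k0)// divr_ge0 ?(ltW c0)// mulr_ge0//.
    lra.
  apply: le_trans (ler_sum _ (fun i _ => Ei i)).
  rewrite !sumrB -mulr_suml sumrB !sumr_const card_ord -mulr_sumr.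
  have -> : \sum_(i < N) 2 * x ord0 i ^+ 2 * (k * a) = 2 * sqn x * (k * a).
    by rewrite -mulr_suml -mulr_sumr.
  rewrite /edens; set D := \sum_(i < N) wgrad u i x ^+ 2.
  have D0 : 0 <= D by rewrite sumr_ge0// => i _; rewrite sqr_ge0.
  have u0 := sqr_ge0 (u x).
  rewrite -[k *+ N]mulr_natr -[(c / (2 * N%:R) * k * u x ^+ 2) *+ N]mulr_natr.
  have -> : c / (2 * N%:R) * k * u x ^+ 2 * N%:R = c / 2 * k * u x ^+ 2.
    by field; rewrite gt_eqF.
  have qk0 : 0 <= sqn x * k by rewrite mulr_ge0// ltW.
  have H1 : 2 * sqn x * (k * a) * u x ^+ 2 <= (g * k + 2 * (sqn x * k)) * u x ^+ 2.
    by rewrite ler_wpM2r//; nra.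
  have H2 : 0 <= 2 * N%:R / c * (sqn x * k) * u x ^+ 2.
    by rewrite mulr_ge0// mulr_ge0// divr_ge0 ?(ltW c0)// mulr_ge0.
  have H3 : 0 <= 2 * (sqn x * k) * D by rewrite mulr_ge0// mulr_ge0.
  move: H1 H2 H3; rewrite -/c; have -> : (N%:R : R) = c + g by rewrite /c subrK.
  move: (2 * (c + g) / c) => b; nra.
have := I_le (intgB (intgZ (c / 2) I1) (intgZ (2 + 2 * N%:R / c) I2)) (intg_sum _ iE) low.
rewrite Isum// (eq_bigr (fun=> 0)) ?big1// IB ?IZ//; try exact: intgZ.
rewrite subr_le0 => H; rewrite -(ler_pM2l (divr_gt0 c0 (ltr0Sn R 1))).
apply: le_trans H _; rewrite mulrA ler_wpM2r//.
  by apply: I_ge0 => x; rewrite mulr_ge0 ?edens_ge0// mulr_ge0 ?sqn_ge0// ltW// kreg_gt0.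
by rewrite le_eqVlt; apply/orP; left; apply/eqP; field; rewrite gt_eqF.
Qed.

End hardy.

Lemma fatou_le d (T : measurableType d) (R : realType) (mu : {measure set T -> \bar R})
    (f : nat -> T -> R) (h : T -> R) (M : R) :
  (forall n, mfun (f n)) -> (forall n x, 0 <= f n x) ->
  (forall x, f n x @[n --> \oo] --> h x) ->
  (forall n, (\int[mu]_x (f n x)%:E <= M%:E)%E) -> (\int[mu]_x (h x)%:E <= M%:E)%E.
Proof.
move=> mf f0 fh fM.
rewrite (_ : (fun x => (h x)%:E) = fun x => limn_einf (fun n => (f n x)%:E)); last first.
  apply/funext => x; apply/esym.
  by apply: (cvg_limn_einf_sup _).1; apply: cvg_EFin; [exact: nearW|exact: fh].
apply: le_trans (fatou mu measurableT _ _) _ => [n|n x _|].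
- exact/measurable_EFinP.
- by rewrite lee_fin.
- rewrite limn_einf_lim; apply: lime_le; first exact: is_cvg_einfs.
  apply: nearW => n; apply: ge_ereal_inf; exists (\int[mu]_x (f n x)%:E)%E => //.
  by exists n => /=.
Qed.

Lemma ge0_le_integral_EFin d (T : measurableType d) (R : realType)
    (mu : {measure set T -> \bar R}) (f g : T -> R) :
  mfun f -> mfun g -> (forall x, 0 <= f x) ->
  (forall x, f x <= g x) -> (\int[mu]_x (f x)%:E <= \int[mu]_x (g x)%:E)%E.
Proof.
move=> mf mg f0 fg; apply: ge0_le_integral => //.
- by move=> x _; rewrite lee_fin.
- exact/measurable_EFinP.
- exact/measurable_EFinP.
- by move=> x _; rewrite lee_fin.
Qed.

Lemma ge0_integralZ_EFin d (T : measurableType d) (R : realType)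
    (mu : {measure set T -> \bar R}) (f : T -> R) (k : R) :
  mfun f -> (forall x, 0 <= f x) -> 0 <= k ->
  (\int[mu]_x (k * f x)%:E = k%:E * \int[mu]_x (f x)%:E)%E.
Proof.
move=> mf f0 k0; under eq_integral do rewrite EFinM.
apply: (ge0_integralZl_EFin mu measurableT (f1 := fun x => (f x)%:E)) => //.
- by move=> x _; rewrite lee_fin.
- exact/measurable_EFinP.
Qed.

Lemma kreg_mul_ge0 (R : realType) (e g q a b : R) : 0 <= a -> 0 <= b -> 0 <= kreg e g q * (a * b).
Proof. by move=> a0 b0; apply: mulr_ge0; [apply/ltW/kreg_gt0|exact: mulr_ge0]. Qed.

Section double_integral.
Context {R : realType} {N : nat}.
Implicit Types (x y z v : 'rV[R]_N) (i j : 'I_N).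
Local Notation mu := (@lebesgue_rV R N).
Local Notation fn := ('rV[R]_N -> R).
Local Notation pm := (mu \x mu)%E.

Lemma measurable_sub2 : mfun (fun p : 'rV[R]_N * 'rV[R]_N => p.1 - p.2).
Proof.
apply: measurable_fun_rV => i.
rewrite [X in measurable_fun _ X](_ : _ = (fun p : 'rV[R]_N * 'rV[R]_N => p.1 ord0 i - p.2 ord0 i)); last first.
  by apply/funext => p; rewrite !mxE.
apply: measurable_funB.
  exact: measurableT_comp (measurable_coord i) measurable_fst.
exact: measurableT_comp (measurable_coord i) measurable_snd.
Qed.

Lemma measurable_kfg (k f g : fn) : mfun k -> mfun f ->
  mfun g ->
  mfun (fun p : 'rV[R]_N * 'rV[R]_N => k (p.1 - p.2) * (f p.1 * g p.2)).
Proof.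
move=> mk mf mg; apply: measurable_funM; first exact: measurableT_comp mk measurable_sub2.
by apply: measurable_funM;
  [exact: measurableT_comp mf measurable_fst|exact: measurableT_comp mg measurable_snd].
Qed.

Lemma measurable_fubini_FG (F : 'rV[R]_N * 'rV[R]_N -> R) :
  mfun F -> (forall p, 0 <= F p) ->
  mfun (fubini_F mu (fun p => (F p)%:E)) /\
  mfun (fubini_G mu (fun p => (F p)%:E)).
Proof.
move=> mF F0.
have mF' : mfun (fun p => (F p)%:E) by exact/measurable_EFinP.
have F0' p : (0 <= (F p)%:E)%E by rewrite lee_fin.
by split; [exact: measurable_fun_fubini_tonelli_F|exact: measurable_fun_fubini_tonelli_G].
Qed.

Lemma tonelli_col (k w r : fn) (M : R) : mfun k -> (forall z, 0 <= k z) ->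
  mfun w -> (forall x, 0 <= w x) -> (forall x, 0 <= r x) -> intg mu r ->
  (forall y, intg mu (fun x => k (x - y) * w x)) ->
  (forall y, \int[mu]_x (k (x - y) * w x) <= M) ->
  (\int[pm]_p (k (p.1 - p.2) * (w p.1 * r p.2))%:E <= (M * \int[mu]_x r x)%:E)%E.
Proof.
move=> mk k0 mw w0 r0 ir ikw kwM; have mr := intg_meas ir.
have M0 : 0 <= M by apply: le_trans (kwM 0); apply: I_ge0 => x; rewrite mulr_ge0.
rewrite fubini_tonelli2; last 2 first.
- by apply/measurable_EFinP; exact: measurable_kfg.
- by move=> p; rewrite lee_fin !mulr_ge0.
rewrite EFinM (EFin_I ir) -ge0_integralZ_EFin//.
apply: ge0_le_integral => //.
- by move=> y _; apply: integral_ge0 => x _; rewrite lee_fin !mulr_ge0.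
- apply: (measurable_fubini_FG (F := fun p => k (p.1 - p.2) * (w p.1 * r p.2)) _ _).2.
  + exact: measurable_kfg.
  + by move=> p; rewrite !mulr_ge0.
- by apply/measurable_EFinP; apply: measurable_funM.
- move=> y _; rewrite /fubini_G /=.
  under eq_integral do rewrite mulrA mulrC.
  rewrite (ge0_integralZ_EFin mu (intg_meas (ikw y)))//; last by move=> x; rewrite mulr_ge0.
  by rewrite -EFin_I// -EFinM lee_fin mulrC ler_wpM2r.
Qed.

Lemma tonelli_row (k w r : fn) (M : R) : mfun k -> (forall z, 0 <= k z) ->
  mfun r -> (forall x, 0 <= w x) -> (forall x, 0 <= r x) -> intg mu w ->
  (forall x, intg mu (fun y => k (x - y) * r y)) ->
  (forall x, \int[mu]_y (k (x - y) * r y) <= M) ->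
  (\int[pm]_p (k (p.1 - p.2) * (w p.1 * r p.2))%:E <= (M * \int[mu]_x w x)%:E)%E.
Proof.
move=> mk k0 mr w0 r0 iw ikr krM; have mw := intg_meas iw.
have M0 : 0 <= M by apply: le_trans (krM 0); apply: I_ge0 => x; rewrite mulr_ge0.
rewrite fubini_tonelli1; last 2 first.
- by apply/measurable_EFinP; exact: measurable_kfg.
- by move=> p; rewrite lee_fin !mulr_ge0.
rewrite EFinM (EFin_I iw) -ge0_integralZ_EFin//.
apply: ge0_le_integral => //.
- by move=> y _; apply: integral_ge0 => x _; rewrite lee_fin !mulr_ge0.
- apply: (measurable_fubini_FG (F := fun p => k (p.1 - p.2) * (w p.1 * r p.2)) _ _).1.
  + exact: measurable_kfg.
  + by move=> p; rewrite !mulr_ge0.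
- by apply/measurable_EFinP; apply: measurable_funM.
- move=> x _; rewrite /fubini_F /=.
  under eq_integral do rewrite mulrCA.
  rewrite (ge0_integralZ_EFin mu (intg_meas (ikr x)))//; last by move=> y; rewrite mulr_ge0.
  by rewrite -EFin_I// -EFinM lee_fin mulrC ler_wpM2r.
Qed.

Lemma I_shift (f : fn) v : mfun f -> \int[mu]_x f (x + v) = \int[mu]_x f x.
Proof.
move=> mf; apply: (@mp_Rintegral _ _ _ mu (fun x => x + v)) => //.
  exact: measurable_shift.
by move=> A mA; exact: shift_measure.
Qed.

Lemma edens_shift_ae (u : fn) v : H1 u ->
  {ae mu, forall x, edens (fun x => u (x + v)) x = edens u (x + v)}.
Proof.
move=> Hu; have : forall i, {ae mu, forall x, wgrad (fun x => u (x + v)) i x = wgrad u i (x + v)}.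
  by move=> i; apply: wgrad_ae; [exact: H1_shift|apply: sderiv_shift; exact: wgrad_sderiv].
move=> H; have HH : {ae mu, forall x, forall i,
   wgrad (fun x => u (x + v)) i x = wgrad u i (x + v)}.
  by apply: filter_forall => i; exact: H.
by apply: filterS HH => x E; rewrite /edens; congr (_ + _); apply: eq_bigr => i _; rewrite E.
Qed.

Lemma hardy_shift e g (u : fn) y : 0 < e -> 0 <= g -> g < N%:R -> H1 u ->
  \int[mu]_x (kreg e g (sqn (x - y)) * u x ^+ 2) <=
  (4 / (N%:R - g) + 4 * N%:R / (N%:R - g) ^+ 2) *
    \int[mu]_x ((sqn (x - y) * kreg e g (sqn (x - y))) * edens u x).
Proof.
move=> e0 g0 gN Hu; have mk := measurable_ksqn (N := N) e g.
have lu := H1_sqint Hu; have mes := intg_meas (intg_edens Hu).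
have mk' : mfun (fun x => kreg e g (sqn (x - y))).
  exact: measurableT_comp mk (measurable_shift (- y)).
have ms' : mfun (fun x : 'rV[R]_N => sqn (x - y)).
  exact: measurableT_comp measurable_sqn (measurable_shift (- y)).
rewrite -(@I_shift (fun x => kreg e g (sqn (x - y)) * u x ^+ 2) y); last first.
  by apply: measurable_funM => //; apply: measurable_funX; exact: sqint_meas lu.
rewrite -(@I_shift (fun x => (sqn (x - y) * kreg e g (sqn (x - y))) * edens u x) y); last first.
  by apply: measurable_funM => //; apply: measurable_funM.
under eq_Rintegral do rewrite addrK.
apply: le_trans (hardy e0 g0 gN (H1_shift y Hu)) _.
rewrite ler_wpM2l//.
  have c0 : 0 < N%:R - g by rewrite subr_gt0.
  by rewrite addr_ge0 ?divr_ge0 ?mulr_ge0 ?sqr_ge0// ltW.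
rewrite le_eqVlt; apply/orP; left; apply/eqP; apply: I_ae.
- apply: measurable_funM; first by apply: measurable_funM => //; exact: measurable_sqn.
  exact: intg_meas (intg_edens (H1_shift y Hu)).
- apply: measurable_funM; last exact: measurableT_comp mes (measurable_shift y).
  rewrite (_ : (fun x => _) = fun x => sqn x * kreg e g (sqn x)).
    by apply: measurable_funM => //; exact: measurable_sqn.
  by apply/funext => x; rewrite addrK.
- by apply: filterS (edens_shift_ae y Hu) => x ->; rewrite addrK.
Qed.

(** One use of Hardy lowers the exponent to g - 2 <= 0, where the regularized kernel is at most 1.
    The constant does not depend on [e] nor on the centre [y]. *)
Lemma hardy_low g : 0 < g -> g <= 2 -> g < N%:R -> exists2 C : R, 0 <= C &
  forall (u : fn) (e : R) y, H1 u -> 0 < e -> e <= 1 ->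
  \int[mu]_x (kreg e g (sqn (x - y)) * u x ^+ 2) <= C * ip u u.
Proof.
move=> g0 g2 gN; exists (4 / (N%:R - g) + 4 * N%:R / (N%:R - g) ^+ 2).
  have c0 : 0 < N%:R - g by rewrite subr_gt0.
  by rewrite addr_ge0 ?divr_ge0 ?mulr_ge0 ?sqr_ge0// ltW.
move=> u e y Hu e0 e1; apply: le_trans (hardy_shift y e0 (ltW g0) gN Hu) _.
have c0 : 0 < N%:R - g by rewrite subr_gt0.
rewrite ler_wpM2l//; first by rewrite addr_ge0 ?divr_ge0 ?mulr_ge0 ?sqr_ge0// ltW.
have mq : mfun (fun x : 'rV[R]_N => sqn (x - y) * kreg e g (sqn (x - y))).
  apply: measurable_funM; first exact: measurableT_comp measurable_sqn (measurable_shift (- y)).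
  exact: measurableT_comp (measurable_ksqn e g) (measurable_shift (- y)).
rewrite -I_edens; apply: I_le => [||x].
- exact: (intg_bdM mq (fun x => (kreg_bound (x - y) e0 (ltW g0)).2) (intg_edens Hu)).
- exact: intg_edens.
- rewrite ler_piMl ?edens_ge0//; apply: le_trans (kreg_shift g e0 (sqn_ge0 _)) _.
  by apply: kreg_small; rewrite ?sqn_ge0 ?e0//; apply/andP; split; lra.
Qed.

(** For g > 2, Hardy in the variable of [u] replaces g by g - 2, at the cost of the energy density
    of [u]; the exponent g - 2 < 2 is then covered by [hardy_low] in the variable of [w]. Two steps
    of 2 are what limits g to values below 4. *)
Lemma double_reg g : 0 < g -> g < 4 -> g < N%:R -> exists2 C : R, 0 <= C &
  forall (u w : fn) (e : R), H1 u -> H1 w -> 0 < e -> e <= 1 ->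
  (\int[pm]_p (kreg e g (sqn (p.1 - p.2)) * (u p.1 ^+ 2 * w p.2 ^+ 2))%:E <=
    (C * (ip u u * ip w w))%:E)%E.
Proof.
move=> g0 g4 gN; have c0 : 0 < N%:R - g by rewrite subr_gt0.
have isq (u : fn) : H1 u -> intg mu (fun x => u x ^+ 2) /\ \int[mu]_x (u x ^+ 2) <= ip u u.
  move=> Hu; split; first exact: sqint_intg (H1_sqint Hu).
  by rewrite -dotLff; exact: dotL_ip_le.
have ik (e h : R) (r : fn) y : 0 < e -> 0 <= h -> intg mu r ->
    intg mu (fun x => kreg e h (sqn (x - y)) * r x).
  move=> e0 h0 ir.
  have mk' : mfun (fun x : 'rV[R]_N => kreg e h (sqn (x - y))).
    exact: measurableT_comp (measurable_ksqn e h) (measurable_shift (- y)).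
  exact: (intg_bdM mk' (fun x => (kreg_bound (x - y) e0 h0).1) ir).
have [g2|g2] := leP g 2.
  have [C C0 HC] := hardy_low g0 g2 gN; exists C => // u w e Hu Hw e0 e1.
  have [iu _] := isq u Hu; have [iw w1] := isq w Hw.
  apply: (le_trans (@tonelli_col (fun z => kreg e g (sqn z)) (fun x => u x ^+ 2)
    (fun x => w x ^+ 2) (C * ip u u) _ _ _ _ _ _ _ _)) => //.
  - exact: measurable_ksqn.
  - by move=> z; rewrite ltW// kreg_gt0.
  - exact: intg_meas iu.
  - by move=> x; rewrite sqr_ge0.
  - by move=> x; rewrite sqr_ge0.
  - by move=> y; apply: ik => //; exact: ltW.
  - by move=> y; apply: HC.
  - rewrite lee_fin mulrA ler_wpM2l// mulr_ge0// (sib_ge0 ip_si)//.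
have h0 : 0 < g - 2 by rewrite subr_gt0.
have h2 : g - 2 <= 2 by lra.
have hN : g - 2 < N%:R by lra.
have [C C0 HC] := hardy_low h0 h2 hN.
set CH := 4 / (N%:R - g) + 4 * N%:R / (N%:R - g) ^+ 2.
have CH0 : 0 <= CH by rewrite addr_ge0 ?divr_ge0 ?mulr_ge0 ?sqr_ge0// ltW.
exists (CH * C); first exact: mulr_ge0.
move=> u w e Hu Hw e0 e1; have [iu _] := isq u Hu; have [iw w1] := isq w Hw.
have ie := intg_edens Hu.
have mk := measurable_ksqn (N := N) e.
have step : (\int[pm]_p (kreg e (g - 2) (sqn (p.1 - p.2)) * (edens u p.1 * w p.2 ^+ 2))%:E <=
    (C * ip w w * ip u u)%:E)%E.
  rewrite -[ip u u]I_edens.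
  apply: (@tonelli_row (fun z => kreg e (g - 2) (sqn z)) (edens u) (fun x => w x ^+ 2)) => //.
  - by move=> z; rewrite ltW// kreg_gt0.
  - exact: intg_meas iw.
  - exact: edens_ge0.
  - by move=> x; rewrite sqr_ge0.
  - move=> x; rewrite (_ : (fun y => _) = (fun y => kreg e (g - 2) (sqn (y - x)) * w y ^+ 2)).
      by apply: ik => //; exact: ltW.
    by apply/funext => y; rewrite sqnB.
  - move=> x; under eq_Rintegral do rewrite sqnB.
    exact: HC.
apply: (@le_trans _ _ (CH%:E * (C * ip w w * ip u u)%:E)%E); last first.
  by rewrite -EFinM lee_fin le_eqVlt; apply/orP; left; apply/eqP; ring.
apply: le_trans (lee_wpmul2l _ step); last by rewrite lee_fin.
rewrite -ge0_integralZ_EFin//; last 2 first.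
- by apply: measurable_kfg (mk _) (intg_meas ie) (intg_meas iw).
- by move=> p; rewrite kreg_mul_ge0 ?edens_ge0 ?sqr_ge0.
rewrite fubini_tonelli2; last 2 first.
- by apply/measurable_EFinP; apply: measurable_kfg (mk _) (intg_meas iu) (intg_meas iw).
- by move=> p; rewrite lee_fin kreg_mul_ge0 ?sqr_ge0.
rewrite fubini_tonelli2; last 2 first.
- apply/measurable_EFinP; apply: measurable_funM => //.
  by apply: measurable_kfg (mk _) (intg_meas ie) (intg_meas iw).
- by move=> p; rewrite lee_fin mulr_ge0// kreg_mul_ge0 ?edens_ge0 ?sqr_ge0.
apply: ge0_le_integral => //.
- move=> y _; apply: integral_ge0 => x _.
  by rewrite lee_fin kreg_mul_ge0 ?sqr_ge0.
- apply: (measurable_fubini_FG (F := fun p => kreg e g (sqn (p.1 - p.2)) * (u p.1 ^+ 2 * w p.2 ^+ 2)) _ _).2.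
  + by apply: measurable_kfg (mk _) (intg_meas iu) (intg_meas iw).
  + by move=> p; rewrite kreg_mul_ge0 ?sqr_ge0.
- apply: (measurable_fubini_FG (F := fun p => CH * (kreg e (g - 2) (sqn (p.1 - p.2)) * (edens u p.1 * w p.2 ^+ 2))) _ _).2.
  + apply: measurable_funM => //.
    by apply: measurable_kfg (mk _) (intg_meas ie) (intg_meas iw).
  + by move=> p; rewrite mulr_ge0// kreg_mul_ge0 ?edens_ge0 ?sqr_ge0.
- move=> y _; rewrite /fubini_G /=.
  have E1 : (\int[mu]_x (kreg e g (sqn (x - y)) * (u x ^+ 2 * w y ^+ 2))%:E =
     (w y ^+ 2 * \int[mu]_x (kreg e g (sqn (x - y)) * u x ^+ 2))%:E)%E.
    under eq_integral do rewrite mulrA mulrC.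
    have i1 := ik e g _ y e0 (ltW g0) iu.
    rewrite (ge0_integralZ_EFin mu (intg_meas i1)) ?sqr_ge0//; last first.
      by move=> x; rewrite mulr_ge0 ?sqr_ge0// ltW// kreg_gt0.
    by rewrite -EFin_I// -EFinM.
  have E2 : (\int[mu]_x (CH * (kreg e (g - 2) (sqn (x - y)) * (edens u x * w y ^+ 2)))%:E =
     (w y ^+ 2 * (CH * \int[mu]_x (kreg e (g - 2) (sqn (x - y)) * edens u x)))%:E)%E.
    rewrite (_ : (fun x => _) = fun x => ((CH * w y ^+ 2) *
       (kreg e (g - 2) (sqn (x - y)) * edens u x))%:E); last first.
      by apply/funext => x; congr (_%:E); ring.
    have i1 := ik e (g - 2) _ y e0 (ltW h0) ie.
    have cw0 : 0 <= CH * w y ^+ 2 by rewrite mulr_ge0 ?sqr_ge0.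
    rewrite (ge0_integralZ_EFin mu (intg_meas i1) _ cw0); last first.
      by move=> x; rewrite mulr_ge0 ?edens_ge0// ltW// kreg_gt0.
    by rewrite -EFin_I// -EFinM; congr (_%:E); ring.
  rewrite E1 E2 lee_fin ler_wpM2l ?sqr_ge0//.
  apply: le_trans (hardy_shift y e0 (ltW g0) gN Hu) _; rewrite -/CH ler_wpM2l//.
  have mq : mfun (fun x : 'rV[R]_N => sqn (x - y) * kreg e g (sqn (x - y))).
    apply: measurable_funM; first exact: measurableT_comp measurable_sqn (measurable_shift (- y)).
    exact: measurableT_comp (measurable_ksqn e g) (measurable_shift (- y)).
  apply: I_le => [||x].
  + exact: (intg_bdM mq (fun x => (kreg_bound (x - y) e0 (ltW g0)).2) (intg_edens Hu)).
  + by apply: ik => //; exact: ltW.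
  + by rewrite ler_wpM2r ?edens_ge0// kreg_shift// sqn_ge0.
Qed.

(** The kernel |z|^-g. By the convention for [powR] its value at the origin is 0 when g is nonzero,
    as for [riesz]. *)
Definition kz (g : R) z : R := sqn z `^ (- (g / 2)).

Lemma kz_ge0 g z : 0 <= kz g z. Proof. exact: powR_ge0. Qed.

Lemma kzN g z : kz g (- z) = kz g z. Proof. by rewrite /kz sqnN. Qed.

Lemma measurable_kz g : mfun (kz g).
Proof. exact: measurableT_comp (measurable_powR _) measurable_sqn. Qed.

(** Fatou's lemma removes [e] from [double_reg] and bounds the energy of the kernel divided by 1 +
    |z|^2. That factor is then removed, since |z|^-g is at most 1 outside the unit ball. *)
Lemma double_kz g : 0 < g -> g < 4 -> g < N%:R -> exists2 C : R, 0 <= C &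
  forall (u w : fn), H1 u -> H1 w ->
  (\int[pm]_p (kz g (p.1 - p.2) * (u p.1 ^+ 2 * w p.2 ^+ 2))%:E <=
    (C * (ip u u * ip w w))%:E)%E.
Proof.
move=> g0 g4 gN; have [C C0 HC] := double_reg g0 g4 gN.
exists (2 * C + 1); first by rewrite addr_ge0// mulr_ge0.
move=> u w Hu Hw; have lu := H1_sqint Hu; have lw := H1_sqint Hw.
have iu := sqint_intg lu; have iw := sqint_intg lw.
have u2 x : 0 <= u x ^+ 2 by rewrite sqr_ge0.
have w2 x : 0 <= w x ^+ 2 by rewrite sqr_ge0.
have m2 : mfun (fun p : 'rV[R]_N * 'rV[R]_N => u p.1 ^+ 2 * w p.2 ^+ 2).
  by apply: measurable_funM; [exact: measurableT_comp (intg_meas iu) measurable_fst|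
    exact: measurableT_comp (intg_meas iw) measurable_snd].
pose kk z : R := kz g z / (1 + sqn z).
have q1 z : 0 < 1 + sqn z by rewrite ltr_pwDl ?sqn_ge0.
have mkk : mfun kk.
  rewrite (_ : kk = fun z => kz g z * (1 + sqn z) `^ (-1)).
    apply: measurable_funM; first exact: measurable_kz.
    apply: (@measurableT_comp _ _ _ _ _ _ (fun t : R => t `^ (-1))) (measurable_powR _) _.
    by apply: measurable_funD => //; exact: measurable_sqn.
  by apply/funext => z; rewrite powR_inv1// ltW.
have kk0 z : 0 <= kk z by rewrite divr_ge0 ?kz_ge0// ltW.
have H1' : (\int[pm]_p (kk (p.1 - p.2) * (u p.1 ^+ 2 * w p.2 ^+ 2))%:E <=
    (C * (ip u u * ip w w))%:E)%E.
  pose en n : R := n.+1%:R^-1.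
  have mkn n : mfun (fun p : 'rV[R]_N * 'rV[R]_N =>
      kreg (en n) g (sqn (p.1 - p.2)) * (u p.1 ^+ 2 * w p.2 ^+ 2)).
    exact: measurable_kfg (measurable_ksqn (en n) g) (intg_meas iu) (intg_meas iw).
  (* On the diagonal the regularized kernels blow up while [kk] is 0; the factor [cut], which
     vanishes there and equals 1 eventually elsewhere, gives convergence at every point. *)
  pose cut n (p : 'rV[R]_N * 'rV[R]_N) : R := Num.min 1 (n%:R * sqn (p.1 - p.2)).
  have mcut n : mfun (cut n).
    apply: measurable_minr => //; apply: measurable_funM => //.
    exact: measurableT_comp measurable_sqn measurable_sub2.
  have cut0 n p : 0 <= cut n p <= 1.
    by rewrite /cut le_min ler01 mulr_ge0 ?sqn_ge0//= ge_min lexx.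
  apply: (fatou_le (f := fun n p => cut n p *
     (kreg (en n) g (sqn (p.1 - p.2)) * (u p.1 ^+ 2 * w p.2 ^+ 2)))).
  - by move=> n; exact: measurable_funM.
  - by move=> n p; case/andP: (cut0 n p) => ? _; rewrite mulr_ge0// kreg_mul_ge0.
  - move=> p; have := sqn_ge0 (p.1 - p.2); rewrite le_eqVlt => /orP[/eqP q0|q0].
      rewrite /kk /kz -q0 powR0 ?mul0r; last by rewrite oppr_eq0 gt_eqF// divr_gt0.
      rewrite [X in X @ _](_ : _ = cst 0); first exact: cvg_cst.
      by apply/funext => n; rewrite /cut -q0 mulr0 min_r// mul0r.
    rewrite -[X in _ --> X]mul1r; apply: cvgM.
      apply: cvg_near_cst; exists (Num.truncn (sqn (p.1 - p.2))^-1).+1 => // n /= Hn.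
      rewrite /cut min_l// -ler_pdivrMr// div1r.
      by apply: le_trans (ltW (truncnS_gt _)) _; rewrite ler_nat.
    apply: cvgMl; rewrite /kk /kz /powR gt_eqF//.
    have -> : (1 + sqn (p.1 - p.2))^-1 = expR (- ln (1 + sqn (p.1 - p.2))).
      by rewrite expRN lnK// posrE.
    rewrite -expRD.
    apply: continuous_cvg; first exact: continuous_expR.
    apply: cvgB; last exact: cvg_cst.
    apply: cvgMr; apply: continuous_cvg; first exact: continuous_ln.
    rewrite -[X in _ --> X]add0r; apply: cvgD; [exact: harm_cvg|exact: cvg_cst].
  - move=> n; have [e0 e1] : 0 < en n /\ en n <= 1.
      by split; [rewrite invr_gt0|rewrite invf_le1// ler1n].
    apply: le_trans (HC u w (en n) Hu Hw e0 e1); apply: ge0_le_integral_EFin => //.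
    + by exact: measurable_funM.
    + by move=> p; case/andP: (cut0 n p) => ? _; rewrite mulr_ge0// kreg_mul_ge0.
    + by move=> p; case/andP: (cut0 n p) => ? ?; rewrite ler_piMl// kreg_mul_ge0.
have H2 : (\int[pm]_p (u p.1 ^+ 2 * w p.2 ^+ 2)%:E <= (ip u u * ip w w)%:E)%E.
  have := @tonelli_col (fun=> 1) (fun x => u x ^+ 2) (fun x => w x ^+ 2) (ip u u).
  under eq_integral do rewrite mul1r.
  move=> H; apply: (le_trans (H _ _ _ _ _ _ _ _)) => //.
  + exact: intg_meas iu.
  + by move=> y; rewrite (_ : (fun x => _) = fun x => u x ^+ 2)//; apply/funext => x; rewrite mul1r.
  + by move=> y; under eq_Rintegral do rewrite mul1r; rewrite -dotLff; exact: dotL_ip_le.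
  + by rewrite lee_fin ler_wpM2l ?(sib_ge0 ip_si)// -dotLff; exact: dotL_ip_le.
apply: (@le_trans _ _ (\int[pm]_p (2 * (kk (p.1 - p.2) * (u p.1 ^+ 2 * w p.2 ^+ 2)) +
   u p.1 ^+ 2 * w p.2 ^+ 2)%:E)%E).
  apply: ge0_le_integral_EFin.
  - exact: measurable_kfg (measurable_kz g) (intg_meas iu) (intg_meas iw).
  - by apply: measurable_funD => //; apply: measurable_funM => //;
      exact: measurable_kfg mkk (intg_meas iu) (intg_meas iw).
  - by move=> p; rewrite mulr_ge0 ?kz_ge0// mulr_ge0.
  - move=> p; have gen (a b W : R) : 0 <= W -> a <= 2 * b + 1 -> a * W <= 2 * (b * W) + W.
      by move=> W0 ab; nra.
    apply: gen; first by rewrite mulr_ge0.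
    rewrite /kk; set z := p.1 - p.2; have [z1|z1] := leP (sqn z) 1.
      apply: (@le_trans _ _ (2 * (kz g z / (1 + sqn z)))); last by rewrite lerDl.
      rewrite mulrA ler_pdivlMr// mulrC ler_wpM2r ?kz_ge0//; lra.
    apply: (@le_trans _ _ 1); last by rewrite lerDr mulr_ge0// divr_ge0 ?kz_ge0// ltW.
    rewrite /kz powRN invf_le1 ?powR_gt0 ?(lt_trans ltr01)//.
    by rewrite /powR gt_eqF ?(lt_trans ltr01)// -expR0 ler_expR mulr_ge0 ?divr_ge0 ?(ltW g0)// ln_ge0// ltW.
under eq_integral do rewrite EFinD.
rewrite ge0_integralD//; last 4 first.
- by move=> p _; rewrite lee_fin mulr_ge0// mulr_ge0// mulr_ge0.
- by apply/measurable_EFinP; apply: measurable_funM => //;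
      exact: measurable_kfg mkk (intg_meas iu) (intg_meas iw).
- by move=> p _; rewrite lee_fin mulr_ge0.
- exact/measurable_EFinP.
rewrite ge0_integralZ_EFin//; last 2 first.
- exact: measurable_kfg mkk (intg_meas iu) (intg_meas iw).
- by move=> p; rewrite mulr_ge0// mulr_ge0.
have H3 := @lee_wpmul2l _ 2%:E _ _ _ H1'.
apply: le_trans (leeD (H3 _) H2) _; first by rewrite lee_fin.
rewrite -EFinM -EFinD lee_fin; lra.
Qed.

End double_integral.

(** * Gamma and Gaussian integrals *)

Section gamma.
Context {R : realType}.
Local Notation leb := (@lebesgue_measure R).
Implicit Types s t c q : R.

Lemma lebesgue_scale c (f : R -> R) : 0 < c -> mfun f -> (forall t, 0 <= f t) ->
  (\int[leb]_t (f t)%:E = c%:E * \int[leb]_t (f (c * t))%:E)%E.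
Proof.
move=> c0 mf f0; have c0' : 0 <= c := ltW c0.
have mc : mfun (fun t : measurableTypeR R => (c * t : measurableTypeR R)).
  exact: measurable_funM.
have mf' : mfun (fun t : measurableTypeR R => (f t)%:E) by exact/measurable_EFinP.
have f0' (t : measurableTypeR R) : (0 <= (f t)%:E)%E by rewrite lee_fin.
have := ge0_integral_pushforward mc leb measurableT mf' (fun t _ => f0' t).
rewrite preimage_setT => <-.
rewrite -[c]/((NngNum c0')%:num) -ge0_integral_mscale//.
apply: eq_measure_integral => A mA _; apply: lebesgue_measure_unique => // X [[a b] /= ab <-].
rewrite /mscale /= /pushforward.
have -> : (fun t => c * t) @^-1` `]a, b] = `]a / c, b / c]%classic.
  apply/seteqP; split => t /=; rewrite !in_itv /= => /andP[H1 H2]; apply/andP; split.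
  - by rewrite ltr_pdivrMr// mulrC.
  - by rewrite ler_pdivlMr// mulrC.
  - by rewrite mulrC -ltr_pdivrMr.
  - by rewrite mulrC -ler_pdivlMr.
rewrite !lebesgue_measure_itv /= !lte_fin ltr_pM2r ?invr_gt0//.
case: ifP => _; last by rewrite mule0.
by rewrite -!EFinB -EFinM; congr (_%:E); field; rewrite gt_eqF.
Qed.

Definition gwt s t : R := (t \in `]0, +oo[%classic)%:R * t `^ (s - 1).

Lemma gwt_ge0 s t : 0 <= gwt s t. Proof. by rewrite mulr_ge0 ?powR_ge0. Qed.

Lemma measurable_gwt s : mfun (gwt s).
Proof.
apply: measurable_funM; last exact: measurable_powR.
rewrite (_ : (fun t => _) = \1_(`]0, +oo[%classic : set R)).
  exact: measurable_indic.
by apply/funext => t; rewrite indicE.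
Qed.

Lemma gwtE s t : gwt s t = if 0 < t then t `^ (s - 1) else 0.
Proof.
rewrite /gwt; case: ifPn => t0; last by rewrite memNset ?mul0r//= in_itv /= andbT; exact/negP.
by rewrite mem_set ?mul1r//= in_itv /= t0.
Qed.

(** An explicit primitive: the opposite of the derivative of 1/(1 + t^s) behaves like t^(s-1) near 0
    and has integral at most 1. It serves as majorant for the Gamma integrand. *)
Let gF s t : R := (1 + t `^ s)^-1.

Let gF_derive s t : 0 < t -> is_derive t (1 : R) (gF s) (- (gF s t ^+ 2 * (s * t `^ (s - 1)))).
Proof.
move=> t0; have H1 := is_deriveD (is_derive_cst (1 : R) t (1 : R)) (is_derive1_powR s t0).
have n0 : (cst (1 : R) + (fun x : R => x `^ s)) t != 0.
  by rewrite gt_eqF// -[X in _ < X]/(1 + t `^ s) ltr_pwDl// powR_ge0.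
have H2 := is_deriveV n0 H1.
apply: is_derive_eq H2 _; rewrite add0r -[_ *: _]/(_ * _) /gF.
by rewrite -[(cst 1 + _) t]/(1 + t `^ s) mulNr exprVn.
Qed.

Let gf_int s n : 0 < s ->
  (\int[leb]_(t in `[(n.+2%:R^-1)%R, (n.+2%:R)%R]) ((gF s t ^+ 2 * (s * t `^ (s - 1))))%:E <= 1)%E.
Proof.
move=> s0; have [a0 ab] : 0 < n.+2%:R^-1 :> R /\ n.+2%:R^-1 < n.+2%:R :> R.
  by split; [rewrite invr_gt0|apply: (@lt_trans _ _ 1); [rewrite invf_lt1// ltr1n|rewrite ltr1n]].
have cont (f : R -> R) (d t : R) : is_derive t (1 : R) f d -> {for t, continuous f}.
  by move=> [dd _]; apply: differentiable_continuous; apply/derivable1_diffP.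
have cf t : 0 < t -> {for t, continuous (fun t => gF s t ^+ 2 * (s * t `^ (s - 1)))}.
  move=> t0; have c1 := cont _ _ _ (gF_derive s t0).
  have c2 := cont _ _ _ (is_derive1_powR (s - 1) t0).
  have H1 : gF s x * gF s x @[x --> t] --> gF s t * gF s t by apply: cvgM.
  have H2 : s * x `^ (s - 1) @[x --> t] --> s * t `^ (s - 1) by apply: cvgMr; exact: c2.
  have E : (fun t => gF s t ^+ 2 * (s * t `^ (s - 1))) =
      (fun t => gF s t * gF s t * (s * t `^ (s - 1))).
    by apply/funext => x; rewrite expr2.
  rewrite E; exact: cvgM H1 H2.
have ncf t : 0 < t -> {for t, continuous (fun t => - gF s t)}.
  by move=> t0; apply: cvgN; exact: (cont _ _ _ (gF_derive s t0)).
rewrite (@continuous_FTC2 _ _ (fun t => - gF s t)).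
- rewrite -EFinB lee_fin opprK addrC.
  have : 0 <= gF s n.+2%:R by rewrite invr_ge0 addr_ge0// powR_ge0.
  have : gF s n.+2%:R^-1 <= 1 by rewrite invf_le1 ?lerDl ?powR_ge0// ltr_pwDl// powR_ge0.
  lra.
- exact: ab.
- apply: continuous_in_subspaceT => t; rewrite inE /= in_itv /= => /andP[ht _].
  by apply: cf; exact: lt_le_trans ht.
- split.
  + move=> t; rewrite in_itv /= => /andP[ht _].
    have t0 := lt_trans a0 ht.
    by have [] := is_deriveN (gF_derive s t0).
  + by apply: cvg_at_right_filter; exact: ncf.
  + by apply: cvg_at_left_filter; apply: ncf; exact: lt_trans ab.
- move=> t; rewrite in_itv /= => /andP[ht _]; have t0 := lt_trans a0 ht.
  by have [_ E] := is_deriveN (gF_derive s t0); rewrite derive1E E opprK.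
Qed.

Lemma gwt_expR_fin s : 0 < s -> (\int[leb]_t (gwt s t * expR (- t))%:E < +oo)%E.
Proof.
move=> s0; have m1 := measurable_gwt s.
have mexp (c : R) : mfun (fun t : R => expR (c * t)).
  by apply: measurableT_comp => //; exact: measurable_funM.
have mexp1 : mfun (fun t : R => expR (- t)).
  by apply: measurableT_comp => //; exact: measurable_funN.
(* As n > s, (1 + t^s)^2 <= 4 (1 + t)^(2n) <= 4 (2n)! exp(1 + t). After division by s this is the
   constant that compares the Gamma integrand with the derivative of [gF]. *)
pose n := (Num.truncn s).+1; pose C : R := 4 * (n.*2)`!%:R * expR 1 / s.
have C0 : 0 <= C by rewrite divr_ge0 ?mulr_ge0 ?expR_ge0// ltW.
apply: (@le_lt_trans _ _ C%:E); last by rewrite ltry.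
apply: (@fatou_le _ (measurableTypeR R) R leb (fun k t => \1_(`[k.+2%:R^-1, k.+2%:R]%classic : set R) t *
   (gwt s t * expR (- t)))).
- move=> k; apply: measurable_funM; first exact: measurable_indic.
  exact: measurable_funM.
- by move=> k t; rewrite mulr_ge0// mulr_ge0 ?gwt_ge0 ?expR_ge0.
- move=> t; have [t0|t0] := ltP 0 t; last first.
    by rewrite gwtE ltNge t0 /= mul0r; under eq_fun do rewrite mulr0; exact: cvg_cst.
  apply: cvg_near_cst; exists (Num.truncn (Num.max t t^-1)).+1 => // k /= Hk.
  rewrite indicE mem_set ?mul1r//= in_itv /=.
  have H : Num.max t t^-1 <= k.+2%:R.
    by apply: le_trans (ltW (truncnS_gt _)) _; rewrite ler_nat; exact/leqW/leqW.
  move: H; rewrite ge_max => /andP[H1 H2].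
  by rewrite H1 andbT -[t]invrK lef_pV2// posrE// invr_gt0.
- move=> k; apply: (@le_trans _ _ (C%:E * \int[leb]_(t in `[(k.+2%:R^-1)%R, (k.+2%:R)%R])
     ((gF s t ^+ 2 * (s * t `^ (s - 1))))%:E)%E); last first.
    by rewrite -[leRHS]mule1; apply: lee_wpmul2l; [rewrite lee_fin|exact: gf_int].
  have mgF : mfun (gF s).
    rewrite (_ : gF s = fun t => (1 + t `^ s) `^ (-1)).
      apply: (@measurableT_comp _ _ _ _ _ _ (fun t : R => t `^ (-1))) (measurable_powR _) _.
      by apply: measurable_funD => //; exact: measurable_powR.
    by apply/funext => t; rewrite powR_inv1// addr_ge0// powR_ge0.
  have mh : mfun (fun t => \1_(`[k.+2%:R^-1, k.+2%:R]%classic : set R) t *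
     (gF s t ^+ 2 * (s * t `^ (s - 1)))).
    apply: measurable_funM; first exact: measurable_indic.
    apply: measurable_funM; first exact: measurable_funX.
    by apply: measurable_funM => //; exact: measurable_powR.
  rewrite [X in (_ * X)%E]integral_mkcond.
  rewrite [X in (_ <= _ * X)%E](_ : _ = (\int[leb]_t (\1_(`[k.+2%:R^-1, k.+2%:R]%classic : set R) t *
     (gF s t ^+ 2 * (s * t `^ (s - 1))))%:E)%E); last first.
    apply: eq_integral => t _; rewrite patchE indicE.
    by case: (t \in _); rewrite ?mul1r ?mul0r.
  rewrite -ge0_integralZ_EFin//; last first.
    by move=> t; rewrite mulr_ge0// mulr_ge0 ?sqr_ge0// mulr_ge0 ?powR_ge0// ltW.
  apply: ge0_le_integral_EFin.
  + apply: measurable_funM; first exact: measurable_indic.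
    exact: measurable_funM.
  + exact: measurable_funM.
  + by move=> t; rewrite mulr_ge0// mulr_ge0 ?gwt_ge0 ?expR_ge0.
  + move=> t; rewrite [leRHS]mulrCA; apply: ler_wpM2l => //.
    rewrite gwtE; case: ifPn => t0; last first.
      by rewrite mul0r mulr_ge0// mulr_ge0 ?sqr_ge0// mulr_ge0 ?powR_ge0// ltW.
    have -> : C * (gF s t ^+ 2 * (s * t `^ (s - 1))) = t `^ (s - 1) * (C * s * gF s t ^+ 2) by ring.
    rewrite ler_wpM2l ?powR_ge0//.
    have p0 : 0 < 1 + t `^ s by rewrite ltr_pwDl// powR_ge0.
    rewrite /gF exprVn ler_pdivlMr ?exprn_gt0// expRN mulrC ler_pdivrMr ?expR_gt0//.
    have -> : C * s = 4 * (n.*2)`!%:R * expR 1 by rewrite /C divfK ?gt_eqF.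
    rewrite -(mulrA (4 * (n.*2)`!%:R)) -expRD.
    have a1 : 1 <= 1 + t by rewrite lerDl ltW.
    have tn : t `^ s <= (1 + t) ^+ n.
      apply: (@le_trans _ _ ((1 + t) `^ s)).
        by apply: ge0_ler_powR; rewrite ?nnegrE ?(ltW s0) ?(ltW t0) ?lerDr// addr_ge0// ltW.
      rewrite -powR_mulrn ?(le_trans ler01)//; apply: ler_powR => //.
      by rewrite ltW// truncnS_gt.
    have b1 : 1 <= (1 + t) ^+ n by exact: exprn_ege1.
    apply: (@le_trans _ _ (4 * (1 + t) ^+ n.*2)).
      apply: (@le_trans _ _ ((2 * (1 + t) ^+ n) ^+ 2)).
        by rewrite lerXn2r ?nnegrE ?(ltW p0) ?mulr_ge0 ?exprn_ge0 ?(le_trans ler01)//; lra.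
      rewrite exprMn -exprM muln2; lra.
    rewrite -mulrA ler_wpM2l//.
    have := expR_ge1Dxn (n.*2.-1) (le_trans ler01 a1).
    rewrite prednK; last by rewrite double_gt0.
    move=> H; rewrite mulrC -ler_pdivrMr ?ltr0n ?fact_gt0//.
    by apply: le_trans H; rewrite lerDr.
Qed.

Lemma Euler_GammaE s : 0 < s ->
  0 < Euler_Gamma s /\ (\int[leb]_t (gwt s t * expR (- t))%:E = (Euler_Gamma s)%:E)%E.
Proof.
move=> s0; have fin := gwt_expR_fin s0.
have mexp1 : mfun (fun t : R => expR (- t)).
  by apply: measurableT_comp => //; exact: measurable_funN.
have mg : mfun (fun t => gwt s t * expR (- t)).
  by apply: measurable_funM => //; exact: measurable_gwt.
have g0 t : 0 <= gwt s t * expR (- t) by rewrite mulr_ge0 ?gwt_ge0 ?expR_ge0.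
have E : (\int[leb]_t (gwt s t * expR (- t))%:E =
    \int[leb]_(t in (`]0%R, +oo[%classic : set R)) (t `^ (s - 1) * expR (- t))%:E)%E.
  rewrite [RHS]integral_mkcond; apply: eq_integral => t _; rewrite patchE /gwt.
  by case: (t \in _); rewrite ?mul1r ?mul0r.
have E2 : (\int[leb]_t (gwt s t * expR (- t))%:E = (Euler_Gamma s)%:E)%E.
  rewrite /Euler_Gamma /Rintegral -E fineK// ge0_fin_numE//.
  by apply: integral_ge0 => t _; rewrite lee_fin.
split=> //; rewrite lt_neqAle; apply/andP; split; last first.
  by rewrite -lee_fin -E2; apply: integral_ge0 => t _; rewrite lee_fin.
apply/eqP => G0; have E20 : (\int[leb]_t (gwt s t * expR (- t))%:E = 0)%E by rewrite E2 -G0.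
have [Z [mZ Z0 ZS]] := @ae_pos _ (measurableTypeR R) R leb _ g0 mg E20.
have : (leb `]0%R, 1%R[ <= 0)%E.
  rewrite -Z0; apply: le_measure; rewrite ?inE//.
  move=> t /=; rewrite in_itv /= => /andP[t0 _]; apply: ZS => /= /eqP.
  by rewrite gwtE t0 mulf_eq0 gt_eqF ?powR_gt0// gt_eqF// expR_gt0.
by rewrite lebesgue_measure_itv /= lte_fin ltr01 oppr0 adde0 lee_fin ler10.
Qed.

(** Exhibits q^-s as a superposition of the exponentials exp(-t q). For q = |z|^2 these are
    Gaussians, which is how the Riesz kernel is shown to be positive semidefinite. *)
Lemma gwt_scale s q : 0 < s -> 0 < q ->
  (\int[leb]_t (gwt s t * expR (- (t * q)))%:E = (q `^ (- s) * Euler_Gamma s)%:E)%E.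
Proof.
move=> s0 q0; have [_ E] := Euler_GammaE s0.
have mexp (c : R) : mfun (fun t : R => expR (- (t * c))).
  by apply: measurableT_comp => //; apply: measurable_funN; exact: measurable_funM.
have mexp1 : mfun (fun t : R => expR (- t)).
  by apply: measurableT_comp => //; exact: measurable_funN.
have m1 := measurable_gwt s.
have := lebesgue_scale (f := fun t => gwt s t * expR (- t)) q0.
rewrite E => H; rewrite EFinM H; last 2 first.
- exact: measurable_funM.
- by move=> t; rewrite mulr_ge0 ?gwt_ge0 ?expR_ge0.
rewrite muleA -EFinM -ge0_integralZ_EFin.
- apply: eq_integral => t _; congr (_%:E); rewrite !gwtE (mulrC t q).
  have -> : (0 < q * t) = (0 < t) by rewrite pmulr_rgt0.
  case: ifPn => t0; last by rewrite !mul0r mulr0.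
  rewrite powRM ?(ltW q0) ?(ltW t0)// mulrA mulrA; congr (_ * _).
  rewrite -[LHS]mul1r; congr (_ * _).
  rewrite -{2}[q](@powRr1 _ q) ?(ltW q0)//.
  rewrite -!powRD ?(gt_eqF q0)//; try by apply/implyP.
  by rewrite (_ : - s + 1 + (s - 1) = 0) ?powRr0//; ring.
- have mq : mfun (fun t : R => q * t) by exact: measurable_funM.
  by apply: (@measurableT_comp _ _ _ R R R (fun t => gwt s t * expR (- t))) => //; exact: measurable_funM.
- by move=> t; rewrite mulr_ge0 ?gwt_ge0 ?expR_ge0.
- by rewrite mulr_ge0 ?powR_ge0// ltW.
Qed.

Lemma gauss_fin (a : R) : 0 < a -> (\int[leb]_t (expR (- (a * t ^+ 2)))%:E < +oo)%E.
Proof.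
move=> a0; have c0 : 0 < Num.sqrt a by rewrite sqrtr_gt0.
have := lebesgue_scale (f := @gauss_fun R) c0 (@measurable_gauss_fun R) (@gauss_fun_ge0 R).
have /integrableP[_] := @integrableT_gauss R.
have -> : (\int[leb]_x `|(EFin \o gauss_fun) x| = \int[leb]_x (gauss_fun x)%:E)%E.
  by apply: eq_integral => x _; rewrite /= ger0_norm// gauss_fun_ge0.
move=> H1 H2; move: H1; rewrite H2.
rewrite (_ : (fun t => (gauss_fun (Num.sqrt a * t))%:E) = fun t => (expR (- (a * t ^+ 2)))%:E); last first.
  by apply/funext => t; rewrite /gauss_fun exprMn sqr_sqrtr// ltW.
have : (0 <= \int[leb]_t (expR (- (a * t ^+ 2)))%:E)%E.
  by apply: integral_ge0 => t _; rewrite lee_fin expR_ge0.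
move: (\int[leb]_t (expR (- (a * t ^+ 2)))%:E)%E => [r||] //= _; first by move=> _; rewrite ltry.
by rewrite gt0_muley// lte_fin.
Qed.

End gamma.

Lemma lebesgue_rV_prod (R : realType) (f : R -> R) (n : nat) :
  mfun f -> (forall t, 0 <= f t) ->
  (\int[lebesgue_rV n]_x (\prod_(i < n) f (x ord0 i))%:E =
   (\int[@lebesgue_measure R]_t (f t)%:E) ^+ n)%E.
Proof.
move=> mf f0.
have mprod k : mfun (fun x : 'rV[R]_k => \prod_(i < k) f (x ord0 i)).
  apply: measurable_prod => i _; exact: measurableT_comp mf (measurable_coord i).
have p0 k (x : 'rV[R]_k) : 0 <= \prod_(i < k) f (x ord0 i) by rewrite prodr_ge0.
elim: n => [|n IHn].
  rewrite expe0 /=; under eq_integral do rewrite big_ord0.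
  by rewrite integral_dirac// diracT mul1e.
rewrite expeS /= /lebesgue_rV_step ge0_integral_pushforward//=; last 3 first.
- exact: measurable_rV_cons.
- by apply/measurable_EFinP; exact: (mprod n.+1).
- by move=> x _; rewrite lee_fin; exact: (p0 n.+1).
rewrite (_ : (fun p => _) = (fun p : R * 'rV[R]_n => (f p.1 * \prod_(i < n) f (p.2 ord0 i))%:E)); last first.
  apply/funext => p /=; rewrite big_ord_recl; congr ((f _ * _)%:E).
    by have := congr1 fst (rV_consK p).
  apply: eq_bigr => i _; congr (f _).
  have := rV_consK p; rewrite /rV_uncons => /(congr1 snd) /= /rowP/(_ i).
  by rewrite mxE.
rewrite fubini_tonelli1; last 2 first.
- apply/measurable_EFinP; apply: measurable_funM.
    exact: measurableT_comp mf measurable_fst.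
  exact: measurableT_comp (mprod n) measurable_snd.
- by move=> p; rewrite lee_fin mulr_ge0.
rewrite -IHn -ge0_integralZr//=.
- apply: eq_integral => t _; rewrite /fubini_F /=.
  exact: (ge0_integralZ_EFin _ (mprod n) (p0 n) (f0 t)).
- exact/measurable_EFinP.
- by move=> t _; rewrite lee_fin.
- by apply: integral_ge0 => x _; rewrite lee_fin; exact: p0.
Qed.

Section leb2.
Context {R : realType} {N : nat}.
Local Notation mu := (@lebesgue_rV R N).
Local Notation pt := ('rV[R]_N * 'rV[R]_N)%type.

(* An alias of the product measure, as the library does not infer that a product
   of two sigma-finite measures is sigma-finite. *)
Definition leb2 : set pt -> \bar R := (mu \x mu)%E.

Let leb2_0 : leb2 set0 = 0%E. Proof. exact: measure0. Qed.

Let leb2_ge0 A : (0 <= leb2 A)%E. Proof. exact: measure_ge0. Qed.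

Let leb2_sigma_additive : semi_sigma_additive leb2.
Proof. exact: measure_semi_sigma_additive. Qed.

HB.instance Definition _ := isMeasure.Build _ _ _ leb2 leb2_0 leb2_ge0 leb2_sigma_additive.

Let leb2_sigma_finite : sigma_finite setT leb2.
Proof.
exists (fun n => cube n.+1%:R `*` cube n.+1%:R).
  apply/seteqP; split=> // -[x y] _.
  exists (Num.truncn (`|x| + `|y|)) => //.
  have H : `|x| + `|y| < (Num.truncn (`|x| + `|y|)).+1%:R by exact: truncnS_gt.
  split; apply/cubeP => i /=; apply: le_lt_trans (rV_norm_coord _ i) _;
    apply: le_lt_trans H; rewrite ?lerDl ?lerDr//.
move=> n; have mc := @measurable_box R N (const_mx (- n.+1%:R)) (const_mx n.+1%:R).
split; first exact: measurableX.
by rewrite /leb2 product_measure1E// lte_mul_pinfty// ?ge0_fin_numE// box_lty.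
Qed.

HB.instance Definition _ := Measure_isSigmaFinite.Build _ _ _ leb2 leb2_sigma_finite.

End leb2.

Section energy_prelim.
Context {R : realType} {N : nat}.
Implicit Types (x y z v : 'rV[R]_N) (i j : 'I_N).
Local Notation mu := (@lebesgue_rV R N).
Local Notation fn := ('rV[R]_N -> R).
Local Notation pt := ('rV[R]_N * 'rV[R]_N)%type.
Local Notation pm := (mu \x mu)%E.

Lemma gauss_rV_fin (a : R) : 0 < a -> exists2 G : R, 0 < G &
  (\int[mu]_x (expR (- (a * sqn x)))%:E = G%:E)%E.
Proof.
move=> a0; have mg : mfun (fun t : R => expR (- (a * t ^+ 2))).
  by apply: measurableT_comp => //; apply: measurable_funN; apply: measurable_funM => //;
    exact: measurable_funX.
have me : mfun (fun x : 'rV[R]_N => expR (- (a * sqn x))).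
  by apply: measurableT_comp => //; apply: measurable_funN; apply: measurable_funM => //;
    exact: measurable_sqn.
have E : (\int[mu]_x (expR (- (a * sqn x)))%:E =
    (\int[@lebesgue_measure R]_t (expR (- (a * t ^+ 2)))%:E) ^+ N)%E.
  rewrite -(lebesgue_rV_prod N mg) => [|t]; last exact: expR_ge0.
  apply: eq_integral => x _; congr (_%:E); rewrite /sqn mulr_sumr -sumrN.
  by rewrite expR_sum.
have := gauss_fin a0.
have : (0 <= \int[@lebesgue_measure R]_t (expR (- (a * t ^+ 2)))%:E)%E.
  by apply: integral_ge0 => t _; rewrite lee_fin expR_ge0.
move: E; move: (\int[@lebesgue_measure R]_t (expR (- (a * t ^+ 2)))%:E)%E => [r||] //= E r0 _.
exists (r ^+ N); last by rewrite E EFin_expe.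
rewrite lt_neqAle; apply/andP; split; last by rewrite exprn_ge0// -lee_fin.
apply/eqP => rN; have E0 : (\int[mu]_x (expR (- (a * sqn x)))%:E = 0)%E by rewrite E -EFin_expe -rN.
have [Z [mZ Z0 ZS]] := ae_pos (fun x => expR_ge0 _) me E0.
have : (mu (cube 1) <= 0)%E.
  rewrite -Z0; apply: le_measure; rewrite ?inE//; first exact: measurable_box.
  by move=> x _; apply: ZS => /= /eqP; rewrite gt_eqF// expR_gt0.
rewrite leNgt box_gt0// => i; rewrite !mxE; lra.
Qed.

(** A kernel that is a superposition of kernels with nonnegative integral against [phi] has the same
    property. [phi] has no sign: the exchange of integrals rests on the absolute integrability of
    [k phi], as the mixture is nonnegative. *)
Lemma pd_mix d1 d (P : measurableType d1) (Z : measurableType d)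
    (rho : {sigma_finite_measure set P -> \bar R}) (nu : {sigma_finite_measure set Z -> \bar R})
    (m : P * Z -> R) (k phi : P -> R) :
  mfun m -> (forall q, 0 <= m q) -> mfun phi ->
  intg rho (fun p => k p * phi p) -> (forall p, 0 <= k p) ->
  {ae rho, forall p, ((k p)%:E = \int[nu]_t (m (p, t))%:E)%E} ->
  (forall t : Z, (0 <= \int[rho]_p (m (p, t) * phi p)%:E)%E) ->
  0 <= \int[rho]_p (k p * phi p).
Proof.
move=> mm m0 mphi ik k0 km H.
have mmp p : mfun (fun t => m (p, t)).
  exact: measurableT_comp mm (measurable_pair1 p).
have mH : mfun (fun q : P * Z => m q * phi q.1).
  by apply: measurable_funM => //; exact: measurableT_comp mphi measurable_fst.
have iH : (rho \x nu)%E.-integrable setT (fun q => (m q * phi q.1)%:E).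
  apply/integrableP; split; first exact/measurable_EFinP.
  have mH' : mfun (fun q : P * Z => `|(m q * phi q.1)%:E|%E).
    by apply: measurableT_comp => //; exact/measurable_EFinP.
  rewrite (fubini_tonelli1 _ mH' (fun q => abse_ge0 _)).
  have /integrableP[_] := ik; congr (_ < _)%E.
  apply: ae_eq_integral => //.
  - by apply: measurableT_comp => //; have /integrableP[] := ik.
  - apply: (measurable_fun_fubini_tonelli_F (m2 := nu)) => [|q]; last exact: abse_ge0.
    by apply: measurableT_comp => //; exact/measurable_EFinP.
  - apply: filterS km => p kp _; rewrite /fubini_F /=.
    under eq_integral do rewrite normrM (ger0_norm (m0 _)) mulrC.
    rewrite ge0_integralZ_EFin// -kp -EFinM normrM (ger0_norm (k0 p)) mulrC//.
have E1 := integral12_prod_meas1 iH; have E2 := integral21_prod_meas1 iH.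
have E3 : (\int[rho]_p (k p * phi p)%:E = \int[rho]_p fubini_F nu (fun q => (m q * phi q.1)%:E) p)%E.
  apply: ae_eq_integral => //.
  - by have /integrableP[] := ik.
  - by have := measurable_fubini_F iH.
  - apply: filterS km => p kp _; rewrite /fubini_F /=.
    under eq_integral do rewrite mulrC EFinM.
    rewrite integralZl//.
      by rewrite -kp -EFinM mulrC.
    apply/integrableP; split; first exact/measurable_EFinP.
    under eq_integral do rewrite gee0_abs ?lee_fin//.
    by rewrite -kp ltry.
rewrite /Rintegral fine_ge0// E3 E1 -E2; apply: integral_ge0 => z _; exact: H.
Qed.

(** Points are null once there is at least one coordinate. Off the diagonal the kernel is genuinely
    |z|^-g and positive, whereas its value on the diagonal is a convention. *)
Lemma diag_null : (0 < N)%N -> {ae pm, forall p, 0 < sqn (p.1 - p.2)}.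
Proof.
move=> N0; pose D := [set p : pt | sqn (p.1 - p.2) <= 0].
have msq : mfun (fun p : pt => sqn (p.1 - p.2)).
  exact: measurableT_comp measurable_sqn measurable_sub2.
have mD : measurable D.
  rewrite (_ : D = (fun p : pt => sqn (p.1 - p.2)) @^-1` `]-oo, 0]%classic).
    by rewrite -[X in measurable X]setTI; exact: msq.
  by apply/seteqP; split=> p; rewrite /D /= in_itv.
exists D; split=> //; last by move=> p /= /negP; rewrite -leNgt.
transitivity (\int[pm]_p (\1_D p)%:E)%E; first by rewrite integral_indic// setIT.
rewrite fubini_tonelli1; last 2 first.
- exact/measurable_EFinP/measurable_indic.
- by move=> p; rewrite lee_fin.
apply: integral0_eq => x _; rewrite /fubini_F /=.
have -> : (fun y => (\1_D (x, y) : R)%:E) = fun y => (\1_[set x] y : R)%:E.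
  apply/funext => y; rewrite !indicE.
  suff -> : ((x, y) \in D) = (y \in [set x]) by [].
  apply/idP/idP; rewrite !inE /D /=.
    move=> H; apply/rowP => i; apply/eqP; rewrite -subr_eq0 -oppr_eq0 opprB -sqrf_eq0.
    by have := sqn_coord (x - y) i; rewrite !mxE eq_le sqr_ge0 andbT => H2; exact: le_trans H2 H.
  by move=> ->; rewrite subrr /sqn big1// => i _; rewrite mxE expr0n.
have Ex : [set x] = [set w : 'rV[R]_N | forall i, [set x ord0 i] (w ord0 i)].
  by apply/seteqP; split=> w /= H; [move=> i; rewrite H|apply/rowP => i; exact: H].
have mx1 : measurable [set x].
  rewrite Ex (_ : mkset _ = \bigcap_(i in [set: 'I_N])
      ((fun v : 'rV[R]_N => v ord0 i) @^-1` [set x ord0 i])).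
    apply: fin_bigcap_measurable => // i _.
    by rewrite -[X in measurable X]setTI; apply: measurable_coord.
  by apply/seteqP; split=> w /= h i; [move=> _|]; exact: h.
rewrite integral_indic// setIT Ex; apply: (etrans (@lebesgue_rV_box R N (fun i => [set x ord0 i]) _)) => //.
by rewrite (bigD1 (Ordinal N0))//= lebesgue_measure_set1 mul0e.
Qed.

Lemma intg_prod (f h : fn) : intg mu f -> intg mu h -> intg pm (fun p => f p.1 * h p.2).
Proof.
move=> If Ih.
have mp : mfun (fun p : pt => f p.1 * h p.2).
  by apply: measurable_funM; [exact: measurableT_comp (intg_meas If) measurable_fst|
    exact: measurableT_comp (intg_meas Ih) measurable_snd].
apply: (@intg_le _ _ _ pm _ (fun p => `|f p.1| * `|h p.2|)) => //; last by move=> p; rewrite normrM.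
apply: intg_ge0P => [|p|]; last 1 first.
- have -> : (\int[pm]_p (`|f p.1| * `|h p.2|)%:E = \int[pm]_p (1 * (`|f p.1| * `|h p.2|))%:E)%E.
    by apply: eq_integral => p _; rewrite mul1r.
  have H := @tonelli_col R N (fun=> 1) (fun x => `|f x|) (fun x => `|h x|) (\int[mu]_x `|f x|).
  apply: (le_lt_trans (H _ _ _ _ _ _ _ _)) => //.
  + exact: intg_meas (intg_abs If).
  + exact: intg_abs.
  + by move=> y; rewrite (_ : (fun x => _) = fun x => `|f x|); [exact: intg_abs|apply/funext => x; rewrite mul1r].
  + by move=> y; under eq_Rintegral do rewrite mul1r.
  + by rewrite ltry.
- by apply: measurable_funM; [exact: measurableT_comp (intg_meas (intg_abs If)) measurable_fst|
    exact: measurableT_comp (intg_meas (intg_abs Ih)) measurable_snd].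
- by rewrite mulr_ge0.
Qed.

Lemma I_prod (f h : fn) : intg mu f -> intg mu h ->
  (\int[pm]_p (f p.1 * h p.2)%:E = ((\int[mu]_x f x) * \int[mu]_x h x)%:E)%E.
Proof.
move=> If Ih; rewrite -(integral12_prod_meas1 (intg_prod If Ih)).
rewrite (_ : fubini_F _ _ = fun x => ((\int[mu]_x h x) * f x)%:E).
  by rewrite -EFin_I ?IZ//; [rewrite mulrC|exact: intgZ].
apply/funext => x; rewrite /fubini_F /=.
by rewrite -EFin_I; [rewrite IZ// mulrC|exact: intgZ].
Qed.

(** Up to a constant, the Gaussian of x - y is the integral over z of a product of a function of x -
    z and the same function of y - z; the form becomes an integral over z of squares. *)
Lemma gauss_pd (a : R) (f : fn) : 0 < a -> intg mu f ->
  intg pm (fun p => expR (- (a * sqn (p.1 - p.2))) * (f p.1 * f p.2)) /\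
  0 <= \int[pm]_p (expR (- (a * sqn (p.1 - p.2))) * (f p.1 * f p.2)).
Proof.
move=> a0 If.
have mex (b : R) : mfun (fun x : 'rV[R]_N => expR (- (b * sqn x))).
  by apply: measurableT_comp => //; apply: measurable_funN; apply: measurable_funM => //;
    exact: measurable_sqn.
have ex1 (b : R) x : 0 <= b -> `|expR (- (b * sqn x))| <= 1.
  move=> b0; rewrite ger0_norm ?expR_ge0// -expR0 ler_expR oppr_le0.
  by rewrite mulr_ge0 ?sqn_ge0.
have mff : mfun (fun p : pt => f p.1 * f p.2) := intg_meas (intg_prod If If).
have iex (b : R) (h : pt -> R) : 0 <= b -> intg pm h ->
    intg pm (fun p => expR (- (b * sqn (p.1 - p.2))) * h p).
  move=> b0 Ih; apply: (@intg_le _ _ _ pm _ (fun p => `|h p|)).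
  - apply: measurable_funM; last exact: intg_meas Ih.
    exact: measurableT_comp (mex b) measurable_sub2.
  - exact: intg_abs.
  - by move=> p; rewrite normrM ler_piMl// ex1.
split; first exact: iex (ltW a0) (intg_prod If If).
have a40 : 0 < 4 * a by rewrite mulr_gt0.
have [G G0 HG] := gauss_rV_fin a40.
suff : 0 <= \int[pm]_p ((G * expR (- (a * sqn (p.1 - p.2)))) * (f p.1 * f p.2)).
  under eq_Rintegral do rewrite -mulrA.
  rewrite IZ; last exact: iex (ltW a0) (intg_prod If If).
  by rewrite pmulr_rge0.
have a20 : 0 <= 2 * a by rewrite mulr_ge0// ltW.
pose mm (q : pt * 'rV[R]_N) := expR (- ((2 * a) * sqn (q.1.1 - q.2))) * expR (- ((2 * a) * sqn (q.1.2 - q.2))).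
pose kk (p : pt) := G * expR (- (a * sqn (p.1 - p.2))).
pose ph (p : pt) := f p.1 * f p.2.
have PD := @pd_mix _ _ _ _ leb2 mu mm kk ph.
apply: PD.
- have ms (s : pt * 'rV[R]_N -> 'rV[R]_N) : mfun s ->
    mfun (fun q : pt * 'rV[R]_N => expR (- ((2 * a) * sqn (s q - q.2)))).
    move=> H; have : mfun (fun q : pt * 'rV[R]_N => (s q, q.2)).
      by apply/measurable_fun_pair => //; exact: measurable_snd.
    move=> H2; exact: measurableT_comp (mex (2 * a)) (measurableT_comp measurable_sub2 H2).
  apply: measurable_funM; apply: ms.
    exact: measurableT_comp measurable_fst measurable_fst.
  exact: measurableT_comp measurable_snd measurable_fst.
- by move=> q; rewrite mulr_ge0 ?expR_ge0.
- exact: mff.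
- under eq_fun do rewrite -mulrA.
  apply: intgZ; exact: iex (ltW a0) (intg_prod If If).
- by move=> p; rewrite mulr_ge0 ?expR_ge0// ltW.
- apply: aeW => -[x y] /=.
  pose mid := 2^-1 *: (x + y).
  (* With m the midpoint, 2a |x - z|^2 + 2a |y - z|^2 = a |x - y|^2 + 4a |z - m|^2. *)
  have E z : expR (- ((2 * a) * sqn (x - z))) * expR (- ((2 * a) * sqn (y - z))) =
    expR (- (a * sqn (x - y))) * expR (- ((4 * a) * sqn (z - mid))).
    rewrite -!expRD; congr expR; rewrite /sqn.
    rewrite -!mulNr !mulr_sumr -!big_split /=; apply: eq_bigr => i _; rewrite !mxE; by field.
  transitivity (\int[mu]_z (expR (- (a * sqn (x - y))) * expR (- ((4 * a) * sqn (z - mid))))%:E)%E;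
    last by apply: eq_integral => z _; rewrite -E.
  have mm4 := measurableT_comp (mex (4 * a)) (measurable_shift (- mid)).
  rewrite (ge0_integralZ_EFin mu mm4 (fun z => expR_ge0 _) (expR_ge0 _)).
  rewrite (@mp_ge0_integral _ _ _ mu (fun z => z - mid) _ _ (fun z => (expR (- (4 * a * sqn z)))%:E)).
  + by rewrite HG -EFinM mulrC.
  + exact: measurable_shift.
  + by move=> A mA; exact: shift_measure.
  + by apply/measurable_EFinP; exact: mex.
  + by move=> z; rewrite lee_fin expR_ge0.
- move=> z; pose h x := expR (- ((2 * a) * sqn (x - z))) * f x.
  have mez : mfun (fun x => expR (- ((2 * a) * sqn (x - z)))).
    exact: measurableT_comp (mex (2 * a)) (measurable_shift (- z)).
  have Ih : intg mu h by exact: (intg_bdM mez (fun x => ex1 _ (x - z) a20) If).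
  apply: (@le_trans _ _ (\int[pm]_p (h p.1 * h p.2)%:E)%E).
    by rewrite I_prod// lee_fin -expr2 sqr_ge0.
  rewrite le_eqVlt; apply/orP; left; apply/eqP; apply: eq_integral => p _.
  by rewrite /h /mm /ph mulrACA.
Qed.

End energy_prelim.

(** * The Riesz energy as a semi-inner product *)

Section energy.
Context {R : realType} {N : nat}.
Implicit Types (x y z v : 'rV[R]_N) (i j : 'I_N).
Local Notation mu := (@lebesgue_rV R N).
Local Notation fn := ('rV[R]_N -> R).
Local Notation pt := ('rV[R]_N * 'rV[R]_N)%type.
Local Notation pm := (mu \x mu)%E.

(* The functions whose Riesz energy is defined by an absolutely convergent
   integral because they are dominated by the square of an H^1 function. *)
Definition FF (f : fn) := mfun f /\ exists2 p, H1 p & forall x, `|f x| <= p x ^+ 2.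

Lemma FF_meas (f : fn) : FF f -> mfun f. Proof. by case. Qed.

Lemma H1_meas (u : fn) : H1 u -> mfun u.
Proof. by move=> /H1_sqint/sqint_meas. Qed.

Lemma FF_absD (u w : fn) : H1 u -> H1 w -> H1 ((fun x => `|u x|) + (fun x => `|w x|)).
Proof. by move=> Hu Hw; apply: (siD ip_si); [case: (H1_abs Hu)|case: (H1_abs Hw)]. Qed.

Lemma FFM (u w : fn) : H1 u -> H1 w -> FF (fun x => u x * w x).
Proof.
move=> Hu Hw; split; first by apply: measurable_funM; exact: H1_meas.
exists ((fun x => `|u x|) + (fun x => `|w x|)); first exact: FF_absD.
move=> x; rewrite fctE normrM; have := normr_ge0 (u x); have := normr_ge0 (w x).
by move: `|u x| `|w x| => a b; nra.
Qed.

Lemma FFsq (u : fn) : H1 u -> FF (fun x => u x ^+ 2).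
Proof. by move=> Hu; under eq_fun do rewrite expr2; exact: FFM. Qed.

Lemma FFD (f h : fn) : FF f -> FF h -> FF (f + h).
Proof.
move=> [mf [p Hp fp]] [mh [q Hq hq]]; split; first exact: measurable_funD.
exists ((fun x => `|p x|) + (fun x => `|q x|)); first exact: FF_absD.
move=> x; rewrite !fctE; apply: le_trans (ler_normD _ _) _.
apply: le_trans (lerD (fp x) (hq x)) _.
rewrite -(real_normK (num_real (p x))) -(real_normK (num_real (q x))).
have := normr_ge0 (p x); have := normr_ge0 (q x).
by move: `|p x| `|q x| => a b; nra.
Qed.

Lemma FFZ (a : R) (f : fn) : FF f -> FF (a *: f).
Proof.
move=> [mf [p Hp fp]]; split; first exact: measurable_funM.
exists (Num.sqrt `|a| *: p); first exact: (siZ ip_si).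
move=> x; rewrite !fctE -![_ *: _]/(_ * _) normrM exprMn sqr_sqrtr//.
by rewrite ler_wpM2l.
Qed.

Lemma FF0 : FF 0.
Proof.
split; first exact: measurable_cst.
exists 0; first exact: (si0 ip_si).
by move=> x; rewrite [X in `|X|](_ : _ = 0)// normr0 sqr_ge0.
Qed.

Lemma FF_intg (f : fn) : FF f -> intg mu f.
Proof.
by move=> [mf [p Hp fp]]; apply: (intg_le mf _ fp); exact: sqint_intg (H1_sqint Hp).
Qed.

Variables (g c : R).
Hypotheses (N0 : (0 < N)%N) (g0 : 0 < g) (g4 : g < 4) (gN : g < N%:R) (c0 : 0 < c).

Definition rk z : R := c * kz g z.

Lemma rk_ge0 z : 0 <= rk z. Proof. by rewrite mulr_ge0 ?kz_ge0// ltW. Qed.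

Lemma rkB x y : rk (x - y) = rk (y - x). Proof. by rewrite /rk -kzN opprB. Qed.

Lemma measurable_rk : mfun rk.
Proof. by apply: measurable_funM => //; exact: measurable_kz. Qed.

Definition DD (f h : fn) : R := \int[pm]_p (rk (p.1 - p.2) * (f p.1 * h p.2)).

Lemma measurable_DD (f h : fn) : mfun f -> mfun h ->
  mfun (fun p : pt => rk (p.1 - p.2) * (f p.1 * h p.2)).
Proof. exact: measurable_kfg measurable_rk. Qed.

Lemma intg_DD (f h : fn) : FF f -> FF h ->
  intg pm (fun p => rk (p.1 - p.2) * (f p.1 * h p.2)).
Proof.
move=> [mf [p Hp fp]] [mh [q Hq hq]].
have [C C0 HC] := double_kz g0 g4 gN.
have mk := measurable_kfg (measurable_kz g) (FF_meas (FFsq Hp)) (FF_meas (FFsq Hq)).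
have I1 : intg pm (fun w => kz g (w.1 - w.2) * (p w.1 ^+ 2 * q w.2 ^+ 2)).
  apply: intg_ge0P => // [w|]; first by rewrite mulr_ge0 ?kz_ge0// mulr_ge0 ?sqr_ge0.
  by apply: le_lt_trans (HC p q Hp Hq) _; rewrite ltry.
apply: (@intg_le _ _ _ pm _ (fun w => c * (kz g (w.1 - w.2) * (p w.1 ^+ 2 * q w.2 ^+ 2)))).
- exact: measurable_DD.
- exact: intgZ.
- move=> w; rewrite normrM (ger0_norm (rk_ge0 _)) /rk -mulrA ler_wpM2l ?(ltW c0)//.
  by rewrite ler_wpM2l ?kz_ge0// normrM ler_pM.
Qed.

Lemma DDE1 (f h : fn) : FF f -> FF h ->
  (DD f h)%:E = (\int[mu]_x \int[mu]_y (rk (x - y) * (f x * h y))%:E)%E.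
Proof.
by move=> Ff Fh; rewrite /DD EFin_I; [rewrite -integral12_prod_meas1|]; try exact: intg_DD.
Qed.

Lemma DDE2 (f h : fn) : FF f -> FF h ->
  (DD f h)%:E = (\int[mu]_y \int[mu]_x (rk (x - y) * (f x * h y))%:E)%E.
Proof.
by move=> Ff Fh; rewrite /DD EFin_I; [rewrite -integral21_prod_meas1|]; try exact: intg_DD.
Qed.

Lemma DDC (f h : fn) : FF f -> FF h -> DD f h = DD h f.
Proof.
move=> Ff Fh; apply: EFin_inj; rewrite (DDE1 Ff Fh) (DDE2 Fh Ff).
by apply: eq_integral => x _; apply: eq_integral => y _; rewrite rkB [f _ * _]mulrC.
Qed.

Lemma DDDl (f f' h : fn) : FF f -> FF f' -> FF h -> DD (f + f') h = DD f h + DD f' h.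
Proof.
move=> Ff Ff' Fh; rewrite /DD -ID; try exact: intg_DD.
by congr (Rintegral _ _ _); apply/funext => p; rewrite !fctE; ring.
Qed.

Lemma DDZl (a : R) (f h : fn) : FF f -> FF h -> DD (a *: f) h = a * DD f h.
Proof.
move=> Ff Fh; rewrite /DD -IZ; last exact: intg_DD.
congr (Rintegral _ _ _); apply/funext => p; rewrite !fctE.
by rewrite -[a *: _]/(a * _); ring.
Qed.

Lemma DD_ge0 (f h : fn) : (forall x, 0 <= f x) -> (forall x, 0 <= h x) -> 0 <= DD f h.
Proof. by move=> f0 h0; apply: I_ge0 => p; rewrite mulr_ge0 ?rk_ge0// mulr_ge0. Qed.

Lemma DD_le (f f' h : fn) : FF f -> FF f' -> FF h -> (forall x, f x <= f' x) ->
  (forall x, 0 <= h x) -> DD f h <= DD f' h.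
Proof.
move=> Ff Ff' Fh ff' h0; apply: I_le => [||p]; try exact: intg_DD.
by rewrite ler_wpM2l ?rk_ge0// ler_wpM2r.
Qed.

Lemma DD_ae (f f' h : fn) : FF f -> FF f' -> FF h -> {ae mu, forall x, f x = f' x} ->
  DD f h = DD f' h.
Proof.
move=> Ff Ff' Fh ff'; apply: EFin_inj; rewrite (DDE1 Ff Fh) (DDE1 Ff' Fh).
apply: ae_eq_integral => //.
- by have := measurable_fubini_F (intg_DD Ff Fh).
- by have := measurable_fubini_F (intg_DD Ff' Fh).
- by apply: filterS ff' => x E _; apply: eq_integral => y _; rewrite E.
Qed.

Lemma FF_shift (f : fn) v : FF f -> FF (fun x => f (x + v)).
Proof.
move=> [mf [p Hp fp]]; split; first exact: measurableT_comp mf (measurable_shift v).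
by exists (fun x => p (x + v)); [exact: H1_shift|move=> x; exact: fp].
Qed.

Lemma DD_shift (f h : fn) v : FF f -> FF h ->
  DD (fun x => f (x + v)) (fun x => h (x + v)) = DD f h.
Proof.
move=> Ff Fh; apply: EFin_inj; rewrite (DDE1 Ff Fh) (DDE1 (FF_shift v Ff) (FF_shift v Fh)).
have sm A : measurable A -> mu ((fun x => x + v) @^-1` A) = mu A by move=> ?; exact: shift_measure.
have mF := measurable_fubini_F (intg_DD Ff Fh).
rewrite -[RHS](mp_integral (measurable_shift v) sm mF).
apply: eq_integral => x _; rewrite /fubini_F /=.
have mr : mfun (fun y => (rk (x + v - y) * (f (x + v) * h y))%:E).
  apply/measurable_EFinP; apply: measurable_funM; last by apply: measurable_funM => //; exact: FF_meas.
  apply: (measurableT_comp measurable_rk).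
  by have := measurableT_comp (measurable_shift (x + v)) measurable_reflect; under eq_fun do rewrite /= addrC.
rewrite -(mp_integral (measurable_shift v) sm mr); apply: eq_integral => y _.
by rewrite opprD addrACA subrr addr0.
Qed.

(** [convolution] takes the value 0 wherever the integral diverges. Fubini gives convergence for
    almost every x with h x nonzero, and where h x = 0 both integrands vanish. *)
Lemma DD_conv (f h : fn) : FF f -> FF h ->
  \int[mu]_x (convolution rk f x * h x) = DD h f.
Proof.
move=> Ff Fh; have iD := intg_DD Fh Ff.
have := integral12_prod_meas1 iD; rewrite -EFin_I// => E.
rewrite /Rintegral -[RHS]/(fine (DD h f)%:E) /DD -E; congr fine.
have mF := measurable_fubini_F iD.
apply/esym; apply: ae_eq_integral => //.
- apply/measurable_EFinP; apply: measurable_funM; last exact: FF_meas.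
  pose k1 (p : pt) := ((rk (p.1 - p.2) * f p.2)%:E : \bar R).
  have mk1 : mfun k1.
    apply/measurable_EFinP; apply: measurable_funM.
      exact: measurableT_comp measurable_rk measurable_sub2.
    exact: measurableT_comp (FF_meas Ff) measurable_snd.
  have mp1 := measurable_fun_fubini_tonelli_F (m2 := mu) (fun p => (k1^\+ p)%E).
  have mn1 := measurable_fun_fubini_tonelli_F (m2 := mu) (fun p => (k1^\- p)%E).
  rewrite (_ : convolution rk f = fun x => fine (fubini_F mu (fun p => (k1^\+ p)%E) x -
      fubini_F mu (fun p => (k1^\- p)%E) x)%E).
    apply: measurableT_comp => //; apply: emeasurable_funB.
      by apply: mp1 => //; exact: measurable_funepos.
    by apply: mn1 => //; exact: measurable_funeneg.
  apply/funext => x; rewrite /convolution /Rintegral integralE /fubini_F; congr fine.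
  by congr (_ - _)%E; apply: eq_integral => y _; rewrite ?funeposE ?funenegE.
- have := ae_integrable1 iD; apply: filterS => x ix _; rewrite /fubini_F /=.
  have [h0|h0] := eqVneq (h x) 0.
    by rewrite h0 mulr0; apply: integral0_eq => y _; rewrite mul0r mulr0.
  have ik : intg mu (fun y => rk (x - y) * f y).
    rewrite (_ : (fun y => _) = fun y => (h x)^-1 * (rk (x - y) * (h x * f y))); first exact: intgZ.
    by apply/funext => y; field.
  rewrite /convolution mulrC -IZ// EFin_I; last exact: intgZ.
  by apply: eq_integral => y _; rewrite mulrCA.
Qed.

(** The kernel is positive off the null diagonal, so a zero energy forces f(x) h(y) = 0 for almost
    every pair, hence a zero product of the integrals. *)
Lemma DD_gt0 (f h : fn) : FF f -> FF h -> (forall x, 0 <= f x) -> (forall x, 0 <= h x) ->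
  ~ ae_zero f -> ~ ae_zero h -> 0 < DD f h.
Proof.
move=> Ff Fh f0 h0 nf nh; rewrite lt_neqAle DD_ge0// andbT; apply/eqP => /esym D0.
have iD := intg_DD Ff Fh.
have /(I_eq0_ae iD) : forall p, 0 <= rk (p.1 - p.2) * (f p.1 * h p.2).
  by move=> p; rewrite mulr_ge0 ?rk_ge0// mulr_ge0.
move=> /(_ D0) Z; have If := FF_intg Ff; have Ih := FF_intg Fh.
have Z2 : {ae pm, forall p, f p.1 * h p.2 = 0}.
  apply: filterS2 Z (diag_null N0) => p E q0.
  move/eqP: E; rewrite mulf_eq0 /rk mulf_eq0 gt_eqF//= /kz gt_eqF ?powR_gt0//= => /eqP.
  exact.
have : \int[mu]_x f x * \int[mu]_x h x = 0.
  have := I_prod If Ih => /(congr1 fine) /= <-; rewrite -[LHS]/(\int[pm]_p (f p.1 * h p.2)).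
  rewrite (_ : 0 = \int[pm]_p (0 : R)); last by rewrite I0.
  by apply: I_ae => //; exact: intg_meas (intg_prod If Ih).
move=> /eqP; rewrite mulf_eq0 => /orP[] /eqP E0.
- by apply: nf; exact: I_eq0_ae If f0 E0.
- by apply: nh; exact: I_eq0_ae Ih h0 E0.
Qed.

(** |z|^-g is a superposition of Gaussians with nonnegative weights, by [gwt_scale] with s = g / 2,
    and each Gaussian is positive semidefinite by [gauss_pd]. *)
Lemma DD_pos (f : fn) : FF f -> 0 <= DD f f.
Proof.
move=> Ff; have If := FF_intg Ff; have iD := intg_DD Ff Ff.
pose s := g / 2; have s0 : 0 < s by rewrite divr_gt0.
have [G0 _] := Euler_GammaE s0; pose K := c / Euler_Gamma s.
have K0 : 0 < K by rewrite divr_gt0.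
pose mm (q : pt * measurableTypeR R) := K * (gwt s q.2 * expR (- (q.2 * sqn (q.1.1 - q.1.2)))).
pose kk (p : pt) := rk (p.1 - p.2).
pose ph (p : pt) := f p.1 * f p.2.
have mff : mfun (fun p : pt => f p.1 * f p.2) := intg_meas (intg_prod If If).
have PD := @pd_mix R _ _ _ _ leb2 (@lebesgue_measure R) mm kk ph.
apply: PD => //.
- have ms : mfun (fun q : pt * measurableTypeR R => (q.2 : R)).
    exact: measurable_snd.
  apply: measurable_funM => //; apply: measurable_funM.
    exact: (measurableT_comp (measurable_gwt s) ms).
  apply: measurableT_comp => //; apply: measurable_funN; apply: measurable_funM => //.
  apply: (measurableT_comp measurable_sqn).
  exact: (measurableT_comp measurable_sub2 measurable_fst).
- by move=> q; rewrite mulr_ge0 ?(ltW K0)// mulr_ge0 ?gwt_ge0 ?expR_ge0.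
- by move=> p; exact: rk_ge0.
- apply: filterS (diag_null N0) => p q0.
  have mex : mfun (fun t : R => gwt s t * expR (- (t * sqn (p.1 - p.2)))).
    apply: measurable_funM; first exact: measurable_gwt.
    by apply: measurableT_comp => //; apply: measurable_funN; exact: measurable_funM.
  have e0 (t : R) : 0 <= gwt s t * expR (- (t * sqn (p.1 - p.2))).
    by rewrite mulr_ge0 ?gwt_ge0 ?expR_ge0.
  rewrite (ge0_integralZ_EFin (@lebesgue_measure R) mex e0 (ltW K0)) gwt_scale// -EFinM.
  by congr (_%:E); rewrite /kk /rk /kz /K; field; rewrite gt_eqF.
- move=> t; rewrite /mm /ph /=.
  have [t0|t0] := ltP 0 t; last first.
    rewrite integral0_eq// => p _.
    by rewrite gwtE ltNge t0 /= mul0r mulr0 mul0r.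
  have [i1 p1] := gauss_pd t0 If.
  rewrite (_ : (fun p : pt => _) = fun p : pt => ((K * gwt s t) *
    (expR (- (t * sqn (p.1 - p.2))) * (f p.1 * f p.2)))%:E); last first.
    by apply/funext => p; congr (_%:E); ring.
  rewrite -(EFin_I (mu := pm)); last exact: intgZ.
  by rewrite lee_fin IZ// mulr_ge0// mulr_ge0 ?gwt_ge0// ltW.
Qed.

Lemma DD_si : semi_inner FF DD.
Proof.
split; [exact: FF0|exact: FFD|exact: FFZ|exact: DDC|exact: DDDl|exact: DDZl|exact: DD_pos].
Qed.

Lemma DD_bound : exists2 C : R, 0 < C & forall u w : fn, H1 u -> H1 w ->
  DD (fun x => u x ^+ 2) (fun x => w x ^+ 2) <= C * (ip u u * ip w w).
Proof.
have [C C0 HC] := double_kz g0 g4 gN; exists (c * (C + 1)).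
  by rewrite mulr_gt0// ltr_wpDl.
move=> u w Hu Hw.
have mk := measurable_kfg (measurable_kz g) (FF_meas (FFsq Hu)) (FF_meas (FFsq Hw)).
have I1 : intg pm (fun p => kz g (p.1 - p.2) * (u p.1 ^+ 2 * w p.2 ^+ 2)).
  apply: intg_ge0P => // [p|]; first by rewrite mulr_ge0 ?kz_ge0// mulr_ge0 ?sqr_ge0.
  by apply: le_lt_trans (HC u w Hu Hw) _; rewrite ltry.
have E : DD (fun x => u x ^+ 2) (fun x => w x ^+ 2) =
    c * \int[pm]_p (kz g (p.1 - p.2) * (u p.1 ^+ 2 * w p.2 ^+ 2)).
  rewrite /DD -(IZ _ I1); congr (Rintegral _ _ _).
  by apply/funext => p; rewrite /rk -(mulrA c).
rewrite E -mulrA ler_wpM2l ?(ltW c0)//.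
apply: (@le_trans _ _ (C * (ip u u * ip w w))).
  by rewrite -lee_fin EFin_I//; exact: HC.
by rewrite ler_wpM2r ?lerDl// mulr_ge0 ?(sib_ge0 ip_si).
Qed.

End energy.

(** * Local compactness *)

Section translations.
Context {R : realType} {N : nat}.
Implicit Types (x y z : 'rV[R]_N) (i : 'I_N).
Local Notation mu := (@lebesgue_rV R N).
Local Notation sqint := (sqint mu).
Local Notation dotL := (dotL mu).
Local Notation fn := ('rV[R]_N -> R).
Local Notation nL := (sinorm dotL).

Lemma sinorm_cvg0 (T : Type) (F : set_system T) {FF : Filter F} (a : T -> R) :
  a t @[t --> F] --> (0 : R) -> Num.sqrt (a t) @[t --> F] --> (0 : R).
Proof. by move=> a0; rewrite -sqrtr0; apply: continuous_cvg a0; exact: sqrt_continuous. Qed.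

(* Telescoping over n steps of size h/n, then n -> oo. *)
Lemma shift_le i (u gu : fn) (h : R) : sderiv i u gu ->
  nL ((fun x => u (x + h *: dirv i)) - u) <= `|h| * nL gu.
Proof.
move=> ug; have [lu lg _] := ug; have S := dotL_si mu.
have [->|h0] := eqVneq h 0.
  rewrite normr0 mul0r (_ : _ - u = 0) ?/sinorm ?(sib0l S) ?sqrtr0//; first exact: sqint0.
  by apply/funext => x; rewrite !fctE scale0r addr0 subrr.
pose e n : R := h * n.+1%:R^-1.
have e0 n : e n != 0 by rewrite mulf_neq0// invr_eq0.
have ecvg : e n @[n --> \oo] --> (0 : R).
  by rewrite -[X in _ --> X](mulr0 h); apply: cvgMr; exact: harm_cvg.
pose ush (a : R) : fn := fun x => u (x + a *: dirv i).
have lsh a : sqint (ush a) by exact: sqint_shift.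
have tel n k : nL (ush (e n *+ k) - u) <= (`|e n| * nL (dq i (e n) u)) *+ k.
  elim: k => [|k IH].
    rewrite !mulr0n (_ : _ - u = 0) ?/sinorm ?(sib0l S) ?sqrtr0//; first exact: sqint0.
    by apply/funext => x; rewrite /ush !fctE scale0r addr0 subrr.
  apply: le_trans (sinorm_triangle S (lsh _) (lsh (e n *+ k)) lu) _.
  rewrite [leRHS]mulrSr addrC; apply: lerD => //.
  rewrite -(sinormZ S _ (sqint_dq i (e n) lu)).
  rewrite le_eqVlt; apply/orP; left; apply/eqP; rewrite /sinorm; congr Num.sqrt.
  have -> : ush (e n *+ k.+1) - ush (e n *+ k) = fun x => (e n *: dq i (e n) u) (x + (e n *+ k) *: dirv i).
    apply/funext => x; rewrite !fctE -[(_ *: _) in RHS]/(_ * _) /dq mulrA divff// mul1r /ush.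
    by rewrite -addrA -scalerDl -mulrSr.
  by apply: dotL_shift; apply: sqintZ; exact: sqint_dq.
have bd n : nL ((fun x => u (x + h *: dirv i)) - u) <= `|h| * nL (dq i (e n) u).
  have := tel n n.+1; have -> : e n *+ n.+1 = h.
    by rewrite -[LHS]mulr_natr /e divfK.
  move=> /le_trans; apply; rewrite -[leLHS]mulr_natr mulrAC /e normrM [`|_^-1|]ger0_norm ?divfK//.
have cv : `|h| * (nL (dq i (e n) u - gu) + nL gu) @[n --> \oo] --> `|h| * (0 + nL gu).
  apply: cvgMr; apply: cvgD; last exact: cvg_cst.
  apply: sinorm_cvg0; exact: (sderiv_seq ug e0 ecvg).
rewrite add0r in cv; rewrite -(cvg_lim (@Rhausdorff R) cv).
apply: limr_ge; first by apply/cvg_ex; exists (`|h| * nL gu).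
apply: nearW => n; apply: le_trans (bd n) _; rewrite ler_wpM2l//.
have ld := sqint_dq i (e n) lu.
rewrite -{1}[dq i (e n) u](subrK gu); exact: (sinormD S (siB S ld lg) lg).
Qed.

Lemma shift_le_vec (u : fn) z (b : R) : H1 u -> (forall i, `|z ord0 i| <= b) ->
  nL ((fun x => u (x + z)) - u) <= N%:R * b * Num.sqrt (ip u u).
Proof.
move=> Hu zb; have lu := H1_sqint Hu; have S := dotL_si mu.
pose zs (s : seq 'I_N) : 'rV[R]_N := \sum_(i <- s) z ord0 i *: dirv i.
have zE : zs (enum 'I_N) = z.
  by rewrite /zs big_enum /= -row_sum_delta.
have main s : nL ((fun x => u (x + zs s)) - u) <= (size s)%:R * (b * Num.sqrt (ip u u)).
  elim: s => [|i s IH].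
    rewrite mul0r (_ : _ - u = 0) ?/sinorm ?(sib0l S) ?sqrtr0//; first exact: sqint0.
    by apply/funext => x; rewrite /zs big_nil !fctE addr0 subrr.
  have l1 : sqint (fun x => u (x + zs (i :: s))) by exact: sqint_shift.
  have l2 : sqint (fun x => u (x + zs s)) by exact: sqint_shift.
  apply: le_trans (sinorm_triangle S l1 l2 lu) _.
  rewrite /= -natr1 mulrDl mul1r addrC; apply: lerD => //.
  have -> : (fun x => u (x + zs (i :: s))) - (fun x => u (x + zs s)) =
     fun x => ((fun x => u (x + z ord0 i *: dirv i)) - u) (x + zs s).
    by apply/funext => x; rewrite !fctE /zs big_cons addrAC addrA.
  rewrite {1}/sinorm dotL_shift; try (apply: (siB S) => //; exact: sqint_shift).
  apply: le_trans (shift_le (z ord0 i) (wgrad_sderiv i Hu)) _.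
  apply: ler_pM => //; first exact: sinorm_ge0.
  by rewrite ler_wsqrtr// dotL_wgrad_le.
by have := main (enum 'I_N); rewrite zE -mulrA size_enum_ord.
Qed.

Lemma shift_ge0 (u : fn) z (b : R) : H1 u -> (forall i, `|z ord0 i| <= b) ->
  \int[mu]_x ((u (x + z) - u x) ^+ 2) <= (N%:R * b) ^+ 2 * ip u u.
Proof.
move=> Hu zb; have lu := H1_sqint Hu; have S := dotL_si mu.
have H := shift_le_vec Hu zb.
rewrite -[ip u u]sqr_sqrtr ?(sib_ge0 ip_si)// -exprMn.
have lB : sqint ((fun x => u (x + z)) - u) by apply: (siB S) => //; exact: sqint_shift.
apply: (@le_trans _ _ (nL ((fun x => u (x + z)) - u) ^+ 2)).
  by rewrite (sinorm_sqr S)// dotLff.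
by rewrite lerXn2r ?nnegrE ?sinorm_ge0//; apply: le_trans H; exact: sinorm_ge0.
Qed.

Local Notation pm := (mu \x mu)%E.

Lemma measurable_coords (A : 'I_N -> set R) :
  (forall i, measurable (A i : set (measurableTypeR R))) ->
  measurable [set x : 'rV[R]_N | forall i, A i (x ord0 i)].
Proof.
move=> mA; rewrite (_ : mkset _ = \bigcap_(i in [set: 'I_N])
    ((fun v : 'rV[R]_N => v ord0 i) @^-1` A i)).
  apply: fin_bigcap_measurable => // i _.
  by rewrite -[X in measurable X]setTI; apply: measurable_coord => //; exact: mA.
by apply/seteqP; split=> w /= H i; [move=> _|]; exact: H.
Qed.

(** Half-open cells are disjoint and still cover the open cube of half-side m h; the shift by [m]
    centres the 2 m indices of each direction at the origin. *)
Definition cell (h : R) (m : nat) (j : {ffun 'I_N -> 'I_(m + m)}) : set 'rV[R]_N :=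
  [set x | forall i, ((j i)%:R - m%:R) * h <= x ord0 i < ((j i).+1%:R - m%:R) * h].

Lemma cell_measure (h : R) m j : 0 < h -> measurable (cell h (m := m) j) /\
  mu (cell h j) = (h ^+ N)%:E.
Proof.
move=> h0; pose A i : set R := `[((j i)%:R - m%:R) * h, ((j i).+1%:R - m%:R) * h[%classic.
have E : cell h j = [set x | forall i, A i (x ord0 i)].
  by apply/seteqP; split => x /= H i; have := H i; rewrite /A /= in_itv.
have mA i : measurable (A i : set (measurableTypeR R)) by exact: measurable_itv.
split.
  by rewrite E; exact: measurable_coords.
rewrite E; apply: etrans (lebesgue_rV_box mA) _.
rewrite (eq_bigr (fun=> h%:E)).
  by rewrite prod_fin prodr_const card_ord.
move=> i _; rewrite lebesgue_measure_itv /= lte_fin ltr_pM2r// ltrD2r ltr_nat ltnSn.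
by rewrite -EFinB; congr (_%:E); rewrite -natr1; ring.
Qed.

Lemma cell_cover (h : R) m x : 0 < h -> cube (m%:R * h) x -> exists j, cell h (m := m) j x.
Proof.
move=> h0 /cubeP xr.
have b i : 0 <= x ord0 i / h + m%:R < (m + m)%:R.
  have E : x ord0 i = x ord0 i / h * h by rewrite divfK// gt_eqF.
  have := xr i; rewrite natrD {1}E ltr_norml -mulNr !ltr_pM2r// => /andP[a1 a2].
  by apply/andP; split; lra.
have tb i : (Num.truncn (x ord0 i / h + m%:R) < m + m)%N.
  by have /andP[b1 b2] := b i; rewrite truncn_lt_nat.
exists [ffun i => Ordinal (tb i)] => i; rewrite ffunE /=.
have /andP[b1 b2] := b i; have /andP[t1 t2] := truncn_itv b1.
by rewrite -ler_pdivlMr// -ltr_pdivrMr//; apply/andP; split; lra.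
Qed.

Lemma cell_inj (h : R) m j j' x : 0 < h -> cell h (m := m) j x -> cell h j' x -> j = j'.
Proof.
move=> h0 H H'; apply/ffunP => i; apply/val_inj; have /andP[a b] := H i; have /andP[a' b'] := H' i.
have := le_lt_trans a b'; have := le_lt_trans a' b.
rewrite !ltr_pM2r// !ltrD2r !ltr_nat !ltnS => l1 l2.
by apply/eqP; rewrite eqn_leq l1 l2.
Qed.

Lemma cell_close (h : R) m j x y i : 0 < h -> cell h (m := m) j x -> cell h j y ->
  `|y ord0 i - x ord0 i| <= h.
Proof.
move=> h0 /(_ i) /andP[a b] /(_ i) /andP[a' b'].
move: a b a' b'; rewrite -natr1 => a b a' b'; rewrite ler_norml; apply/andP; split; nra.
Qed.

Lemma sqint_ind (A : set 'rV[R]_N) (q : R) : measurable A -> mu A = q%:E -> sqint (\1_A : fn) /\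
  intg mu (\1_A : fn) /\ \int[mu]_x (\1_A x : R) = q.
Proof.
move=> mA Aq; have m1 : mfun (\1_A : fn) by exact: measurable_indic.
have i1 : intg mu (\1_A : fn).
  apply: intg_ge0P => //; rewrite integral_indic// setIT -[X in (X < _)%E]/(mu A) Aq ltry//.
split; last split=> //.
  apply/sqintP; split=> //; rewrite (_ : (fun x => _) = (\1_A : fn))//.
  by apply/funext => x; rewrite indicE; case: (_ \in _); rewrite ?expr1n ?expr0n.
by rewrite /Rintegral integral_indic// setIT -[X in fine X]/(mu A) Aq.
Qed.

(* A Poincare inequality, with the translation estimate in place of the gradient. *)
Lemma cube_sqr_le (u : fn) (h : R) m : 0 < h -> H1 u ->
  \int[mu]_x (\1_(cube (m%:R * h)) x * u x ^+ 2) <=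
  2 ^+ N * (N%:R * h) ^+ 2 * ip u u +
  \sum_(j : {ffun 'I_N -> 'I_(m + m)}) (dotL u (\1_(cell h j)) ^+ 2 / h ^+ N).
Proof.
move=> h0 Hu; have lu := H1_sqint Hu; have iu := sqint_intg lu.
pose ind j : fn := \1_(cell h (m := m) j).
have mc j : measurable (cell h (m := m) j) by case: (cell_measure j h0).
have mind j : mfun (ind j) by exact: measurable_indic.
have [lind iind] : (forall j, sqint (ind j)) /\ (forall j, intg mu (ind j) /\ \int[mu]_x ind j x = h ^+ N).
  by split=> j; case: (sqint_ind (mc j) (cell_measure j h0).2) => // ? [].
have ind01 j x : 0 <= ind j x <= 1 by rewrite /ind indicE; case: (x \in _); rewrite ?lexx ler01.
have ind2 j x : ind j x * ind j x = ind j x by rewrite /ind indicE; case: (_ \in _); rewrite ?mulr1 ?mulr0.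
have iu2 j : intg mu (fun x => ind j x * u x ^+ 2).
  by apply: (intg_bdM (M := 1)) => // x; have /andP[? ?] := ind01 j x; rewrite ger0_norm.
have iu1 j : intg mu (fun x => ind j x * u x) by exact: sqintM.
pose A j := \int[mu]_x (ind j x * u x ^+ 2); pose B j := dotL u (ind j).
have BE j : \int[mu]_x (ind j x * u x) = B j.
  by rewrite /B; congr (Rintegral _ _ _); apply/funext => x; rewrite mulrC.
have hN0 : 0 < h ^+ N by rewrite exprn_gt0.
have step1 : \int[mu]_x (\1_(cube (m%:R * h)) x * u x ^+ 2) <= \sum_j A j.
  rewrite -Isum//; apply: I_le => [||x].
  - apply: (intg_bdM (M := 1)) => //; first by apply: measurable_indic; exact: measurable_box.
    by move=> x; rewrite indicE ger0_norm; case: (_ \in _).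
  - exact: intg_sum.
  - have t0 j : 0 <= ind j x * u x ^+ 2 by have /andP[? _] := ind01 j x; rewrite mulr_ge0 ?sqr_ge0.
    have [xc|nxc] := pselect (cube (m%:R * h) x); last first.
      by rewrite indicE (memNset nxc) mul0r sumr_ge0.
    have [j jx] := cell_cover h0 xc; rewrite (bigD1 j)//= /ind !indicE (mem_set xc) (mem_set jx).
    by rewrite lerDl sumr_ge0// => k _; exact: t0.
(* The variance identity: the double integral of (u(y) - u(x))^2 over a cell of volume h^N is 2 h^N
   times the integral of u^2 minus twice the square of the integral of u. *)
pose G j (p : 'rV[R]_N * 'rV[R]_N) := ind j p.1 * ind j p.2 * (u p.2 - u p.1) ^+ 2.
have GE j : intg pm (G j) /\ \int[pm]_p G j p = 2 * h ^+ N * A j - 2 * B j ^+ 2.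
  have [i0 i0E] := iind j.
  have I1 := intg_prod (iu2 j) i0; have I2 := intg_prod (iu1 j) (iu1 j); have I3 := intg_prod i0 (iu2 j).
  have E : G j = fun p => ((ind j p.1 * u p.1 ^+ 2) * ind j p.2 + ind j p.1 * (ind j p.2 * u p.2 ^+ 2))
      - 2 * ((ind j p.1 * u p.1) * (ind j p.2 * u p.2)).
    by apply/funext => p; rewrite /G; ring.
  have tr (f k : fn) : intg mu f -> intg mu k ->
      \int[pm]_p (f p.1 * k p.2) = (\int[mu]_x f x) * \int[mu]_x k x.
    by move=> If Ik; rewrite /Rintegral I_prod.
  rewrite E; split; first by apply: intgB; [exact: intgD|exact: intgZ].
  rewrite (IB (intgD I1 I3) (intgZ 2 I2)) (ID I1 I3) (IZ 2 I2).
  rewrite (tr _ _ (iu2 j) i0) (tr _ _ i0 (iu2 j)) (tr _ _ (iu1 j) (iu1 j)) BE i0E -/(A j); ring.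
have S1 : \sum_j (2 * h ^+ N * A j - 2 * B j ^+ 2) <= (2 * h) ^+ N * ((N%:R * h) ^+ 2 * ip u u).
  rewrite -(eq_bigr _ (fun j _ => (GE j).2)) -Isum; last by move=> j; case: (GE j).
  have iS : intg pm (fun p => \sum_j G j p) by apply: intg_sum => j; case: (GE j).
  pose bx : set 'rV[R]_N := [set z | forall i, `[- h, h]%classic (z ord0 i)].
  have mI i : measurable (`[- h, h]%classic : set (measurableTypeR R)) by exact: measurable_itv.
  have mbx : measurable bx.
    exact: (measurable_coords (A := fun=> `[- h, h]%classic)).
  have mubx : mu bx = ((2 * h) ^+ N)%:E.
    apply: etrans (lebesgue_rV_box mI) _; rewrite (eq_bigr (fun=> (2 * h)%:E)).
      by rewrite prod_fin prodr_const card_ord.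
    move=> i _; rewrite lebesgue_measure_itv /= lte_fin (_ : (- h < h) = true); last lra.
    by rewrite -EFinB; congr (_%:E); ring.
  have [_ [ibx ibxE]] := sqint_ind mbx mubx.
  (* Two points of one cell differ by a vector of [-h, h]^N, and the cells are disjoint. The sum of
     all variances is thus bounded by an average of translation errors over a set of measure (2
     h)^N. *)
  have Gle p : \sum_j G j p <= \1_bx (p.2 - p.1) * (u p.2 - u p.1) ^+ 2.
    have q0 := sqr_ge0 (u p.2 - u p.1).
    have r0 : 0 <= \1_bx (p.2 - p.1) * (u p.2 - u p.1) ^+ 2 by rewrite mulr_ge0.
    have [[j jx]|no] := pselect (exists j, cell h (m := m) j p.1); last first.
      rewrite big1// => j _; rewrite /G /ind indicE memNset ?mul0r// => jx; apply: no; by exists j.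
    rewrite (bigD1 j)//= big1 ?addr0; last first.
      move=> k kj; rewrite /G /ind indicE memNset ?mul0r// => kx.
      by move/eqP: kj; apply; exact: (cell_inj h0 kx jx).
    rewrite /G /ind !indicE (mem_set jx) mul1r.
    have [jy|njy] := pselect (cell h j p.2); last by rewrite (memNset njy) !mul0r.
    rewrite (mem_set jy) mem_set// => i /=; rewrite in_itv /= -ler_norml !mxE.
    exact: cell_close h0 jx jy.
  pose Wf (p : 'rV[R]_N * 'rV[R]_N) := \1_bx (p.2 - p.1) * (u p.2 - u p.1) ^+ 2.
  have m21 : mfun (fun p : 'rV[R]_N * 'rV[R]_N => p.2 - p.1).
    rewrite (_ : (fun p => _) = (fun p : 'rV[R]_N * 'rV[R]_N => - (p.1 - p.2))).
      exact: measurableT_comp measurable_reflect measurable_sub2.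
    by apply/funext => p; rewrite opprB.
  have mib : mfun (\1_bx : fn) by exact: measurable_indic.
  have mu1 : mfun (fun p : 'rV[R]_N * 'rV[R]_N => u p.1).
    exact: measurableT_comp (H1_meas Hu) measurable_fst.
  have mu2 : mfun (fun p : 'rV[R]_N * 'rV[R]_N => u p.2).
    exact: measurableT_comp (H1_meas Hu) measurable_snd.
  have mW : mfun Wf.
    apply: measurable_funM; first exact: (measurableT_comp mib m21).
    by apply: measurable_funX; exact: measurable_funB mu2 mu1.
  pose W2 (p : 'rV[R]_N * 'rV[R]_N) := \1_bx p.2 * (u (p.2 + p.1) - u p.1) ^+ 2.
  have mW2 : mfun W2.
    apply: measurable_funM; first exact: (measurableT_comp mib measurable_snd).
    apply: measurable_funX; apply: measurable_funB => //.
    apply: (measurableT_comp (H1_meas Hu)).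
    apply: measurable_fun_rV => i; under eq_fun do rewrite mxE.
    by apply: measurable_funD; [exact: measurableT_comp (measurable_coord i) measurable_snd|
      exact: measurableT_comp (measurable_coord i) measurable_fst].
  rewrite -lee_fin EFin_I//; apply: (@le_trans _ _ (\int[pm]_p (Wf p)%:E)%E).
    apply: ge0_le_integral_EFin => //; first exact: intg_meas iS.
    move=> p; apply: sumr_ge0 => j _; rewrite mulr_ge0 ?sqr_ge0//.
    by have /andP[? _] := ind01 j p.1; have /andP[? _] := ind01 j p.2; rewrite mulr_ge0.
  rewrite fubini_tonelli1; last 2 first.
  - exact/measurable_EFinP.
  - by move=> p; rewrite lee_fin mulr_ge0 ?sqr_ge0.
  have -> : (\int[mu]_x fubini_F mu (fun p => (Wf p)%:E) x =
      \int[mu]_x \int[mu]_y (W2 (x, y))%:E)%E.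
    apply: eq_integral => x _; rewrite /fubini_F.
    have mx : mfun (fun y => (Wf (x, y))%:E).
      by apply/measurable_EFinP; exact: measurableT_comp mW (measurable_pair1 x).
    rewrite -(@mp_ge0_integral _ _ _ mu (fun y => y + x) _ _ (fun y => (Wf (x, y))%:E))//.
    - by apply: eq_integral => y _; rewrite /Wf /W2 /= addrK.
    - exact: measurable_shift.
    - by move=> ? ?; exact: shift_measure.
    - by move=> y; rewrite lee_fin mulr_ge0 ?sqr_ge0.
  rewrite (fubini_tonelli (m1 := mu) (m2 := mu) (fun p => (W2 p)%:E)); last 2 first.
  - exact/measurable_EFinP.
  - by move=> p; rewrite lee_fin mulr_ge0 ?sqr_ge0.
  apply: (@le_trans _ _ (\int[mu]_y (((N%:R * h) ^+ 2 * ip u u) * \1_bx y)%:E)%E); last first.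
    have cc0 : 0 <= (N%:R * h) ^+ 2 * ip u u by rewrite mulr_ge0 ?sqr_ge0// (sib_ge0 ip_si).
    have i0 (y : 'rV[R]_N) : 0 <= (\1_bx y : R) by rewrite indicE.
    by rewrite (ge0_integralZ_EFin mu mib i0 cc0) -(EFin_I ibx) ibxE -EFinM mulrC.
  apply: ge0_le_integral => //.
  - by move=> y _; apply: integral_ge0 => x _; rewrite lee_fin mulr_ge0 ?sqr_ge0.
  - have := measurable_fun_fubini_tonelli_G (m1 := mu) (fun p => (W2 p)%:E).
    by apply; [exact/measurable_EFinP|move=> p; rewrite lee_fin mulr_ge0 ?sqr_ge0].
  - by apply/measurable_EFinP; apply: measurable_funM => //; exact: measurable_indic.
  - move=> y _; rewrite indicE /W2 /=.
    have [yb|nyb] := pselect (bx y); last first.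
      rewrite (memNset nyb) mulr0 integral0_eq// => x _.
      by rewrite indicE (memNset nyb) mul0r.
    rewrite (mem_set yb) mulr1; have yb' i : `|y ord0 i| <= h.
      by have := yb i; rewrite /= in_itv /= ler_norml.
    have lB : intg mu (fun x => (u (x + y) - u x) ^+ 2).
      by apply: sqint_intg; apply: (siB (dotL_si mu)) => //; exact: sqint_shift.
    rewrite (_ : (fun x => _) = fun x => ((u (x + y) - u x) ^+ 2)%:E); last first.
      by apply/funext => x; rewrite indicE (mem_set yb) mul1r (addrC y).
    by rewrite -EFin_I// lee_fin; exact: shift_ge0.
apply: le_trans step1 _.
have -> : \sum_j A j = (2 * h ^+ N)^-1 * \sum_j (2 * h ^+ N * A j - 2 * B j ^+ 2) +
    \sum_(j : {ffun 'I_N -> 'I_(m + m)}) (B j ^+ 2 / h ^+ N).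
  rewrite mulr_sumr -big_split /=; apply: eq_bigr => j _; field; rewrite gt_eqF//.
apply: lerD => //; rewrite mulrC ler_pdivrMr ?mulr_gt0//.
apply: le_trans S1 _; rewrite exprMn.
have X0 : 0 <= (N%:R * h) ^+ 2 * ip u u by rewrite mulr_ge0 ?sqr_ge0// (sib_ge0 ip_si).
have -> : 2 ^+ N * (N%:R * h) ^+ 2 * ip u u * (2 * h ^+ N) =
  2 * (2 ^+ N * h ^+ N * ((N%:R * h) ^+ 2 * ip u u)) by ring.
rewrite ler_peMl ?ler1n// mulr_ge0// mulr_ge0 ?exprn_ge0// ltW//.
Qed.

(** For a small cell size the first term of [cube_sqr_le] is small uniformly in t; what remains is a
    finite sum of squared means, each of which tends to 0 by weak convergence. *)
Lemma rellich (T : Type) (F : set_system T) {PF : Filter F} (u : T -> fn) (M r : R) :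
  (forall t, H1 (u t)) -> (forall t, ip (u t) (u t) <= M) -> 0 < r ->
  (forall w, sqint w -> dotL (u t) w @[t --> F] --> (0 : R)) ->
  \int[mu]_x (\1_(cube r) x * u t x ^+ 2) @[t --> F] --> (0 : R).
Proof.
move=> Hu uM r0 cu; apply/cvgrPdist_le => e e0.
have h1 : exists m : nat, (0 < m)%N /\ 2 ^+ N * (N%:R * (r / m%:R)) ^+ 2 * M <= e / 2.
  pose K := 2 ^+ N * (N%:R * r) ^+ 2 * `|M| / (e / 2).
  have a0 : 0 <= 2 ^+ N * (N%:R * r) ^+ 2 * `|M|.
    by apply: mulr_ge0 => //; apply: mulr_ge0; [exact: exprn_ge0|exact: sqr_ge0].
  have e20 : 0 < e / 2 by rewrite divr_gt0.
  pose m := (Num.truncn K).+1; exists m; split=> //.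
  have Km : K <= m%:R by exact: ltW (truncnS_gt _).
  have m1 : 1 <= m%:R :> R by rewrite ler1n.
  have m0 : 0 < m%:R :> R by rewrite ltr0n.
  apply: (@le_trans _ _ (2 ^+ N * (N%:R * r) ^+ 2 * `|M| / m%:R)); last first.
    by rewrite ler_pdivrMr// [leRHS]mulrC -ler_pdivrMr.
  have -> : 2 ^+ N * (N%:R * (r / m%:R)) ^+ 2 * M = (2 ^+ N * (N%:R * r) ^+ 2 * M) / m%:R / m%:R.
    by field; rewrite gt_eqF.
  apply: (@le_trans _ _ ((2 ^+ N * (N%:R * r) ^+ 2 * `|M|) / m%:R / m%:R)).
    do 2 (apply: ler_wpM2r; first by rewrite invr_ge0 ltW).
    by apply: ler_wpM2l; [apply: mulr_ge0; [exact: exprn_ge0|exact: sqr_ge0]|exact: ler_norm].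
  rewrite ler_pdivrMr// ler_peMr//.
  by rewrite divr_ge0 ?(ltW m0).
have [m [m0 hm]] := h1; set h := r / m%:R in hm.
have m0R : 0 < m%:R :> R by rewrite ltr0n.
have h0 : 0 < h by rewrite divr_gt0.
have rE : m%:R * h = r by rewrite /h mulrC divfK// gt_eqF.
pose S t := \sum_(j : {ffun 'I_N -> 'I_(m + m)}) (dotL (u t) (\1_(cell h j)) ^+ 2 / h ^+ N).
have cS : S t @[t --> F] --> (0 : R).
  rewrite -[X in _ --> X](big1 (idx := 0) (op := +%R)
    (index_enum {ffun 'I_N -> 'I_(m + m)}) xpredT (fun=> 0))//.
  apply: cvg_big; [exact: add_continuous|move=> j _].
  have lj : sqint (\1_(cell h j) : fn).
    by case: (cell_measure j h0) => a b; case: (sqint_ind a b).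
  have cj := cu _ lj; rewrite -(mul0r (h ^+ N)^-1) -(mul0r 0); apply: cvgMl.
  by under eq_fun do rewrite expr2; exact: cvgM.
have HH : \forall t \near F, `|S t| <= e / 2.
  by apply: (cvgr0_norm_le S cS); rewrite divr_gt0.
apply: filterS HH => t HS; rewrite sub0r normrN ger0_norm; last first.
  by apply: I_ge0 => x; rewrite mulr_ge0 ?sqr_ge0// indicE.
have := cube_sqr_le m h0 (Hu t); rewrite rE -/(S t) => H; apply: le_trans H _.
have : 2 ^+ N * (N%:R * h) ^+ 2 * ip (u t) (u t) <= 2 ^+ N * (N%:R * h) ^+ 2 * M.
  by rewrite ler_wpM2l// mulr_ge0 ?sqr_ge0// exprn_ge0.
have := ler_norm (S t); lra.
Qed.

End translations.

(** * Riesz energy along weakly convergent families *)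

Section compactness.
Context {R : realType} {N : nat}.
Implicit Types (x y z : 'rV[R]_N) (i : 'I_N).
Local Notation mu := (@lebesgue_rV R N).
Local Notation sqint := (sqint mu).
Local Notation dotL := (dotL mu).
Local Notation fn := ('rV[R]_N -> R).
Local Notation pt := ('rV[R]_N * 'rV[R]_N)%type.
Local Notation pm := (mu \x mu)%E.

Lemma powRN_le (a b s : R) : 0 < a -> a <= b -> 0 <= s -> b `^ (- s) <= a `^ (- s).
Proof.
move=> a0 ab s0; have b0 := lt_le_trans a0 ab.
rewrite !powRN lef_pV2 ?posrE ?powR_gt0//.
by apply: ge0_ler_powR => //; rewrite nnegrE ltW.
Qed.

(** Near the origin |z|^-g is small compared with the more singular |z|^-g'; far away it is itself
    small; in between it is bounded, on a bounded set. *)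
Lemma kz_split (g g' e : R) : 0 < g -> g < g' -> 0 < e -> exists A r : R,
  [/\ 0 <= A, 0 < r & forall z : 'rV[R]_N,
    kz g z <= e * kz g' z + e + A * \1_(cube r) z].
Proof.
move=> g0 gg' e0; pose s := (g' - g) / 2; have s0 : 0 < s by rewrite divr_gt0// subr_gt0.
have g20 : 0 < g / 2 by rewrite divr_gt0.
(* The two radii, for |z|^2, at which the small parts equal [e]: d^s = e and r0^(-g/2) = e. As z_i^2
   <= |z|^2 < r0 implies |z_i| < r0 + 1, the intermediate shell lies in the cube of half-side r0 +
   1. *)
pose d := e `^ (s^-1); have d0 : 0 < d by rewrite powR_gt0.
pose r0 := e `^ (- (g / 2)^-1); have r00 : 0 < r0 by rewrite powR_gt0.
exists (d `^ (- (g / 2))), (r0 + 1); split; rewrite ?powR_ge0 ?addr_gt0// => z.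
have k0 : 0 <= e * kz g' z by rewrite mulr_ge0 ?kz_ge0// ltW.
have e0' := ltW e0.
have A0 : 0 <= d `^ (- (g / 2)) * \1_(cube (r0 + 1)) z by rewrite mulr_ge0 ?powR_ge0.
have [q0|q0] := eqVneq (sqn z) 0.
  rewrite {1}/kz q0 powR0 ?oppr_eq0 ?gt_eqF//.
  by rewrite addr_ge0// addr_ge0.
have {}q0 : 0 < sqn z by rewrite lt_neqAle eq_sym q0 sqn_ge0.
have [qd|qd] := leP (sqn z) d.
  apply: (@le_trans _ _ (e * kz g' z)); last by rewrite -addrA lerDl addr_ge0.
  have -> : kz g z = sqn z `^ s * kz g' z.
    by rewrite /kz -powRD ?(gt_eqF q0) ?implybT//; congr (_ `^ _); rewrite /s; ring.
  rewrite ler_wpM2r ?kz_ge0//; apply: (@le_trans _ _ (d `^ s)).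
    by apply: ge0_ler_powR => //; rewrite ?nnegrE ltW.
  by rewrite /d -powRrM mulVf ?gt_eqF// powRr1// ltW.
have [qr|qr] := leP r0 (sqn z).
  apply: (@le_trans _ _ e); last by rewrite addrAC lerDr addr_ge0.
  apply: le_trans (powRN_le r00 qr (ltW g20)) _.
  by rewrite /r0 -powRrM mulrNN mulVf ?gt_eqF// powRr1// ltW.
rewrite indicE mem_set ?mulr1.
  apply: (@le_trans _ _ (d `^ (- (g / 2)))); last by rewrite lerDr addr_ge0.
  exact: powRN_le d0 (ltW qd) (ltW g20).
apply/cubeP => i; have := sqn_coord z i; rewrite -(real_normK (num_real (z ord0 i))).
move=> H; have {}H := le_lt_trans H qr; rewrite ltNge; apply/negP => H2.
have := normr_ge0 (z ord0 i); move: `|_| H H2 => a; nra.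
Qed.

Variables (g c : R).
Hypotheses (N0 : (0 < N)%N) (g0 : 0 < g) (g4 : g < 4) (gN : g < N%:R) (c0 : 0 < c).
Local Notation DD := (DD g c).
Let SD := DD_si N0 g0 g4 gN c0.
Let SH := @ip_si R N.
Let SL := @dotL_si _ _ _ mu.

Definition Jc (r : R) (u w : fn) : R :=
  \int[pm]_p (\1_(cube r) (p.1 - p.2) * (u p.1 ^+ 2 * w p.2 ^+ 2)).

Lemma measurable_cube (r : R) : measurable (cube r : set 'rV[R]_N).
Proof. exact: measurable_box. Qed.

Lemma ind_itv (A : set 'rV[R]_N) x : 0 <= (\1_A x : R) <= 1.
Proof. by rewrite indicE; case: (x \in A); rewrite ?lexx ler01. Qed.

Lemma ind_abs (A : set 'rV[R]_N) x : `|\1_A x : R| <= 1.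
Proof. by have /andP[? ?] := ind_itv A x; rewrite ger0_norm. Qed.

Lemma measurable_ind_sub (r : R) :
  mfun (fun p : pt => \1_(cube r) (p.1 - p.2) : R).
Proof.
have m1 : mfun (\1_(cube r) : fn) by apply: measurable_indic; exact: measurable_cube.
exact: measurableT_comp m1 measurable_sub2.
Qed.

Lemma intg_Jc (r : R) (u w : fn) : H1 u -> H1 w ->
  intg pm (fun p => \1_(cube r) (p.1 - p.2) * (u p.1 ^+ 2 * w p.2 ^+ 2)).
Proof.
move=> Hu Hw; have I1 := intg_prod (FF_intg (FFsq Hu)) (FF_intg (FFsq Hw)).
apply: (@intg_le _ _ _ pm _ (fun p => u p.1 ^+ 2 * w p.2 ^+ 2)) => //.
- by apply: measurable_funM; [exact: measurable_ind_sub|exact: intg_meas I1].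
- move=> p; have p0 : 0 <= u p.1 ^+ 2 * w p.2 ^+ 2 by rewrite mulr_ge0 ?sqr_ge0.
  by rewrite normrM (ger0_norm p0) ler_piMl// ind_abs.
Qed.

(** There is room for an exponent g' strictly between g and min(4, N), for which the energy is still
    bounded on H^1; [kz_split] then confines the energy, up to [e], to pairs of points at bounded
    distance. *)
Lemma DD_split (e : R) : 0 < e -> exists B r : R, [/\ 0 <= B, 0 < r &
  forall u w : fn, H1 u -> H1 w ->
  DD (fun x => u x ^+ 2) (fun x => w x ^+ 2) <= e * (ip u u * ip w w) + B * Jc r u w].
Proof.
move=> e0; pose g' := (g + Num.min 4 N%:R) / 2.
have gm : g < Num.min 4 N%:R by rewrite lt_min g4 gN.
have [m4 mN] : Num.min 4 N%:R <= (4 : R) /\ Num.min 4 N%:R <= (N%:R : R).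
  by rewrite !ge_min !lexx orbT.
have gg' : g < g' by rewrite /g'; lra.
have g'4 : g' < 4 by rewrite /g'; lra.
have g'N : g' < N%:R by rewrite /g'; lra.
have g'0 : 0 < g' := lt_trans g0 gg'.
have [C C0 HC] := DD_bound g'0 g'4 g'N c0.
pose e1 := e / (C + c); have e10 : 0 < e1 by rewrite divr_gt0// addr_gt0.
have [A [r [A0 r0 HA]]] := kz_split g0 gg' e10.
exists (c * A), r; split=> //; first by rewrite mulr_ge0// ltW.
move=> u w Hu Hw; have I1 := intg_prod (FF_intg (FFsq Hu)) (FF_intg (FFsq Hw)).
have iD := intg_DD g0 g4 gN c0 (FFsq Hu) (FFsq Hw).
have iD' := intg_DD g'0 g'4 g'N c0 (FFsq Hu) (FFsq Hw).
have iJ := intg_Jc r Hu Hw.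
apply: (@le_trans _ _ (\int[pm]_p (e1 * (rk g' c (p.1 - p.2) * (u p.1 ^+ 2 * w p.2 ^+ 2)) +
   (c * e1) * (u p.1 ^+ 2 * w p.2 ^+ 2) +
   (c * A) * (\1_(cube r) (p.1 - p.2) * (u p.1 ^+ 2 * w p.2 ^+ 2))))).
  apply: I_le => // [|p].
    by apply: intgD; [apply: intgD; exact: intgZ|exact: intgZ].
  have p0 : 0 <= u p.1 ^+ 2 * w p.2 ^+ 2 by rewrite mulr_ge0 ?sqr_ge0.
  move: p0; move: (u p.1 ^+ 2 * w p.2 ^+ 2) => X X0; rewrite /rk.
  have := ler_wpM2r X0 (ler_wpM2l (ltW c0) (HA (p.1 - p.2))); lra.
rewrite (ID (intgD (intgZ e1 iD') (intgZ (c * e1) I1)) (intgZ (c * A) iJ)).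
rewrite (ID (intgZ e1 iD') (intgZ (c * e1) I1)) (IZ _ iD') (IZ _ I1) (IZ _ iJ) lerD2r.
have H1' : \int[pm]_p (rk g' c (p.1 - p.2) * (u p.1 ^+ 2 * w p.2 ^+ 2)) <= C * (ip u u * ip w w) := HC u w Hu Hw.
have H2 : \int[pm]_p (u p.1 ^+ 2 * w p.2 ^+ 2) <= ip u u * ip w w.
  rewrite /Rintegral (I_prod (FF_intg (FFsq Hu)) (FF_intg (FFsq Hw))) /=.
  rewrite -!dotLff; apply: ler_pM; rewrite ?dotL_ip_le//; apply: (sib_ge0 SL); exact: H1_sqint.
have E : e * (ip u u * ip w w) = e1 * (C * (ip u u * ip w w)) + c * e1 * (ip u u * ip w w).
  by rewrite /e1; field; rewrite gt_eqF// addr_gt0.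
rewrite E; apply: lerD; first by rewrite ler_wpM2l// ltW.
by rewrite ler_wpM2l// mulr_ge0// ltW.
Qed.

Lemma tail_small (w : fn) (e : R) : sqint w -> 0 < e ->
  exists2 r : R, 0 < r & \int[mu]_x (\1_(~` cube r) x * w x ^+ 2) <= e.
Proof.
move=> lw e0; have m1 n : mfun (\1_(cube n.+1%:R) : fn).
  by apply: measurable_indic; exact: measurable_cube.
have law : sqint (fun x => `|w x|).
  by apply: (sqint_le _ lw) => [|x]; [apply: measurableT_comp => //; exact: sqint_meas lw|rewrite normr_id].
have [l1 cv] : (forall n, sqint ((fun x => \1_(cube n.+1%:R) x * w x) - w)) /\
   dotL ((fun x => \1_(cube n.+1%:R) x * w x) - w) ((fun x => \1_(cube n.+1%:R) x * w x) - w)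
     @[n --> \oo] --> (0 : R).
  apply: (L2_dct (g := fun x => `|w x|)) => //.
  - by move=> n; apply: measurable_funM => //; exact: sqint_meas lw.
  - exact: sqint_meas lw.
  - by move=> n x; rewrite normrM ler_piMl// ind_abs.
  - apply: aeW => x; apply: cvg_near_cst; exists (Num.truncn `|x|).+1 => // n /= Hn.
    rewrite indicE mem_set ?mul1r//; apply/cubeP => i.
    apply: le_lt_trans (rV_norm_coord x i) _; apply: lt_le_trans (truncnS_gt _) _.
    by rewrite ler_nat; exact: leqW.
have HH : \forall n \near \oo, `|dotL ((fun x => \1_(cube n.+1%:R) x * w x) - w)
   ((fun x => \1_(cube n.+1%:R) x * w x) - w)| <= e by exact: (cvgr0_norm_le _ cv _ e0).
have [n _ Hn] := HH; exists n.+1%:R => //.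
apply: le_trans (le_trans (ler_norm _) (Hn n (leqnn n))).
rewrite le_eqVlt; apply/orP; left; apply/eqP; congr (Rintegral _ _ _); apply/funext => x.
rewrite !fctE !indicE in_setC; case: (x \in cube _) => /=; ring.
Qed.

(** Since w^2 has small tails and only pairs at bounded distance matter, only the mass of u^2 in a
    fixed cube contributes substantially. Combined with [rellich], it makes interactions with weakly
    null families vanish. *)
Lemma DD_local (w : fn) (e : R) : H1 w -> 0 < e -> exists B r : R, [/\ 0 <= B, 0 < r &
  forall u : fn, H1 u -> DD (fun x => w x ^+ 2) (fun x => u x ^+ 2) <=
    e * ip u u + B * \int[mu]_x (\1_(cube r) x * u x ^+ 2)].
Proof.
move=> Hw e0; have lw := H1_sqint Hw; have iw0 : 0 <= ip w w by exact: (sib_ge0 SH).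
pose e1 := e / 2 / (ip w w + 1); have e10 : 0 < e1 by rewrite !divr_gt0// ltr_wpDl.
have [B [r [B0 r0 H]]] := DD_split e10.
pose e2 := e / 2 / (B + 1); have e20 : 0 < e2 by rewrite !divr_gt0// ltr_wpDl.
have [s s0 Hs] := tail_small lw e20.
exists (B * dotL w w), (s + r); split; rewrite ?addr_gt0 ?mulr_ge0 ?(sib_ge0 SL)// => u Hu.
have lu := H1_sqint Hu; have iu0 : 0 <= ip u u by exact: (sib_ge0 SH).
apply: le_trans (H w u Hw Hu) _.
have mc (a : R) : mfun (\1_(cube a) : fn).
  by apply: measurable_indic; exact: measurable_cube.
have mcC (a : R) : mfun (\1_(~` cube a) : fn).
  by apply: measurable_indic; apply: measurableC; exact: measurable_cube.
have i1 : intg mu (fun x => \1_(~` cube s) x * w x ^+ 2).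
  exact: (intg_bdM (mcC s) (fun x => ind_abs _ x) (sqint_intg lw)).
have i2 : intg mu (fun x => \1_(cube (s + r)) x * u x ^+ 2).
  exact: (intg_bdM (mc (s + r)) (fun x => ind_abs _ x) (sqint_intg lu)).
have iw := sqint_intg lw; have iu := sqint_intg lu.
have I1 := intg_prod i1 iu; have I2 := intg_prod iw i2.
set X := \int[mu]_x (\1_(cube (s + r)) x * u x ^+ 2).
have tr (f k : fn) : intg mu f -> intg mu k ->
    \int[pm]_p (f p.1 * k p.2) = (\int[mu]_x f x) * \int[mu]_x k x.
  by move=> If Ik; rewrite /Rintegral I_prod.
have J1 : Jc r w u <= (\int[mu]_x (\1_(~` cube s) x * w x ^+ 2)) * dotL u u + dotL w w * X.
  rewrite !dotLff -(tr _ _ i1 iu) -(tr _ _ iw i2) -(ID I1 I2).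
  apply: I_le; [exact: intg_Jc|exact: intgD|move=> p].
  have w0 := sqr_ge0 (w p.1); have u0 := sqr_ge0 (u p.2).
  have -> : \1_(~` cube s) p.1 * w p.1 ^+ 2 * u p.2 ^+ 2 + w p.1 ^+ 2 * (\1_(cube (s + r)) p.2 * u p.2 ^+ 2) =
    (\1_(~` cube s) p.1 + \1_(cube (s + r)) p.2) * (w p.1 ^+ 2 * u p.2 ^+ 2) by ring.
  apply: ler_wpM2r; first exact: mulr_ge0.
  rewrite !indicE in_setC.
  have [c1|c1] := pselect (cube s p.1); last first.
    by rewrite (memNset c1) /=; case: (_ \in cube r); case: (_ \in cube _); rewrite ?addr0 ?addr_ge0 ?lerDl.
  have [c2|c2] := pselect (cube r (p.1 - p.2)); last by rewrite (memNset c2) addr_ge0.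
  rewrite (mem_set c1) (mem_set c2) mem_set ?add0r//.
  apply/cubeP => i; move/cubeP: c1 => /(_ i) c1; move/cubeP: c2 => /(_ i); rewrite !mxE => c2.
  have -> : p.2 ord0 i = p.1 ord0 i - (p.1 ord0 i - p.2 ord0 i) by ring.
  by apply: le_lt_trans (ler_normB _ _) _; exact: ltrD.
have J2 := ler_wpM2l B0 J1.
have u1 : dotL u u <= ip u u by exact: dotL_ip_le.
have u00 : 0 <= dotL u u by exact: (sib_ge0 SL).
have E1 : e1 * (ip w w * ip u u) <= e / 2 * ip u u.
  rewrite mulrA ler_wpM2r// /e1 -mulrA ler_piMr ?divr_ge0 ?(ltW e0)//.
  by rewrite mulrC ler_pdivrMr ?mul1r ?lerDl// ltr_wpDl.
have E2 : B * (\int[mu]_x (\1_(~` cube s) x * w x ^+ 2) * dotL u u) <= e / 2 * ip u u.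
  apply: (@le_trans _ _ (B * (e2 * ip u u))).
    rewrite ler_wpM2l// ler_pM//; apply: I_ge0 => x.
    by rewrite mulr_ge0 ?sqr_ge0//; case/andP: (ind_itv (~` cube s) x).
  rewrite mulrA ler_wpM2r// /e2 mulrCA ler_piMr ?divr_ge0 ?(ltW e0)//.
  by rewrite ler_pdivrMr ?mul1r ?lerDl// ltr_wpDl.
move: J2; rewrite mulrDr => J2; rewrite -(mulrA B); lra.
Qed.

(** Lions' vanishing lemma for the Riesz energy: if no translated cube carries more than [s] of the
    mass of u^2, the part of the energy at bounded distance is at most [s] times the total mass. *)
Lemma DD_nonvanish (e : R) : 0 < e -> exists B r : R, [/\ 0 <= B, 0 < r &
  forall (u : fn) (s : R), H1 u ->
  (forall y, \int[mu]_x (\1_(cube r) (x - y) * u x ^+ 2) <= s) ->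
  DD (fun x => u x ^+ 2) (fun x => u x ^+ 2) <= e * ip u u ^+ 2 + B * s * ip u u].
Proof.
move=> e0; have [B [r [B0 r0 H]]] := DD_split e0; exists B, r; split=> // u s Hu us.
apply: le_trans (H u u Hu Hu) _; rewrite -expr2 lerD2l -mulrA ler_wpM2l//.
have iu := sqint_intg (H1_sqint Hu).
have m1 : mfun (\1_(cube r) : fn) by apply: measurable_indic; exact: measurable_cube.
rewrite -lee_fin /Jc EFin_I; last exact: intg_Jc.
apply: le_trans (tonelli_col (k := \1_(cube r)) (w := fun x => u x ^+ 2) (r := fun x => u x ^+ 2) m1 _ _ _ _ iu _ us) _.
- by move=> z; case/andP: (ind_itv (cube r) z).
- exact: intg_meas iu.
- by move=> x; exact: sqr_ge0.
- by move=> x; exact: sqr_ge0.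
- move=> y; apply: (intg_bdM (M := 1)) => //; last by move=> x; exact: ind_abs.
  exact: measurableT_comp m1 (measurable_shift (- y)).
- rewrite lee_fin -dotLff; apply: ler_wpM2l; last exact: dotL_ip_le.
  by apply: le_trans (us 0); apply: I_ge0 => x; rewrite mulr_ge0 ?sqr_ge0.
Qed.

Definition wcvg (T : Type) (F : set_system T) (u : T -> fn) (u0 : fn) :=
  forall w, H1 w -> ip (u t) w @[t --> F] --> ip u0 w.

Section weak.
Variables (T : Type) (F : set_system T).
Hypothesis PF : ProperFilter F.

Lemma wcvgB (u : T -> fn) (u0 : fn) : (forall t, H1 (u t)) -> H1 u0 -> wcvg F u u0 ->
  wcvg F (fun t => u t - u0) 0.
Proof.
move=> Hu Hu0 cu w Hw; rewrite (sib0l SH Hw) -(subrr (ip u0 w)).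
rewrite (_ : (fun t => _) = fun t => ip (u t) w - ip u0 w).
  by apply: cvgB; [exact: cu|exact: cvg_cst].
by apply/funext => t; rewrite (sibBl SH).
Qed.

Lemma weak_DD0 (u : T -> fn) (M : R) (f : fn) : (forall t, H1 (u t)) ->
  (forall t, ip (u t) (u t) <= M) -> wcvg F u 0 -> FF f ->
  DD f (fun x => u t x ^+ 2) @[t --> F] --> (0 : R).
Proof.
move=> Hu uM cu [mf [p Hp fp]].
have Ff : FF f by split=> //; exists p.
have Fp := FFsq Hp.
apply/cvgrPdist_le => e e0; pose e1 := e / 2 / (`|M| + 1).
have M1 : 0 < `|M| + 1 by rewrite ltr_wpDl.
have e10 : 0 < e1 by rewrite !divr_gt0.
have [B [r [B0 r0 H]]] := DD_local Hp e10.
have H10 : H1 (0 : fn) := si0 SH.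
have cL (w : fn) : sqint w -> dotL (u t) w @[t --> F] --> (0 : R).
  move=> lw; have H0 : dotL (u t) w @[t --> F] --> dotL 0 w by exact: ip_weak_dotL.
  by rewrite (sib0l SL) in H0.
have cR : \int[mu]_x (\1_(cube r) x * u t x ^+ 2) @[t --> F] --> (0 : R) by exact: rellich.
have HH : \forall t \near F, `|\int[mu]_x (\1_(cube r) x * u t x ^+ 2)| <= e / 2 / (B + 1).
  by apply: (cvgr0_norm_le _ cR); rewrite !divr_gt0// ltr_wpDl.
apply: filterS HH => t Ht; rewrite sub0r normrN.
have Fu := FFsq (Hu t).
have le1 : `|DD f (fun x => u t x ^+ 2)| <= DD (fun x => p x ^+ 2) (fun x => u t x ^+ 2).
  rewrite ler_norml; apply/andP; split.
    rewrite -(sibNl SD Fp Fu); apply: (DD_le g0 g4 gN c0 (siN SD Fp) Ff Fu) => x.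
      by have := fp x; rewrite ler_norml => /andP[].
    exact: sqr_ge0.
  apply: (DD_le g0 g4 gN c0 Ff Fp Fu) => x; last exact: sqr_ge0.
  by apply: le_trans (fp x); exact: ler_norm.
apply: le_trans le1 _; apply: le_trans (H _ (Hu t)) _.
have a1 : e1 * ip (u t) (u t) <= e / 2.
  apply: (@le_trans _ _ (e1 * (`|M| + 1))).
    rewrite ler_wpM2l ?(ltW e10)//; apply: le_trans (uM t) _; have := ler_norm M; lra.
  by rewrite /e1 divfK// gt_eqF.
have a2 : B * \int[mu]_x (\1_(cube r) x * u t x ^+ 2) <= e / 2.
  apply: (@le_trans _ _ (B * (e / 2 / (B + 1)))).
    by rewrite ler_wpM2l//; apply: le_trans (ler_norm _) Ht.
  by rewrite mulrCA ler_piMr ?divr_ge0 ?(ltW e0)// ler_pdivrMr ?mul1r ?lerDl// ltr_wpDl.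
lra.
Qed.

(** After symmetrization in the two variables the difference of the integrands is (u(x) w(y) - u(y)
    w(x))^2 / 2 times the kernel. *)
Lemma DD_mulmul (u w : fn) : H1 u -> H1 w ->
  DD (fun x => u x * w x) (fun x => u x * w x) <= DD (fun x => u x ^+ 2) (fun x => w x ^+ 2).
Proof.
move=> Hu Hw; have Fuw := FFM Hu Hw; have Fu := FFsq Hu; have Fw := FFsq Hw.
have -> : DD (fun x => u x ^+ 2) (fun x => w x ^+ 2) = 2^-1 *
    (DD (fun x => u x ^+ 2) (fun x => w x ^+ 2) + DD (fun x => w x ^+ 2) (fun x => u x ^+ 2)).
  rewrite (DDC g0 g4 gN c0 Fw Fu); lra.
have i1 := intg_DD g0 g4 gN c0 Fu Fw; have i2 := intg_DD g0 g4 gN c0 Fw Fu.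
rewrite -(ID i1 i2) -(IZ _ (intgD i1 i2)); apply: I_le => [||p].
- exact: (intg_DD g0 g4 gN c0 Fuw Fuw).
- by apply: intgZ; exact: intgD.
- rewrite -mulrDr [leRHS]mulrCA; apply: ler_wpM2l; first exact: rk_ge0.
  have := sqr_ge0 (u p.1 * w p.2 - u p.2 * w p.1); nra.
Qed.

(** A Brezis-Lieb property in the energy norm: the error is 2 u0 (u - u0), whose energy is at most 4
    DD(u0^2, (u - u0)^2) by [DD_mulmul], and this tends to 0. *)
Lemma weak_decouple (u : T -> fn) (u0 : fn) (M : R) : (forall t, H1 (u t)) -> H1 u0 ->
  (forall t, ip (u t) (u t) <= M) -> wcvg F u u0 ->
  sinorm DD ((fun x => u t x ^+ 2) - ((fun x => u0 x ^+ 2) + (fun x => (u t - u0) x ^+ 2)))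
    @[t --> F] --> (0 : R).
Proof.
move=> Hu Hu0 uM cu; apply: sinorm_cvg0.
have HB t : H1 (u t - u0) by exact: (siB SH).
have BM t : ip (u t - u0) (u t - u0) <= 2 * M + 2 * ip u0 u0.
  have := sib_sqrD_le SH (Hu t) (siN SH Hu0).
  by rewrite (sibNl SH) ?(sibNr SH) ?opprK//; [have := uM t; lra|exact: (siN SH)].
have := weak_DD0 HB BM (wcvgB Hu Hu0 cu) (FFsq Hu0).
move=> /(@cvgMr _ _ _ PF _ 4); rewrite mulr0 => H.
apply: squeeze_cvgr H; last exact: cvg_cst.
apply: nearW => t; have Fuv := FFM Hu0 (HB t).
have -> : (fun x => u t x ^+ 2) - ((fun x => u0 x ^+ 2) + (fun x => (u t - u0) x ^+ 2)) =
    2 *: (fun x => u0 x * (u t - u0) x).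
  by apply/funext => x; rewrite !fctE -[RHS]/(2 * (u0 x * (u t x - u0 x))); ring.
rewrite (sib_sqrZ SD)// mulr_ge0 ?sqr_ge0 ?(sib_ge0 SD)//=.
have := DD_mulmul Hu0 (HB t); lra.
Qed.

End weak.

Lemma VV_si (f : fn) : FF f -> (forall x, 0 <= f x) ->
  semi_inner (@H1 R N) (fun u w => DD f (fun x => u x * w x)).
Proof.
move=> Ff f0; split; [exact: (si0 SH)|exact: (siD SH)|exact: (siZ SH)| | | |].
- by move=> u w _ _; congr (DD f _); apply/funext => x; rewrite mulrC.
- move=> u v w Hu Hv Hw; rewrite -(sibDr SD (FFM Hu Hw) (FFM Hv Hw) Ff); congr (DD f _).
  by apply/funext => x; rewrite !fctE mulrDl.
- move=> a u w Hu Hw; rewrite -(sibZr SD _ (FFM Hu Hw) Ff); congr (DD f _).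
  by apply/funext => x; rewrite !fctE -[LHS]/(a * u x * w x) -[RHS]/(a * (u x * w x)) mulrA.
- move=> u Hu; apply: DD_ge0 => // x; by rewrite -expr2 sqr_ge0.
Qed.

(** The form attached to a fixed density is weakly continuous: weak convergence in H^1 becomes
    strong convergence in its seminorm, by [weak_DD0]. *)
Lemma weak_VV (T : Type) (F : set_system T) (PF : ProperFilter F) (u w : T -> fn) (u0 w0 : fn) (M : R) (f : fn) :
  (forall t, H1 (u t)) -> H1 u0 -> (forall t, ip (u t) (u t) <= M) -> wcvg F u u0 ->
  (forall t, H1 (w t)) -> H1 w0 -> (forall t, ip (w t) (w t) <= M) -> wcvg F w w0 ->
  FF f -> (forall x, 0 <= f x) ->
  DD f (fun x => u t x * w t x) @[t --> F] --> DD f (fun x => u0 x * w0 x).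
Proof.
move=> Hu Hu0 uM cu Hw Hw0 wM cw Ff f0; pose V (a b : fn) := DD f (fun x => a x * b x).
have SV : semi_inner (@H1 R N) V := VV_si Ff f0.
have bd (a : T -> fn) (a0 : fn) t : (forall t, H1 (a t)) -> H1 a0 -> (forall t, ip (a t) (a t) <= M) ->
    ip (a t - a0) (a t - a0) <= 2 * M + 2 * ip a0 a0.
  move=> Ha Ha0 aM; have := sib_sqrD_le SH (Ha t) (siN SH Ha0).
  by rewrite (sibNl SH) ?(sibNr SH) ?opprK//; [have := aM t; lra|exact: (siN SH)].
have z (a : T -> fn) (a0 : fn) : (forall t, H1 (a t)) -> H1 a0 -> (forall t, ip (a t) (a t) <= M) ->
    wcvg F a a0 -> sinorm V (a t - a0) @[t --> F] --> (0 : R).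
  move=> Ha Ha0 aM ca; apply: sinorm_cvg0.
  have HB t : H1 (a t - a0) by exact: (siB SH).
  have := weak_DD0 PF HB (fun t => bd a a0 t Ha Ha0 aM) (wcvgB PF Ha Ha0 ca) Ff.
  rewrite /V; apply: cvg_trans; apply: near_eq_cvg; apply: nearW => t.
  by congr (DD f _); apply/funext => x; rewrite expr2.
have zu := z u u0 Hu Hu0 uM cu; have zw := z w w0 Hw Hw0 wM cw.
have H : sinorm V (u t - u0) * (sinorm V (w t - w0) + sinorm V w0) + sinorm V u0 * sinorm V (w t - w0)
    @[t --> F] --> 0 * (0 + sinorm V w0) + sinorm V u0 * (0 : R).
  by apply: cvgD; [apply: cvgM => //; apply: cvgD => //; exact: cvg_cst|exact: cvgMr].
rewrite mul0r mulr0 addr0 in H.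
apply/cvgrPdist_le => e e0.
have HH : \forall t \near F, `|sinorm V (u t - u0) * (sinorm V (w t - w0) + sinorm V w0) +
    sinorm V u0 * sinorm V (w t - w0)| <= e by exact: (cvgr0_norm_le _ H _ e0).
apply: filterS HH => t Ht.
have Hut := Hu t; have Hwt := Hw t.
have HBu := siB SH Hut Hu0; have HBw := siB SH Hwt Hw0.
have E : V (u t) (w t) - V u0 w0 = V (u t - u0) (w t) + V u0 (w t - w0).
  by rewrite (sibBl SV) ?(sibBr SV)// addrA subrK.
rewrite -/(V _ _) -/(V (u t) (w t)) distrC E.
apply: le_trans (ler_normD _ _) _; apply: le_trans (le_trans (ler_norm _) Ht); apply: lerD.
  apply: le_trans (sib_CSn SV HBu Hwt) _; apply: ler_wpM2l; first exact: sinorm_ge0.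
  rewrite -{1}(subrK w0 (w t)); exact: (sinormD SV HBw Hw0).
exact: (sib_CSn SV Hu0 HBw).
Qed.

End compactness.

(** * Maximum principle *)

Section support.
Context {R : realType} {N : nat}.
Implicit Types (x y z : 'rV[R]_N) (i : 'I_N).
Local Notation mu := (@lebesgue_rV R N).
Local Notation sqint := (sqint mu).
Local Notation dotL := (dotL mu).
Local Notation fn := ('rV[R]_N -> R).
Local Notation nL := (sinorm dotL).

(* Compare the two expressions of the derivative of |v| = v for v = |u| + u. *)
Lemma sderiv_zero_ae i (u gu : fn) : sderiv i u gu -> {ae mu, forall x, u x = 0 -> gu x = 0}.
Proof.
move=> ug; have vg := sderivD (sderiv_abs ug) ug; set v : fn := _ + u in vg.
have vE : (fun x => `|v x|) = v.
  apply/funext => x; rewrite /v fctE ger0_norm//.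
  by have := ler_norm (- u x); rewrite normrN; lra.
have := sderiv_abs vg; rewrite vE => vg2.
have := sderiv_unique vg vg2; apply: filterS => x; rewrite /v !fctE => + u0.
by rewrite u0 normr0 addr0 sgr0 !mul0r add0r.
Qed.

(** The gradient of a function vanishes almost everywhere on its zero set, so the gradients have
    disjoint supports too. *)
Lemma ip_disjoint (u w : fn) : H1 u -> H1 w -> (forall x, u x * w x = 0) -> ip u w = 0.
Proof.
move=> Hu Hw uw; rewrite ipE// big1 ?add0r => [|i _]; rewrite /dotL.
  by rewrite (_ : (fun x => _) = fun=> 0) ?I0//; apply/funext.
have [lu lw] := (sqint_wgrad i Hu, sqint_wgrad i Hw).
rewrite (I_ae (g := fun=> 0)) ?I0//; first exact: intg_meas (sqintM lu lw).
have := sderiv_zero_ae (wgrad_sderiv i Hu); have := sderiv_zero_ae (wgrad_sderiv i Hw).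
apply: filterS2 => x w0 u0; have /eqP := uw x.
by rewrite mulf_eq0 => /orP[/eqP/u0 ->|/eqP/w0 ->]; rewrite ?mul0r ?mulr0.
Qed.
Lemma pos_neg_disjoint (u : fn) x : u^\+ x * u^\- x = 0.
Proof.
rewrite /funrpos /funrneg; have [u0|u0] := leP 0 (u x).
  by rewrite (@max_r _ _ (- u x)) ?mulr0// oppr_le0.
by rewrite mul0r.
Qed.

Lemma ip_pos_neg0 (u : fn) : H1 u -> ip u^\+ u^\- = 0.
Proof. by move=> Hu; apply: ip_disjoint (H1_pos Hu) (H1_neg Hu) _; exact: pos_neg_disjoint. Qed.

(** A local version of [shift_le]: the weight [b] dominates [a] along the whole segment of
    translation. It is needed because the logarithmic gradient is controlled only after
    multiplication by a cutoff. *)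
Lemma shift_le_weighted i (a b : fn) (u gu : fn) (h Mb : R) :
  mfun a -> mfun b -> (forall x, `|b x| <= Mb) ->
  (forall x (t : R), 0 <= t <= 1 -> `|a (x - (t * h) *: dirv i)| <= `|b x|) ->
  sderiv i u gu ->
  nL (fun x => a x * (u (x + h *: dirv i) - u x)) <= `|h| * nL (fun x => b x * gu x).
Proof.
move=> ma mb bM ab ug; have [lu lg _] := ug; have S := dotL_si mu.
have aM x : `|a x| <= Mb.
  by have := ab x 0; rewrite mul0r scale0r subr0 lexx ler01 => /(_ isT) H; exact: le_trans H (bM x).
have Mb0 : 0 <= Mb by apply: le_trans (bM 0).
have lbg : sqint (fun x => b x * gu x) by exact: sqint_bdM bM lg.
have [->|h0] := eqVneq h 0.
  rewrite normr0 mul0r (_ : (fun x => _) = 0) ?/sinorm ?(sib0l S) ?sqrtr0//; first exact: sqint0.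
  by apply/funext => x; rewrite scale0r addr0 subrr mulr0.
pose e n : R := h * n.+1%:R^-1.
have e0 n : e n != 0 by rewrite mulf_neq0// invr_eq0.
have ecvg : e n @[n --> \oo] --> (0 : R).
  by rewrite -[X in _ --> X](mulr0 h); apply: cvgMr; exact: harm_cvg.
pose ush (t : R) : fn := fun x => u (x + t *: dirv i).
have lsh t : sqint (ush t) by exact: sqint_shift.
have lash (t s : R) : sqint (fun x => a x * (ush t x - ush s x)).
  by apply: sqint_bdM aM _ => //; exact: (siB S (lsh t) (lsh s)).
have u0E : ush 0 = u by apply/funext => x; rewrite /ush scale0r addr0.
have ldq n : sqint (dq i (e n) u) by exact: sqint_dq.
have lbdq n : sqint (fun x => b x * dq i (e n) u x) by exact: sqint_bdM bM (ldq n).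
have tel n k : (k <= n.+1)%N ->
    nL (fun x => a x * (ush (e n *+ k) x - u x)) <= (`|e n| * nL (fun x => b x * dq i (e n) u x)) *+ k.
  elim: k => [|k IH] kn.
    rewrite !mulr0n u0E (_ : (fun x => _) = 0) ?/sinorm ?(sib0l S) ?sqrtr0//; first exact: sqint0.
    by apply/funext => x; rewrite subrr mulr0.
  have -> : (fun x => a x * (ush (e n *+ k.+1) x - u x)) =
     (fun x => a x * (ush (e n *+ k.+1) x - ush (e n *+ k) x)) + (fun x => a x * (ush (e n *+ k) x - u x)).
    by apply/funext => x; rewrite !fctE; ring.
  have lau : sqint (fun x => a x * (ush (e n *+ k) x - u x)) by have := lash (e n *+ k) 0; rewrite u0E.
  apply: le_trans (sinormD S (lash _ _) lau) _.
  rewrite [leRHS]mulrSr addrC; apply: lerD; first by apply: IH; exact: ltnW.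
  rewrite -(sinormZ S _ (lbdq n)).
  pose W : fn := fun x => a (x - (e n *+ k) *: dirv i) * (e n * dq i (e n) u x).
  have mW : mfun (fun x => a (x - (e n *+ k) *: dirv i)).
    exact: measurableT_comp ma (measurable_shift _).
  have lW : sqint W by exact: (sqint_bdM mW (fun x => aM _) (sqintZ (e n) (ldq n))).
  have -> : (fun x => a x * (ush (e n *+ k.+1) x - ush (e n *+ k) x)) = fun x => W (x + (e n *+ k) *: dirv i).
    apply/funext => x; rewrite /W addrK /dq mulVKf// /ush -addrA -scalerDl -mulrSr//.
  rewrite {1}/sinorm dotL_shift//; apply: ler_wsqrtr; apply: dotL_le => //.
    exact: (siZ S).
  move=> x; rewrite /W !fctE -[e n *: _]/(e n * (b x * dq i (e n) u x)) !normrM mulrCA.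
  rewrite ler_wpM2l// ler_wpM2r//.
  have -> : e n *+ k = (k%:R / n.+1%:R) * h by rewrite -[LHS]mulr_natr /e; ring.
  by apply: ab; rewrite divr_ge0//= ler_pdivrMr// mul1r ler_nat ltnW.
have bd n : nL (fun x => a x * (u (x + h *: dirv i) - u x)) <= `|h| * nL (fun x => b x * dq i (e n) u x).
  have := tel n n.+1 (leqnn _); have -> : e n *+ n.+1 = h by rewrite -[LHS]mulr_natr /e divfK.
  move=> /le_trans; apply; rewrite -[leLHS]mulr_natr mulrAC /e normrM [`|_^-1|]ger0_norm ?divfK//.
have cv : `|h| * (Mb * nL (dq i (e n) u - gu) + nL (fun x => b x * gu x)) @[n --> \oo] -->
    `|h| * (Mb * 0 + nL (fun x => b x * gu x)).
  apply: cvgMr; apply: cvgD; last exact: cvg_cst.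
  by apply: cvgMr; apply: sinorm_cvg0; exact: (sderiv_seq ug e0 ecvg).
rewrite mulr0 add0r in cv; rewrite -(cvg_lim (@Rhausdorff R) cv).
apply: limr_ge; first by apply/cvg_ex; exists (`|h| * nL (fun x => b x * gu x)).
apply: nearW => n; apply: le_trans (bd n) _; apply: ler_wpM2l => //.
have lB := siB S (ldq n) lg.
have lbB : sqint (fun x => b x * (dq i (e n) u - gu) x) by exact: sqint_bdM bM lB.
have -> : (fun x => b x * dq i (e n) u x) = (fun x => b x * (dq i (e n) u - gu) x) + (fun x => b x * gu x).
  by apply/funext => x; rewrite !fctE; ring.
apply: le_trans (sinormD S lbB lbg) _; rewrite lerD2r.
rewrite /sinorm -{1}(ger0_norm Mb0) -sqrtr_sqr -sqrtrM ?sqr_ge0//; apply: ler_wsqrtr.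
exact: dotL_bdM mb bM lB.
Qed.

(** At distance at least 1 from both ends each of the two factors is at least exp(-1). *)
Lemma bumpf_ge (r s : R) : `|s| <= r - 1 -> expR (- 2) <= bumpf (- r) r 1 s.
Proof.
rewrite ler_norml => /andP[s1 s2].
have H (t : R) : 1 <= t -> expR (- 1) <= expinv 1 t.
  move=> t1; have t0 : 0 < t by lra.
  rewrite /expinv t0 hornerC mul1r ler_expR lerN2 invf_le1//.
rewrite /bumpf !mul1r (_ : - 2 = - 1 + - 1 :> R) ?expRD; last by lra.
by apply: ler_pM; rewrite ?expR_ge0//; apply: H; lra.
Qed.

Definition ccut (r : R) : fn := box_bump (const_mx (- r)) (const_mx r) 0.

Lemma ccut_ge (r : R) x : (forall i, `|x ord0 i| <= r - 1) -> expR (- 2) ^+ N <= ccut r x.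
Proof.
move=> xr; rewrite /ccut /box_bump /coord_prod.
rewrite -[X in _ ^+ X]card_ord -prodr_const; apply: ler_prod => i _.
by rewrite expR_ge0 !mxE bumpf_ge.
Qed.

Lemma test_lip (w : fn) : test_function w -> exists2 L : R, 0 <= L & forall i,
  (forall x, `|partial i w x| <= L) /\
  (forall x (h : R), `|w (x + h *: dirv i) - w x| <= L * `|h|).
Proof.
move=> tw.
have /choice[M HM] i : exists M : R, 0 < M /\ forall x, `|partial i w x| <= M.
  by have [M M0 HM] := test_bounded (test_partial i tw); exists M.
exists (\sum_i M i); first by apply: sumr_ge0 => i _; apply: ltW; have [] := HM i.
move=> i; have Mi x : `|partial i w x| <= \sum_i M i.
  have [_ /(_ x)/le_trans] := HM i; apply; rewrite (bigD1 i)//= lerDl.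
  by apply: sumr_ge0 => j _; apply: ltW; have [] := HM j.
split=> // x h; have sw := tw.1.
have H (t : R) : is_derive t (1 : R) (fun s : R => w (x + s *: dirv i)) (partial i w (x + t *: dirv i)).
  exact/is_derive_line/smooth_derive.
have [c _] := mvt0 h H; rewrite scale0r addr0 => ->; rewrite normrM.
by apply: ler_wpM2r.
Qed.

Section supersol.
Variable e : fn.
Hypotheses (He : H1 e) (e_ge0 : forall x, 0 <= e x)
  (sup : forall psi : fn, H1 psi -> (forall x, 0 <= psi x) -> 0 <= ip e psi).

Let de i := wgrad e i.
Let lde i : sqint (de i). Proof. exact: sqint_wgrad. Qed.
Let me : mfun e := H1_meas He.

Lemma measurable_inv_shift (d : R) : 0 < d -> mfun (fun x => (e x + d)^-1).
Proof.
move=> d0; rewrite (_ : (fun x => _) = fun x => expR (- ln (e x + d))); last first.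
  by apply/funext => x; rewrite expRN lnK// posrE ltr_wpDl.
apply: (measurableT_comp (@measurable_expR R)); apply: measurableT_comp => //.
apply: (measurableT_comp (@measurable_ln R)); exact: measurable_funD.
Qed.

Let inv_itv (d : R) x : 0 < d -> 0 < (e x + d)^-1 <= d^-1.
Proof.
move=> d0; have p : 0 < e x + d by rewrite ltr_wpDl.
by rewrite invr_gt0 p /= lef_pV2 ?posrE// lerDr e_ge0.
Qed.

Let sderiv_ln (d : R) i : 0 < d ->
  sderiv i (fun x => ln (d + e x) - ln d) (fun x => (e x + d)^-1 * de i x).
Proof.
move=> d0.
have H := @sderiv_chain _ _ (fun s => 0 <= s) (fun s => ln (d + s) - ln d) (fun s => (s + d)^-1)
  (fun s => - (s + d) ^- 2) d^-1 (d ^+ 2)^-1 i e (de i).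
apply: H => //.
- by move=> a b c a0 _ /andP[ac _]; exact: le_trans ac.
- by rewrite addr0 subrr.
- move=> s s0; have p : 0 < d + s by rewrite ltr_pwDl.
  have h := is_derive_addl d s.
  have h2 := @is_derive1_comp _ (@ln R) (fun t => d + t) _ _ _ (is_derive1_ln p) h.
  by apply: is_derive_eq (is_deriveB h2 (is_derive_cst (ln d) s (1 : R))) _; rewrite subr0 mulr1 addrC.
- move=> s s0; have p : 0 < s + d by rewrite ltr_wpDl.
  have h := is_derive_addr d s.
  have := is_deriveV (f := fun t => t + d) (lt0r_neq0 p) h.
  by move=> h3; apply: is_derive_eq h3 _; rewrite -[LHS]/(_ * _) mulr1.
- move=> s s0; have p : 0 < s + d by rewrite ltr_wpDl.
  by rewrite gtr0_norm ?invr_gt0// lef_pV2// lerDr.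
- move=> s s0; have p : 0 < s + d by rewrite ltr_wpDl.
  rewrite normrN gtr0_norm ?invr_gt0 ?exprn_gt0// lef_pV2 ?posrE ?exprn_gt0//.
  by rewrite ler_pXn2r ?nnegrE ?lerDr// ltW.
- apply: measurable_funB => //; apply: (measurableT_comp (@measurable_ln R)); exact: measurable_funD.
- exact: measurable_inv_shift.
- exact: wgrad_sderiv.
Qed.

Let sderiv_inv (d : R) i : 0 < d ->
  sderiv i (fun x => (e x + d)^-1 - d^-1) (fun x => - (e x + d) ^- 2 * de i x).
Proof.
move=> d0.
have H := @sderiv_chain _ _ (fun s => 0 <= s) (fun s => (s + d)^-1 - d^-1) (fun s => - (s + d) ^- 2)
  (fun s => 2 * (s + d) ^- 3) (d ^+ 2)^-1 (2 * (d ^+ 3)^-1) i e (de i).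
apply: H => //.
- by move=> a b c a0 _ /andP[ac _]; exact: le_trans ac.
- by rewrite add0r subrr.
- move=> s s0; have p : 0 < s + d by rewrite ltr_wpDl.
  have h := is_derive_addr d s.
  have h3 := is_deriveV (f := fun t => t + d) (lt0r_neq0 p) h.
  apply: is_derive_eq (is_deriveB h3 (is_derive_cst d^-1 s (1 : R))) _.
  by rewrite subr0 -[LHS]/(_ * _) mulr1.
- move=> s s0; have p : 0 < s + d by rewrite ltr_wpDl.
  have h := is_derive_addr d s.
  have h2 : is_derive s (1 : R) (fun t : R => (t + d) ^+ 2) (2 * (s + d)).
    by apply: is_derive_eq (is_deriveM h h) _; rewrite -![_ *: _]/(_ * _); ring.
  have h3 := is_deriveN (is_deriveV (f := fun t => (t + d) ^+ 2) (lt0r_neq0 (exprn_gt0 2 p)) h2).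
  by apply: is_derive_eq h3 _; rewrite -![_ *: _]/(_ * _); field; rewrite gt_eqF.
- move=> s s0; have p : 0 < s + d by rewrite ltr_wpDl.
  rewrite normrN gtr0_norm ?invr_gt0 ?exprn_gt0// lef_pV2 ?posrE ?exprn_gt0//.
  by rewrite ler_pXn2r ?nnegrE ?lerDr// ltW.
- move=> s s0; have p : 0 < s + d by rewrite ltr_wpDl.
  rewrite normrM [`|2|]ger0_norm// ler_pM2l//.
  rewrite gtr0_norm ?invr_gt0 ?exprn_gt0// lef_pV2 ?posrE ?exprn_gt0//.
  by rewrite ler_pXn2r ?nnegrE ?lerDr// ltW.
- by apply: measurable_funB => //; exact: measurable_inv_shift.
- apply: measurableT_comp => //; rewrite (_ : (fun x => _) = fun x => (e x + d)^-1 ^+ 2).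
    by apply: measurable_funX; exact: measurable_inv_shift.
  by apply/funext => x; rewrite exprVn.
- exact: wgrad_sderiv.
Qed.

(* Test the inequality with w^2 / (e + d). *)
Lemma log_energy (w : fn) : test_function w -> exists C : R, forall (d : R) i, 0 < d ->
  dotL (fun x => w x * ((e x + d)^-1 * de i x)) (fun x => w x * ((e x + d)^-1 * de i x)) <= C.
Proof.
move=> tw; have [Mw Mw0 wM] := test_bounded tw; have [Lw Lw0 HL] := test_lip tw.
have mw := test_meas tw; have lw := test_sqint tw.
pose dw i := partial i w; have tdw i : test_function (dw i) by exact: test_partial.
have mdw i := test_meas (tdw i); have ldw i := test_sqint (tdw i).
exists (4 * \sum_i dotL (dw i) (dw i) + 2 * dotL w w) => d i d0.
have mi := measurable_inv_shift d0.
have bi x : `|(e x + d)^-1| <= d^-1 by have /andP[a b] := inv_itv x d0; rewrite gtr0_norm.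
have smul j (u gu : fn) : sderiv j u gu -> sderiv j (fun x => w x * u x) (fun x => w x * gu x + dw j x * u x).
  move=> H; apply: (sderiv_mul mw (mdw j) wM _ _ _ H (L := Lw)).
  - by have [] := HL j.
  - by have [_] := HL j.
  - by move=> x; exact: smooth_derive tw.1.
pose q j : fn := fun x => w x * ((e x + d)^-1 * de j x).
have lq j : sqint (q j).
  by apply: (sqint_bdM mw wM); exact: (sqint_bdM mi bi (lde j)).
have sZ j : sderiv j (fun x => w x * (e x + d)^-1) (fun x => - (e x + d)^-1 * q j x + (e x + d)^-1 * dw j x).
  have H := sderivD (smul j _ _ (sderiv_inv j d0)) (sderivZ d^-1 (test_sderiv j tw)).
  congr (sderiv j _ _): H; apply/funext => x; rewrite !fctE -[_ *: _]/(_ * _).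
    by ring.
  rewrite /q -exprVn /dw; ring.
have sP j := smul j _ _ (sZ j).
pose psi : fn := fun x => w x * (w x * (e x + d)^-1).
have lpsi : sqint psi.
  apply: (sqint_bdM mw wM); rewrite (_ : (fun x => _) = fun x => (e x + d)^-1 * w x).
    exact: sqint_bdM mi bi lw.
  by apply/funext => x; rewrite mulrC.
have Hpsi : H1 psi := H1_intro lpsi sP.
have psi0 x : 0 <= psi x.
  by rewrite /psi mulrA mulr_ge0 -?expr2 ?sqr_ge0// ltW//; have /andP[] := inv_itv x d0.
have := sup Hpsi psi0; rewrite (ip_sderiv (H1_sqint He) lpsi (fun j => wgrad_sderiv j He) sP) => E.
have S := dotL_si mu.
have Ej j : dotL (de j) (fun x => w x * (- (e x + d)^-1 * q j x + (e x + d)^-1 * dw j x) +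
    dw j x * (w x * (e x + d)^-1)) = - dotL (q j) (q j) + 2 * dotL (q j) (dw j).
  have -> : - dotL (q j) (q j) + 2 * dotL (q j) (dw j) = dotL (q j) (- q j + 2 *: dw j).
    rewrite (sibDr S) ?(sibNr S) ?(sibZr S)//; [exact: (siN S)|exact: (siZ S)].
  rewrite /dotL; congr Rintegral; apply/funext => x.
  rewrite -[(- q j + 2 *: dw j) x]/(- q j x + 2 * dw j x) /q; ring.
have Eu : dotL e psi <= dotL w w.
  rewrite /dotL; apply: I_le; [exact: (sqintM (H1_sqint He) lpsi)|exact: (sqintM lw lw)|move=> x].
  have /andP[a b] := inv_itv x d0; have p : 0 < e x + d by rewrite ltr_wpDl.
  rewrite /psi (_ : e x * _ = (e x / (e x + d)) * (w x * w x)); last by ring.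
  by rewrite ler_piMl -?expr2 ?sqr_ge0// ler_pdivrMr// mul1r lerDl ltW.
rewrite (eq_bigr _ (fun j _ => Ej j)) in E.
have Yj j : 2 * dotL (q j) (dw j) <= 2^-1 * dotL (q j) (q j) + 2 * dotL (dw j) (dw j).
  have := sib_ge0 S (siB S (lq j) (siZ S 2 (ldw j))).
  rewrite (sib_sqrB S) ?(sib_sqrZ S) ?(sibZr S)//; last exact: (siZ S).
  lra.
have E2 : 0 <= \sum_j (- (2^-1 * dotL (q j) (q j)) + 2 * dotL (dw j) (dw j)) + dotL w w.
  apply: le_trans E _; apply: lerD => //; apply: ler_sum => j _; have := Yj j; lra.
rewrite big_split/= sumrN -!mulr_sumr in E2.
have : dotL (q i) (q i) <= \sum_j dotL (q j) (q j).
  by rewrite (bigD1 i)//= lerDl; apply: sumr_ge0 => j _; exact: (sib_ge0 S).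
by move=> /le_trans; apply; lra.
Qed.

(** If e = 0 at x and e(x + h) >= 1/(n+1) on a set of positive measure, ln(d + e) jumps there by an
    arbitrarily large amount as d tends to 0, whereas [log_energy] bounds its gradient locally and
    independently of d. *)
Lemma zero_dir i (h : R) : {ae mu, forall x, e x = 0 -> e (x + h *: dirv i) = 0}.
Proof.
have S := dotL_si mu.
pose B n : set 'rV[R]_N := cube n.+1%:R `&` [set x | e x = 0] `&` [set x | n.+1%:R^-1 <= e (x + h *: dirv i)].
have mB n : measurable (B n).
  apply: measurableI; first apply: measurableI.
  - exact: measurable_cube.
  - rewrite (_ : [set x | _] = setT `&` e @^-1` [set 0]); last by rewrite setTI.
    by apply: me => //; exact: measurable_set1.
  - have ms : mfun (fun x => e (x + h *: dirv i)).
      exact: measurableT_comp me (measurable_shift _).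
    rewrite (_ : [set x | _] = setT `&` (fun x => e (x + h *: dirv i)) @^-1` `[n.+1%:R^-1, +oo[%classic).
      by apply: ms => //; exact: measurable_itv.
    by rewrite setTI; apply/seteqP; split=> x /=; rewrite in_itv/= andbT.
have lB n : sqint (\1_(B n) : fn).
  apply: (sqint_le _ (sqint_cube n.+1%:R)); first exact: measurable_indic.
  move=> x; rewrite !indicE; case: (pselect (B n x)) => [b|b].
    by rewrite (mem_set b) (mem_set b.1.1).
  by rewrite (memNset b) normr0.
have B0 n : {ae mu, forall x, (\1_(B n) x : R) = 0}.
  apply: dotL_eq0 => //; set Q := dotL _ _.
  have Q0 : 0 <= Q by exact: (sib_ge0 S).
  pose r : R := n.+1%:R + `|h| + 1.
  pose w := ccut r; have tw : test_function w by exact: test_box_bump.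
  have [C HC] := log_energy tw; have mw := test_meas tw.
  have w1 x : `|w x| <= 1 by have /andP[a b] := box_bump_itv (const_mx (- r)) (const_mx r) 0 x; rewrite ger0_norm.
  pose m : R := expR (- 2) ^+ N; have m0 : 0 < m by rewrite exprn_gt0// expR_gt0.
  have key (K : R) : 0 < K -> m ^+ 2 * K ^+ 2 * Q <= h ^+ 2 * C.
    (* With this [d] the logarithm increases by at least [K] between x and x + h for every x in
       [B n]. *)
    move=> K0; pose d : R := n.+1%:R^-1 / expR K.
    have d0 : 0 < d by rewrite divr_gt0 ?invr_gt0 ?expR_gt0.
    have sl := sderiv_ln i d0; have [ll lgl _] := sl.
    pose a : fn := fun x => m * \1_(cube n.+1%:R) x.
    have ma : mfun a.
      have mI : mfun (\1_(cube n.+1%:R) : fn) by apply: measurable_indic; exact: measurable_cube.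
      by rewrite /a; exact: (measurable_funM (measurable_cst m) mI).
    have aw x (t : R) : 0 <= t <= 1 -> `|a (x - (t * h) *: dirv i)| <= `|w x|.
      move=> /andP[t0 t1]; rewrite /a indicE; case: (pselect (cube n.+1%:R (x - (t * h) *: dirv i))) => xc; last first.
        by rewrite (memNset xc) mulr0 normr0.
      rewrite (mem_set xc) mulr1 gtr0_norm//; apply: le_trans (ler_norm _); apply: ccut_ge => j.
      have /cubeP/(_ j) := xc; rewrite !mxE => H.
      have H2 : `|t * h * ((0 == 0 :> 'I_1) && (j == i))%:R| <= `|h|.
        rewrite !normrM -[leRHS]mulr1 -[leRHS]mul1r mulrA; apply: ler_pM => //; last by case: (_ && _); rewrite ?normr1 ?normr0.
        by apply: ler_wpM2r => //; rewrite ger0_norm.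
      have := ler_normD (x ord0 j - t * h * ((0 == 0 :> 'I_1) && (j == i))%:R) (t * h * ((0 == 0 :> 'I_1) && (j == i))%:R).
      rewrite subrK /r; lra.
    have lW : sqint (fun x => a x * ((ln (d + e (x + h *: dirv i)) - ln d) - (ln (d + e x) - ln d))).
      apply: (sqint_bdM (M := m) ma); last exact: (siB S (sqint_shift _ ll) ll).
      move=> x; rewrite /a normrM (gtr0_norm m0) ler_piMr ?(ltW m0)//; have /andP[? ?] := ind_itv (cube n.+1%:R) x; by rewrite ger0_norm.
    have H := shift_le_weighted ma mw w1 aw sl (h := h).
    have H2 := HC d i d0.
    have lwg : sqint (fun x => w x * ((e x + d)^-1 * de i x)) by exact: sqint_bdM mw w1 lgl.
    have H3 : dotL (fun x => a x * ((ln (d + e (x + h *: dirv i)) - ln d) - (ln (d + e x) - ln d)))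
      (fun x => a x * ((ln (d + e (x + h *: dirv i)) - ln d) - (ln (d + e x) - ln d))) <= h ^+ 2 * C.
      rewrite -(sinorm_sqr S lW); apply: le_trans (_ : (`|h| * nL (fun x => w x * ((e x + d)^-1 * de i x))) ^+ 2 <= _).
        by rewrite ler_pXn2r ?nnegrE ?sinorm_ge0// mulr_ge0 ?sinorm_ge0.
      by rewrite exprMn (sinorm_sqr S lwg) real_normK ?num_real//; apply: ler_wpM2l; rewrite ?sqr_ge0.
    apply: le_trans H3; rewrite /Q -exprMn -(sib_sqrZ S _ (lB n)); apply: dotL_le => //; first exact: (siZ S).
    move=> x; rewrite -[(_ *: _) x]/(m * K * \1_(B n) x) indicE; case: (pselect (B n x)) => xB; last first.
      by rewrite (memNset xB) mulr0 normr0.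
    rewrite (mem_set xB) mulr1; case: xB => -[xc /= x0] xn.
    rewrite /a indicE (mem_set xc) mulr1 x0 addr0 subrr subr0 !normrM ler_pM2l ?normr_gt0 ?gt_eqF//.
    rewrite (gtr0_norm K0); apply: le_trans (ler_norm _).
    have p : 0 < d + e (x + h *: dirv i) by rewrite ltr_pwDl.
    have EK : expR K <= (d + e (x + h *: dirv i)) / d.
      rewrite ler_pdivlMr// {1}/d mulrC divfK ?gt_eqF ?expR_gt0//; apply: le_trans xn _; rewrite lerDr.
      exact: ltW.
    rewrite -ln_div ?posrE// -(expRK K) ler_ln// posrE; [exact: expR_gt0|exact: divr_gt0].
  apply/eqP; rewrite eq_le Q0 andbT leNgt; apply/negP => Qp.
  have mQ : 0 < m ^+ 2 * Q by rewrite mulr_gt0// exprn_gt0.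
  (* Large enough for m^2 Q K^2 >= m^2 Q K > h^2 C, against [key]. *)
  pose K : R := 1 + `|h ^+ 2 * C| / (m ^+ 2 * Q).
  have K1 : 1 <= K by rewrite lerDl divr_ge0// ltW.
  have := key K (lt_le_trans ltr01 K1).
  have KK : K <= K ^+ 2 by rewrite expr2 ler_peMr// (le_trans ler01).
  have : m ^+ 2 * Q * K = m ^+ 2 * Q + `|h ^+ 2 * C|.
    by rewrite /K mulrDr mulr1; congr (_ + _); rewrite [LHS]mulrC divfK// gt_eqF.
  have : m ^+ 2 * Q * K <= m ^+ 2 * Q * K ^+ 2 by rewrite ler_pM2l.
  have := ler_norm (h ^+ 2 * C); lra.
have := ae_foralln B0; apply: filterS => x Hx x0; apply/eqP; apply: contrapT => /negP ex.
have xp : 0 < e (x + h *: dirv i) by rewrite lt_neqAle eq_sym ex e_ge0.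
have [n Hn] := ltr_add_invr xp.
pose n' := maxn n (Num.truncn `|x|).
have : B n' x.
  split; first split => //.
  - apply/cubeP => j; apply: le_lt_trans (rV_norm_coord x j) _.
    apply: lt_le_trans (truncnS_gt `|x|) _; by rewrite ler_nat ltnS leq_maxr.
  - rewrite /=; apply: le_trans (ltW Hn); rewrite add0r lef_pV2 ?posrE// ler_nat ltnS; exact: leq_maxl.
by move=> b; have := Hx n'; rewrite indicE (mem_set b) => /eqP; rewrite oner_eq0.
Qed.

Lemma zero_shift z : {ae mu, forall x, e x = 0 -> e (x + z) = 0}.
Proof.
have H (s : seq 'I_N) : {ae mu, forall x, e x = 0 -> e (x + \sum_(i <- s) z ord0 i *: dirv i) = 0}.
  elim: s => [|i s IH]; first by apply: aeW => x; rewrite big_nil addr0.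
  have IH2 := mp_ae (measurable_shift (z ord0 i *: dirv i)) (fun A mA => shift_measure _ mA) IH.
  have Z := zero_dir i (z ord0 i); apply: filterS2 Z IH2 => x h1 h2 x0.
  by rewrite big_cons addrA; exact: h2 (h1 x0).
have E : \sum_(i <- index_enum 'I_N) z ord0 i *: dirv i = z by rewrite [RHS]row_sum_delta.
by have := H (index_enum 'I_N); rewrite E.
Qed.

(** The double integral of p(x)^2 e(x + z)^2 is the product of the two squared L^2 norms when z is
    integrated first. It is 0 when x is integrated first: where p(x) is nonzero e(x) = 0, hence e(x
    + z) = 0 by [zero_shift]. This replaces Harnack's inequality. *)
Lemma max_principle (p : fn) : ~ ae_zero e -> sqint p -> {ae mu, forall x, e x * p x = 0} -> ae_zero p.
Proof.
move=> ne lp ep; have le := H1_sqint He; have mp := sqint_meas lp.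
pose F (q : 'rV[R]_N * 'rV[R]_N) : \bar R := (p q.1 ^+ 2 * e (q.1 + q.2) ^+ 2)%:E.
have mF : mfun F.
  apply/measurable_EFinP; apply: measurable_funM; apply: measurable_funX.
    exact: measurableT_comp mp measurable_fst.
  apply: (measurableT_comp me); apply: measurable_fun_rV => i.
  under eq_fun do rewrite mxE.
  by apply: measurable_funD; apply: (measurableT_comp (measurable_coord i)); [exact: measurable_fst|exact: measurable_snd].
have F0 q : (0 <= F q)%E by rewrite lee_fin mulr_ge0 ?sqr_ge0.
have T := @fubini_tonelli _ _ _ _ R mu mu F mF F0.
have I1 : (\int[mu]_x \int[mu]_z F (x, z) = (dotL e e * dotL p p)%:E)%E.
  transitivity (\int[mu]_x (dotL e e * p x ^+ 2)%:E)%E.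
    apply: eq_integral => x _; rewrite /F/=.
    rewrite (ge0_integralZ_EFin mu (f := fun z => e (x + z) ^+ 2) _ (fun z => sqr_ge0 _) (sqr_ge0 (p x))); last first.
      apply: measurable_funX; apply: (measurableT_comp me).
      rewrite (_ : +%R x = fun z => z + x); last by apply/funext => z; rewrite addrC.
      exact: measurable_shift.
    under eq_integral do rewrite addrC.
    rewrite (mp_ge0_integral (measurable_shift x) (fun A mA => shift_measure x mA) (f := fun y => (e y ^+ 2)%:E)).
    - by rewrite -(EFin_dotL le) -EFinM mulrC.
    - by apply/measurable_EFinP; exact: measurable_funX.
    - by move=> y; rewrite lee_fin sqr_ge0.
  rewrite (ge0_integralZ_EFin mu (f := fun z => p z ^+ 2) _ (fun z => sqr_ge0 _) (sib_ge0 (dotL_si mu) le)); last exact: measurable_funX.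
  by rewrite -EFin_dotL.
have I2 : (\int[mu]_z \int[mu]_x F (x, z) = 0)%E.
  apply: integral0_eq => z _.
  transitivity (\int[mu]_x cst 0%E x)%E; last exact: integral0.
  apply: ae_eq_integral; [exact: measurableT|exact: measurableT_comp mF (pair2_measurable z)|exact: measurable_cst|].
  have Z := zero_shift z; apply: filterS2 ep Z => x h1 h2 _.
  rewrite /F/=; move/eqP: h1; rewrite mulf_eq0 => /orP[/eqP/h2 ->|/eqP ->].
    by rewrite expr0n mulr0.
  by rewrite expr0n mul0r.
move: T; rewrite I1 I2 => -[] /eqP; rewrite mulf_eq0 => /orP[/eqP E|/eqP E].
  by case: ne; exact: dotL_eq0 E.
exact: dotL_eq0 E.
Qed.

End supersol.
End support.

Lemma quad_derive (R : realType) (f : R -> R) (d C s : R) : 0 <= C ->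
  (forall h : R, `|f (s + h) - f s - d * h| <= C * h ^+ 2) -> is_derive s (1 : R) f d.
Proof.
move=> C0 H; apply: is_derive_cvg; apply/cvgrPdist_le => e e0.
have C1 : 0 < C + 1 by rewrite ltr_wpDl.
have A : \forall h \near (0 : R)^', `|h| < e / (C + 1) by apply: dnbhs0_lt; exact: divr_gt0.
have B : \forall h \near (0 : R)^', h != 0 by exact: nbhs_dnbhs_neq.
apply: filterS2 A B => h he h0.
have -> : d - h^-1 * (f (s + h) - f s) = - (h^-1 * (f (s + h) - f s - d * h)) by field.
rewrite normrN normrM normfV mulrC ler_pdivrMr ?normr_gt0//; apply: le_trans (H h) _.
rewrite -real_normK ?num_real// expr2 mulrA; apply: ler_wpM2r => //.
apply: le_trans (_ : (C + 1) * `|h| <= _); first by apply: ler_wpM2r => //; rewrite lerDl.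
by rewrite mulrC -ler_pdivlMr// ltW.
Qed.

Definition pp (R : realType) (s : R) := Num.max s 0 ^+ 2.

Lemma pp_derive (R : realType) (s : R) : is_derive s (1 : R) (@pp R) (2 * Num.max s 0).
Proof.
apply: (quad_derive ler01) => h; rewrite mul1r /pp.
have [s0|s0] := leP 0 s; rewrite ?(max_l s0) ?(max_r (ltW s0)).
  have [t0|t0] := leP 0 (s + h); rewrite ?(max_l t0) ?(max_r (ltW t0)).
    by rewrite (_ : _ - _ - _ = h ^+ 2) ?ger0_norm ?sqr_ge0//; ring.
  rewrite expr0n sub0r ler_norml; apply/andP; split; [|have := sqr_ge0 (s + h)]; nra.
have [t0|t0] := leP 0 (s + h); rewrite ?(max_l t0) ?(max_r (ltW t0)).
  by rewrite expr0n subr0 mulr0 mul0r subr0 ger0_norm ?sqr_ge0//; nra.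
by rewrite expr0n subr0 mulr0 mul0r subr0 normr0 sqr_ge0.
Qed.

(** * One-dimensional cutoffs and the localization formula *)

Section cutoff.
Context {R : realType}.

(** The cutoff (1 - 4 s^2/r^2)_+^2, supported in |s| <= r/2. Being flat at 0, it has 1 - chi^2 and
    r^2 chi'^2 bounded by a multiple of s^2/r^2, so that a second moment controls the truncation
    error. *)
Definition chi (r s : R) := pp (1 - 4 * s ^+ 2 / r ^+ 2).
Definition dchi (r s : R) := 2 * Num.max (1 - 4 * s ^+ 2 / r ^+ 2) 0 * (- 8 * s / r ^+ 2).
Definition flin (r s : R) := r * dsabs r s.
Definition dflin (r s : R) := r * (r ^+ 2 / Num.sqrt (s ^+ 2 + r ^+ 2) ^+ 3).

Lemma chi_derive (r s : R) : 0 < r -> is_derive s (1 : R) (chi r) (dchi r s).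
Proof.
move=> r0.
have Hs : is_derive s (1 : R) (fun t : R => t ^+ 2) (2 * s).
  by apply: is_derive_eq (is_deriveM (is_derive_id s (1 : R)) (is_derive_id s (1 : R))) _; rewrite -[LHS]/(s * 1 + s * 1) mulr1; ring.
have H : is_derive s (1 : R) (fun t : R => 1 - 4 * t ^+ 2 / r ^+ 2) (- 8 * s / r ^+ 2).
  have K := is_deriveB (is_derive_cst (1 : R) s (1 : R)) (is_deriveZ (4 / r ^+ 2) Hs).
  apply: (is_derive_eq (f := fun t : R => 1 - 4 * t ^+ 2 / r ^+ 2) _ (_ : 0 - (4 / r ^+ 2) *: (2 * s) = _)).
    rewrite (_ : (fun t : R => _) = cst 1 - (4 / r ^+ 2) *: (fun t : R => t ^+ 2)) //.
    by apply/funext => t; rewrite !fctE -[_ *: _]/(_ * _); ring.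
  by rewrite -[_ *: _]/(_ * _); ring.
exact: (@is_derive1_comp _ (@pp R) _ _ _ _ (pp_derive _) H).
Qed.

Lemma flin_derive (r s : R) : 0 < r -> is_derive s (1 : R) (flin r) (dflin r s).
Proof. by move=> r0; exact: (is_deriveZ r (dsabs_derive s r0)). Qed.

Lemma flin_sqr (r s : R) : 0 < r -> flin r s ^+ 2 = r ^+ 2 * s ^+ 2 / (s ^+ 2 + r ^+ 2).
Proof.
move=> r0; have q : 0 <= s ^+ 2 + r ^+ 2 by rewrite addr_ge0 ?sqr_ge0.
by rewrite /flin /dsabs !exprMn exprVn sqr_sqrtr// mulrA.
Qed.

Lemma flin_le (r s : R) : 0 < r -> flin r s ^+ 2 <= s ^+ 2 /\ flin r s ^+ 2 <= r ^+ 2.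
Proof.
move=> r0; have q : 0 < s ^+ 2 + r ^+ 2 by rewrite ltr_wpDl ?sqr_ge0// exprn_gt0.
rewrite flin_sqr// !ler_pdivrMr//; have := sqr_ge0 (s ^+ 2); have := sqr_ge0 (r ^+ 2).
by rewrite !mulrDr -!expr2 [s ^+ 2 * r ^+ 2]mulrC; split; lra.
Qed.

Lemma dflin_le (r s : R) : 0 < r -> `|dflin r s| <= 1.
Proof.
move=> r0; have [h1 _] := sabs_sqrt_ge s r0; have q := lt_le_trans r0 h1.
rewrite /dflin ger0_norm; last by rewrite mulr_ge0 ?divr_ge0 ?exprn_ge0 ?ltW.
by rewrite mulrA -exprS ler_pdivrMr ?exprn_gt0// mul1r ler_pXn2r ?nnegrE// ltW.
Qed.

Lemma chi_itv (r s : R) : 0 < r -> 0 <= chi r s <= 1.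
Proof.
move=> r0; rewrite /chi /pp sqr_ge0 /=; apply: exprn_ile1; first by rewrite le_max lexx orbT.
have y0 : 0 <= 4 * s ^+ 2 / r ^+ 2.
  by apply: divr_ge0; [apply: mulr_ge0 => //; exact: sqr_ge0|exact: sqr_ge0].
rewrite ge_max ler01 andbT; lra.
Qed.

Lemma chi_out (r s : R) : 0 < r -> r / 2 <= `|s| -> chi r s = 0.
Proof.
move=> r0 rs; rewrite /chi /pp max_r ?expr0n//.
rewrite subr_le0 ler_pdivlMr ?exprn_gt0// mul1r -[s ^+ 2]real_normK ?num_real//.
by rewrite (_ : r ^+ 2 = 4 * (r / 2) ^+ 2) ?ler_pM2l ?ler_pXn2r ?nnegrE//; [rewrite divr_ge0// ltW|field].
Qed.

Lemma chi_half (r s : R) : 0 < r -> `|s| <= r / 4 -> 4^-1 <= chi r s ^+ 2.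
Proof.
move=> r0 rs; have : 4 * s ^+ 2 / r ^+ 2 <= 4^-1.
  rewrite ler_pdivrMr ?exprn_gt0// -[s ^+ 2]real_normK ?num_real//.
  rewrite (_ : 4^-1 * r ^+ 2 = 4 * (r / 4) ^+ 2); last by field.
  by rewrite ler_pM2l ?ler_pXn2r ?nnegrE// divr_ge0// ltW.
rewrite /chi /pp; set y := 4 * _ / _ => y1; rewrite max_l; last by lra.
have : (3 / 4) ^+ 2 <= (1 - y) ^+ 2 by rewrite ler_pXn2r ?nnegrE//; lra.
move=> h; have : ((3 / 4) ^+ 2) ^+ 2 <= ((1 - y) ^+ 2) ^+ 2 by rewrite ler_pXn2r ?nnegrE ?sqr_ge0.
lra.
Qed.

Lemma chi_bounds : exists2 K : R, 1 <= K & forall r s, 0 < r ->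
  [/\ 1 - chi r s ^+ 2 <= K / r ^+ 2 * flin r s ^+ 2,
      dchi r s ^+ 2 <= K / r ^+ 4 * flin r s ^+ 2 & `|dchi r s| <= K / r].
Proof.
(* In terms of y = s^2/r^2 and z = y/(1 + y) = (flin/r)^2, the estimate of chi' reads 256 y m^2 <= K
   z; for y < 1/4 one has z >= 4 y / 5, whence 256 * 5 / 4. *)
have [K [K1 K320]] : exists K : R, 1 <= K /\ 256 * 5 / 4 <= K by exists (1 + 256 * 5 / 4); lra.
exists K => // r s r0; have r2 : 0 < r ^+ 2 by rewrite exprn_gt0.
have K0 : 0 <= K by lra.
have q : 0 < s ^+ 2 + r ^+ 2 by rewrite ltr_wpDl ?sqr_ge0.
set y := s ^+ 2 / r ^+ 2; set f2 := flin r s ^+ 2.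
have y0 : 0 <= y by rewrite divr_ge0 ?sqr_ge0.
have rn : r != 0 by rewrite gt_eqF.
have qn : s ^+ 2 + r ^+ 2 != 0 by rewrite gt_eqF.
have qn' : r ^+ 2 + s ^+ 2 != 0 by rewrite addrC.
have y1 : 0 < 1 + y by lra.
pose z := y / (1 + y); pose m := Num.max (1 - 4 * y) 0.
have Ef : f2 = r ^+ 2 * z by rewrite /f2 flin_sqr// /z /y; field; rewrite ?rn ?qn ?qn'.
have Ey : 1 - 4 * s ^+ 2 / r ^+ 2 = 1 - 4 * y by rewrite /y mulrA.
have Ed : dchi r s ^+ 2 = (16 / r) ^+ 2 * (y * m ^+ 2).
  by rewrite /dchi Ey -/m; rewrite /y; field.
have Ec : chi r s = m ^+ 2 by rewrite /chi /pp Ey.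
have zK : z <= 1 by rewrite /z ler_pdivrMr//; lra.
have z0 : 0 <= z by rewrite divr_ge0// ltW.
have [A B] : 1 - (m ^+ 2) ^+ 2 <= K * z /\ 16 ^+ 2 * (y * m ^+ 2) <= K * z.
  rewrite /m; have [h|h] := leP (1 - 4 * y) 0.
    have z1 : 5^-1 <= z by rewrite /z ler_pdivlMr//; lra.
    by rewrite expr0n/= mulr0 mulr0 expr0n/= subr0 mulr_ge0//; split=> //; nra.
  have z1 : 4 / 5 * y <= z by rewrite /z ler_pdivlMr//; nra.
  have h2 : (1 - 4 * y) ^+ 2 <= 1 by nra.
  have h3 : 1 - 16 * y <= ((1 - 4 * y) ^+ 2) ^+ 2 by nra.
  have h4 : y * (1 - 4 * y) ^+ 2 <= y by rewrite ler_piMr.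
  have h5 : 256 * 5 / 4 * z <= K * z by apply: ler_wpM2r.
  have h6 : (16 : R) ^+ 2 = 256 by ring.
  by rewrite h6; split; lra.
have C : dchi r s ^+ 2 <= K / r ^+ 4 * f2.
  rewrite Ed Ef (_ : (16 / r) ^+ 2 * _ = (16 ^+ 2 * (y * m ^+ 2)) / r ^+ 2); last by field.
  rewrite (_ : K / r ^+ 4 * _ = (K * z) / r ^+ 2); last by field.
  by rewrite ler_pM2r ?invr_gt0.
split => //.
  rewrite Ec Ef (_ : K / r ^+ 2 * _ = K * z)//; by field.
have Kr : 0 <= K / r by rewrite divr_ge0// ltW.
have : `|dchi r s| ^+ 2 <= (K / r) ^+ 2.
  rewrite real_normK ?num_real//; apply: le_trans C _; rewrite Ef.
  rewrite (_ : K / r ^+ 4 * _ = (K * z) / r ^+ 2); last by field.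
  rewrite (_ : (K / r) ^+ 2 = (K * K) / r ^+ 2); last by field.
  by rewrite ler_pM2r ?invr_gt0//; apply: ler_wpM2l => //; lra.
by rewrite ler_pXn2r ?nnegrE.
Qed.

End cutoff.

Section coord_mul.
Context {R : realType} {N : nat}.
Implicit Types (x y z : 'rV[R]_N) (i : 'I_N).
Local Notation mu := (@lebesgue_rV R N).
Local Notation sqint := (sqint mu).
Local Notation dotL := (dotL mu).
Local Notation fn := ('rV[R]_N -> R).
Variable i0 : 'I_N.

Definition cm (f : R -> R) (u : fn) : fn := fun x => f (x ord0 i0) * u x.

Section phi.
Variables (f df : R -> R) (B L : R).
Hypotheses (fd : forall s : R, is_derive s (1 : R) f (df s)) (dfc : mfun df)
  (fB : forall s, `|f s| <= B) (dfL : forall s, `|df s| <= L).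

Let L0 : 0 <= L. Proof. exact: le_trans (dfL 0). Qed.

Let mf : mfun (fun x : 'rV[R]_N => f (x ord0 i0)).
Proof.
apply: measurableT_comp (measurable_coord i0); apply: continuous_measurable_fun => s.
by apply: differentiable_continuous; apply/derivable1_diffP; have [] := fd s.
Qed.

Let mdf : mfun (fun x : 'rV[R]_N => df (x ord0 i0)).
Proof. exact: measurableT_comp dfc (measurable_coord i0). Qed.

Let lip (s h : R) : `|f (s + h) - f s| <= L * `|h|.
Proof.
have H (t : R) : is_derive t (1 : R) (fun r => f (s + r)) (df (s + t)).
  by have := @is_derive1_comp _ f _ _ _ _ (fd (s + t)) (is_derive_addl s t); rewrite mulr1.
have [c _] := mvt0 h H; rewrite addr0 => ->; rewrite normrM; exact: ler_wpM2r.
Qed.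

Let coord_line x i (h : R) : (x + h *: dirv i) ord0 i0 = x ord0 i0 + h * (i0 == i)%:R.
Proof. by rewrite !mxE eqxx /=. Qed.

Definition dcm i x := (i0 == i)%:R * df (x ord0 i0).

Lemma sderiv_cm i (u gu : fn) : sderiv i u gu ->
  sderiv i (cm f u) (fun x => f (x ord0 i0) * gu x + dcm i x * u x).
Proof.
have b1 : `|((i0 == i)%:R : R)| <= 1 by case: (i0 == i); rewrite ?normr1 ?normr0.
apply: (sderiv_mul mf _ (fun x => fB _) (L := L)).
- by apply: measurable_funM.
- by move=> x; rewrite /dcm normrM -[leRHS]mul1r; apply: ler_pM.
- move=> x h; rewrite coord_line; apply: le_trans (lip _ _) _; apply: ler_wpM2l => //.
  by rewrite normrM ler_piMr.
- move=> x; have := @is_derive_line R N (fun y => f (y ord0 i0)) x (dirv i) 0 (dcm i x).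
  rewrite scale0r addr0 => <-.
  rewrite (_ : (fun s => _) = fun s : R => f (x ord0 i0 + s * (i0 == i)%:R)); last first.
    by apply/funext => s; rewrite coord_line.
  have K : is_derive (0 : R) (1 : R) (fun s : R => x ord0 i0 + s * (i0 == i)%:R) ((i0 == i)%:R : R).
    have := is_deriveD (is_derive_cst (x ord0 i0) (0 : R) (1 : R)) (is_deriveM (is_derive_id (0 : R) (1 : R)) (is_derive_cst ((i0 == i)%:R : R) (0 : R) (1 : R))).
    by move=> h; apply: is_derive_eq h _; rewrite -![_ *: _]/(_ * _) /=; ring.
  have Fx : is_derive (x ord0 i0 + 0 * (i0 == i)%:R) (1 : R) f (df (x ord0 i0)) by rewrite mul0r addr0.
  by have := @is_derive1_comp _ f (fun s : R => x ord0 i0 + s * (i0 == i)%:R) 0 _ _ Fx K; rewrite mulrC.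
Qed.

Lemma H1_cm (u : fn) : H1 u -> H1 (cm f u).
Proof.
move=> Hu; apply: (@H1_intro _ _ _ (fun i x => f (x ord0 i0) * wgrad u i x + dcm i x * u x)).
  exact: (sqint_bdM mf (fun x => fB _) (H1_sqint Hu)).
by move=> i; exact: sderiv_cm (wgrad_sderiv i Hu).
Qed.

(** The IMS localization formula: the gradient cross terms of <f u, f u> and <u, f^2 u> agree, and
    only |f'|^2 u^2 is left over. *)
Lemma ip_cm (u : fn) : H1 u ->
  ip (cm f u) (cm f u) = ip u (cm f (cm f u)) + dotL (cm df u) (cm df u).
Proof.
move=> Hu; have S := dotL_si mu; have lu := H1_sqint Hu.
have lg i := sqint_wgrad i Hu.
have lfu (v : fn) : sqint v -> sqint (cm f v) by move=> lv; exact: (sqint_bdM mf (fun x => fB _) lv).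
have ldu : sqint (cm df u) by exact: (sqint_bdM mdf (fun x => dfL _) lu).
have s1 i := sderiv_cm (wgrad_sderiv i Hu); have s2 i := sderiv_cm (s1 i).
rewrite (ip_sderiv (lfu _ lu) (lfu _ lu) s1 s1) (ip_sderiv lu (lfu _ (lfu _ lu)) (fun i => wgrad_sderiv i Hu) s2).
have E0 : dotL (cm f u) (cm f u) = dotL u (cm f (cm f u)).
  by rewrite /dotL; congr Rintegral; apply/funext => x; rewrite /cm; ring.
rewrite E0 addrAC; congr (_ + _).
have Ei i : dotL (fun x => f (x ord0 i0) * wgrad u i x + dcm i x * u x) (fun x => f (x ord0 i0) * wgrad u i x + dcm i x * u x) =
   dotL (wgrad u i) (fun x => f (x ord0 i0) * (f (x ord0 i0) * wgrad u i x + dcm i x * u x) + dcm i x * cm f u x)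
   + (i0 == i)%:R * dotL (cm df u) (cm df u).
  have l1 := let: And3 _ l _ := s1 i in l; have l2 := let: And3 _ l _ := s2 i in l.
  rewrite /dotL -(IZ _ (sqintM ldu ldu)) -(ID (sqintM (lg i) l2) (intgZ _ (sqintM ldu ldu))).
  congr Rintegral; apply/funext => x; rewrite /cm /dcm.
  by case: (i0 == i); rewrite /=; ring.
rewrite (eq_bigr _ (fun i _ => Ei i)) big_split /=; congr (_ + _).
rewrite (bigD1 i0)//= eqxx mul1r big1 ?addr0// => i ni.
by rewrite eq_sym (negbTE ni) mul0r.
Qed.

End phi.
End coord_mul.

Lemma le_lim_near (R : realType) (T : Type) (F : set_system T) (PF : ProperFilter F) (f h : T -> R) (l k : R) :
  f t @[t --> F] --> l -> h t @[t --> F] --> k -> (\forall t \near F, f t <= h t) -> l <= k.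
Proof.
move=> fl hk fh; rewrite leNgt; apply/negP => kl.
have d0 : 0 < (l - k) / 2 by lra.
have A : \forall t \near F, `|l - f t| < (l - k) / 2 by move/cvgrPdist_lt : fl => /(_ _ d0).
have B : \forall t \near F, `|k - h t| < (l - k) / 2 by move/cvgrPdist_lt : hk => /(_ _ d0).
have [t [[]]] := filter_ex (filterI (filterI A B) fh).
by rewrite !ltr_norml => /andP[h2 h3] /andP[h4 h5] h1; lra.
Qed.

Lemma le_lim (R : realType) (T : Type) (F : set_system T) (PF : ProperFilter F) (f h : T -> R) (l k : R) :
  f t @[t --> F] --> l -> h t @[t --> F] --> k -> (forall t, f t <= h t) -> l <= k.
Proof. by move=> fl hk fh; apply: (le_lim_near PF fl hk); apply: filterE. Qed.

Lemma cvg_sub (R : realType) (F G : set_system nat) (a : nat -> R) (l : R) :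
  F `<=` G -> a n @[n --> F] --> l -> a n @[n --> G] --> l.
Proof. by move=> FG al A /al; exact: FG. Qed.

Lemma ultra_nat : exists2 F : set_system nat, UltraFilter F & \oo `<=` F.
Proof. by have [F [UF FF]] := @ultraFilterLemma nat \oo _; exists F. Qed.

(** S b - q is a nonnegative form on the orthogonal complement of [z] and vanishes at [e];
    Cauchy-Schwarz for this form puts [e] in its kernel. No differentiation is involved. *)
Lemma maximizer_eq (R : realType) (V : lmodType R) (P : V -> Prop) (b q : V -> V -> R) (S : R) (e z : V) :
  semi_inner P b -> semi_inner P q -> P e -> P z -> b e z = 0 -> q e e = S * b e e ->
  (forall w, P w -> b w z = 0 -> q w w <= S * b w w) ->
  forall w, P w -> b w z = 0 -> q e w = S * b e w.
Proof.
move=> Hb Hq Pe Pz ez qe H w Pw wz.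
have : (S * b e w - q e w) ^+ 2 <= (S * b e e - q e e) * (S * b w w - q w w).
  apply: quad_ge0; first by rewrite subr_ge0 H.
  move=> t; have Pt := siD Hb Pe (siZ Hb t Pw).
  have := H _ Pt; rewrite (sibDl Hb Pe (siZ Hb t Pw) Pz) (sibZl Hb _ Pw Pz) ez wz mulr0 addr0 => /(_ erefl).
  rewrite (sib_sqrD Hb Pe (siZ Hb t Pw)) (sib_sqrD Hq Pe (siZ Hq t Pw)).
  rewrite (sib_sqrZ Hb t Pw) (sib_sqrZ Hq t Pw) (sibZr Hb t Pw Pe) (sibZr Hq t Pw Pe); lra.
rewrite qe subrr mul0r => h; have : (S * b e w - q e w) ^+ 2 == 0 by rewrite eq_le h sqr_ge0.
by rewrite sqrf_eq0 subr_eq0 => /eqP.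
Qed.

Lemma lim_gt (R : realType) (T : Type) (F : set_system T) (PF : Filter F) (f : T -> R) (l k : R) :
  f t @[t --> F] --> l -> k < l -> \forall t \near F, k < f t.
Proof.
move=> fl kl; have d0 : 0 < l - k by rewrite subr_gt0.
have A : \forall t \near F, `|l - f t| < l - k by move/cvgrPdist_lt : fl => /(_ _ d0).
by apply: filterS A => t; rewrite ltr_norml => /andP[h2 h3]; lra.
Qed.

Lemma squeeze0 (R : realType) (T : Type) (F : set_system T) (PF : Filter F) (f h : T -> R) :
  (forall t, `|f t| <= h t) -> h t @[t --> F] --> (0 : R) -> f t @[t --> F] --> (0 : R).
Proof.
move=> fh /cvgr0Pnorm_le H; apply/cvgr0Pnorm_le => e e0; apply: filterS (H e e0) => t.
by apply: le_trans; apply: le_trans (fh t) _; exact: ler_norm.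
Qed.

(** Scalar part of the first alternative in [minimizer]: A is the squared norm before the limit, i
    and V are the norm and form of the weak limit, l is the form of the remainder. If the remainder
    satisfies its form inequality with a constant r < 1, the limit must satisfy the reverse one. *)
Lemma weak_form_bound (R : realType) (r A i l V : R) : r < 1 -> i <= A ->
  A <= V + l -> l <= r * (A - i) -> i <= V /\ (i = 0 -> V <= 0 -> A <= 0).
Proof. by move=> r1 iA AV lr; split=> [|i0 V0]; nra. Qed.

(** The opposite alternative: the weak limit has form at most r times its norm, so the remainder,
    with its form multiplied by 1 + e, dominates its norm with the uniform margin e (1 - r). *)
Lemma strict_form_bound (R : realType) (e r A i l V : R) : 0 < e -> 0 <= r -> r <= 1 -> 0 <= i -> i <= A ->
  A <= V + l -> V <= r * i -> e * (1 - r) * A <= (1 + e) * l - (A - i).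
Proof.
move=> e0 r0 r1 i0 iA AV Vr.
have h1 : (1 + e) * (A - r * i) <= (1 + e) * l by apply: ler_wpM2l; lra.
have h2 : 0 <= e * r * (A - i) by rewrite !mulr_ge0 ?subr_ge0// ltW.
have h3 : 0 <= (1 - r) * i by rewrite mulr_ge0// subr_ge0.
lra.
Qed.

(** * The minimization problem *)

Section choquard_kernel.
Context {R : realType} {N : nat}.
Implicit Types (x y z : 'rV[R]_N) (i : 'I_N).
Local Notation mu := (@lebesgue_rV R N).
Local Notation sqint := (sqint mu).
Local Notation dotL := (dotL mu).
Local Notation fn := ('rV[R]_N -> R).
Local Notation pt := ('rV[R]_N * 'rV[R]_N)%type.
Local Notation pm := (mu \x mu)%E.
Local Notation sq u := (fun x : 'rV[R]_N => u x ^+ 2).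
Variables (g c : R).
Hypotheses (N0 : (0 < N)%N) (g0 : 0 < g) (g4 : g < 4) (gN : g < N%:R) (c0 : 0 < c).
Local Notation DD := (DD g c).
Local Notation nD := (sinorm DD).
Let SD := DD_si N0 g0 g4 gN c0.
Let SH := @ip_si R N.
Let SL := @dotL_si _ _ _ mu.

Definition VV (f u w : fn) : R := DD f (fun x => u x * w x).

Lemma V_si (f : fn) : FF f -> (forall x, 0 <= f x) -> semi_inner (@H1 R N) (VV f).
Proof. exact: VV_si. Qed.

Let SV (f : fn) (Ff : FF f) (fge : forall x, 0 <= f x) : semi_inner (@H1 R N) (VV f) := V_si Ff fge.

Lemma VVE (f u : fn) : VV f u u = DD f (sq u). Proof. by []. Qed.

Lemma VV_bound (f : fn) : FF f -> (forall x, 0 <= f x) ->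
  exists2 C : R, 0 < C & forall u, H1 u -> VV f u u <= C * ip u u.
Proof.
move=> Ff fge; have [mf [p Hp fp]] := Ff; have [C C0 HC] := DD_bound g0 g4 gN c0 (N := N).
exists (C * ip p p + 1); first by rewrite ltr_wpDl ?mulr_ge0 ?(sib_ge0 SH)// ltW.
move=> u Hu; rewrite VVE; apply: le_trans (_ : DD (sq p) (sq u) <= _).
  apply: (DD_le g0 g4 gN c0 Ff (FFsq Hp) (FFsq Hu)) => x; last exact: sqr_ge0.
  by apply: le_trans (fp x); exact: ler_norm.
apply: le_trans (HC _ _ Hp Hu) _; rewrite mulrDl mul1r mulrA lerDl; exact: (sib_ge0 SH).
Qed.

Lemma weak_limit_norm (T : Type) (F : set_system T) (PF : ProperFilter F) (u : T -> fn) (u0 : fn) (M : R) :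
  0 <= M -> (forall t, H1 (u t)) -> H1 u0 -> (forall t, ip (u t) (u t) <= M) -> wcvg F u u0 -> ip u0 u0 <= M.
Proof.
move=> M0 Hu Hu0 uM wc; have H : ip (u t) u0 @[t --> F] --> ip u0 u0 by exact: wc.
have le : ip u0 u0 <= Num.sqrt M * Num.sqrt (ip u0 u0).
  have K : cst (Num.sqrt M * Num.sqrt (ip u0 u0)) t @[t --> F] --> Num.sqrt M * Num.sqrt (ip u0 u0) by exact: cvg_cst.
  apply: (le_lim PF H K) => t; apply: le_trans (ler_norm _) _.
  apply: le_trans (sib_CSn SH (Hu t) Hu0) _; apply: ler_wpM2r; first exact: sqrtr_ge0.
  exact: ler_wsqrtr.
have p := sib_ge0 SH Hu0.
have [z|nz] := eqVneq (ip u0 u0) 0; first by rewrite z.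
have p2 : 0 < Num.sqrt (ip u0 u0) by rewrite sqrtr_gt0 lt_neqAle eq_sym nz.
move: le; rewrite -{1}(sqr_sqrtr p) expr2 ler_pM2r// ler_sqrt//.
Qed.

(** The supremum of the form on the unit ball orthogonal to [zz] is attained because the form is
    weakly continuous. [zz = 0] yields the first eigenfunction, [zz = e1] the second. *)
Lemma eig_exists (f zz : fn) : FF f -> (forall x, 0 <= f x) -> H1 zz ->
  (exists u, [/\ H1 u, ip u zz = 0 & 0 < VV f u u]) ->
  exists e S, [/\ H1 e, ip e zz = 0, ip e e = 1, 0 < S &
   VV f e e = S /\ forall w, H1 w -> ip w zz = 0 -> VV f w w <= S * ip w w].
Proof.
move=> Ff fge Hz [v [Hv vz v0]]; have [C C0 HC] := VV_bound Ff fge; have SVf := V_si Ff fge.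
have vv : 0 < ip v v by rewrite lt_neqAle (sib_ge0 SH) // andbT; apply/eqP => E; have := HC v Hv; rewrite -E mulr0; lra.
pose A : set R := [set s | exists u, [/\ H1 u, ip u u <= 1, ip u zz = 0 & s = VV f u u]].
have hA : has_sup A.
  split; first by exists 0, 0; split; rewrite ?(sib0l SH)//; [exact: (si0 SH)|exact: (si0 SH)|rewrite (sib0l SVf)//; exact: (si0 SH)].
  exists C => _ [u [Hu u1 _ ->]]; apply: le_trans (HC u Hu) _.
  by rewrite -[leRHS]mulr1; apply: ler_wpM2l => //; exact: ltW.
pose S := sup A.
have SA u : H1 u -> ip u u <= 1 -> ip u zz = 0 -> VV f u u <= S.
  by move=> Hu u1 uz; apply: sup_upper_bound => //; exists u.
have Sle w : H1 w -> ip w zz = 0 -> VV f w w <= S * ip w w.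
  move=> Hw wz; have wp := sib_ge0 SH Hw.
  have [E|nz] := eqVneq (ip w w) 0; first by have := HC w Hw; rewrite E !mulr0.
  have w0 : 0 < ip w w by rewrite lt_neqAle eq_sym nz.
  pose k := (Num.sqrt (ip w w))^-1; have k2 : k ^+ 2 = (ip w w)^-1 by rewrite exprVn sqr_sqrtr.
  have := SA (k *: w) (siZ SH k Hw); rewrite (sib_sqrZ SH k Hw) (sib_sqrZ SVf k Hw) (sibZl SH k Hw Hz) wz mulr0 k2.
  by rewrite mulVf// lexx => /(_ isT erefl); rewrite ler_pdivrMl// mulrC.
have S0 : 0 < S by rewrite -(pmulr_lgt0 _ vv) (lt_le_trans v0)// Sle.
have /choice[u Hu] (n : nat) : exists u, [/\ H1 u, ip u u <= 1, ip u zz = 0 & S - n.+1%:R^-1 < VV f u u].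
  have e0 : 0 < (n.+1%:R^-1 : R) by rewrite invr_gt0.
  by have [_ [u [Hu u1 uz ->]] H] := sup_adherent e0 hA; exists u.
have [F UF oF] := ultra_nat.
have uH n : H1 (u n) by case: (Hu n). have u1 n : ip (u n) (u n) <= 1 by case: (Hu n).
have [e He We] := H1_weak_compact UF uH u1.
have e1 : ip e e <= 1 := weak_limit_norm _ ler01 uH He u1 We.
have ez : ip e zz = 0.
  have H := We _ Hz; have H2 : ip (u n) zz @[n --> F] --> (0 : R).
    by rewrite (_ : (fun n => _) = cst 0); [exact: cvg_cst|apply/funext => n; case: (Hu n)].
  exact: (cvg_unique (@Rhausdorff R) H H2).
have cV : VV f (u n) (u n) @[n --> F] --> VV f e e.
  exact: (weak_VV N0 g0 g4 gN c0 _ uH He u1 We uH He u1 We Ff fge).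
have cS : S - n.+1%:R^-1 @[n --> F] --> S.
  apply: (cvg_sub oF); rewrite -[X in _ --> X]subr0; apply: cvgB; [exact: cvg_cst|exact: harm_cvg].
have Se : S <= VV f e e.
  by apply: (le_lim _ cS cV) => n; case: (Hu n) => _ _ _ /ltW.
have Ve := Sle _ He ez.
have ee1 : ip e e = 1.
  apply/eqP; rewrite eq_le e1 /= -(ler_pM2l S0) mulr1; exact: le_trans Ve.
exists e, S; split => //; split => //; apply/eqP; rewrite eq_le Se andbT.
by rewrite -[leRHS]mulr1 -ee1.
Qed.

Lemma eig_eq (f zz e : fn) (S : R) : FF f -> (forall x, 0 <= f x) -> H1 zz -> H1 e -> ip e zz = 0 ->
  VV f e e = S * ip e e -> (forall w, H1 w -> ip w zz = 0 -> VV f w w <= S * ip w w) ->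
  forall w, H1 w -> ip w zz = 0 -> VV f e w = S * ip e w.
Proof.
move=> Ff fge Hz He ez Ve H w Hw wz.
exact: (maximizer_eq SH (SV Ff fge) He Hz ez Ve H Hw wz).
Qed.

(** Contrapositive of [DD_nonvanish], with [s] small enough for both terms of that bound to be at
    most d/4. The translation prevents the weak limits from vanishing. *)
Lemma nonvanish_shift (d M : R) : 0 < d -> 0 < M -> exists r s : R, [/\ 0 < r, 0 < s &
  forall u : fn, H1 u -> ip u u <= M -> d <= DD (sq u) (sq u) ->
  exists y, s <= \int[mu]_x (\1_(cube r) x * u (x + y) ^+ 2)].
Proof.
move=> d0 M0; have e0 : 0 < d / (4 * M ^+ 2) by rewrite divr_gt0// mulr_gt0// exprn_gt0.
have [B [r [B0 r0 H]]] := DD_nonvanish g0 g4 gN c0 e0 (N := N).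
pose s := d / (4 * (B + 1) * M).
have B1 : 0 < B + 1 by rewrite ltr_wpDl.
have s0 : 0 < s by rewrite divr_gt0// !mulr_gt0.
exists r, s; split => // u Hu uM du; apply: contrapT => /forallNP ny.
have Hy y : \int[mu]_x (\1_(cube r) (x - y) * u x ^+ 2) <= s.
  have /negP := ny y; rewrite -ltNge => /ltW.
  rewrite -(I_shift (f := fun x => \1_(cube r) (x - y) * u x ^+ 2) y).
    rewrite (_ : \int[mu]_x (\1_(cube r) (x + y - y) * u (x + y) ^+ 2) =
      \int[mu]_x (\1_(cube r) x * u (x + y) ^+ 2)) //.
    by apply: eq_Rintegral => x _; rewrite addrK.
  apply: measurable_funM; last by apply: measurable_funX; exact: H1_meas.
  have mI : mfun (\1_(cube r) : fn) by apply: measurable_indic; exact: measurable_cube.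
  exact: (measurableT_comp mI (measurable_shift (- y))).
have le := H u s Hu Hy.
have p := sib_ge0 SH Hu.
have a1 : d / (4 * M ^+ 2) * ip u u ^+ 2 <= d / 4.
  rewrite (_ : d / 4 = d / (4 * M ^+ 2) * M ^+ 2); last by field; rewrite gt_eqF.
  by apply: ler_wpM2l; [exact: ltW|rewrite ler_pXn2r ?nnegrE// ltW].
have a2 : B * s * ip u u <= d / 4.
  rewrite (_ : d / 4 = (B + 1) * s * M); last by rewrite /s; field; rewrite !gt_eqF.
  apply: ler_pM => //; first by rewrite mulr_ge0// ltW.
  by apply: ler_wpM2r; [exact: ltW|rewrite lerDl].
have : d <= d / 4 + d / 4 by apply: le_trans du _; apply: le_trans le _; exact: lerD.
lra.
Qed.

Lemma weak_nonzero (T : Type) (F : set_system T) (PF : ProperFilter F) (u : T -> fn) (u0 : fn) (M r s : R) :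
  (forall t, H1 (u t)) -> H1 u0 -> (forall t, ip (u t) (u t) <= M) -> wcvg F u u0 -> 0 < r -> 0 < s ->
  (forall t, s <= \int[mu]_x (\1_(cube r) x * u t x ^+ 2)) -> 0 < ip u0 u0.
Proof.
move=> Hu Hu0 uM wc r0 s0 H; rewrite lt_neqAle (sib_ge0 SH Hu0) andbT; apply/eqP => E.
have H0 : H1 (0 : fn) := si0 SH.
have wc0 : wcvg F u 0.
  move=> w Hw; rewrite (sib0l SH Hw) (_ : 0 = ip u0 w); first exact: wc.
  apply/esym/eqP; rewrite -sqrf_eq0 eq_le sqr_ge0 andbT.
  by have := sib_CS SH Hu0 Hw; rewrite -E mul0r.
have dc w : sqint w -> dotL (u t) w @[t --> F] --> (0 : R).
  move=> lw; have X : dotL (u t) w @[t --> F] --> dotL 0 w by exact: (ip_weak_dotL Hu H0 wc0 lw).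
  by rewrite (sib0l (dotL_si mu) lw) in X.
have cv : \int[mu]_x (\1_(cube r) x * u t x ^+ 2) @[t --> F] --> (0 : R) by exact: (rellich Hu uM r0 dc).
have K : cst s t @[t --> F] --> s by exact: cvg_cst.
have : s <= 0 by apply: (le_lim PF K cv).
by rewrite leNgt s0.
Qed.

Lemma energy_limit (T : Type) (F : set_system T) (PF : ProperFilter F) (u : T -> fn) (u0 : fn) (M : R) :
  (forall t, H1 (u t)) -> H1 u0 -> (forall t, ip (u t) (u t) <= M) -> wcvg F u u0 ->
  DD (sq u0) (sq (u t - u0)) @[t --> F] --> (0 : R) /\
  ip (u t) (u t) - ip (u t - u0) (u t - u0) @[t --> F] --> ip u0 u0.
Proof.
move=> Hu Hu0 uM wc; have wc0 := wcvgB PF Hu Hu0 wc; split.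
  have HB t : H1 (u t - u0) := siB SH (Hu t) Hu0.
  apply: (weak_DD0 N0 g0 g4 gN c0 PF (u := fun t => u t - u0) (M := 2 * M + 2 * ip u0 u0)) => //; last exact: FFsq.
  move=> t; have := sib_parallelogram SH (Hu t) Hu0; have := sib_ge0 SH (siD SH (Hu t) Hu0).
  have := uM t; lra.
have H : 2 * ip (u t) u0 - ip u0 u0 @[t --> F] --> 2 * ip u0 u0 - ip u0 u0.
  by apply: cvgB; [apply: cvgMr; exact: wc|exact: cvg_cst].
rewrite (_ : 2 * ip u0 u0 - ip u0 u0 = ip u0 u0) in H; last by ring.
apply: cvg_trans H; apply: near_eq_cvg; apply: nearW => t; rewrite (sib_sqrB SH (Hu t) Hu0); ring.
Qed.

Definition Mconst (M : R) (w : fn) := [/\ H1 w, (forall x, 0 <= w x), ip w w = 1, 0 < M &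
  DD (sq w) (sq w) = M /\ forall u, H1 u -> DD (sq u) (sq u) <= M * ip u u ^+ 2].

Lemma H1_nonzero : exists2 v : fn, H1 v & 0 < DD (sq v) (sq v).
Proof.
pose v : fn := ccut 2; have Hv : H1 v by apply: H1_test; exact: test_box_bump.
have nv : ~ ae_zero (sq v).
  move=> H; have : mu.-negligible (cube 1 : set 'rV[R]_N).
    apply: negligibleS H => x xc /= /eqP; rewrite sqrf_eq0 => /eqP E.
    have : expR (- 2) ^+ N <= v x.
      apply: ccut_ge => i; rewrite (_ : 2 - 1 = 1 :> R); last by lra.
      by apply: ltW; have /cubeP := xc; apply.
    by rewrite E leNgt exprn_gt0// expR_gt0.
  move=> /(measure_negligible (measurable_cube 1)) E.
  have := @box_gt0 R N (const_mx (- 1)) (const_mx 1); rewrite -/(cube 1) E ltxx => H0.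
  by suff : false by []; apply: H0 => i; rewrite !mxE; lra.
exists v => //; apply: (DD_gt0 N0 g0 g4 gN c0 (FFsq Hv) (FFsq Hv)) => // x; exact: sqr_ge0.
Qed.

Lemma sqrt_cvg (T : Type) (F : set_system T) {FF : Filter F} (a : T -> R) (l : R) :
  a t @[t --> F] --> l -> Num.sqrt (a t) @[t --> F] --> Num.sqrt l.
Proof. by move=> H; apply: (cvg_comp _ _ H); exact: sqrt_continuous. Qed.

(** Translations exclude vanishing. If t in ]0, 1] is the squared norm of the weak limit, splitting
    would give M <= M t^2 + M (1 - t)^2, which forces t = 1. *)
Lemma M_exists : exists M w, Mconst M w.
Proof.
have [C C0 HC] := DD_bound g0 g4 gN c0 (N := N).
have [v Hv v0] := H1_nonzero.
pose E (u : fn) := DD (sq u) (sq u).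
have EC u : H1 u -> E u <= C * ip u u ^+ 2 by move=> Hu; rewrite expr2; exact: HC.
have EZ (k : R) u : H1 u -> E (k *: u) = k ^+ 4 * E u.
  move=> Hu; rewrite /E (_ : sq (k *: u) = k ^+ 2 *: sq u); last first.
    by apply/funext => x; rewrite -[(k *: u) x]/(k * u x) -[RHS]/(k ^+ 2 * u x ^+ 2) exprMn.
  by rewrite (sib_sqrZ SD _ (FFsq Hu)) -exprM.
have E_ge0 u : H1 u -> 0 <= E u by move=> Hu; exact: (DD_pos N0 g0 g4 gN c0 (FFsq Hu)).
have vv : 0 < ip v v.
  rewrite lt_neqAle (sib_ge0 SH) // andbT; apply/eqP => E0; have := EC v Hv; rewrite -E0 expr0n mulr0.
  by rewrite leNgt v0.
pose A : set R := [set s | exists u, [/\ H1 u, ip u u <= 1 & s = E u]].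
have hA : has_sup A.
  split; first by exists (E 0), 0; split; rewrite ?(sib0l SH)//; exact: (si0 SH).
  exists C => _ [u [Hu u1 ->]]; apply: le_trans (EC u Hu) _.
  rewrite -[leRHS]mulr1; apply: ler_wpM2l; [exact: ltW|exact: exprn_ile1 (sib_ge0 SH Hu) u1].
pose M := sup A.
have MA u : H1 u -> ip u u <= 1 -> E u <= M.
  by move=> Hu u1; apply: sup_upper_bound => //; exists u.
have Mle w : H1 w -> E w <= M * ip w w ^+ 2.
  move=> Hw; have wp := sib_ge0 SH Hw.
  have [z|nz] := eqVneq (ip w w) 0; first by have := EC w Hw; rewrite z expr0n !mulr0.
  have w0 : 0 < ip w w by rewrite lt_neqAle eq_sym nz.
  pose k := (Num.sqrt (ip w w))^-1; have k2 : k ^+ 2 = (ip w w)^-1 by rewrite exprVn sqr_sqrtr.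
  have k4 : k ^+ 4 = (ip w w ^+ 2)^-1 by rewrite (exprM k 2 2) k2 exprVn.
  have := MA (k *: w) (siZ SH k Hw); rewrite (sib_sqrZ SH k Hw) EZ// k2 k4.
  by rewrite mulVf// lexx => /(_ isT); rewrite ler_pdivrMl ?exprn_gt0// mulrC.
have M0 : 0 < M by rewrite -(pmulr_lgt0 _ (exprn_gt0 2 vv)) (lt_le_trans v0)// Mle.
have M2 : 0 < M / 2 by rewrite divr_gt0.
have [r [s [r0 s0 NV]]] := nonvanish_shift M2 ltr01.
(* The error M/2 / (n+1) keeps every energy above M/2, so that the nonvanishing estimate holds for
   all n and not only eventually. *)
have /choice[u Hu] (n : nat) : exists u, [/\ H1 u, ip u u <= 1, M - M / 2 * n.+1%:R^-1 < E u &
    s <= \int[mu]_x (\1_(cube r) x * u x ^+ 2)].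
  have e0 : 0 < M / 2 * n.+1%:R^-1 by rewrite mulr_gt0 ?invr_gt0.
  have [_ [u [Hu u1 ->]] H] := sup_adherent e0 hA.
  have n1 : n.+1%:R^-1 <= 1 :> R by rewrite invf_le1// ler1n.
  have e1 : M / 2 * n.+1%:R^-1 <= M / 2 by rewrite ler_piMr// ltW.
  have [|y Hy] := NV u Hu u1; first by have H' : M - M / 2 * n.+1%:R^-1 < DD (sq u) (sq u) := H; apply: le_trans (ltW H'); apply: le_trans (_ : M - M / 2 <= _); [lra|by rewrite lerD2l lerN2].
  exists (fun x => u (x + y)); split => //; [exact: H1_shift|by rewrite ip_shift|].
  by rewrite /E (DD_shift g0 g4 gN c0 y (FFsq Hu) (FFsq Hu)).
have [F UF oF] := ultra_nat.
have uH n : H1 (u n) by case: (Hu n). have u1 n : ip (u n) (u n) <= 1 by case: (Hu n).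
have [w Hw Ww] := H1_weak_compact UF uH u1.
have w0 : 0 < ip w w by apply: (weak_nonzero _ uH Hw u1 Ww r0 s0) => n; case: (Hu n).
have w1 : ip w w <= 1 := weak_limit_norm _ ler01 uH Hw u1 Ww.
have HB n : H1 (u n - w) := siB SH (uH n) Hw.
have [cv1 cv2] := energy_limit _ uH Hw u1 Ww.
have dec : sinorm DD (sq (u n) - (sq w + sq (u n - w))) @[n --> F] --> (0 : R).
  exact: (weak_decouple N0 g0 g4 gN c0 _ uH Hw u1 Ww).
pose X n := E w + 2 * DD (sq w) (sq (u n - w)) + M * (1 - (ip (u n) (u n) - ip (u n - w) (u n - w))) ^+ 2.
have cX : X n @[n --> F] --> E w + 2 * 0 + M * (1 - ip w w) ^+ 2.
  apply: cvgD; first by apply: cvgD; [exact: cvg_cst|apply: cvgMr; exact: cv1].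
  apply: cvgMr; rewrite expr2; under eq_fun do rewrite expr2.
  by apply: cvgM; apply: cvgB; [exact: cvg_cst|exact: cv2|exact: cvg_cst|exact: cv2].
have key n : Num.sqrt (M - M / 2 * n.+1%:R^-1) <=
    sinorm DD (sq (u n) - (sq w + sq (u n - w))) + Num.sqrt (X n).
  have Fh := siD SD (FFsq Hw) (FFsq (HB n)); have Fu := FFsq (uH n).
  apply: le_trans (_ : sinorm DD (sq (u n)) <= _).
    by apply: ler_wsqrtr; apply: ltW; case: (Hu n).
  have := sinormD SD (siB SD Fu Fh) Fh; rewrite subrK => /le_trans; apply; rewrite lerD2l.
  apply: ler_wsqrtr; rewrite (sib_sqrD SD (FFsq Hw) (FFsq (HB n))) -/(E w) -/(E (u n - w)) /X lerD2l.
  apply: le_trans (Mle _ (HB n)) _; apply: ler_wpM2l; first exact: ltW.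
  have p := sib_ge0 SH (HB n); have := u1 n => un.
  by rewrite ler_pXn2r ?nnegrE//; lra.
have cS : M - M / 2 * n.+1%:R^-1 @[n --> F] --> M.
  apply: (cvg_sub oF); rewrite -[X in _ --> X]subr0 -(mulr0 (M / 2)).
  by apply: cvgB; [exact: cvg_cst|apply: cvgMr; exact: harm_cvg].
(* The remainder has squared norm tending to at most 1 - |w|^2 and obeys the inequality with
   constant M; the cross term with w^2 disappears. *)
have lim : M <= E w + 2 * 0 + M * (1 - ip w w) ^+ 2.
  have a1 : Num.sqrt (M - M / 2 * n.+1%:R^-1) @[n --> F] --> Num.sqrt M by exact: (sqrt_cvg cS).
  have a2 : sinorm DD (sq (u n) - (sq w + sq (u n - w))) + Num.sqrt (X n) @[n --> F] -->
      0 + Num.sqrt (E w + 2 * 0 + M * (1 - ip w w) ^+ 2) by apply: cvgD; [exact: dec|exact: (sqrt_cvg cX)].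
  rewrite add0r in a2; have := le_lim _ a1 a2; rewrite ler_sqrt; last first.
    rewrite mulr0 addr0; apply: addr_ge0; [exact: E_ge0|apply: mulr_ge0; [exact: ltW|exact: sqr_ge0]].
  by apply.
have Mw := Mle _ Hw.
have ww1 : ip w w = 1.
  apply/eqP; rewrite eq_le w1 /=.
  have : M * (1 - ip w w ^+ 2 - (1 - ip w w) ^+ 2) <= 0 by lra.
  rewrite pmulr_rle0// (_ : _ - _ = 2 * (ip w w * (1 - ip w w))); last by ring.
  by rewrite pmulr_rle0// pmulr_rle0// subr_le0.
have Ew : E w = M.
  apply/eqP; rewrite eq_le; move: lim Mw; rewrite ww1 subrr expr0n/= expr1n !mulr0 !addr0 mulr1.
  by move=> -> ->.
have [Ha Ha1] := H1_abs Hw.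
have Ea : E (fun x => `|w x|) = M.
  by rewrite -Ew /E; congr DD; apply/funext => x; rewrite real_normK ?num_real.
have aa1 : ip (fun x => `|w x|) (fun x => `|w x|) = 1.
  apply/eqP; rewrite eq_le -{1}ww1 Ha1 /=.
  have := Mle _ Ha; rewrite Ea -{1}(mulr1 M) ler_pM2l//.
  by rewrite -{1}(expr1n _ 2) ler_pXn2r ?nnegrE// (sib_ge0 SH Ha).
exists M, (fun x => `|w x|); split => //; split => //; exact: Mle.
Qed.

Section with_M.
Variables (M : R) (wM : fn).
Hypothesis HM : Mconst M wM.

Lemma DD_M (u : fn) f : H1 u -> FF f -> DD f (sq u) <= Num.sqrt (M * DD f f) * ip u u.
Proof.
case: HM => _ _ _ M0 [_ Mle] Hu Ff; apply: le_trans (ler_norm _) _.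
apply: le_trans (sib_CSn SD Ff (FFsq Hu)) _; rewrite mulrC sqrtrM ?(ltW M0)// mulrAC.
apply: ler_wpM2r; first exact: sqrtr_ge0.
apply: le_trans (ler_wsqrtr (Mle _ Hu)) _.
by rewrite sqrtrM ?(ltW M0)// sqrtr_sqr ger0_norm// (sib_ge0 SH Hu).
Qed.

(** By [DD_M] the quadratic form attached to wM^2 is at most M times the squared norm, with equality
    at wM. The Euler equation of the quartic problem is thus an eigenvalue equation. *)
Lemma wM_eq (v : fn) : H1 v -> DD (sq wM) (fun x => wM x * v x) = M * ip wM v.
Proof.
case: HM => Hw w0 w1 M0 [Ew Mle] Hv; have H0 := si0 SH.
have Ve : VV (sq wM) wM wM = M * ip wM wM by rewrite w1 mulr1 -Ew.
have mx w : H1 w -> ip w 0 = 0 -> VV (sq wM) w w <= M * ip w w; last first.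
  exact: (eig_eq (FFsq Hw) (fun x => sqr_ge0 _) H0 Hw (sib0r SH Hw) Ve mx Hv (sib0r SH Hv)).
move=> Hw' _; apply: le_trans (DD_M Hw' (FFsq Hw)) _; by rewrite Ew -expr2 sqrtr_sqr ger0_norm// ltW.
Qed.

End with_M.

Lemma ae_zero_ip (u : fn) : H1 u -> ae_zero u -> ip u u = 0.
Proof. by move=> Hu u0; rewrite (ip_ae Hu (si0 SH) Hu u0) (sib0l SH Hu). Qed.

Lemma ip_gt0 (u : fn) : H1 u -> ~ ae_zero u -> 0 < ip u u.
Proof.
move=> Hu nu; rewrite lt_neqAle (sib_ge0 SH Hu) andbT; apply/eqP => E.
by apply: nu; exact: ip_eq0_ae.
Qed.

Lemma ae_zero_sq (u : fn) : ae_zero (sq u) -> ae_zero u.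
Proof. by apply: filterS => x /eqP; rewrite sqrf_eq0 => /eqP. Qed.

Lemma DD_sq_gt0 (u : fn) : H1 u -> 0 < ip u u -> 0 < DD (sq u) (sq u).
Proof.
move=> Hu u0; have nu : ~ ae_zero (sq u).
  by move=> /ae_zero_sq /(ae_zero_ip Hu) E; rewrite E ltxx in u0.
by apply: (DD_gt0 N0 g0 g4 gN c0 (FFsq Hu) (FFsq Hu)) => // x; exact: sqr_ge0.
Qed.

Lemma VV_disjoint (f u w : fn) : FF f -> (forall x, u x * w x = 0) -> VV f u w = 0.
Proof.
move=> Ff uw; rewrite /VV (_ : (fun x => _) = 0) ?(sib0r SD Ff)//.
by apply/funext => x; exact: uw.
Qed.

Lemma VV_ge0 (f u w : fn) : (forall x, 0 <= f x) -> (forall x, 0 <= u x) -> (forall x, 0 <= w x) -> 0 <= VV f u w.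
Proof. by move=> f0 u0 w0; apply: (DD_ge0 g c0) => // x; exact: mulr_ge0. Qed.

Section posneg.
Variables (b : fn -> fn -> R) (Sb : semi_inner (@H1 R N) b) (e : fn).
Hypotheses (He : H1 e) (dis : b e^\+ e^\- = 0).
Let Hp := H1_pos He. Let Hn := H1_neg He.

Lemma pn_pos : b e e^\+ = b e^\+ e^\+.
Proof. by rewrite -{1}(posneg_eq e) (sibBl Sb Hp Hn Hp) (sibC Sb Hn Hp) dis subr0. Qed.

Lemma pn_neg : b e e^\- = - b e^\- e^\-.
Proof. by rewrite -{1}(posneg_eq e) (sibBl Sb Hp Hn Hn) dis sub0r. Qed.

Lemma pn_sum : b e e = b e^\+ e^\+ + b e^\- e^\-.
Proof. by rewrite -{2}(posneg_eq e) (sibBr Sb Hp Hn He) pn_pos pn_neg opprK. Qed.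
End posneg.

(* The form |u|^2 - DD(f, u^2) is nonpositive on the plane spanned by p and q; the
   last clause says that p and q are independent. *)
Definition Adm (f : fn) := [/\ FF f, (forall x, 0 <= f x) & exists p q, [/\ H1 p, H1 q &
  forall a b : R, ip (a *: p + b *: q) (a *: p + b *: q) <= VV f (a *: p + b *: q) (a *: p + b *: q) /\
    (ip (a *: p + b *: q) (a *: p + b *: q) = 0 -> a = 0 /\ b = 0)]].

(** [S1] and [S] are inverses of the first two eigenvalues of - Laplacian + 1 with weight I_alpha *
    f, so that [1 <= S] says that the second eigenvalue is at most 1. *)
Record spec2 (f e1 e : fn) (S1 S : R) : Prop := Spec2 {
  sp_H1 : H1 e1; sp_H : H1 e; sp_ge0 : forall x, 0 <= e1 x;
  sp_11 : ip e1 e1 = 1; sp_ee : ip e e = 1; sp_orth : ip e e1 = 0;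
  sp_S : 1 <= S; sp_S1 : S <= S1;
  sp_eq1 : forall w, H1 w -> VV f e1 w = S1 * ip e1 w;
  sp_eq : forall w, H1 w -> VV f e w = S * ip e w;
  sp_pos : 0 < ip e^\+ e^\+; sp_neg : 0 < ip e^\- e^\- }.

Lemma max_principle_eig (f e : fn) (S : R) (r : fn) : FF f -> (forall x, 0 <= f x) -> H1 e ->
  (forall x, 0 <= e x) -> 0 < ip e e -> 0 < S ->
  (forall w, H1 w -> VV f e w = S * ip e w) -> sqint r ->
  {ae mu, forall x, e x * r x = 0} -> ae_zero r.
Proof.
move=> Ff fge He ege e0 S0 eqe lr; apply: (max_principle He ege) => //.
  move=> psi Hp p0; rewrite -(pmulr_rge0 _ S0) -eqe//; exact: VV_ge0.
by move=> /(ae_zero_ip He) E; rewrite E ltxx in e0.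
Qed.

(** The first eigenfunction may be taken nonnegative by passing to its absolute value. The second is
    orthogonal to it, also for the form of [f]; the form being positive on nonnegative functions,
    both of its parts must be nonzero. *)
Lemma Adm_spec (f : fn) : Adm f -> exists e1 e S1 S, spec2 f e1 e S1 S.
Proof.
case=> Ff fge [p [q [Hp Hq pq]]]; have SVf := SV Ff fge; have H0 := si0 SH.
pose th (a b : R) : fn := a *: p + b *: q.
have Hth a b : H1 (th a b) := siD SH (siZ SH a Hp) (siZ SH b Hq).
have th_gt0 a b : (a != 0) || (b != 0) -> 0 < ip (th a b) (th a b) /\ ip (th a b) (th a b) <= VV f (th a b) (th a b).
  move=> ab; have [h1 h2] := pq a b; split=> //.
  rewrite lt_neqAle (sib_ge0 SH (Hth a b)) andbT; apply/eqP => E; have [a0 b0] := h2 (esym E).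
  by rewrite a0 b0 eqxx in ab.
have [e0 [S1 [He0 _ e01 S10 [Ve0 max0]]]] : exists e S, [/\ H1 e, ip e 0 = 0, ip e e = 1, 0 < S &
   VV f e e = S /\ forall w, H1 w -> ip w 0 = 0 -> VV f w w <= S * ip w w].
  apply: (eig_exists Ff fge H0); exists (th 1 0).
  have [|h1 h2] := th_gt0 1 0; first by rewrite oner_eq0.
  by split; [exact: Hth|rewrite (sib0r SH (Hth 1 0))|exact: lt_le_trans h2].
have max1 w : H1 w -> VV f w w <= S1 * ip w w by move=> Hw; apply: max0 => //; rewrite (sib0r SH Hw).
pose e1 : fn := fun x => `|e0 x|; have [He1 ip1] : H1 e1 /\ ip e1 e1 <= ip e0 e0 := H1_abs He0.
have V1 : VV f e1 e1 = S1.
  by rewrite -Ve0; congr DD; apply/funext => x; rewrite /e1 -normrM ger0_norm// -expr2 sqr_ge0.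
have e11 : ip e1 e1 = 1.
  apply/eqP; rewrite eq_le -{1}e01 ip1 /= -(ler_pM2l S10) mulr1 -{1}V1; exact: max1.
have eq1 w : H1 w -> VV f e1 w = S1 * ip e1 w.
  move=> Hw; apply: (eig_eq Ff fge H0 He1 _ _ _ Hw); rewrite ?(sib0r SH)//.
  by rewrite e11 mulr1.
have e1ge x : 0 <= e1 x by exact: normr_ge0.
(* A plane meets every hyperplane; the vector found satisfies the form inequality and shows that the
   second maximum is at least 1. *)
have [a [b [ab orth]]] : exists a b : R, (a != 0) || (b != 0) /\ ip (th a b) e1 = 0.
  have E a b : ip (th a b) e1 = a * ip p e1 + b * ip q e1.
    by rewrite (sibDl SH (siZ SH a Hp) (siZ SH b Hq) He1) (sibZl SH _ Hp He1) (sibZl SH _ Hq He1).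
  have [z|nz] := eqVneq (ip p e1) 0.
    by exists 1, 0; rewrite oner_eq0 E z mulr0 mul0r addr0.
  by exists (ip q e1), (- ip p e1); rewrite oppr_eq0 nz orbT E mulNr mulrC subrr.
have [t0 tV] := th_gt0 a b ab.
have [e [S [He ee1 ee S0 [Ve maxe]]]] : exists e S, [/\ H1 e, ip e e1 = 0, ip e e = 1, 0 < S &
   VV f e e = S /\ forall w, H1 w -> ip w e1 = 0 -> VV f w w <= S * ip w w].
  apply: (eig_exists Ff fge He1); exists (th a b).
  by split; [exact: Hth|exact: orth|exact: lt_le_trans tV].
have S1' : 1 <= S.
  by rewrite -(ler_pM2r t0) mul1r; apply: le_trans tV _; exact: (maxe _ (Hth a b) orth).
have Vee1 : VV f e e1 = 0 by rewrite (sibC SVf He He1) eq1// (sibC SH He1 He) ee1 mulr0.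
(* The test function is projected orthogonally to [e1]; the removed component contributes to neither
   side, since [e1] is an eigenfunction and orthogonal to [e]. *)
have eqe w : H1 w -> VV f e w = S * ip e w.
  move=> Hw; pose k := ip w e1; have Hk := siZ SH k He1; have Hwk := siB SH Hw Hk.
  have wk : ip (w - k *: e1) e1 = 0 by rewrite (sibBl SH Hw Hk He1) (sibZl SH k He1 He1) e11 mulr1 subrr.
  have := eig_eq Ff fge He1 He ee1 _ maxe Hwk wk.
  rewrite ee mulr1 => /(_ Ve); rewrite (sibBr SVf Hw Hk He) (sibZr SVf k He1 He) Vee1 mulr0 subr0.
  by rewrite (sibBr SH Hw Hk He) (sibZr SH k He1 He) ee1 mulr0 subr0.
have Hep := H1_pos He; have Hen := H1_neg He.
have e1p : 0 < ip e1 e1 by rewrite e11.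
(* A zero form value forces e1 r = 0 almost everywhere, the kernel being positive and [f] nonzero;
   the maximum principle for [e1] gives r = 0. *)
have nz r : H1 r -> (forall x, 0 <= r x) -> VV f e1 r = 0 -> ae_zero r.
  move=> Hr rge E; apply: (max_principle_eig Ff fge He1 e1ge e1p S10 eq1 (H1_sqint Hr)).
  apply: contrapT => ne.
  have nf : ~ ae_zero f.
    move=> zf; have : VV f e1 e1 = DD 0 (fun x => e1 x * e1 x).
      exact: (DD_ae g0 g4 gN c0 Ff FF0 (FFM He1 He1) zf).
    by rewrite V1 (sib0l SD (FFM He1 He1)) => S1z; rewrite S1z ltxx in S10.
  have := DD_gt0 N0 g0 g4 gN c0 Ff (FFM He1 Hr) fge (fun x => mulr_ge0 (e1ge x) (rge x)) nf ne.
  by rewrite -/(VV f e1 r) E ltxx.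
have Vpn : VV f e1 e^\+ = VV f e1 e^\-.
  by apply/eqP; rewrite -subr_eq0 -(sibBr SVf Hep Hen He1) posneg_eq (sibC SVf He1 He) Vee1.
have zV r : H1 r -> ip r r = 0 -> VV f e1 r = 0.
  move=> Hr rz; apply/eqP; rewrite -sqrf_eq0 eq_le sqr_ge0 andbT.
  apply: le_trans (sib_CS SVf He1 Hr) _; rewrite mulr_ge0_le0 ?(sib_ge0 SVf)//.
  by have := max1 _ Hr; rewrite rz mulr0.
have pge x : 0 <= e^\+ x by rewrite /funrpos le_max lexx orbT.
have nge x : 0 <= e^\- x by rewrite /funrneg le_max lexx orbT.
have sum := pn_sum SH He (ip_pos_neg0 He).
exists e1, e, S1, S; split=> //.
- by have := max1 _ He; rewrite ee mulr1 Ve.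
- rewrite lt_neqAle (sib_ge0 SH Hep) andbT; apply/eqP => E.
  have := zV _ Hep (esym E); rewrite Vpn => /(nz _ Hen nge)/(ae_zero_ip Hen) E2.
  by move: sum; rewrite ee -E E2 addr0 => /eqP; rewrite oner_eq0.
- rewrite lt_neqAle (sib_ge0 SH Hen) andbT; apply/eqP => E.
  have := zV _ Hen (esym E); rewrite -Vpn => /(nz _ Hep pge)/(ae_zero_ip Hep) E2.
  by move: sum; rewrite ee -E E2 addr0 => /eqP; rewrite oner_eq0.
Qed.

Definition pairf (t s : R) (p q : fn) : fn := t *: sq p + s *: sq q.

(* Complementarity conditions characterizing the density of least energy among
   those satisfying DD(f, p^2) >= |p|^2 and DD(f, q^2) >= |q|^2. *)
Definition Pr (p q : fn) (t s : R) := [/\ 0 <= t, 0 <= s, ip p p <= DD (pairf t s p q) (sq p),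
  ip q q <= DD (pairf t s p q) (sq q) & DD (pairf t s p q) (pairf t s p q) = t * ip p p + s * ip q q].

(** The 2x2 linear complementarity problem. If one multiplier alone already satisfies the other
    constraint, the other multiplier is 0. If neither does, the determinant is positive and the
    linear system has a nonnegative solution. *)
Lemma lcp (a b d n m : R) : 0 < a -> 0 < d -> 0 <= b -> 0 < n -> 0 < m -> exists t s : R,
  [/\ 0 <= t, 0 <= s, n <= a * t + b * s, m <= b * t + d * s &
    t * (a * t + b * s) + s * (b * t + d * s) = t * n + s * m].
Proof.
move=> a0 d0 b0 n0 m0.
have [h1|h1] := leP (a * m) (b * n).
  have E : a * (n / a) = n by field; rewrite gt_eqF.
  exists (n / a), 0; rewrite !mulr0 !addr0 !mul0r !addr0 E; split => //.
  - by rewrite divr_ge0// ltW.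
  - by rewrite mulrA ler_pdivlMr// mulrC.
have [h2|h2] := leP (d * n) (b * m).
  have E : d * (m / d) = m by field; rewrite gt_eqF.
  exists 0, (m / d); rewrite !mulr0 !add0r !mul0r !add0r E; split => //.
  - by rewrite divr_ge0// ltW.
  - by rewrite mulrA ler_pdivlMr// mulrC.
have det : 0 < a * d - b * b.
  have nm : 0 < n * m by rewrite mulr_gt0.
  rewrite -(pmulr_rgt0 _ nm) mulrBr subr_gt0.
  rewrite (_ : n * m * (b * b) = (b * n) * (b * m)); last by ring.
  rewrite (_ : n * m * (a * d) = (a * m) * (d * n)); last by ring.
  apply: (@le_lt_trans _ _ ((a * m) * (b * m))).
    by apply: ler_wpM2r; [rewrite mulr_ge0// ltW|exact: ltW].
  by rewrite ltr_pM2l// mulr_gt0.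
have nd : a * d - b * b != 0 by rewrite gt_eqF.
pose t := (d * n - b * m) / (a * d - b * b); pose s := (a * m - b * n) / (a * d - b * b).
have E1 : a * t + b * s = n by rewrite /t /s; field.
have E2 : b * t + d * s = m by rewrite /t /s; field.
exists t, s; rewrite E1 E2; split => //; rewrite divr_ge0 ?(ltW det)// subr_ge0; exact: ltW.
Qed.

Section pair.
Variables p q : fn.
Hypotheses (Hp : H1 p) (Hq : H1 q).
Let Fp := FFsq Hp. Let Fq := FFsq Hq.

Lemma FF_pairf t s : FF (pairf t s p q).
Proof. exact: (siD SD (siZ SD t Fp) (siZ SD s Fq)). Qed.

Lemma pairf_ge0 t s x : 0 <= t -> 0 <= s -> 0 <= pairf t s p q x.
Proof. by move=> t0 s0; rewrite /pairf !fctE; apply: addr_ge0; apply: mulr_ge0; rewrite ?sqr_ge0. Qed.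

Lemma DD_pairl t s h : FF h -> DD (pairf t s p q) h = t * DD (sq p) h + s * DD (sq q) h.
Proof.
by move=> Fh; rewrite (sibDl SD (siZ SD t Fp) (siZ SD s Fq) Fh) (sibZl SD t Fp Fh) (sibZl SD s Fq Fh).
Qed.

Lemma DD_pairr t s h : FF h -> DD h (pairf t s p q) = t * DD h (sq p) + s * DD h (sq q).
Proof.
by move=> Fh; rewrite (sibC SD Fh (FF_pairf t s)) DD_pairl// (sibC SD Fp Fh) (sibC SD Fq Fh).
Qed.

Lemma Pr_exists : 0 < ip p p -> 0 < ip q q -> exists t s, Pr p q t s.
Proof.
move=> p0 q0.
have a0 := DD_sq_gt0 Hp p0; have d0 := DD_sq_gt0 Hq q0.
have b0 : 0 <= DD (sq p) (sq q) by apply: (DD_ge0 g c0) => x; exact: sqr_ge0.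
have [t [s [t0 s0 h1 h2 E]]] := lcp a0 d0 b0 p0 q0.
exists t, s; split => //; rewrite ?(DD_pairl t s Fp) ?(DD_pairl t s Fq) ?(sibC SD Fq Fp).
- by rewrite mulrC [s * _]mulrC.
- by rewrite mulrC [s * _]mulrC.
- rewrite (DD_pairr t s (FF_pairf t s)) (DD_pairl t s Fp) (DD_pairl t s Fq) (sibC SD Fq Fp) -E; ring.
Qed.

Lemma Pr_le (f : fn) t s : FF f -> ip p p <= DD f (sq p) -> ip q q <= DD f (sq q) -> Pr p q t s ->
  DD (pairf t s p q) (pairf t s p q) <= DD f (pairf t s p q).
Proof.
move=> Ff fp fq [t0 s0 _ _ ->]; rewrite DD_pairr//.
by apply: lerD; apply: ler_wpM2l.
Qed.

Lemma Adm_pair (f : fn) : FF f -> (forall x, 0 <= f x) -> (forall x, p x * q x = 0) -> 0 < ip p p -> 0 < ip q q ->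
  ip p p <= DD f (sq p) -> ip q q <= DD f (sq q) -> Adm f.
Proof.
move=> Ff fge dis p0 q0 fp fq; split => //; exists p, q; split => // a b.
have SVf := SV Ff fge; have Ha := siZ SH a Hp; have Hb := siZ SH b Hq.
have ipE : ip (a *: p + b *: q) (a *: p + b *: q) = a ^+ 2 * ip p p + b ^+ 2 * ip q q.
  rewrite (sib_sqrD SH Ha Hb) (sib_sqrZ SH a Hp) (sib_sqrZ SH b Hq) (sibZl SH a Hp Hb) (sibZr SH b Hq Hp).
  by rewrite (ip_disjoint Hp Hq dis) !mulr0 addr0.
have VE : VV f (a *: p + b *: q) (a *: p + b *: q) = a ^+ 2 * DD f (sq p) + b ^+ 2 * DD f (sq q).
  rewrite (sib_sqrD SVf Ha Hb) (sib_sqrZ SVf a Hp) (sib_sqrZ SVf b Hq) (sibZl SVf a Hp Hb) (sibZr SVf b Hq Hp).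
  by rewrite (VV_disjoint Ff dis) !mulr0 addr0.
rewrite ipE VE; split; first by apply: lerD; apply: ler_wpM2l => //; exact: sqr_ge0.
have a1 : 0 <= a ^+ 2 * ip p p by rewrite mulr_ge0 ?sqr_ge0// ltW.
have b1 : 0 <= b ^+ 2 * ip q q by rewrite mulr_ge0 ?sqr_ge0// ltW.
move=> /eqP; rewrite paddr_eq0// !mulf_eq0 (gt_eqF p0) (gt_eqF q0) !orbF !orbb.
by move=> /andP[/eqP -> /eqP ->].
Qed.

Lemma Pr_Adm t s : (forall x, p x * q x = 0) -> 0 < ip p p -> 0 < ip q q -> Pr p q t s -> Adm (pairf t s p q).
Proof.
move=> dis p0 q0 [t0 s0 h1 h2 _]; apply: Adm_pair => //; first exact: FF_pairf.
by move=> x; exact: pairf_ge0.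
Qed.
End pair.

Lemma DD_le_of (f h : fn) : FF f -> FF h -> DD h h <= DD f h -> DD h h <= DD f f.
Proof. by move=> Ff Fh H; have := sib_ge0 SD (siB SD Ff Fh); rewrite (sib_sqrB SD Ff Fh); lra. Qed.

(** The two parts of a second eigenfunction satisfy the constraint separately, because the cross
    terms vanish and S >= 1. Normalizing them to norm 1 turns the energy of the pair into t + s,
    which bounds all the data of a minimizing sequence. *)
Lemma Adm_reduce (f : fn) : Adm f -> exists p q t s, [/\ H1 p /\ H1 q, (forall x, p x * q x = 0),
  ip p p = 1 /\ ip q q = 1, Pr p q t s & DD (pairf t s p q) (pairf t s p q) <= DD f f].
Proof.
move=> Af; have [Ff fge _] := Af; have [e1 [e [S1 [S He]]]] := Adm_spec Af.
have SVf := SV Ff fge; have H := sp_H He; have Hp := H1_pos H; have Hn := H1_neg H.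
have dV := VV_disjoint Ff (pos_neg_disjoint e).
have nrm (r : fn) : H1 r -> 0 < ip r r -> VV f r r = S * ip r r -> exists k : R, [/\ ip (k *: r) (k *: r) = 1 &
    1 <= DD f (sq (k *: r))].
  move=> Hr r0 Vr; exists (Num.sqrt (ip r r))^-1.
  rewrite -/(VV f _ _) (sib_sqrZ SH _ Hr) exprVn sqr_sqrtr ?(ltW r0)// mulVf ?gt_eqF//; split=> //.

  rewrite (sib_sqrZ SVf _ Hr) exprVn sqr_sqrtr ?(ltW r0)// Vr mulrCA mulVf ?gt_eqF// mulr1; exact: (sp_S He).
have [k [k1 k2]] : exists k : R, [/\ ip (k *: e^\+) (k *: e^\+) = 1 & 1 <= DD f (sq (k *: e^\+))].
  apply: nrm (sp_pos He) _ => //.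
  by rewrite -(pn_pos SVf H dV) (sp_eq He Hp) (pn_pos SH H (ip_pos_neg0 H)).
have [l [l1 l2]] : exists k : R, [/\ ip (k *: e^\-) (k *: e^\-) = 1 & 1 <= DD f (sq (k *: e^\-))].
  apply: nrm (sp_neg He) _ => //.
  by apply/eqP; rewrite -eqr_opp -mulrN -(pn_neg SVf H dV) (sp_eq He Hn) (pn_neg SH H (ip_pos_neg0 H)).
have Hk := siZ SH k Hp; have Hl := siZ SH l Hn.
have kp : 0 < ip (k *: e^\+) (k *: e^\+) by rewrite k1.
have lp : 0 < ip (l *: e^\-) (l *: e^\-) by rewrite l1.
have [t [s P]] := Pr_exists Hk Hl kp lp.
exists (k *: e^\+), (l *: e^\-), t, s; split => //.
  move=> x; have := pos_neg_disjoint e x => E.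
  by rewrite -[LHS]/((k * e^\+ x) * (l * e^\- x)) mulrACA E mulr0.
apply: DD_le_of => //; first exact: FF_pairf.
by apply: (Pr_le Hk Hl Ff) => //; rewrite ?k1 ?l1.
Qed.

(** * An admissible density of energy less than 2 / M *)

Section strict.
Variables (M : R) (w : fn).
Hypothesis HM : Mconst M w.
Variable i0 : 'I_N.

Let Hw : H1 w. Proof. by case: HM. Qed.
Let w_ge0 x : 0 <= w x. Proof. by case: HM. Qed.
Let w1 : ip w w = 1. Proof. by case: HM. Qed.
Let M0 : 0 < M. Proof. by case: HM. Qed.
Let Ew : DD (sq w) (sq w) = M. Proof. by case: HM => _ _ _ _ []. Qed.
Let Mle u : H1 u -> DD (sq u) (sq u) <= M * ip u u ^+ 2. Proof. by case: HM => _ _ _ _ [_ H]; exact: H. Qed.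

Let DDw u : H1 u -> DD (sq w) (sq u) <= M * ip u u.
Proof.
move=> Hu; apply: le_trans (DD_M HM Hu (FFsq Hw)) _.
by rewrite Ew -expr2 sqrtr_sqr ger0_norm// ltW.
Qed.

Section mul.
Variables (f df : R -> R) (B L : R).
Hypotheses (fd : forall s : R, is_derive s (1 : R) f (df s)) (dfc : mfun df)
  (fB : forall s, `|f s| <= B) (dfL : forall s, `|df s| <= L).

(** The localization formula [ip_cm] tested in the equation of [w]: the norm of the truncated
    function is the form of w^2 plus the error due to the derivative of the cutoff. *)
Lemma cm_energy : H1 (cm i0 f w) /\ ip (cm i0 f w) (cm i0 f w) =
  DD (sq w) (sq (cm i0 f w)) / M + dotL (cm i0 df w) (cm i0 df w).
Proof.
have H1v := H1_cm i0 fd dfc fB dfL Hw; have H2v := H1_cm i0 fd dfc fB dfL H1v; split => //.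
rewrite (ip_cm i0 fd dfc fB dfL Hw); congr (_ + _).
have := wM_eq HM H2v => E; apply: (mulfI (lt0r_neq0 M0)).
rewrite -E mulrC divfK ?gt_eqF//; congr DD; apply/funext => x; rewrite /cm; ring.
Qed.
End mul.

Lemma measurable_dflin (r : R) : 0 < r -> mfun (dflin r).
Proof.
move=> r0; apply: measurable_funM => //; apply: measurable_funM => //.
have cont : continuous (fun s : R => Num.sqrt (s ^+ 2 + r ^+ 2)).
  move=> s; apply: (@continuous_comp _ _ _ (fun s : R => s ^+ 2 + r ^+ 2) Num.sqrt); last exact: sqrt_continuous.
  by apply: cvgD; [exact: exprn_continuous|exact: cvg_cst].
apply: continuous_measurable_fun => s; apply: cvgV.
  rewrite expf_neq0// gt_eqF// sqrtr_gt0 ltr_wpDl ?sqr_ge0// exprn_gt0//.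
exact: (cvgM (cont s) (cvgM (cont s) (cont s))).
Qed.

Lemma measurable_dchi (r : R) : mfun (dchi r).
Proof.
have m2 : mfun (fun s : R => s ^+ 2) by exact: measurable_funX.
apply: measurable_funM.
  apply: measurable_funM => //; apply: measurable_maxr => //; apply: measurable_funB => //.
  by apply: measurable_funM => //; exact: measurable_funM.
by apply: measurable_funM => //; exact: measurable_funM.
Qed.

(* flin r is a bounded regularization of the identity; the bound does not depend on r. *)
Lemma moment : exists2 K : R, 0 < K & forall r : R, 0 < r ->
  H1 (cm i0 (flin r) w) /\ ip (cm i0 (flin r) w) (cm i0 (flin r) w) <= K.
Proof.
have M20 : 0 < M / 2 by rewrite divr_gt0.
have [B [r1 [B0 r10 H]]] := DD_local g0 g4 gN c0 Hw M20.
have r12 : 0 < r1 ^+ 2 by rewrite exprn_gt0.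
exists (2 * (B * r1 ^+ 2 / M + 1)).
  by rewrite mulr_gt0// ltr_wpDl// divr_ge0 ?mulr_ge0// ltW.
move=> r r0.
have fB s : `|flin r s| <= r.
  rewrite -(@ler_pXn2r _ 2)// ?nnegrE ?(ltW r0)// real_normK ?num_real//.
  by have [_] := flin_le s r0.
have fd (s : R) := flin_derive s r0; have dL (s : R) := dflin_le s r0.
have mdf := measurable_dflin r0.
have [Hv E] := cm_energy fd mdf fB dL; split=> //.
set v := cm i0 (flin r) w in Hv E *; have Iv := H v Hv.
have lw := H1_sqint Hw.
have D1 : dotL (cm i0 (dflin r) w) (cm i0 (dflin r) w) <= 1.
  rewrite -w1; apply: le_trans (dotL_ip_le Hw); apply: dotL_le => //.
    by apply: (sqint_bdM _ (fun x => dL _)) => //; exact: measurableT_comp mdf (measurable_coord i0).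
  by move=> x; rewrite /cm normrM ler_piMl.
have mI : mfun (\1_(cube r1) : fn) by apply: measurable_indic; exact: measurable_cube.
have D2 : \int[mu]_x (\1_(cube r1) x * v x ^+ 2) <= r1 ^+ 2.
  apply: le_trans (_ : \int[mu]_x (r1 ^+ 2 * w x ^+ 2) <= _).
    apply: I_le.
    - exact: (intg_bdM mI (fun x => ind_abs _ x) (sqint_intg (H1_sqint Hv))).
    - exact: (intgZ _ (sqint_intg lw)).
    - move=> x; rewrite indicE; case: (pselect (cube r1 x)) => xc; last first.
        by rewrite (memNset xc) mul0r mulr_ge0 ?sqr_ge0.
      rewrite (mem_set xc) mul1r /v /cm exprMn; apply: ler_wpM2r; first exact: sqr_ge0.
      have [h _] := flin_le (x ord0 i0) r0; apply: le_trans h _.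
      have /cubeP/(_ i0) := xc; rewrite -[x ord0 i0 ^+ 2]real_normK ?num_real// => h.
      by rewrite ler_pXn2r ?nnegrE ?(ltW r10)// ltW.
  rewrite (IZ _ (sqint_intg lw)) -dotLff; have := dotL_ip_le Hw; rewrite w1 => h.
  by rewrite -[leRHS]mulr1; apply: ler_wpM2l; [exact: ltW|].
have D3 : DD (sq w) (sq v) / M <= ip v v / 2 + B * r1 ^+ 2 / M.
  rewrite ler_pdivrMr//; apply: le_trans Iv _.
  rewrite (_ : (_ + _) * M = M / 2 * ip v v + B * r1 ^+ 2); last by field; rewrite gt_eqF.
  by rewrite lerD2l; apply: ler_wpM2l.
have := D3; have := D1; have := E; lra.
Qed.

(* With X = <w, chi^2 w> = DD(w^2, p^2) / M and e the integral of |chi'|^2 w^2, the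
   defect is at most M ((1 - X)^2 + 2 X e + e^2); the second moment of w yields
   1 - X = O(r^-2) and e = O(r^-4). *)
Lemma cut_estimate : exists C r1 : R, [/\ 0 < C, 1 <= r1 & forall r : R, r1 <= r ->
  [/\ H1 (cm i0 (chi r) w), 0 < ip (cm i0 (chi r) w) (cm i0 (chi r) w) &
   M * ip (cm i0 (chi r) w) (cm i0 (chi r) w) ^+ 2 <=
     DD (sq (cm i0 (chi r) w)) (sq (cm i0 (chi r) w)) + C / r ^+ 4]].
Proof.
have [K K0 HK] := moment; have [K' K1 Hchi] := @chi_bounds R.
have K'0 : 0 < K' by lra.
pose A := K' * K; have A0 : 0 < A by rewrite mulr_gt0.
exists (M * (A ^+ 2 + 2 * A + A ^+ 2)), (1 + 2 * A).
split.
- by rewrite mulr_gt0// addr_gt0 ?addr_gt0 ?exprn_gt0 ?mulr_gt0.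
- by lra.
move=> r rA; have r1 : 1 <= r by lra.
have r0 : 0 < r by lra.
have [Hv vK] := HK r r0; set v := cm i0 (flin r) w in Hv vK.
have fd (s : R) := chi_derive s r0.
have cB s : `|chi r s| <= 1 by have /andP[a b] := chi_itv s r0; rewrite ger0_norm.
have dL s : `|dchi r s| <= K' / r by have [] := Hchi r s r0.
have mdf := measurable_dchi r.
have [Hp E] := cm_energy fd mdf cB dL.
set p := cm i0 (chi r) w in Hp E *; set X := DD (sq w) (sq p) / M in E.
set e := dotL _ _ in E.
have r2 : 0 < r ^+ 2 by rewrite exprn_gt0.
have r4 : 0 < r ^+ 4 by rewrite exprn_gt0.
have lw := H1_sqint Hw.
have lv := H1_sqint Hv.
have e0 : 0 <= e by apply: (sib_ge0 SL); apply: (sqint_bdM _ (fun x => dL _)) => //; exact: measurableT_comp mdf (measurable_coord i0).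
have eA : e <= A / r ^+ 4.
  apply: le_trans (_ : K' / r ^+ 4 * dotL v v <= _).
    rewrite dotLff -(IZ _ (sqint_intg lv)) /e dotLff; apply: I_le.
    - apply: sqint_intg; apply: (sqint_bdM _ (fun x => dL _)) => //; exact: measurableT_comp mdf (measurable_coord i0).
    - exact: (intgZ _ (sqint_intg lv)).
    - move=> x; have -> : v x ^+ 2 = flin r (x ord0 i0) ^+ 2 * w x ^+ 2 by exact: exprMn.
      have -> : cm i0 (dchi r) w x ^+ 2 = dchi r (x ord0 i0) ^+ 2 * w x ^+ 2 by exact: exprMn.
      rewrite mulrA; apply: ler_wpM2r; first exact: sqr_ge0.
      by have [] := Hchi r (x ord0 i0) r0.
  rewrite (_ : A / r ^+ 4 = K' / r ^+ 4 * K); last by rewrite /A; ring.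
  apply: ler_wpM2l; last exact: le_trans (dotL_ip_le Hv) vK.
  by rewrite divr_ge0// ltW.
have Fp := FFsq Hp; have Fw := FFsq Hw; have Fv := FFsq Hv.
have pw x : p x ^+ 2 <= w x ^+ 2.
  rewrite /p /cm exprMn ler_piMl ?sqr_ge0//; have /andP[a b] := chi_itv (x ord0 i0) r0.
  exact: exprn_ile1.
have X1 : X <= 1.
  rewrite /X ler_pdivrMr// mul1r -Ew (sibC SD Fw Fp).
  apply: (DD_le g0 g4 gN c0 Fp Fw Fw) => // x; exact: sqr_ge0.
have X0 : 0 <= X by rewrite /X divr_ge0 ?(ltW M0)//; apply: (DD_ge0 g c0) => x; exact: sqr_ge0.
have XA : 1 - X <= A / r ^+ 2.
  have -> : 1 - X = DD (sq w - sq p) (sq w) / M.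
    by rewrite (sibBl SD Fw Fp Fw) Ew /X (sibC SD Fp Fw) mulrBl divff ?gt_eqF.
  rewrite ler_pdivrMr//; apply: le_trans (_ : DD ((K' / r ^+ 2) *: sq v) (sq w) <= _).
    apply: (DD_le g0 g4 gN c0 (siB SD Fw Fp) (siZ SD _ Fv) Fw) => x; last exact: sqr_ge0.
    rewrite -[leLHS]/(w x ^+ 2 - p x ^+ 2) -[leRHS]/(K' / r ^+ 2 * v x ^+ 2).
    have -> : v x ^+ 2 = flin r (x ord0 i0) ^+ 2 * w x ^+ 2 by exact: exprMn.
    have -> : p x ^+ 2 = chi r (x ord0 i0) ^+ 2 * w x ^+ 2 by exact: exprMn.
    rewrite -{1}[w x ^+ 2]mul1r -mulrBl mulrA; apply: ler_wpM2r; first exact: sqr_ge0.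
    by have [] := Hchi r (x ord0 i0) r0.
  rewrite (sibZl SD _ Fv Fw) (sibC SD Fv Fw).
  rewrite (_ : A / r ^+ 2 * M = K' / r ^+ 2 * (M * K)); last by rewrite /A; ring.
  apply: ler_wpM2l; first by rewrite divr_ge0// ltW.
  by apply: le_trans (DDw Hv) _; apply: ler_wpM2l => //; exact: ltW.
have Dp : 2 * M * X - M <= DD (sq p) (sq p).
  have := sib_ge0 SD (siB SD Fw Fp); rewrite (sib_sqrB SD Fw Fp) Ew.
  have -> : DD (sq w) (sq p) = M * X by rewrite /X mulrC divfK ?gt_eqF.
  lra.
have Xh : 2^-1 <= X.
  have : A / r ^+ 2 <= 2^-1; last by lra.
  rewrite ler_pdivrMr//; have : r <= r ^+ 2 by rewrite expr2 ler_peMr// ltW.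
  lra.
split => //; first by rewrite E; lra.
apply: le_trans (_ : M * (X + e) ^+ 2 <= _); first by rewrite E.
have a1 : (1 - X) ^+ 2 <= A ^+ 2 / r ^+ 4.
  rewrite (_ : A ^+ 2 / r ^+ 4 = (A / r ^+ 2) ^+ 2); last by field; rewrite gt_eqF.
  by rewrite ler_pXn2r ?nnegrE ?subr_ge0// divr_ge0// ltW.
have a2 : 2 * X * e <= 2 * A / r ^+ 4.
  rewrite -mulrA -(mulrA 2) ler_pM2l//; apply: le_trans eA; exact: ler_piMl.
have a3 : e ^+ 2 <= A ^+ 2 / r ^+ 4.
  apply: le_trans (_ : (A / r ^+ 4) ^+ 2 <= _).
    by rewrite ler_pXn2r ?nnegrE// divr_ge0// ltW.
  rewrite exprMn; apply: ler_wpM2l; first exact: sqr_ge0.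
  by rewrite exprVn lef_pV2 ?posrE ?exprn_gt0// expr2 ler_peMr ?(ltW r4)// exprn_ege1.
have : M * ((1 - X) ^+ 2 + 2 * X * e + e ^+ 2) <= M * (A ^+ 2 + 2 * A + A ^+ 2) / r ^+ 4.
  rewrite -[leRHS]mulrA; apply: ler_wpM2l; first exact: ltW.
  by rewrite (mulrDl (A ^+ 2 + 2 * A)) (mulrDl (A ^+ 2)); apply: lerD => //; exact: lerD.
move: Dp; rewrite (_ : M * (X + e) ^+ 2 = 2 * M * X - M + M * ((1 - X) ^+ 2 + 2 * X * e + e ^+ 2)); last by ring.
lra.
Qed.

Lemma intg_DDpos (f h : fn) : intg mu f -> intg mu h -> (forall x, 0 <= f x) -> (forall x, 0 <= h x) ->
  \int[pm]_p (f p.1 * h p.2) = (\int[mu]_x f x) * \int[mu]_x h x.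
Proof. by move=> If Ih f0 h0; rewrite /Rintegral I_prod. Qed.

Lemma DD_lower (k : R) (f h f1 h1 : fn) : 0 <= k -> FF f -> FF h -> (forall x, 0 <= f1 x <= f x) -> (forall x, 0 <= h1 x <= h x) ->
  mfun f1 -> mfun h1 ->
  (forall x y, f1 x != 0 -> h1 y != 0 -> k <= rk g c (x - y)) ->
  k * ((\int[mu]_x f1 x) * \int[mu]_x h1 x) <= DD f h.
Proof.
move=> k0 Ff Fh f1f h1h mf1 mh1 kr.
have f10 x : 0 <= f1 x by have /andP[] := f1f x. have h10 x : 0 <= h1 x by have /andP[] := h1h x.
have If1 : intg mu f1.
  by apply: (intg_le mf1 (FF_intg Ff)) => x; rewrite ger0_norm//; have /andP[] := f1f x.
have Ih1 : intg mu h1.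
  by apply: (intg_le mh1 (FF_intg Fh)) => x; rewrite ger0_norm//; have /andP[] := h1h x.
rewrite -(intg_DDpos If1 Ih1 f10 h10) -(IZ k (intg_prod If1 Ih1)).
rewrite -[leRHS]/(\int[pm]_p (rk g c (p.1 - p.2) * (f p.1 * h p.2))); apply: I_le.
- exact: (intgZ k (intg_prod If1 Ih1)).
- exact: (intg_DD g0 g4 gN c0 Ff Fh).
move=> [x y] /=; have /andP[_ a] := f1f x; have /andP[_ b] := h1h y.
have fh : 0 <= f x * h y by apply: mulr_ge0; [exact: le_trans (f10 x) a|exact: le_trans (h10 y) b].
have [z|nz] := eqVneq (f1 x * h1 y) 0; first by rewrite z mulr0 mulr_ge0// rk_ge0.
move: nz; rewrite mulf_eq0 negb_or => /andP[n1 n2].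
by apply: ler_pM => //; [exact: mulr_ge0|exact: kr|exact: ler_pM].
Qed.

Lemma rk_lower (r : R) x : 0 < r -> (exists i, x ord0 i != 0) -> (forall i, `|x ord0 i| <= 2 * r) ->
  c * ((4 * N%:R) `^ (- (g / 2)) * r `^ (- g)) <= rk g c x.
Proof.
move=> r0 [i xi] xr; have NN : 0 < (4 * N%:R : R) by rewrite mulr_gt0// ltr0n.
rewrite /rk ler_pM2l// /kz.
have r2 : r `^ (- g) = (r ^+ 2) `^ (- (g / 2)).
  rewrite -powR_mulrn ?(ltW r0)// -powRrM; congr (_ `^ _); by field.
rewrite r2 -powRM ?(ltW NN) ?sqr_ge0//; apply: powRN_le; last by rewrite divr_ge0// ltW.
  by apply: lt_le_trans (sqn_coord x i); rewrite lt_neqAle sqr_ge0 andbT eq_sym sqrf_eq0.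
apply: le_trans (_ : \sum_(i < N) (2 * r) ^+ 2 <= _).
  apply: ler_sum => j _; rewrite -[x ord0 j ^+ 2]real_normK ?num_real// ler_pXn2r ?nnegrE//.
  by rewrite mulr_ge0// ltW.
rewrite sumr_const card_ord -[leLHS]mulr_natr (_ : (2 * r) ^+ 2 * N%:R = 4 * N%:R * r ^+ 2) //; ring.
Qed.

(** Only the mass near the two centres is kept. A cube carries half of the mass of w^2, and points
    of the two cubes are distinct and at distance of order r. *)
Lemma interaction : exists k r1 : R, [/\ 0 < k, 0 < r1 & forall r : R, r1 <= r -> H1 (cm i0 (chi r) w) ->
  k * r `^ (- g) <= DD (sq (cm i0 (chi r) w)) (sq (fun x => cm i0 (chi r) w (x + r *: dirv i0)))].
Proof.
have lw := H1_sqint Hw; have Iw := sqint_intg lw.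
pose m := dotL w w.
have m0 : 0 < m.
  rewrite lt_neqAle (sib_ge0 SL lw) andbT; apply/eqP => E.
  have /(ae_zero_ip Hw) := dotL_eq0 lw (esym E); rewrite w1 => /eqP; by rewrite oner_eq0.
have m2 : 0 < m / 2 by rewrite divr_gt0.
have [r1 r10 T] := tail_small lw m2.
have mC := measurable_cube r1 (R := R) (N := N).
have mI : mfun (\1_(cube r1) : fn) by apply: measurable_indic.
have mI' : mfun (\1_(~` cube r1) : fn) by apply: measurable_indic; exact: measurableC.
(* For r >= 4 r1 the cutoff satisfies chi^2 >= 1/4 on the cube, so [f1] bounds the truncated square
   from below independently of r. *)
pose f1 : fn := fun x => 4^-1 * (\1_(cube r1) x * w x ^+ 2).
have If : intg mu (fun x => \1_(cube r1) x * w x ^+ 2) by exact: (intg_bdM mI (fun x => ind_abs _ x) Iw).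
have If' : intg mu (fun x => \1_(~` cube r1) x * w x ^+ 2) by exact: (intg_bdM mI' (fun x => ind_abs _ x) Iw).
have mass : m / 2 <= \int[mu]_x (\1_(cube r1) x * w x ^+ 2).
  have : \int[mu]_x (\1_(cube r1) x * w x ^+ 2) + \int[mu]_x (\1_(~` cube r1) x * w x ^+ 2) = m.
    rewrite -(ID If If') /m dotLff; congr Rintegral; apply/funext => x.
    by rewrite -mulrDl !indicE in_setC; case: (x \in cube r1); rewrite /= ?addr0 ?add0r mul1r.
  lra.
have I1 : m / 8 <= \int[mu]_x f1 x by rewrite /f1 (IZ _ If); lra.
have mw := H1_meas Hw.
have mf1 : mfun f1.
  by apply: measurable_funM => //; apply: measurable_funM => //; exact: measurable_funX.
exists (c * (4 * N%:R) `^ (- (g / 2)) * (m / 8) ^+ 2), (4 * r1); split.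
- by rewrite !mulr_gt0 ?powR_gt0 ?exprn_gt0 ?mulr_gt0 ?divr_gt0 ?ltr0n.
- by rewrite mulr_gt0.
move=> r rr Hp; have r0 : 0 < r by lra.
set p := cm i0 (chi r) w in Hp *; pose h1 : fn := fun x => f1 (x + r *: dirv i0).
have f1p x : 0 <= f1 x <= p x ^+ 2.
  rewrite /f1 /p indicE; case: (pselect (cube r1 x)) => xc; last first.
    by rewrite (memNset xc) mul0r mulr0 lexx sqr_ge0.
  rewrite (mem_set xc) mul1r mulr_ge0 ?sqr_ge0 ?invr_ge0//=.
  have -> : cm i0 (chi r) w x ^+ 2 = chi r (x ord0 i0) ^+ 2 * w x ^+ 2 by exact: exprMn.
  apply: ler_wpM2r; first exact: sqr_ge0.
  by apply: chi_half => //; have /cubeP/(_ i0) := xc; lra.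
have Hs := H1_shift (r *: dirv i0) Hp.
pose k := c * ((4 * N%:R) `^ (- (g / 2)) * r `^ (- g)).
have k0 : 0 <= k by rewrite !mulr_ge0 ?powR_ge0// ltW.
have mh1 : mfun h1 by exact: measurableT_comp mf1 (measurable_shift _).
have kr x y : f1 x != 0 -> h1 y != 0 -> k <= rk g c (x - y).
  have cu z : f1 z != 0 -> cube r1 z.
    by apply: contraPP => zc; rewrite /f1 indicE (memNset zc) mul0r mulr0 eqxx.
  move=> /cu/cubeP xc /cu/cubeP yc; apply: rk_lower => //.
    exists i0; have := xc i0; have := yc i0; rewrite !mxE !eqxx /= mulr1 !ltr_norml => /andP[? ?] /andP[? ?].
    by rewrite gt_eqF//; lra.
  move=> i; have := xc i; have := yc i; rewrite !mxE eqxx /=.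
  have b1 : 0 <= r * (i == i0)%:R <= r by case: (i == i0); rewrite /= ?mulr1 ?mulr0 ?lexx ltW.
  rewrite !ltr_norml ler_norml => /andP[? ?] /andP[? ?]; case/andP: b1 => ? ?; apply/andP; split; lra.
apply: le_trans (DD_lower k0 (FFsq Hp) (FFsq Hs) f1p (fun x => f1p (x + r *: dirv i0)) mf1 mh1 kr).
have -> : \int[mu]_x f1 (x + r *: dirv i0) = \int[mu]_x f1 x by exact: I_shift.
rewrite (_ : _ * r `^ (- g) = k * (m / 8) ^+ 2); last by rewrite /k; ring.
by apply: ler_wpM2l => //; rewrite -expr2 ler_pXn2r ?nnegrE//; [lra|apply: le_trans I1; lra].
Qed.

Lemma Adm_strict : exists2 f : fn, Adm f & DD f f < 2 / M.
Proof.
have [C [r1 [C0 r11 HC]]] := cut_estimate; have [k [r2 [k0 r20 HI]]] := interaction.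
(* r^(4 - g) >= a > C / k is exactly C / r^4 < k r^-g; the exponent 4 - g is positive. *)
pose a := C / k + 1; have a1 : 1 <= a by rewrite lerDr divr_ge0// ltW.
have g40 : 0 < 4 - g by rewrite subr_gt0.
pose r := Num.max (Num.max r1 r2) (a `^ (4 - g)^-1).
have rr1 : r1 <= r by rewrite !le_max lexx.
have rr2 : r2 <= r by rewrite !le_max lexx !orbT.
have rra : a `^ (4 - g)^-1 <= r by rewrite le_max lexx orbT.
have r0 : 0 < r by lra.
have key : C / r ^+ 4 < k * r `^ (- g).
  have H : a <= r `^ (4 - g).
    have E1 : a = (a `^ (4 - g)^-1) `^ (4 - g) by rewrite -powRrM mulVf ?gt_eqF// powRr1//; lra.
    rewrite {1}E1; apply: ge0_ler_powR => //; rewrite ?nnegrE ?powR_ge0 ?(ltW g40) ?(ltW r0)//.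
  have E : r `^ (4 - g) = r ^+ 4 * r `^ (- g).
    by rewrite powRD ?(gt_eqF r0) ?implybT// -powR_mulrn// ltW.
  rewrite ltr_pdivrMr ?exprn_gt0// mulrAC -mulrA -E mulrC -ltr_pdivrMr//.
  by apply: lt_le_trans H; rewrite /a ltrDl.
have [Hp p0 Hcut] := HC r rr1; have HI' := HI r rr2 Hp.
set p := cm i0 (chi r) w in Hp p0 Hcut HI'; pose q : fn := fun x => p (x + r *: dirv i0).
have Hq : H1 q := H1_shift _ Hp.
have qp : ip q q = ip p p by rewrite ip_shift.
have Dqp : DD (sq q) (sq q) = DD (sq p) (sq p) by exact: (DD_shift g0 g4 gN c0 _ (FFsq Hp) (FFsq Hp)).
have dis x : p x * q x = 0.
  have [h|h] := leP (r / 2) `|x ord0 i0|; first by rewrite /p /cm chi_out// !mul0r.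
  rewrite /q /p /cm (chi_out (s := (x + r *: dirv i0) ord0 i0))// ?mul0r ?mulr0//.
  rewrite !mxE !eqxx mulr1; move: h; rewrite ltr_norml => /andP[h1 h2].
  by rewrite ger0_norm; lra.
have Fp := FFsq Hp; have Fq := FFsq Hq.
set A := DD (sq p) (sq p) in Hcut Dqp; set I := DD (sq p) (sq q) in HI'.
have A0 : 0 <= A by apply: (DD_ge0 g c0) => x; exact: sqr_ge0.
have AI : M * ip p p ^+ 2 < A + I by lra.
have S0 : 0 < A + I by apply: le_lt_trans AI; rewrite mulr_ge0 ?sqr_ge0// ltW.
(* By symmetry equal multipliers make both constraints equalities, and the energy becomes 2 |p|^4 /
   (A + I). *)
pose t := ip p p / (A + I); have t0 : 0 <= t by rewrite divr_ge0// ltW.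
pose f := pairf t t p q; have Ff : FF f := FF_pairf Hp Hq t t.
have Ep : DD f (sq p) = ip p p.
  rewrite (DD_pairl Hp Hq t t Fp) -/A (sibC SD Fq Fp) -/I -mulrDr divfK ?gt_eqF//.
have Eq : DD f (sq q) = ip q q.
  rewrite (DD_pairl Hp Hq t t Fq) Dqp -/I addrC -mulrDr qp divfK ?gt_eqF//.
exists f.
  apply: (Adm_pair Hp Hq Ff _ dis) => //; rewrite ?qp ?Ep ?Eq ?qp//.
  by move=> x; exact: pairf_ge0.
rewrite (DD_pairr Hp Hq t t Ff) Ep Eq qp -mulrDr /t.
rewrite (_ : _ * _ = 2 * ip p p ^+ 2 / (A + I)); last by ring.
by rewrite ltr_pdivrMr// mulrAC ltr_pdivlMr// -mulrA ltr_pM2l// mulrC.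
Qed.
End strict.

(** * Existence of a minimizing density *)

Section minimizer.
Variables (M : R) (wM : fn).
Hypothesis HM : Mconst M wM.

Let M0 : 0 < M. Proof. by case: HM. Qed.
Let Mle u : H1 u -> DD (sq u) (sq u) <= M * ip u u ^+ 2. Proof. by case: HM => _ _ _ _ [_ H]; exact: H. Qed.

Let nD_sq u : H1 u -> nD (sq u) <= Num.sqrt M * ip u u.
Proof.
move=> Hu; apply: le_trans (ler_wsqrtr (Mle Hu)) _.
by rewrite sqrtrM ?(ltW M0)// sqrtr_sqr ger0_norm// (sib_ge0 SH Hu).
Qed.

Section weak.
Variables (F : set_system nat) (UF : UltraFilter F) (p q : nat -> fn) (t s : nat -> R)
  (p0 q0 : fn) (t0 s0 T : R).
Hypotheses (Hp : forall n, H1 (p n)) (Hq : forall n, H1 (q n)) (Hp0 : H1 p0) (Hq0 : H1 q0)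
  (p1 : forall n, ip (p n) (p n) = 1) (q1 : forall n, ip (q n) (q n) = 1)
  (Wp : wcvg F p p0) (Wq : wcvg F q q0) (ct : t n @[n --> F] --> t0) (cs : s n @[n --> F] --> s0)
  (tT : forall n, 0 <= t n <= T) (sT : forall n, 0 <= s n <= T).

Let PF : ProperFilter F. Proof. exact: ultra_proper. Qed.
Let FF' : Filter F. Proof. exact: filter_filter. Qed.
Let T0 : 0 <= T. Proof. by have /andP[a b] := tT 0; exact: le_trans b. Qed.

Let h n : fn := pairf (t n) (s n) (p n) (q n).
Let h0 : fn := pairf t0 s0 p0 q0.
Let p' n : fn := p n - p0.
Let q' n : fn := q n - q0.
Let k n : fn := pairf (t n) (s n) (p' n) (q' n).
Let Hp' n : H1 (p' n). Proof. exact: (siB SH (Hp n) Hp0). Qed.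
Let Hq' n : H1 (q' n). Proof. exact: (siB SH (Hq n) Hq0). Qed.
Let p1' n : ip (p n) (p n) <= 1. Proof. by rewrite p1. Qed.
Let q1' n : ip (q n) (q n) <= 1. Proof. by rewrite q1. Qed.
Let Fh n : FF (h n). Proof. exact: (FF_pairf (Hp n) (Hq n)). Qed.
Let Fh0 : FF h0. Proof. exact: (FF_pairf Hp0 Hq0). Qed.
Let Fk n : FF (k n). Proof. exact: (FF_pairf (Hp' n) (Hq' n)). Qed.

Let th (a b : R) n : fn := a *: p n + b *: q n.
Let th0 (a b : R) : fn := a *: p0 + b *: q0.
Let th' (a b : R) n : fn := a *: p' n + b *: q' n.
Let Hth a b n : H1 (th a b n). Proof. exact: (siD SH (siZ SH a (Hp n)) (siZ SH b (Hq n))). Qed.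
Let Hth0 a b : H1 (th0 a b). Proof. exact: (siD SH (siZ SH a Hp0) (siZ SH b Hq0)). Qed.
Let Hth' a b n : H1 (th' a b n). Proof. exact: (siD SH (siZ SH a (Hp' n)) (siZ SH b (Hq' n))). Qed.
Let th'E a b n : th' a b n = th a b n - th0 a b.
Proof. by rewrite /th' /th /th0 /p' /q' !scalerBr opprD addrACA. Qed.

Let th_bd a b n : ip (th a b n) (th a b n) <= 2 * a ^+ 2 + 2 * b ^+ 2.
Proof.
have := sib_sqrD_le SH (siZ SH a (Hp n)) (siZ SH b (Hq n)).
by rewrite (sib_sqrZ SH a (Hp n)) (sib_sqrZ SH b (Hq n)) p1 q1 !mulr1.
Qed.

Let Wth a b : wcvg F (th a b) (th0 a b).
Proof.
move=> v Hv; rewrite /th0 (sibDl SH (siZ SH a Hp0) (siZ SH b Hq0) Hv) (sibZl SH a Hp0 Hv) (sibZl SH b Hq0 Hv).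
rewrite (_ : (fun n => _) = fun n => a * ip (p n) v + b * ip (q n) v).
  by apply: cvgD; apply: cvgMr; [exact: Wp|exact: Wq].
apply/funext => n; rewrite /th (sibDl SH (siZ SH a (Hp n)) (siZ SH b (Hq n)) Hv).
by rewrite (sibZl SH a (Hp n) Hv) (sibZl SH b (Hq n) Hv).
Qed.

Let sqbd a b n : nD (sq (th a b n)) <= Num.sqrt M * (2 * a ^+ 2 + 2 * b ^+ 2).
Proof. by apply: le_trans (nD_sq (Hth a b n)) _; apply: ler_wpM2l; [exact: sqrtr_ge0|exact: th_bd]. Qed.

Let dec a b n := sq (th a b n) - (sq (th0 a b) + sq (th' a b n)).
Let dec0 a b : nD (dec a b n) @[n --> F] --> (0 : R).
Proof.
have H : nD (sq (th a b n) - (sq (th0 a b) + sq (th a b n - th0 a b))) @[n --> F] --> (0 : R).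
  exact: (weak_decouple N0 g0 g4 gN c0 PF (Hth a b) (Hth0 a b) (th_bd a b) (@Wth a b)).
by rewrite (_ : (fun n => _) = fun n => nD (sq (th a b n) - (sq (th0 a b) + sq (th a b n - th0 a b)))) //; apply/funext => n; rewrite /dec th'E.
Qed.

Let Fdec a b n : FF (dec a b n).
Proof. exact: (siB SD (FFsq (Hth a b n)) (siD SD (FFsq (Hth0 a b)) (FFsq (Hth' a b n)))). Qed.

Let weak0 a b f : FF f -> DD f (sq (th' a b n)) @[n --> F] --> (0 : R).
Proof.
move=> Ff; apply: (weak_DD0 N0 g0 g4 gN c0 PF (u := th' a b) (M := 2 * (2 * a ^+ 2 + 2 * b ^+ 2) + 2 * ip (th0 a b) (th0 a b)) (Hth' a b)) => //.
  move=> n; rewrite th'E; have := sib_parallelogram SH (Hth a b n) (Hth0 a b).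
  by have := sib_ge0 SH (siD SH (Hth a b n) (Hth0 a b)); have := th_bd a b n; lra.
move=> v Hv; have := wcvgB PF (Hth a b) (Hth0 a b) (@Wth a b) Hv.
by rewrite (_ : (fun n => ip (th a b n - th0 a b) v) = fun n => ip (th' a b n) v) //; apply/funext => n; rewrite th'E.
Qed.

Let thp n : th 1 0 n = p n. Proof. by rewrite /th scale1r scale0r addr0. Qed.
Let thq n : th 0 1 n = q n. Proof. by rewrite /th scale1r scale0r add0r. Qed.
Let th0p : th0 1 0 = p0. Proof. by rewrite /th0 scale1r scale0r addr0. Qed.
Let th0q : th0 0 1 = q0. Proof. by rewrite /th0 scale1r scale0r add0r. Qed.
Let th'p n : th' 1 0 n = p' n. Proof. by rewrite /th' scale1r scale0r addr0. Qed.
Let th'q n : th' 0 1 n = q' n. Proof. by rewrite /th' scale1r scale0r add0r. Qed.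

Let bounded0 (x y : nat -> R) : (forall n, `|x n| <= T) -> y n @[n --> F] --> (0 : R) -> x n * y n @[n --> F] --> (0 : R).
Proof.
move=> xT y0; apply: (@squeeze0 _ _ _ FF' _ (fun n => T * `|y n|)).
  by move=> n; rewrite normrM; apply: ler_wpM2r.
by rewrite -(mulr0 T); apply: cvgMr; rewrite -(normr0 R); exact: cvg_norm.
Qed.

Let tabs n : `|t n| <= T. Proof. by have /andP[a b] := tT n; rewrite ger0_norm. Qed.
Let sabs' n : `|s n| <= T. Proof. by have /andP[a b] := sT n; rewrite ger0_norm. Qed.

Let weakk f : FF f -> DD f (k n) @[n --> F] --> (0 : R).
Proof.
move=> Ff; rewrite (_ : (fun n => _) = fun n => t n * DD f (sq (p' n)) + s n * DD f (sq (q' n))).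
  rewrite -(addr0 0); apply: cvgD; apply: bounded0 => //.
    by have := weak0 1 0 Ff; under eq_fun do rewrite th'p.
  by have := weak0 0 1 Ff; under eq_fun do rewrite th'q.
by apply/funext => n; rewrite /k (DD_pairr (Hp' n) (Hq' n) _ _ Ff).
Qed.

Let E n := nD (h n - (h0 + k n)).
Let E0 : E n @[n --> F] --> (0 : R).
Proof.
apply: (@squeeze0 _ _ _ FF' _ (fun n => (T * nD (dec 1 0 n) + T * nD (dec 0 1 n)) +
   (`|t n - t0| * nD (sq p0) + `|s n - s0| * nD (sq q0)))); last first.
  rewrite [X in _ --> X](_ : _ = (T * 0 + T * 0) + (0 * nD (sq p0) + 0 * nD (sq q0))); last by ring.
  apply: cvgD; apply: cvgD.
  - by apply: cvgMr; exact: dec0.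
  - by apply: cvgMr; exact: dec0.
  - apply: cvgMl; rewrite -(normr0 R) -(subrr t0).
    by apply: cvg_norm; apply: cvgB => //; exact: cvg_cst.
  - apply: cvgMl; rewrite -(normr0 R) -(subrr s0).
    by apply: cvg_norm; apply: cvgB => //; exact: cvg_cst.
move=> n; rewrite ger0_norm ?sinorm_ge0// /E.
have Fp0 := FFsq Hp0; have Fq0 := FFsq Hq0.
have -> : h n - (h0 + k n) = (t n *: dec 1 0 n + s n *: dec 0 1 n) + ((t n - t0) *: sq p0 + (s n - s0) *: sq q0).
  rewrite /dec thp thq th0p th0q th'p th'q; apply/funext => x.
  rewrite /h /h0 /k /pairf !fctE -![_ *: _]/(_ * _); ring.
have a1 := siD SD (siZ SD (t n) (Fdec 1 0 n)) (siZ SD (s n) (Fdec 0 1 n)).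
have a2 := siD SD (siZ SD (t n - t0) Fp0) (siZ SD (s n - s0) Fq0).
apply: le_trans (sinormD SD a1 a2) _; apply: lerD.
  apply: le_trans (sinormD SD (siZ SD _ (Fdec 1 0 n)) (siZ SD _ (Fdec 0 1 n))) _.
  rewrite (sinormZ SD _ (Fdec 1 0 n)) (sinormZ SD _ (Fdec 0 1 n)).
  by apply: lerD; apply: ler_wpM2r; rewrite ?sinorm_ge0.
apply: le_trans (sinormD SD (siZ SD _ Fp0) (siZ SD _ Fq0)) _.
by rewrite (sinormZ SD _ Fp0) (sinormZ SD _ Fq0).
Qed.

Lemma pair_bd (a b : fn) n : H1 a -> H1 b -> nD (pairf (t n) (s n) a b) <= T * Num.sqrt M * (ip a a + ip b b).
Proof.
move=> Ha Hb; apply: le_trans (sinormD SD (siZ SD _ (FFsq Ha)) (siZ SD _ (FFsq Hb))) _.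
rewrite (sinormZ SD _ (FFsq Ha)) (sinormZ SD _ (FFsq Hb)) mulrDr -!mulrA.
by apply: lerD; apply: ler_pM; rewrite ?sinorm_ge0//; exact: nD_sq.
Qed.

(** In the energy norm the densities are asymptotically [h0 + k n], by [weak_decouple] applied to
    [p] and [q]; the cross term with the fixed [h0] vanishes, so the energies add up. *)
Lemma split_energy (d : R) : DD (h n) (h n) @[n --> F] --> d ->
  exists kap B : R, [/\ DD (k n) (k n) @[n --> F] --> kap, d = DD h0 h0 + kap & forall n, DD (k n) (k n) <= B].
Proof.
move=> hd.
have p'b n : ip (p' n) (p' n) <= 2 + 2 * ip p0 p0.
  have := sib_parallelogram SH (Hp n) Hp0; have := sib_ge0 SH (siD SH (Hp n) Hp0); rewrite /p' p1; lra.
have q'b n : ip (q' n) (q' n) <= 2 + 2 * ip q0 q0.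
  have := sib_parallelogram SH (Hq n) Hq0; have := sib_ge0 SH (siD SH (Hq n) Hq0); rewrite /q' q1; lra.
pose B := T * Num.sqrt M * ((2 + 2 * ip p0 p0) + (2 + 2 * ip q0 q0)).
have kb n : nD (k n) <= B.
  apply: le_trans (pair_bd n (Hp' n) (Hq' n)) _; apply: ler_wpM2l; last exact: lerD.
  by rewrite mulr_ge0// sqrtr_ge0.
have kb2 n : DD (k n) (k n) <= B ^+ 2.
  by rewrite -(sinorm_sqr SD (Fk n)) ler_pXn2r ?nnegrE ?sinorm_ge0//; apply: le_trans (kb n); exact: sinorm_ge0.
have [kap ck] : exists l : R, DD (k n) (k n) @[n --> F] --> l.
  by apply: (ultra_cvg_bounded (M := B ^+ 2)) => // n; rewrite ger0_norm ?(sib_ge0 SD (Fk n)).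
exists kap, (B ^+ 2); split => //.
have c1 : DD (h0 + k n) (h0 + k n) @[n --> F] --> DD h0 h0 + 2 * 0 + kap.
  under eq_fun do rewrite (sib_sqrD SD Fh0 (Fk _)).
  by apply: cvgD => //; apply: cvgD; [exact: cvg_cst|apply: cvgMr; exact: weakk].
rewrite mulr0 addr0 in c1.
have c2 : nD (h0 + k n) @[n --> F] --> Num.sqrt (DD h0 h0 + kap) by exact: sqrt_cvg c1.
have c3 : nD (h n) @[n --> F] --> Num.sqrt d by exact: sqrt_cvg hd.
have c4 : nD (h n) - nD (h0 + k n) @[n --> F] --> (0 : R).
  apply: (@squeeze0 _ _ _ FF' _ E _ E0) => n; rewrite ler_norml; apply/andP; split.
    have := sinormD SD (siB SD (siD SD Fh0 (Fk n)) (Fh n)) (Fh n); rewrite subrK.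
    rewrite -(opprB (h n)) (sinormN SD (siB SD (Fh n) (siD SD Fh0 (Fk n)))) -/(E n); lra.
  have := sinormD SD (siB SD (Fh n) (siD SD Fh0 (Fk n))) (siD SD Fh0 (Fk n)); rewrite subrK -/(E n); lra.
have c5 : nD (h n) - nD (h0 + k n) @[n --> F] --> Num.sqrt d - Num.sqrt (DD h0 h0 + kap) by exact: cvgB.
have e1 : Num.sqrt d - Num.sqrt (DD h0 h0 + kap) = 0 by exact: (cvg_unique (@Rhausdorff R) c5 c4).
have d0 : 0 <= d by apply: (le_lim PF (cvg_cst (0 : R)) hd) => n; exact: (sib_ge0 SD (Fh n)).
have k0 : 0 <= kap by apply: (le_lim PF (cvg_cst (0 : R)) ck) => n; exact: (sib_ge0 SD (Fk n)).
have D0 := sib_ge0 SD Fh0.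
rewrite -(sqr_sqrtr d0) -[RHS]sqr_sqrtr ?addr_ge0//; congr (_ ^+ 2); lra.
Qed.

(** Expanding both the density and the square of the test function into limit and remainder, every
    mixed term tends to 0, so the constraint splits into a part of the limit and a part of the
    remainder. *)
Lemma split_form (a b : R) : (forall n, ip (p n) (q n) = 0) ->
  (forall n, ip (th a b n) (th a b n) <= VV (h n) (th a b n) (th a b n)) ->
  a ^+ 2 + b ^+ 2 - ip (th' a b n) (th' a b n) @[n --> F] --> ip (th0 a b) (th0 a b) /\
  (forall l : R, VV (k n) (th' a b n) (th' a b n) @[n --> F] --> l ->
    a ^+ 2 + b ^+ 2 <= VV h0 (th0 a b) (th0 a b) + l).
Proof.
move=> pq H.
have ipth n : ip (th a b n) (th a b n) = a ^+ 2 + b ^+ 2.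
  rewrite /th (sib_sqrD SH (siZ SH a (Hp n)) (siZ SH b (Hq n))) (sib_sqrZ SH a (Hp n)) (sib_sqrZ SH b (Hq n)).
  by rewrite (sibZl SH a (Hp n) (siZ SH b (Hq n))) (sibZr SH b (Hq n) (Hp n)) pq p1 q1 !mulr0 !mulr1 addr0.
split.
  have [_ X] := energy_limit PF (Hth a b) (Hth0 a b) (th_bd a b) (@Wth a b).
  by rewrite (_ : (fun n => _) = fun n => ip (th a b n) (th a b n) - ip (th a b n - th0 a b) (th a b n - th0 a b)) //; apply/funext => n; rewrite ipth th'E.
move=> l cl.
have Fs n := FFsq (Hth a b n); have Fs0 := FFsq (Hth0 a b); have Fs' n := FFsq (Hth' a b n).
pose B := T * Num.sqrt M * (1 + 1).
have hb n : nD (h n) <= B by apply: le_trans (pair_bd n (Hp n) (Hq n)) _; rewrite p1 q1.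
pose C := Num.sqrt M * (2 * a ^+ 2 + 2 * b ^+ 2).
have key n : a ^+ 2 + b ^+ 2 <= DD h0 (sq (th0 a b)) + DD h0 (sq (th' a b n)) + DD (sq (th0 a b)) (k n)
   + DD (k n) (sq (th' a b n)) + (B * nD (dec a b n) + E n * (C + nD (dec a b n))).
  rewrite -(ipth n); apply: le_trans (H n) _; rewrite VVE.
  have Fz := siD SD Fs0 (Fs' n); have Fhk := siD SD Fh0 (Fk n).
  have e1 : DD (h n) (sq (th a b n)) = DD (h n) (sq (th0 a b) + sq (th' a b n)) + DD (h n) (dec a b n).
    by rewrite -(sibDr SD Fz (Fdec a b n) (Fh n)) /dec addrC subrK.
  have e2 : DD (h n) (sq (th0 a b) + sq (th' a b n)) = DD (h0 + k n) (sq (th0 a b) + sq (th' a b n)) +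
      DD (h n - (h0 + k n)) (sq (th0 a b) + sq (th' a b n)).
    by rewrite -(sibDl SD Fhk (siB SD (Fh n) Fhk) Fz); congr (DD _ _); rewrite [RHS]addrC subrK.
  have e3 : DD (h0 + k n) (sq (th0 a b) + sq (th' a b n)) =
     DD h0 (sq (th0 a b)) + DD h0 (sq (th' a b n)) + DD (sq (th0 a b)) (k n) + DD (k n) (sq (th' a b n)).
    rewrite (sibDl SD Fh0 (Fk n) Fz) (sibDr SD Fs0 (Fs' n) Fh0) (sibDr SD Fs0 (Fs' n) (Fk n)) (sibC SD (Fk n) Fs0).
    by rewrite addrA.
  have b1 : DD (h n) (dec a b n) <= B * nD (dec a b n).
    apply: le_trans (ler_norm _) _; apply: le_trans (sib_CSn SD (Fh n) (Fdec a b n)) _.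
    by apply: ler_wpM2r; rewrite ?sinorm_ge0.
  have b2 : DD (h n - (h0 + k n)) (sq (th0 a b) + sq (th' a b n)) <= E n * (C + nD (dec a b n)); last first.
    by rewrite e1 e2 e3 -[leLHS]addrA lerD2l addrC; exact: lerD.
  apply: le_trans (ler_norm _) _; apply: le_trans (sib_CSn SD (siB SD (Fh n) Fhk) Fz) _.
  apply: ler_wpM2l; first exact: sinorm_ge0.
  have := sinormB SD (Fs n) (Fdec a b n).
  rewrite (_ : sq (th a b n) - dec a b n = sq (th0 a b) + sq (th' a b n)); last by rewrite /dec opprB addrC subrK.
  by have := sqbd a b n; rewrite -/C; lra.
have lim : DD h0 (sq (th0 a b)) + DD h0 (sq (th' a b n)) + DD (sq (th0 a b)) (k n)
   + DD (k n) (sq (th' a b n)) + (B * nD (dec a b n) + E n * (C + nD (dec a b n))) @[n --> F] -->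
   DD h0 (sq (th0 a b)) + 0 + 0 + l + (B * 0 + 0 * (C + 0)).
  apply: cvgD; last first.
    by apply: cvgD; [apply: cvgMr; exact: dec0|apply: cvgM; [exact: E0|apply: cvgD; [exact: cvg_cst|exact: dec0]]].
  apply: cvgD; last exact: cl.
  by apply: cvgD; [apply: cvgD; [exact: cvg_cst|exact: weak0]|exact: weakk].
have cc : cst (a ^+ 2 + b ^+ 2) n @[n --> F] --> a ^+ 2 + b ^+ 2 by exact: cvg_cst.
have := le_lim PF cc lim key.
by rewrite !addr0 mulr0 mul0r !addr0.
Qed.

End weak.

Lemma Pr_swap (p q : fn) t s : Pr p q t s -> Pr q p s t.
Proof.
case=> t0 s0 h1 h2 h3; have E : pairf s t q p = pairf t s p q by rewrite /pairf addrC.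
by split; rewrite ?E// addrC.
Qed.

Lemma Pr_shift (p q : fn) t s y : H1 p -> H1 q -> Pr p q t s ->
  Pr (fun x => p (x + y)) (fun x => q (x + y)) t s.
Proof.
move=> Hp Hq [t0 s0 h1 h2 h3]; have Fp := FFsq Hp; have Fq := FFsq Hq.
have FP := FF_pairf Hp Hq t s.
have E : pairf t s (fun x => p (x + y)) (fun x => q (x + y)) = fun x => pairf t s p q (x + y) by [].
split; rewrite ?E ?ip_shift//.
- by rewrite (DD_shift g0 g4 gN c0 y FP Fp).
- by rewrite (DD_shift g0 g4 gN c0 y FP Fq).
- by rewrite (DD_shift g0 g4 gN c0 y FP FP).
Qed.

(** The normalized second eigenfunction has form value S >= 1, which [DD_M] bounds by sqrt(M DD(f,
    f)). *)
Lemma Adm_lower (f : fn) : Adm f -> 1 <= M * DD f f.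
Proof.
move=> Af; have [Ff fge _] := Af; have [e1 [e [S1 [S Sp]]]] := Adm_spec Af.
have := DD_M HM (sp_H Sp) Ff; rewrite -VVE (sp_eq Sp (sp_H Sp)) (sp_ee Sp) !mulr1 => H.
have H2 : 1 <= Num.sqrt (M * DD f f) := le_trans (sp_S Sp) H.
have Mf : 0 <= M * DD f f by rewrite mulr_ge0 ?(sib_ge0 SD)// ltW.
by rewrite -(sqr_sqrtr Mf) exprn_ege1.
Qed.

(** Uniform positivity is turned into two strict scalar inequalities. These are open conditions, so
    they pass from the limit form to the forms of index n near the filter, where [quad_pos_form]
    restores positivity. *)
Lemma quad_pos (al be ga e : R) : 0 < e ->
  (forall a b : R, e * (a ^+ 2 + b ^+ 2) <= a ^+ 2 * al + 2 * a * b * be + b ^+ 2 * ga) ->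
  0 < al /\ 0 < al * ga - be ^+ 2.
Proof.
move=> e0 H.
have h1 : e <= al by have := H 1 0; lra.
have h2 : e <= ga by have := H 0 1; lra.
have h3 : be ^+ 2 <= (al - e) * (ga - e).
  apply: quad_ge0; first by lra.
  by move=> t; have := H 1 t; nra.
by split; nra.
Qed.

Lemma quad_pos_form (al be ga a b : R) : 0 < al -> 0 < al * ga - be ^+ 2 ->
  0 <= a ^+ 2 * al + 2 * a * b * be + b ^+ 2 * ga /\
  (a ^+ 2 * al + 2 * a * b * be + b ^+ 2 * ga = 0 -> a = 0 /\ b = 0).
Proof.
move=> al0 d0; set Q := _ + _ + _.
have E : al * Q = (al * a + be * b) ^+ 2 + (al * ga - be ^+ 2) * b ^+ 2 by rewrite /Q; ring.
have s1 := sqr_ge0 (al * a + be * b).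
have s2 : 0 <= (al * ga - be ^+ 2) * b ^+ 2 by rewrite mulr_ge0 ?sqr_ge0// ltW.
split; first by rewrite -(pmulr_rge0 _ al0) E addr_ge0.
move=> Q0; move: E; rewrite Q0 mulr0 => /esym/eqP; rewrite paddr_eq0// => /andP[z1 z2].
have b0 : b = 0 by move: z2; rewrite mulf_eq0 (gt_eqF d0)/= sqrf_eq0 => /eqP.
split=> //; move: z1; rewrite b0 mulr0 addr0 sqrf_eq0 mulf_eq0 (gt_eqF al0)/= => /eqP; exact.
Qed.

(* Either the remainder has energy less than 1 / M and the weak limit is
   admissible, or the weak limit has energy less than 1 / M and the remainder,
   multiplied by 1 + e, is admissible with less energy. *)
Lemma minimizer : exists2 f : fn, Adm f & forall f' : fn, Adm f' -> DD f f <= DD f' f'.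
Proof.
have [fs As Ds] := Adm_strict HM (Ordinal N0).
pose A : set R := [set r | exists f : fn, Adm f /\ r = DD f f].
have lbA : lbound A M^-1.
  by move=> _ [f [Af ->]]; rewrite -div1r ler_pdivrMr// mulrC; exact: Adm_lower.
have A0 : A !=set0 by exists (DD fs fs), fs.
have hA : has_inf A by split => //; exists M^-1.
pose d := inf A.
have dle (f : fn) : Adm f -> d <= DD f f by move=> Af; apply: ge_inf; [exists M^-1|exists f].
have dM : M^-1 <= d by exact: lb_le_inf.
have d0 : 0 < d by apply: lt_le_trans dM; rewrite invr_gt0.
have d2 : d < 2 / M by apply: le_lt_trans Ds; exact: dle.
pose T := d + 1; have T0 : 0 < T by rewrite addr_gt0.
(* One part carries t^2 DD(p^2, p^2) >= d/4, and t <= t + s <= d + 1 = T; hence DD(p^2, p^2) >=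
   [del], the threshold for nonvanishing. *)
pose del := d / (4 * T ^+ 2); have del0 : 0 < del by rewrite divr_gt0// mulr_gt0// exprn_gt0.
have [rr [s1 [rr0 s10 NV]]] := nonvanish_shift del0 ltr01.
pose ok (p q : fn) (t s : R) (n : nat) := [/\ H1 p /\ H1 q, (forall x, p x * q x = 0), ip p p = 1 /\ ip q q = 1, Pr p q t s &
   DD (pairf t s p q) (pairf t s p q) <= d + n.+1%:R^-1].
have okT p q t s n : ok p q t s n -> [/\ 0 <= t <= T, 0 <= s <= T & DD (pairf t s p q) (pairf t s p q) = t + s].
  case=> _ _ [p1 q1] [t0 s0 _ _ E]; rewrite E p1 q1 !mulr1 => H.
  have n1 : n.+1%:R^-1 <= 1 :> R by rewrite invf_le1// ler1n.
  move: H n1; set v := _^-1 => H n1; rewrite /T; split=> //; apply/andP; split=> //; lra.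
have /choice[u Hu] (n : nat) : exists u : fn * fn * R * R, ok u.1.1.1 u.1.1.2 u.1.2 u.2 n /\
    [/\ d / 4 <= u.1.2 ^+ 2 * M & s1 <= \int[mu]_x (\1_(cube rr) x * u.1.1.1 x ^+ 2)].
  have e0 : 0 < (n.+1%:R^-1 : R) by rewrite invr_gt0.
  have [_ [f [Af ->]] Hf] := inf_adherent e0 hA.
  have [p [q [t [s [[Hp Hq] dis [p1 q1] P Hle]]]]] := Adm_reduce Af.
  have okpq : ok p q t s n by split => //; apply: le_trans Hle (ltW Hf).
  have sw p' q' t' s' : ok p' q' t' s' n -> ok q' p' s' t' n.
    case=> [[a1 a2]] a3 [a4 a5] a6 a7; split => //; last by rewrite /pairf addrC.
      by move=> x; rewrite mulrC.
    exact: Pr_swap.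
  (* The energy of the pair is at most twice the sum of the energies of its two terms, so one of
     these is at least d/4; the names are exchanged to make it the first. *)
  have [p2 [q2 [t2 [s2 [ok2 big]]]]] : exists p' q' t' s', ok p' q' t' s' n /\ d / 4 <= t' ^+ 2 * DD (sq p') (sq p').
    have Fp := FFsq Hp; have Fq := FFsq Hq.
    have dh : d <= DD (pairf t s p q) (pairf t s p q).
      by apply: dle; apply: (Pr_Adm Hp Hq) => //; rewrite ?p1 ?q1.
    have := sib_sqrD_le SD (siZ SD t Fp) (siZ SD s Fq); rewrite (sib_sqrZ SD t Fp) (sib_sqrZ SD s Fq) => H.
    have [h|h] := leP (d / 4) (t ^+ 2 * DD (sq p) (sq p)); first by exists p, q, t, s.
    exists q, p, s, t; split; first exact: sw.
    by have := le_trans dh H; lra.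
  have [[Hp2 Hq2] dis2 [p21 q21] P2 le2] := ok2; have [tT sT _] := okT _ _ _ _ _ ok2.
  have Dp := Mle Hp2; rewrite p21 expr1n mulr1 in Dp.
  have t2T : t2 ^+ 2 <= T ^+ 2 by case/andP: tT => a b; rewrite ler_pXn2r ?nnegrE// ltW.
  have [||y Hy] := NV p2 Hp2; first by rewrite p21.
    rewrite /del ler_pdivrMr ?mulr_gt0 ?exprn_gt0//.
    have Dp0 : 0 <= DD (sq p2) (sq p2) by exact: (sib_ge0 SD (FFsq Hp2)).
    have : t2 ^+ 2 * DD (sq p2) (sq p2) <= T ^+ 2 * DD (sq p2) (sq p2) by apply: ler_wpM2r.
    by lra.
  have Fh2 := FF_pairf Hp2 Hq2 t2 s2.
  exists (fun x => p2 (x + y), fun x => q2 (x + y), t2, s2) => /=; split.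
    split; first by split; exact: H1_shift.
    - by move=> x; exact: dis2.
    - by rewrite !ip_shift.
    - exact: Pr_shift.
    - by have := DD_shift g0 g4 gN c0 y Fh2 Fh2 => E; rewrite -E in le2.
  split=> //; apply: le_trans big _; apply: ler_wpM2l => //; exact: sqr_ge0.
pose p n := (u n).1.1.1; pose q n := (u n).1.1.2; pose t n := (u n).1.2; pose s n := (u n).2.
have ok' n : ok (p n) (q n) (t n) (s n) n by case: (Hu n).
have Hp n : H1 (p n) by case: (ok' n) => -[].
have Hq n : H1 (q n) by case: (ok' n) => -[].
have p1 n : ip (p n) (p n) = 1 by case: (ok' n) => _ _ [].
have q1 n : ip (q n) (q n) = 1 by case: (ok' n) => _ _ [].
have dis n x : p n x * q n x = 0 by case: (ok' n).
have tT n : 0 <= t n <= T by case: (okT _ _ _ _ _ (ok' n)).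
have sT n : 0 <= s n <= T by case: (okT _ _ _ _ _ (ok' n)).
have Ph n : Pr (p n) (q n) (t n) (s n) by case: (ok' n).
have Ah n : Adm (pairf (t n) (s n) (p n) (q n)).
  by apply: (Pr_Adm (Hp n) (Hq n)) => //; rewrite ?p1 ?q1.
have [F UF oF] := ultra_nat; have PF : ProperFilter F by exact: ultra_proper.
have [p0 Hp0 Wp] : exists2 u0, H1 u0 & wcvg F p u0.
  by apply: (H1_weak_compact (M := 1) UF Hp) => n; rewrite p1.
have [q0 Hq0 Wq] : exists2 u0, H1 u0 & wcvg F q u0.
  by apply: (H1_weak_compact (M := 1) UF Hq) => n; rewrite q1.
have [t0 ct] : exists l : R, t n @[n --> F] --> l.
  by apply: (ultra_cvg_bounded (M := T)) => // n; have /andP[a b] := tT n; rewrite ger0_norm.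
have [s0 cs] : exists l : R, s n @[n --> F] --> l.
  by apply: (ultra_cvg_bounded (M := T)) => // n; have /andP[a b] := sT n; rewrite ger0_norm.
have cz (a : R) : cst a n @[n --> F] --> a by exact: cvg_cst.
have t00 : 0 <= t0 by apply: (le_lim PF (cz 0) ct) => n; have /andP[] := tT n.
have s00 : 0 <= s0 by apply: (le_lim PF (cz 0) cs) => n; have /andP[] := sT n.
have t0p : 0 < t0.
  rewrite lt_neqAle t00 andbT; apply/eqP => t0z.
  have c2 : t n * t n * M @[n --> F] --> t0 * t0 * M by apply: cvgMl; exact: cvgM.
  have : d / 4 <= t0 * t0 * M by apply: (le_lim PF (cz _) c2) => n; rewrite -expr2; case: (Hu n) => _ [].
  by rewrite -t0z !mul0r; lra.
have p0p : 0 < ip p0 p0.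
  by apply: (weak_nonzero PF (M := 1) Hp Hp0 _ Wp rr0 s10) => n; [rewrite p1|case: (Hu n) => _ []].
pose h n := pairf (t n) (s n) (p n) (q n); pose h0 := pairf t0 s0 p0 q0.
pose k n := pairf (t n) (s n) (p n - p0) (q n - q0).
have Fh0 : FF h0 := FF_pairf Hp0 Hq0 t0 s0.
have h0ge x : 0 <= h0 x by exact: pairf_ge0.
have Hp' n : H1 (p n - p0) := siB SH (Hp n) Hp0.
have Hq' n : H1 (q n - q0) := siB SH (Hq n) Hq0.
have Fk n : FF (k n) := FF_pairf (Hp' n) (Hq' n) (t n) (s n).
have kge n x : 0 <= k n x.
  by have /andP[? _] := tT n; have /andP[? _] := sT n; exact: pairf_ge0.
have hd : DD (h n) (h n) @[n --> F] --> d.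
  apply: (@squeeze_cvgr _ _ _ _ (cst d) (fun n => d + n.+1%:R^-1)).
  - apply: nearW => n; rewrite /cst dle//; last exact: Ah.
    by case: (ok' n).
  - exact: cvg_cst.
  - apply: (cvg_sub oF); rewrite -[X in _ --> X]addr0.
    by apply: cvgD; [exact: cvg_cst|exact: harm_cvg].
have [kap [BB [ck dE kBB]]] := split_energy UF Hp Hq Hp0 Hq0 p1 q1 Wp Wq ct cs tT sT hd.
rewrite -/h0 in dE; have D0 := sib_ge0 SD Fh0.
have k0 : 0 <= kap by apply: (le_lim PF (cz 0) ck) => n; exact: (sib_ge0 SD (Fk n)).
have D0p : 0 < DD h0 h0.
  have Fp0 := FFsq Hp0.
  apply: lt_le_trans (_ : t0 ^+ 2 * DD (sq p0) (sq p0) <= _).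
    by rewrite mulr_gt0 ?exprn_gt0//; exact: (DD_sq_gt0 Hp0).
  rewrite /h0 (DD_pairr Hp0 Hq0 _ _ Fh0) (DD_pairl Hp0 Hq0 _ _ Fp0).
  rewrite mulrDr -addrA mulrA -expr2 lerDl addr_ge0//.
    by rewrite !mulr_ge0//; apply: (DD_ge0 g c0) => x; exact: sqr_ge0.
  by rewrite mulr_ge0//; apply: (DD_ge0 g c0) => // x; exact: sqr_ge0.
pose th (a b : R) := a *: p0 + b *: q0.
pose th' (a b : R) n := a *: (p n - p0) + b *: (q n - q0).
have Hth a b : H1 (th a b) := siD SH (siZ SH a Hp0) (siZ SH b Hq0).
have Hth' a b n : H1 (th' a b n) := siD SH (siZ SH a (Hp' n)) (siZ SH b (Hq' n)).
have form a b : a ^+ 2 + b ^+ 2 - ip (th' a b n) (th' a b n) @[n --> F] --> ip (th a b) (th a b) /\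
  (forall l : R, VV (k n) (th' a b n) (th' a b n) @[n --> F] --> l ->
    a ^+ 2 + b ^+ 2 <= VV h0 (th a b) (th a b) + l).
  apply: (split_form UF Hp Hq Hp0 Hq0 p1 q1 Wp Wq ct cs tT sT) => n.
    exact: (ip_disjoint (Hp n) (Hq n) (dis n)).
  have /andP[tn _] := tT n; have /andP[sn _] := sT n.
  have [_ _ h1 h2 _] := Ph n; have Fh := FF_pairf (Hp n) (Hq n) (t n) (s n).
  have SVh := SV Fh (fun x => pairf_ge0 (p n) (q n) x tn sn).
  have Ha := siZ SH a (Hp n); have Hb := siZ SH b (Hq n).
  rewrite (sib_sqrD SH Ha Hb) (sib_sqrZ SH a (Hp n)) (sib_sqrZ SH b (Hq n)) (sibZl SH a (Hp n) Hb) (sibZr SH b (Hq n) (Hp n)).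
  rewrite (sib_sqrD SVh Ha Hb) (sib_sqrZ SVh a (Hp n)) (sib_sqrZ SVh b (Hq n)) (sibZl SVh a (Hp n) Hb) (sibZr SVh b (Hq n) (Hp n)).
  rewrite (ip_disjoint (Hp n) (Hq n) (dis n)) (VV_disjoint Fh (dis n)) !mulr0 !addr0.
  by apply: lerD; apply: ler_wpM2l; rewrite ?sqr_ge0.
have ipth' a b n : ip (th' a b n) (th' a b n) <= 0 + (a ^+ 2 + b ^+ 2 - (a ^+ 2 + b ^+ 2 - ip (th' a b n) (th' a b n))).
  by rewrite add0r opprB addrC subrK.
have cip a b : ip (th' a b n) (th' a b n) @[n --> F] --> a ^+ 2 + b ^+ 2 - ip (th a b) (th a b).
  have [X _] := form a b; have := cvgB (cz (a ^+ 2 + b ^+ 2)) X.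
  rewrite (_ : (_ - _ : nat -> R) = fun n => ip (th' a b n) (th' a b n)); first by apply.
  by apply/funext => n; rewrite !fctE /cst opprB addrC subrK.
have ith a b : 0 <= ip (th a b) (th a b) := sib_ge0 SH (Hth a b).
have iA a b : ip (th a b) (th a b) <= a ^+ 2 + b ^+ 2.
  by rewrite -subr_ge0; apply: (le_lim PF (cz 0) (cip a b)) => n; exact: (sib_ge0 SH (Hth' a b n)).
have Zle n a b : VV (k n) (th' a b n) (th' a b n) <= Num.sqrt (M * DD (k n) (k n)) * ip (th' a b n) (th' a b n).
  exact: (DD_M HM (Hth' a b n) (Fk n)).
have Zlim a b : exists l : R, VV (k n) (th' a b n) (th' a b n) @[n --> F] --> l.
  have pb (v : nat -> fn) v0 n : H1 v0 -> H1 (v n) -> ip (v n) (v n) = 1 -> ip (v n - v0) (v n - v0) <= 2 + 2 * ip v0 v0.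
    move=> Hv0 Hv v1; have := sib_parallelogram SH Hv Hv0; have := sib_ge0 SH (siD SH Hv Hv0); rewrite v1; lra.
  pose B := 2 * (a ^+ 2 * (2 + 2 * ip p0 p0)) + 2 * (b ^+ 2 * (2 + 2 * ip q0 q0)).
  apply: (ultra_cvg_bounded (M := Num.sqrt (M * BB) * B)) => // n.
  rewrite ger0_norm ?(sib_ge0 (SV (Fk n) (kge n)))//; apply: le_trans (Zle n a b) _.
  apply: ler_pM; rewrite ?sqrtr_ge0 ?(sib_ge0 SH)//.
    by apply: ler_wsqrtr; apply: ler_wpM2l; [exact: ltW|exact: kBB].
  apply: le_trans (sib_sqrD_le SH (siZ SH a (Hp' n)) (siZ SH b (Hq' n))) _.
  rewrite (sib_sqrZ SH a (Hp' n)) (sib_sqrZ SH b (Hq' n)).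
  apply: lerD; apply: ler_wpM2l => //; apply: ler_wpM2l; rewrite ?sqr_ge0//.
    exact: (pb p p0 n Hp0 (Hp n) (p1 n)).
  exact: (pb q q0 n Hq0 (Hq n) (q1 n)).
(* First case: the remainder is too weak to satisfy the constraint, so the limit does, with energy d
   - kap <= d. *)
have [kM|kM] := ltP (M * kap) 1.
  exists h0; last by move=> f Af; apply: le_trans (dle f Af); rewrite dE lerDl.
  split => //; exists p0, q0; split => // a b; rewrite -/(th a b).
  pose r := Num.sqrt (M * kap).
  have r1 : r < 1 by rewrite -sqrtr1 ltr_sqrt.
  have r0 : 0 <= r := sqrtr_ge0 _.
  have cZ : Num.sqrt (M * DD (k n) (k n)) * ip (th' a b n) (th' a b n) @[n --> F] -->
      r * (a ^+ 2 + b ^+ 2 - ip (th a b) (th a b)).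
    by apply: cvgM (cip a b); apply: sqrt_cvg; apply: cvgMr.
  have [l cl] := Zlim a b; have [_ /(_ l cl) fl] := form a b.
  have lr : l <= r * (a ^+ 2 + b ^+ 2 - ip (th a b) (th a b)) by apply: (le_lim PF cl cZ) => n; exact: Zle.
  have [h1 h2] := weak_form_bound r1 (iA a b) fl lr.
  split=> // iz; have [C C0 HC] := VV_bound Fh0 h0ge.
  have := HC _ (Hth a b); rewrite iz mulr0 => /(h2 iz) ab0.
  have /eqP : a ^+ 2 + b ^+ 2 = 0 by apply/eqP; rewrite eq_le ab0 addr_ge0 ?sqr_ge0.
  by rewrite paddr_eq0 ?sqr_ge0// !sqrf_eq0 => /andP[/eqP -> /eqP ->].
exfalso.
suff : d <= kap by rewrite dE; lra.
(* M d < 2 and M kap >= 1: here the strict bound 2 / M enters. *)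
have MD : M * DD h0 h0 < 1.
  have : M * d < 2 by rewrite mulrC -ltr_pdivlMr.
  rewrite dE; lra.
pose r := Num.sqrt (M * DD h0 h0).
have r1 : r < 1 by rewrite -sqrtr1 ltr_sqrt.
have r0 : 0 <= r := sqrtr_ge0 _.
apply: (@le_eps _ _ _ (3 * kap)) => e e0 e1.
apply: le_trans (_ : (1 + e) ^+ 2 * kap <= _); last first.
  have : e ^+ 2 * kap <= e * kap by apply: ler_wpM2r => //; rewrite expr2 ler_piMr// ltW.
  rewrite (_ : (1 + e) ^+ 2 * kap = kap + 2 * (e * kap) + e ^+ 2 * kap); last by ring.
  lra.
rewrite leNgt; apply/negP => lt.
(* The constraint for the remainder with its density multiplied by 1 + e. Its limit is at least e (1
   - r)(a^2 + b^2), hence positive definite. Letting e tend to 0 gives d <= kap, although h0 has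
   positive energy. *)
pose X a b n := (1 + e) * VV (k n) (th' a b n) (th' a b n) - ip (th' a b n) (th' a b n).
have Xlim a b : exists2 l : R, X a b n @[n --> F] --> l & e * (1 - r) * (a ^+ 2 + b ^+ 2) <= l.
  have [l cl] := Zlim a b; have [_ /(_ l cl) fl] := form a b.
  exists ((1 + e) * l - (a ^+ 2 + b ^+ 2 - ip (th a b) (th a b))).
    by apply: cvgB (cip a b); apply: cvgMr.
  have Vr : VV h0 (th a b) (th a b) <= r * ip (th a b) (th a b).
    exact: (DD_M HM (Hth a b) Fh0).
  exact: (strict_form_bound e0 r0 (ltW r1) (ith a b) (iA a b) fl Vr).
(* Coefficients of the quadratic form X in (a, b), recovered from three values by polarization. *)
pose al n := X 1 0 n; pose ga n := X 0 1 n; pose be n := (X 1 1 n - X 1 0 n - X 0 1 n) / 2.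
have XE a b n : X a b n = a ^+ 2 * al n + 2 * a * b * be n + b ^+ 2 * ga n.
  have SVk := SV (Fk n) (kge n).
  have Y a' b' : X a' b' n = a' ^+ 2 * ((1 + e) * VV (k n) (p n - p0) (p n - p0) - ip (p n - p0) (p n - p0)) +
     2 * a' * b' * ((1 + e) * VV (k n) (p n - p0) (q n - q0) - ip (p n - p0) (q n - q0)) +
     b' ^+ 2 * ((1 + e) * VV (k n) (q n - q0) (q n - q0) - ip (q n - q0) (q n - q0)).
    have Ha := siZ SH a' (Hp' n); have Hb := siZ SH b' (Hq' n).
    rewrite /X /th' (sib_sqrD SH Ha Hb) (sib_sqrZ SH a' (Hp' n)) (sib_sqrZ SH b' (Hq' n)) (sibZl SH a' (Hp' n) Hb) (sibZr SH b' (Hq' n) (Hp' n)).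
    rewrite (sib_sqrD SVk Ha Hb) (sib_sqrZ SVk a' (Hp' n)) (sib_sqrZ SVk b' (Hq' n)) (sibZl SVk a' (Hp' n) Hb) (sibZr SVk b' (Hq' n) (Hp' n)).
    by ring.
  by rewrite /al /be /ga !Y; field.
have [la cla _] := Xlim 1 0; have [lg clg _] := Xlim 0 1; have [l1 cl1 _] := Xlim 1 1.
have clb : be n @[n --> F] --> (l1 - la - lg) / 2.
  by apply: cvgMl; apply: cvgB => //; exact: cvgB.
have [la0 det0] : 0 < la /\ 0 < la * lg - ((l1 - la - lg) / 2) ^+ 2.
  apply: (@quad_pos _ _ _ (e * (1 - r))); first by rewrite mulr_gt0// subr_gt0.
  move=> a b; have [l cl le] := Xlim a b.
  have cl' : X a b n @[n --> F] --> a ^+ 2 * la + 2 * a * b * ((l1 - la - lg) / 2) + b ^+ 2 * lg.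
    rewrite (_ : X a b = fun n => a ^+ 2 * al n + 2 * a * b * be n + b ^+ 2 * ga n); last by apply/funext => n; exact: XE.
    by apply: cvgD; [apply: cvgD; apply: cvgMr|apply: cvgMr].
  by have El : l = _ := cvg_unique (@Rhausdorff R) cl cl'; rewrite -El.
have cdet : al n * ga n - be n * be n @[n --> F] --> la * lg - ((l1 - la - lg) / 2) * ((l1 - la - lg) / 2).
  by apply: cvgB; apply: cvgM.
have cE : d - (1 + e) ^+ 2 * DD (k n) (k n) @[n --> F] --> d - (1 + e) ^+ 2 * kap.
  by apply: cvgB; [exact: cvg_cst|apply: cvgMr].
have F0 : Filter F by exact: filter_filter.
have ev1 := lim_gt F0 cla la0.
have ev2 : \forall n \near F, 0 < al n * ga n - be n * be n by apply: (lim_gt F0 cdet); rewrite -expr2.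
have ev3 : \forall n \near F, 0 < d - (1 + e) ^+ 2 * DD (k n) (k n) by apply: (lim_gt F0 cE); rewrite subr_gt0.
have [n [[n1 n2] n3]] := filter_ex (filterI (filterI ev1 ev2) ev3).
have e10 : 0 <= 1 + e by rewrite addr_ge0// ltW.
have Fek := siZ SD (1 + e) (Fk n).
have Aek : Adm ((1 + e) *: k n).
  split => //.
    by move=> x; rewrite -[_ x]/((1 + e) * k n x) mulr_ge0.
  exists (p n - p0), (q n - q0); split => // a b; rewrite -/(th' a b n).
  have VE : VV ((1 + e) *: k n) (th' a b n) (th' a b n) = (1 + e) * VV (k n) (th' a b n) (th' a b n).
    exact: (sibZl SD _ (Fk n) (FFM (Hth' a b n) (Hth' a b n))).
  have n2' : 0 < al n * ga n - be n ^+ 2 by rewrite expr2.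
  have [q0' qz] := quad_pos_form a b n1 n2'; rewrite -XE in q0' qz; rewrite VE; split.
    by rewrite -subr_ge0.
  move=> iz; apply: qz; rewrite /X iz subr0.
  have [C C0 HC] := VV_bound (Fk n) (kge n).
  have := HC _ (Hth' a b n); rewrite iz mulr0 => V0.
  have V1 := sib_ge0 (SV (Fk n) (kge n)) (Hth' a b n).
  have Vz : VV (k n) (th' a b n) (th' a b n) = 0 by apply/eqP; rewrite eq_le V0.
  by rewrite Vz mulr0.
by have := dle _ Aek; rewrite (sib_sqrZ SD _ (Fk n)) -subr_le0 leNgt n3.
Qed.
End minimizer.

(** * From the minimizing density to a solution *)

Lemma pos_lip (a b : R) : `|Num.max a 0 - Num.max b 0| <= `|a - b|.
Proof.
rewrite ler_norml; have := ler_norm (a - b); have := ler_norm (- (a - b)); rewrite normrN => h1 h2.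
have [a0|a0] := leP a 0; have [b0|b0] := leP b 0; rewrite ?(max_r a0) ?(max_l (ltW a0)) ?(max_r b0) ?(max_l (ltW b0));
  by apply/andP; split; lra.
Qed.

Lemma strong_sq (u : nat -> fn) (u0 : fn) (F : set_system nat) (PF : ProperFilter F) (B : R) :
  (forall n, H1 (u n)) -> H1 u0 -> (forall n, ip (u n) (u n) <= B) ->
  ip (u n - u0) (u n - u0) @[n --> F] --> (0 : R) -> nD (sq (u n) - sq u0) @[n --> F] --> (0 : R).
Proof.
move=> Hu Hu0 uB cv; have [C C0 HC] := DD_bound g0 g4 gN c0 (N := N).
have FF0 : Filter F by exact: filter_filter.
pose K := C * (2 * B + 2 * ip u0 u0).
have cK : Num.sqrt (K * ip (u n - u0) (u n - u0)) @[n --> F] --> (0 : R).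
  by rewrite -(sqrtr0 R) -(mulr0 K); apply: sqrt_cvg; apply: cvgMr.
apply: (@squeeze0 _ _ _ FF0 _ _ _ cK) => n; rewrite ger0_norm ?sinorm_ge0//; apply: ler_wsqrtr.
have Hm := siB SH (Hu n) Hu0; have Hp := siD SH (Hu n) Hu0.
have -> : sq (u n) - sq u0 = fun x => (u n - u0) x * (u n + u0) x.
  by apply/funext => x; rewrite !fctE; ring.
apply: le_trans (DD_mulmul g0 g4 gN c0 Hm Hp) _; apply: le_trans (HC _ _ Hm Hp) _.
rewrite /K mulrAC -mulrA; apply: ler_wpM2l; first exact: ltW.
apply: ler_wpM2l; first exact: (sib_ge0 SH Hm).
by apply: le_trans (sib_sqrD_le SH (Hu n) Hu0) _; have := uB n; lra.
Qed.

(** The parts are Lipschitz in L^2, which identifies their weak limits in H^1. As the squared norms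
    of the two parts add up to that of the function, which converges, the convergence is strong. *)
Lemma posneg_cvg (e eta : fn) (F : set_system nat) (UF : UltraFilter F) (dl : nat -> R) :
  H1 e -> H1 eta -> (forall n, `|dl n| <= 1) -> dl n @[n --> F] --> (0 : R) ->
  ip ((e + dl n *: eta)^\+ - e^\+) ((e + dl n *: eta)^\+ - e^\+) @[n --> F] --> (0 : R) /\
  ip ((e + dl n *: eta)^\- - e^\-) ((e + dl n *: eta)^\- - e^\-) @[n --> F] --> (0 : R).
Proof.
move=> He Het d1 d0; have PF : ProperFilter F by exact: ultra_proper.
have FF0 : Filter F by exact: filter_filter.
pose w n : fn := e + dl n *: eta; have Hw n : H1 (w n) := siD SH He (siZ SH (dl n) Het).
have lip n x : `|(w n)^\+ x - e^\+ x| <= `|(dl n *: eta) x| /\ `|(w n)^\- x - e^\- x| <= `|(dl n *: eta) x|.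
  split; apply: le_trans (pos_lip _ _) _; rewrite -[(w n) x]/(e x + (dl n *: eta) x).
    by rewrite addrAC subrr add0r.
  by rewrite opprK opprD addrAC addNr add0r normrN.
have dl2 : dl n ^+ 2 @[n --> F] --> (0 : R).
  have X : dl n * dl n @[n --> F] --> (0 * 0 : R) by exact: cvgM.
  by rewrite mul0r in X.
have Kb n : ip (w n) (w n) <= 2 * ip e e + 2 * ip eta eta.
  apply: le_trans (sib_sqrD_le SH He (siZ SH (dl n) Het)) _; rewrite (sib_sqrZ SH _ Het) lerD2l ler_pM2l//.
  by rewrite ler_piMl ?(sib_ge0 SH)// -real_normK ?num_real// exprn_ile1.
have wk (P : fn -> fn) : (forall u, H1 u -> H1 (P u) /\ ip (P u) (P u) <= ip u u) ->
    (forall n x, `|P (w n) x - P e x| <= `|(dl n *: eta) x|) -> wcvg F (fun n => P (w n)) (P e).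
  move=> HP lipP; have Hn n : H1 (P (w n)) by have [] := HP _ (Hw n).
  have HPe : H1 (P e) by have [] := HP _ He.
  have [Q HQ WQ] : exists2 u0, H1 u0 & wcvg F (fun n => P (w n)) u0.
    apply: (H1_weak_compact (M := 2 * ip e e + 2 * ip eta eta) UF Hn) => n; have [_ h] := HP _ (Hw n).
    exact: le_trans (Kb n).
  have QE : {ae mu, forall x, Q x = P e x}.
    have lQ := H1_sqint HQ; have lP := H1_sqint HPe; have lB := siB SL lQ lP.
    have c1 : dotL (P (w n)) (Q - P e) @[n --> F] --> dotL Q (Q - P e) by exact: (ip_weak_dotL Hn HQ WQ lB).
    have c2 : dotL (P (w n) - P e) (Q - P e) @[n --> F] --> (0 : R).
      pose K := sinorm dotL (Q - P e) * sinorm dotL eta.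
      have cK : `|dl n| * K @[n --> F] --> (0 : R).
        by rewrite -(mul0r K); apply: cvgMl; rewrite -(normr0 R); exact: cvg_norm.
      apply: (@squeeze0 _ _ _ FF0 _ _ _ cK) => n.
      have lD := siB SL (H1_sqint (Hn n)) lP; have le := H1_sqint Het.
      apply: le_trans (sib_CSn SL lD lB) _.
      rewrite [leRHS]mulrC /K -mulrA [leLHS]mulrC; apply: ler_wpM2l; first exact: sinorm_ge0.
      rewrite [leRHS]mulrC -(sinormZ SL _ le); apply: ler_wsqrtr; apply: dotL_le => //; first exact: (siZ SL).
      by move=> x; exact: lipP.
    have c3 : dotL (P (w n)) (Q - P e) - dotL (P (w n) - P e) (Q - P e) @[n --> F] --> dotL Q (Q - P e) - 0 by exact: cvgB.
    have c4 : dotL (P (w n)) (Q - P e) - dotL (P (w n) - P e) (Q - P e) @[n --> F] --> dotL (P e) (Q - P e).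
      rewrite (_ : (fun n => _) = cst (dotL (P e) (Q - P e))); first exact: cvg_cst.
      by apply/funext => n; rewrite (sibBl SL (H1_sqint (Hn n)) lP lB) opprB addrC subrK.
    have E : dotL Q (Q - P e) - 0 = dotL (P e) (Q - P e) by exact: (cvg_unique (@Rhausdorff R) c3 c4).
    have : dotL (Q - P e) (Q - P e) = 0 by rewrite (sibBl SL lQ lP lB) -E subr0 subrr.
    by move=> /(dotL_eq0 lB); apply: filterS => x; rewrite !fctE => /eqP; rewrite subr_eq0 => /eqP.
  by move=> v Hv; rewrite -(ip_ae HQ HPe Hv QE); exact: WQ.
have pnle (u : fn) : H1 u -> ip u^\+ u^\+ <= ip u u /\ ip u^\- u^\- <= ip u u.
  move=> Hu; rewrite (pn_sum SH Hu (ip_pos_neg0 Hu)) lerDl lerDr.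
  by rewrite (sib_ge0 SH (H1_pos Hu)) (sib_ge0 SH (H1_neg Hu)).
have Wp : wcvg F (fun n => (w n)^\+) e^\+.
  by apply: (wk (fun u => u^\+)) => [u Hu|n x]; [split; [exact: H1_pos|exact: (pnle u Hu).1]|exact: (lip n x).1].
have Wn : wcvg F (fun n => (w n)^\-) e^\-.
  by apply: (wk (fun u => u^\-)) => [u Hu|n x]; [split; [exact: H1_neg|exact: (pnle u Hu).2]|exact: (lip n x).2].
have Hp := H1_pos He; have Hn := H1_neg He.
have Hwp n := H1_pos (Hw n); have Hwn n := H1_neg (Hw n).
have cww : ip (w n) (w n) @[n --> F] --> ip e e.
  have X : ip e e + 2 * (dl n * ip e eta) + dl n ^+ 2 * ip eta eta @[n --> F] --> ip e e + 2 * (0 * ip e eta) + 0 * ip eta eta.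
    by apply: cvgD; [apply: cvgD; [exact: cvg_cst|apply: cvgMr; exact: cvgMl]|exact: cvgMl].
  rewrite !mul0r mulr0 !addr0 in X; rewrite (_ : (fun n => _) = fun n => ip e e + 2 * (dl n * ip e eta) + dl n ^+ 2 * ip eta eta)//.
  apply/funext => n; rewrite (sib_sqrD SH He (siZ SH (dl n) Het)) (sib_sqrZ SH _ Het) (sibZr SH _ Het He).
  by [].
have sum : ip ((w n)^\+ - e^\+) ((w n)^\+ - e^\+) + ip ((w n)^\- - e^\-) ((w n)^\- - e^\-) @[n --> F] --> (0 : R).
  have X : ip (w n) (w n) - 2 * (ip (w n)^\+ e^\+ + ip (w n)^\- e^\-) + ip e e @[n --> F] -->
      ip e e - 2 * (ip e^\+ e^\+ + ip e^\- e^\-) + ip e e.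
    apply: cvgD; last exact: cvg_cst.
    by apply: cvgB => //; apply: cvgMr; apply: cvgD; [exact: Wp|exact: Wn].
  rewrite -(pn_sum SH He (ip_pos_neg0 He)) (_ : ip e e - 2 * ip e e + ip e e = 0) in X; last by ring.
  rewrite (_ : (fun n => _) = fun n => ip (w n) (w n) - 2 * (ip (w n)^\+ e^\+ + ip (w n)^\- e^\-) + ip e e)//.
  apply/funext => n; rewrite (sib_sqrB SH (Hwp n) Hp) (sib_sqrB SH (Hwn n) Hn).
  rewrite (pn_sum SH (Hw n) (ip_pos_neg0 (Hw n))) (pn_sum SH He (ip_pos_neg0 He)); ring.
split; apply: (@squeeze0 _ _ _ FF0 _ _ _ sum) => n; rewrite ger0_norm ?lerDl ?lerDr ?(sib_ge0 SH)//.
- exact: (siB SH (Hwn n) Hn).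
- exact: (siB SH (Hwp n) Hp).
- exact: (siB SH (Hwp n) Hp).
- exact: (siB SH (Hwn n) Hn).
Qed.

Lemma nD_cvg_DD (F : set_system nat) (PF : ProperFilter F) (a b : nat -> fn) (a0 b0 : fn) :
  (forall n, FF (a n)) -> (forall n, FF (b n)) -> FF a0 -> FF b0 ->
  nD (a n - a0) @[n --> F] --> (0 : R) -> nD (b n - b0) @[n --> F] --> (0 : R) ->
  DD (a n) (b n) @[n --> F] --> DD a0 b0.
Proof.
move=> Fa Fb Fa0 Fb0 ca cb; have FF0 : Filter F by exact: filter_filter.
have Fda n := siB SD (Fa n) Fa0; have Fdb n := siB SD (Fb n) Fb0.
have c0' : DD (a n) (b n) - DD a0 b0 @[n --> F] --> (0 : R).
  have cK : nD (a n - a0) * (nD (b n - b0) + nD b0) + nD a0 * nD (b n - b0) @[n --> F] --> (0 : R).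
    rewrite [X in _ --> X](_ : _ = 0 * (0 + nD b0) + nD a0 * 0); last by ring.
    by apply: cvgD; [apply: cvgM => //; apply: cvgD => //; exact: cvg_cst|exact: cvgMr].
  apply: (@squeeze0 _ _ _ FF0 _ _ _ cK) => n.
  have -> : DD (a n) (b n) - DD a0 b0 = DD (a n - a0) (b n) + DD a0 (b n - b0).
    by rewrite (sibBl SD (Fa n) Fa0 (Fb n)) (sibBr SD (Fb n) Fb0 Fa0); ring.
  apply: le_trans (ler_normD _ _) _; apply: lerD; last exact: (sib_CSn SD Fa0 (Fdb n)).
  apply: le_trans (sib_CSn SD (Fda n) (Fb n)) _; apply: ler_wpM2l; first exact: sinorm_ge0.
  by have := sinormD SD (Fdb n) Fb0; rewrite subrK.
have := cvgD c0' (@cvg_cst _ (DD a0 b0) _ F FF0).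
rewrite add0r (_ : (_ + _ : nat -> R) = fun n => DD (a n) (b n)); first exact.
by apply/funext => n; rewrite !fctE /cst subrK.
Qed.

Lemma strong_ip (F : set_system nat) (PF : ProperFilter F) (u : nat -> fn) (u0 : fn) :
  (forall n, H1 (u n)) -> H1 u0 -> ip (u n - u0) (u n - u0) @[n --> F] --> (0 : R) ->
  (forall v, H1 v -> ip (u n) v @[n --> F] --> ip u0 v) /\ ip (u n) (u n) @[n --> F] --> ip u0 u0.
Proof.
move=> Hu Hu0 cv; have FF0 : Filter F by exact: filter_filter.
have A v : H1 v -> ip (u n) v @[n --> F] --> ip u0 v.
  move=> Hv; have c0' : ip (u n) v - ip u0 v @[n --> F] --> (0 : R).
    have cK : Num.sqrt (ip (u n - u0) (u n - u0)) * sinorm (@ip R N) v @[n --> F] --> (0 : R).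
      by rewrite -(mul0r (sinorm (@ip R N) v)) -(sqrtr0 R); apply: cvgMl; apply: sqrt_cvg.
    apply: (@squeeze0 _ _ _ FF0 _ _ _ cK) => n; rewrite -(sibBl SH (Hu n) Hu0 Hv).
    exact: (sib_CSn SH (siB SH (Hu n) Hu0) Hv).
  have := cvgD c0' (@cvg_cst _ (ip u0 v) _ F FF0).
  rewrite add0r (_ : (_ + _ : nat -> R) = fun n => ip (u n) v); first exact.
  by apply/funext => n; rewrite !fctE /cst subrK.
split => //.
have X : ip (u n - u0) (u n - u0) + 2 * ip (u n) u0 - ip u0 u0 @[n --> F] --> 0 + 2 * ip u0 u0 - ip u0 u0.
  by apply: cvgB; [apply: cvgD => //; apply: cvgMr; exact: A|exact: cvg_cst].
rewrite (_ : 0 + 2 * ip u0 u0 - ip u0 u0 = ip u0 u0) in X; last by ring.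
rewrite (_ : (fun n => _) = fun n => ip (u n - u0) (u n - u0) + 2 * ip (u n) u0 - ip u0 u0)//.
by apply/funext => n; rewrite (sib_sqrB SH (Hu n) Hu0); ring.
Qed.

Section extremal.
Variable f : fn.
Hypotheses (Af : Adm f) (fmin : forall f' : fn, Adm f' -> DD f f <= DD f' f').
Let Ff : FF f. Proof. by case: Af. Qed.
Let fge x : 0 <= f x. Proof. by case: Af. Qed.
Let SVf := SV Ff fge.

Lemma DDf_gt0 : 0 < DD f f.
Proof.
have [e1 [e [S1 [S Sp]]]] := Adm_spec Af.
rewrite lt_neqAle (sib_ge0 SD Ff) andbT; apply/eqP => E.
have : VV f e e = 0.
  apply/eqP; rewrite -sqrf_eq0 eq_le sqr_ge0 andbT VVE.
  by apply: le_trans (sib_CS SD Ff (FFsq (sp_H Sp))) _; rewrite -E mul0r.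
by rewrite (sp_eq Sp (sp_H Sp)) (sp_ee Sp) mulr1; have := sp_S Sp; lra.
Qed.

(** If S > 1 the density f / S would still be admissible, with less energy, since the parts of [e]
    satisfy the constraint for [f] with the factor S to spare. *)
Lemma spec_S1 (e1 e : fn) (S1 S : R) : spec2 f e1 e S1 S -> S = 1.
Proof.
move=> Sp; have He := sp_H Sp; have Hp := H1_pos He; have Hn := H1_neg He.
have S1' := sp_S Sp; have S0 : 0 < S by lra.
have dV := VV_disjoint Ff (pos_neg_disjoint e).
have Fi := siZ SD S^-1 Ff.
have A : Adm (S^-1 *: f).
  apply: (Adm_pair Hp Hn Fi _ (pos_neg_disjoint e) (sp_pos Sp) (sp_neg Sp)).
  - by move=> x; rewrite -[_ x]/(S^-1 * f x) mulr_ge0// invr_ge0 ltW.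
  - rewrite (sibZl SD _ Ff (FFsq Hp)) -VVE -(pn_pos SVf He dV) (sp_eq Sp Hp) (pn_pos SH He (ip_pos_neg0 He)).
    by rewrite mulKf// gt_eqF.
  - rewrite (sibZl SD _ Ff (FFsq Hn)) -VVE -[VV _ _ _]opprK -(pn_neg SVf He dV) (sp_eq Sp Hn) (pn_neg SH He (ip_pos_neg0 He)).
    by rewrite !mulrN opprK mulKf// gt_eqF.
have := fmin A; rewrite (sib_sqrZ SD _ Ff) -{1}[DD f f]mul1r ler_pM2r ?DDf_gt0// exprVn => h.
have : S ^+ 2 <= 1 by rewrite -invf_ge1// exprn_gt0.
by move=> h2; apply/eqP; rewrite eq_le S1' andbT -(@ler_pXn2r _ 2)// ?nnegrE ?(ltW S0)// expr1n.
Qed.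

(** With H the pair density, [Pr_le] gives DD(H, H) <= DD(f, H) and minimality gives DD(f, f) <=
    DD(H, H). Hence DD(f - H, f - H) <= 0, and Cauchy-Schwarz finishes. The two densities agree as
    elements of the energy space, not pointwise. *)
Lemma pair_represents (p q : fn) t s : H1 p -> H1 q -> (forall x, p x * q x = 0) -> 0 < ip p p -> 0 < ip q q ->
  ip p p <= DD f (sq p) -> ip q q <= DD f (sq q) -> Pr p q t s ->
  forall h, FF h -> DD f h = t * DD (sq p) h + s * DD (sq q) h.
Proof.
move=> Hp Hq dis p0 q0 fp fq P h Fh; rewrite -(DD_pairl Hp Hq t s Fh).
have FH := FF_pairf Hp Hq t s.
have le1 := Pr_le Hp Hq Ff fp fq P.
have le2 := fmin (Pr_Adm Hp Hq dis p0 q0 P).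
have z : DD (f - pairf t s p q) (f - pairf t s p q) <= 0.
  rewrite (sib_sqrB SD Ff FH); lra.
apply/eqP; rewrite -subr_eq0 -(sibBl SD Ff FH Fh) -sqrf_eq0 eq_le sqr_ge0 andbT.
apply: le_trans (sib_CS SD (siB SD Ff FH) Fh) _.
by rewrite mulr_le0_ge0// (sib_ge0 SD Fh).
Qed.

Section perturb.
Variable e : fn.
Hypotheses (He : H1 e) (eqe : forall w, H1 w -> VV f e w = ip e w)
  (ep : 0 < ip e^\+ e^\+) (en : 0 < ip e^\- e^\-).
Let p : fn := e^\+.
Let q : fn := e^\-.
Let Hp : H1 p := H1_pos He.
Let Hq : H1 q := H1_neg He.

(* The two parts of e + d eta are admissible competitors; divide the resulting
   inequality by d and let d -> 0+. *)
Lemma perturb (eta : fn) : H1 eta -> exists t s : R, Pr p q t s /\ 0 <= (t - s) * (ip p eta - VV f p eta).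
Proof.
move=> Het; have [F UF oF] := ultra_nat; have PF : ProperFilter F by exact: ultra_proper.
have FF0 : Filter F by exact: filter_filter.
pose dl n : R := n.+1%:R^-1.
have dl0 n : 0 < dl n by rewrite invr_gt0.
have dl1 n : `|dl n| <= 1 by rewrite gtr0_norm// invf_le1// ler1n.
have cdl : dl n @[n --> F] --> (0 : R) by apply: (cvg_sub oF); exact: harm_cvg.
have [cp cq] := posneg_cvg UF He Het dl1 cdl.
pose w n : fn := e + dl n *: eta; have Hw n : H1 (w n) := siD SH He (siZ SH (dl n) Het).
pose P n : fn := (w n)^\+; pose Q n : fn := (w n)^\-.
have HP n : H1 (P n) := H1_pos (Hw n). have HQ n : H1 (Q n) := H1_neg (Hw n).
rewrite -/p -/q in cp cq.
have [wP nP] := strong_ip PF HP Hp cp; have [wQ nQ] := strong_ip PF HQ Hq cq.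
have wb n : ip (w n) (w n) <= 2 * ip e e + 2 * ip eta eta.
  apply: le_trans (sib_sqrD_le SH He (siZ SH (dl n) Het)) _; rewrite (sib_sqrZ SH _ Het) lerD2l ler_pM2l//.
  by rewrite ler_piMl ?(sib_ge0 SH)// -real_normK ?num_real// exprn_ile1.
set K := 2 * ip e e + 2 * ip eta eta in wb.
have K0 : 0 <= K := le_trans (sib_ge0 SH (Hw 0)) (wb 0).
have PQ n : ip (w n) (w n) = ip (P n) (P n) + ip (Q n) (Q n) := pn_sum SH (Hw n) (ip_pos_neg0 (Hw n)).
have Pb n : ip (P n) (P n) <= K by have := wb n; rewrite PQ; have := sib_ge0 SH (HQ n); lra.
have Qb n : ip (Q n) (Q n) <= K by have := wb n; rewrite PQ; have := sib_ge0 SH (HP n); lra.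
have sP := strong_sq PF HP Hp Pb cp; have sQ := strong_sq PF HQ Hq Qb cq.
have FP n := FFsq (HP n). have FQ n := FFsq (HQ n). have Fp := FFsq Hp; have Fq := FFsq Hq.
have cPP := nD_cvg_DD PF FP FP Fp Fp sP sP; have cPQ := nD_cvg_DD PF FP FQ Fp Fq sP sQ.
have cQQ := nD_cvg_DD PF FQ FQ Fq Fq sQ sQ.
have a0 := DD_sq_gt0 Hp ep; have b0 := DD_sq_gt0 Hq en.
set a := DD (sq p) (sq p) in a0 cPP; set b := DD (sq q) (sq q) in b0 cQQ.
pose m := Num.min (a / 2) (b / 2).
have m0 : 0 < m by rewrite lt_min !divr_gt0.
have ma : m < a by apply: (@le_lt_trans _ _ (a / 2)); [rewrite ge_min lexx|lra].
have mb : m < b by apply: (@le_lt_trans _ _ (b / 2)); [rewrite ge_min lexx orbT|lra].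
(* An open condition, satisfied near the filter, that keeps both parts and their energies away from
   0. *)
pose good n := [/\ 0 < ip (P n) (P n), 0 < ip (Q n) (Q n), m < DD (sq (P n)) (sq (P n)) & m < DD (sq (Q n)) (sq (Q n))].
have gF : \forall n \near F, good n.
  have e1 := lim_gt FF0 nP ep; have e2 := lim_gt FF0 nQ en.
  have e3 := lim_gt FF0 cPP ma; have e4 := lim_gt FF0 cQQ mb.
  by apply: filterS (filterI (filterI e1 e2) (filterI e3 e4)) => n [[h1 h2] [h3 h4]]; split.
pose B := 2 * K / m; have B0 : 0 <= B by rewrite divr_ge0 ?mulr_ge0// ltW.
have Pr_bd n t s : good n -> Pr (P n) (Q n) t s -> t <= B /\ s <= B.
  case=> g1 g2 g3 g4' [t0 s0 _ _ E].
  have E2 : t ^+ 2 * m + s ^+ 2 * m <= (t + s) * K.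
    apply: le_trans (_ : t * ip (P n) (P n) + s * ip (Q n) (Q n) <= _).
      rewrite -E (DD_pairl (HP n) (HQ n) t s (FF_pairf (HP n) (HQ n) t s)).
      rewrite !(DD_pairr (HP n) (HQ n) t s)//.
      have d1 : 0 <= DD (sq (P n)) (sq (Q n)) by apply: (DD_ge0 g c0) => x; exact: sqr_ge0.
      have d2 : 0 <= DD (sq (Q n)) (sq (P n)) by apply: (DD_ge0 g c0) => x; exact: sqr_ge0.
      have x1 : t ^+ 2 * m <= t ^+ 2 * DD (sq (P n)) (sq (P n)) by apply: ler_wpM2l; [exact: sqr_ge0|exact: ltW].
      have x2 : s ^+ 2 * m <= s ^+ 2 * DD (sq (Q n)) (sq (Q n)) by apply: ler_wpM2l; [exact: sqr_ge0|exact: ltW].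
      have x3 : 0 <= t * s * DD (sq (P n)) (sq (Q n)) by rewrite !mulr_ge0.
      have x4 : 0 <= s * t * DD (sq (Q n)) (sq (P n)) by rewrite !mulr_ge0.
      lra.
    by rewrite mulrDl; apply: lerD; apply: ler_wpM2l.
  have ts : (t + s) ^+ 2 * m <= 2 * K * (t + s).
    have : (t + s) ^+ 2 * m <= 2 * (t ^+ 2 * m + s ^+ 2 * m).
      rewrite -subr_ge0 (_ : _ - _ = (t - s) ^+ 2 * m); last by ring.
      by rewrite mulr_ge0 ?sqr_ge0// ltW.
    lra.
  have tsB : t + s <= B.
    rewrite /B ler_pdivlMr//; have [z|nz] := eqVneq (t + s) 0; first by rewrite z mul0r mulr_ge0.
    have p1 : 0 < t + s by rewrite lt_neqAle eq_sym nz addr_ge0.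
    by rewrite -(ler_pM2r p1); apply: le_trans ts; rewrite expr2 mulrAC.
  by split; lra.
have /choice[ts Hts] n : exists ts : R * R, [/\ 0 <= ts.1 <= B, 0 <= ts.2 <= B & good n -> Pr (P n) (Q n) ts.1 ts.2].
  have [gn|ngn] := pselect (good n); last by exists (0, 0); rewrite lexx B0.
  have [g1 g2 _ _] := gn; have [t [s X]] := Pr_exists (HP n) (HQ n) g1 g2.
  have [h1 h2] := Pr_bd _ _ _ gn X; have [t0 s0 _ _ _] := X.
  by exists (t, s); rewrite /= h1 h2 t0 s0.
pose t n := (ts n).1; pose s n := (ts n).2.
have tB n : 0 <= t n <= B by case: (Hts n). have sB n : 0 <= s n <= B by case: (Hts n).
have PrF : \forall n \near F, Pr (P n) (Q n) (t n) (s n) by apply: filterS gF => n; case: (Hts n).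
have [t0 ct] : exists l : R, t n @[n --> F] --> l.
  by apply: (ultra_cvg_bounded (M := B)) => // n; have /andP[? ?] := tB n; rewrite ger0_norm.
have [s0 cs] : exists l : R, s n @[n --> F] --> l.
  by apply: (ultra_cvg_bounded (M := B)) => // n; have /andP[? ?] := sB n; rewrite ger0_norm.
have cz (r : R) : cst r n @[n --> F] --> r by exact: cvg_cst.
have cHP : t n * DD (sq (P n)) (sq (P n)) + s n * DD (sq (P n)) (sq (Q n)) @[n --> F] --> t0 * a + s0 * DD (sq p) (sq q).
  by apply: cvgD; apply: cvgM.
have cHQ : t n * DD (sq (P n)) (sq (Q n)) + s n * DD (sq (Q n)) (sq (Q n)) @[n --> F] --> t0 * DD (sq p) (sq q) + s0 * b.
  by apply: cvgD; apply: cvgM.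
have DHP t' s' (u v : fn) : H1 u -> H1 v -> DD (pairf t' s' u v) (sq u) = t' * DD (sq u) (sq u) + s' * DD (sq u) (sq v).
  by move=> Hu Hv; rewrite (DD_pairl Hu Hv t' s' (FFsq Hu)) (sibC SD (FFsq Hv) (FFsq Hu)).
have DHQ t' s' (u v : fn) : H1 u -> H1 v -> DD (pairf t' s' u v) (sq v) = t' * DD (sq u) (sq v) + s' * DD (sq v) (sq v).
  by move=> Hu Hv; rewrite (DD_pairl Hu Hv t' s' (FFsq Hv)).
exists t0, s0; split.
  split.
  - by apply: (le_lim PF (cz 0) ct) => n; case/andP: (tB n).
  - by apply: (le_lim PF (cz 0) cs) => n; case/andP: (sB n).
  - rewrite (DHP _ _ _ _ Hp Hq); apply: (le_lim_near PF nP cHP); apply: filterS PrF => n [_ _ h _ _].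
    by rewrite -(DHP _ _ _ _ (HP n) (HQ n)).
  - rewrite (DHQ _ _ _ _ Hp Hq); apply: (le_lim_near PF nQ cHQ); apply: filterS PrF => n [_ _ _ h _].
    by rewrite -(DHQ _ _ _ _ (HP n) (HQ n)).
  - have FH := FF_pairf Hp Hq t0 s0.
    rewrite (DD_pairr Hp Hq t0 s0 FH) (DHP _ _ _ _ Hp Hq) (DHQ _ _ _ _ Hp Hq).
    have c1 : t n * (t n * DD (sq (P n)) (sq (P n)) + s n * DD (sq (P n)) (sq (Q n))) +
        s n * (t n * DD (sq (P n)) (sq (Q n)) + s n * DD (sq (Q n)) (sq (Q n))) @[n --> F] -->
        t0 * (t0 * a + s0 * DD (sq p) (sq q)) + s0 * (t0 * DD (sq p) (sq q) + s0 * b).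
      by apply: cvgD; apply: cvgM.
    have c2 : t n * ip (P n) (P n) + s n * ip (Q n) (Q n) @[n --> F] --> t0 * ip p p + s0 * ip q q.
      by apply: cvgD; apply: cvgM.
    have ev : \forall n \near F, t n * (t n * DD (sq (P n)) (sq (P n)) + s n * DD (sq (P n)) (sq (Q n))) +
        s n * (t n * DD (sq (P n)) (sq (Q n)) + s n * DD (sq (Q n)) (sq (Q n))) = t n * ip (P n) (P n) + s n * ip (Q n) (Q n).
      apply: filterS PrF => n [_ _ _ _ <-].
      rewrite (DD_pairr (HP n) (HQ n) _ _ (FF_pairf (HP n) (HQ n) _ _)).
      by rewrite (DHP _ _ _ _ (HP n) (HQ n)) (DHQ _ _ _ _ (HP n) (HQ n)).
    apply/eqP; rewrite eq_le; apply/andP; split.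
      by apply: (le_lim_near PF c1 c2); apply: filterS ev => n ->.
    by apply: (le_lim_near PF c2 c1); apply: filterS ev => n ->.
have VVc (u : nat -> fn) u0 : (forall n, H1 (u n)) -> H1 u0 -> (forall n, ip (u n) (u n) <= K) ->
    (forall v, H1 v -> ip (u n) v @[n --> F] --> ip u0 v) -> VV f (u n) eta @[n --> F] --> VV f u0 eta.
  move=> Hu Hu0 uK wu; pose K' := K + ip eta eta.
  apply: (weak_VV N0 g0 g4 gN c0 PF (M := K') Hu Hu0 _ wu (w := fun=> eta) _ Het) => //.
  - by move=> n; apply: le_trans (uK n) _; rewrite lerDl (sib_ge0 SH).
  - by move=> n; rewrite lerDr.
  - by move=> v _; exact: cvg_cst.
pose Bf (u v : fn) := ip u v - VV f u v.
have cBP : t n * Bf (P n) eta - s n * Bf (Q n) eta @[n --> F] --> t0 * Bf p eta - s0 * Bf q eta.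
  apply: cvgB; apply: cvgM => //; apply: cvgB; [exact: wP|exact: VVc|exact: wQ|exact: VVc].
(* [Bf e eta = 0] by the equation of [e], and e = p - q. *)
have Bpq : Bf p eta = Bf q eta.
  have : Bf e eta = 0 by rewrite /Bf eqe// subrr.
  rewrite /Bf -{1 2}(posneg_eq e) (sibBl SH Hp Hq Het) (sibBl SVf Hp Hq Het); lra.
suff : 0 <= t0 * Bf p eta - s0 * Bf q eta by rewrite -Bpq -mulrBl.
apply: (le_lim_near PF (cz 0) cBP); near=> n; rewrite /cst.
have gn : good n by near: n; exact: gF.
have Pn : Pr (P n) (Q n) (t n) (s n) by case: (Hts n) => _ _; exact.
have [g1 g2 _ _] := gn.
have dis := pos_neg_disjoint (w n).
have AH := Pr_Adm (HP n) (HQ n) dis g1 g2 Pn.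
have FH := FF_pairf (HP n) (HQ n) (t n) (s n).
have h1 := fmin AH; have h2 := sib_ge0 SD (siB SD Ff FH); rewrite (sib_sqrB SD Ff FH) in h2.
(* Minimality against the perturbed pair H, together with DD(f - H, f - H) >= 0. With
   complementarity this says that the weighted sum of the constraint defects of the two parts is
   nonnegative, and those defects are of first order in [dl n]. *)
have h3 : DD f (pairf (t n) (s n) (P n) (Q n)) <= DD (pairf (t n) (s n) (P n) (Q n)) (pairf (t n) (s n) (P n) (Q n)) by lra.
have [_ _ _ _ E] := Pn; rewrite E (DD_pairr (HP n) (HQ n) _ _ Ff) in h3.
have dV := VV_disjoint Ff dis.
have Hde := siZ SH (dl n) Het.
have EP : ip (P n) (P n) - VV f (P n) (P n) = dl n * Bf (P n) eta.
  rewrite -(pn_pos SH (Hw n) (ip_pos_neg0 (Hw n))) -(pn_pos SVf (Hw n) dV) -/(P n) /w.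
  rewrite (sibDl SH He Hde (HP n)) (sibDl SVf He Hde (HP n)) (eqe (HP n)) (sibZl SH _ Het (HP n)) (sibZl SVf _ Het (HP n)).
  rewrite (sibC SH Het (HP n)) (sibC SVf Het (HP n)) /Bf; ring.
have EQ : ip (Q n) (Q n) - VV f (Q n) (Q n) = - (dl n * Bf (Q n) eta).
  have := pn_neg SH (Hw n) (ip_pos_neg0 (Hw n)); have := pn_neg SVf (Hw n) dV; rewrite -/(Q n) /w.
  rewrite (sibDl SH He Hde (HQ n)) (sibDl SVf He Hde (HQ n)) (eqe (HQ n)) (sibZl SH _ Het (HQ n)) (sibZl SVf _ Het (HQ n)).
  rewrite (sibC SH Het (HQ n)) (sibC SVf Het (HQ n)) /Bf; lra.
rewrite -(pmulr_rge0 _ (dl0 n)).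
have -> : dl n * (t n * Bf (P n) eta - s n * Bf (Q n) eta) =
    t n * (ip (P n) (P n) - VV f (P n) (P n)) + s n * (ip (Q n) (Q n) - VV f (Q n) (Q n)) by rewrite EP EQ; ring.
rewrite !VVE; lra.
Unshelve. all: by end_near.
Qed.

End perturb.

(** Perturbing in opposite directions eta and -eta yields two multiplier pairs ordered in opposite
    ways, both of which represent [f]. A convex combination with equal multipliers represents it as
    well, so f is a multiple of p^2 + q^2 = e^2 in the energy space. *)
Lemma extremal_solution : exists U : fn, [/\ H1 U, ~ ae_zero U^\+, ~ ae_zero U^\-,
  forall v, H1 v -> ip U v = DD (sq U) (fun x => U x * v x) & DD (sq U) (sq U) = DD f f].
Proof.
have [e1 [e [S1 [S Sp]]]] := Adm_spec Af.
have Sone := spec_S1 Sp; have He := sp_H Sp.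
have eqe v : H1 v -> VV f e v = ip e v by move=> Hv; rewrite (sp_eq Sp Hv) Sone mul1r.
have ep := sp_pos Sp; have en := sp_neg Sp.
pose p : fn := e^\+; pose q : fn := e^\-.
have Hp : H1 p := H1_pos He; have Hq : H1 q := H1_neg He; have dis := pos_neg_disjoint e.
have dV := VV_disjoint Ff dis.
have fp : DD f (sq p) = ip p p.
  by rewrite -VVE -(pn_pos SVf He dV) (eqe _ Hp) (pn_pos SH He (ip_pos_neg0 He)).
have fq : DD f (sq q) = ip q q.
  by rewrite -VVE -[VV _ _ _]opprK -(pn_neg SVf He dV) (eqe _ Hq) (pn_neg SH He (ip_pos_neg0 He)) opprK.
have rep t s : Pr p q t s -> forall h, FF h -> DD f h = t * DD (sq p) h + s * DD (sq q) h.
  by move=> P h Fh; apply: (pair_represents Hp Hq dis ep en _ _ P Fh); rewrite ?fp ?fq.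
(* Otherwise e^+ would satisfy the eigenvalue equation by itself; the maximum principle would then
   make e^- vanish. *)
have [eta [Het Bp]] : exists eta, H1 eta /\ 0 < ip p eta - VV f p eta.
  apply: contrapT => /forallNP ne.
  have Bz eta : H1 eta -> VV f p eta = 1 * ip p eta.
    move=> Het; have n1 : ~ 0 < ip p eta - VV f p eta by move=> h; apply: (ne eta).
    have n2 : ~ 0 < ip p (- eta) - VV f p (- eta) by move=> h; apply: (ne (- eta)); split => //; exact: (siN SH Het).
    rewrite (sibNr SH Het Hp) (sibNr SVf Het Hp) in n2; move/negP: n1; move/negP: n2; rewrite -!leNgt; lra.
  have pge x : 0 <= p x by rewrite /p /funrpos le_max lexx orbT.
  have zq : ae_zero q.
    by apply: (max_principle_eig Ff fge Hp pge ep ltr01 Bz (H1_sqint Hq)); apply: aeW => x; exact: dis.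
  by move: en; rewrite (ae_zero_ip Hq zq) ltxx.
have [t1 [s1 [P1 ts1]]] := perturb He eqe ep en Het.
have [t2 [s2 [P2 ts2]]] := perturb He eqe ep en (siN SH Het).
have d1 : 0 <= t1 - s1 by move: ts1; rewrite pmulr_lge0.
have d2 : 0 <= s2 - t2.
  by move: ts2; rewrite (sibNr SH Het Hp) (sibNr SVf Het Hp) -opprD mulrN -mulNr pmulr_lge0// opprB.
have [tau rept] : exists tau : R, forall h, FF h -> DD f h = tau * (DD (sq p) h + DD (sq q) h).
  have [z|nz] := eqVneq (t1 - s1) 0.
    by exists t1 => h Fh; rewrite (rep _ _ P1 h Fh) mulrDr; congr (_ + _ * _); lra.
  have D0 : 0 < (t1 - s1) + (s2 - t2) by apply: ltr_pwDl => //; rewrite lt_neqAle eq_sym nz.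
  (* The weight for which l (t1 - s1) + (1 - l)(t2 - s2) = 0. *)
  pose l := (s2 - t2) / ((t1 - s1) + (s2 - t2)).
  exists (l * t1 + (1 - l) * t2) => h Fh.
  have E : l * s1 + (1 - l) * s2 = l * t1 + (1 - l) * t2.
    by rewrite /l; field; rewrite gt_eqF.
  rewrite mulrDr -{2}E.
  transitivity (l * DD f h + (1 - l) * DD f h); first by ring.
  by rewrite {1}(rep _ _ P1 h Fh) (rep _ _ P2 h Fh); ring.
have Fp := FFsq Hp; have Fq := FFsq Hq; have Fe := FFsq He.
have sqe : sq e = sq p + sq q.
  apply/funext => x; have ex : e x = p x - q x by rewrite -{1}(posneg_eq e).
  by rewrite !fctE ex sqrrB (dis x : p x * q x = 0) mul0rn subr0.
have repe h : FF h -> DD f h = tau * DD (sq e) h.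
  by move=> Fh; rewrite rept// sqe (sibDl SD Fp Fq Fh).
have tau0 : 0 < tau.
  have := DDf_gt0; rewrite repe// => h; rewrite ltNge; apply/negP => tn.
  have : tau * DD (sq e) f <= 0.
    by apply: mulr_le0_ge0 => //; apply: (DD_ge0 g c0) => // x; exact: sqr_ge0.
  by rewrite leNgt h.
(* The equation for [e] is linear with weight tau e^2; scaling by sqrt(tau) makes the weight the
   square of the solution itself. *)
pose r := Num.sqrt tau; have r2 : r ^+ 2 = tau by rewrite sqr_sqrtr// ltW.
have r0 : 0 < r by rewrite sqrtr_gt0.
have HU := siZ SH r He.
have sqU : sq (r *: e) = tau *: sq e by apply/funext => x; rewrite -r2; exact: exprMn.
have posU : (r *: e)^\+ = r *: p.
  by apply/funext => x; rewrite /p /funrpos -[LHS]/(Num.max (r * e x) 0) -[RHS]/(r * Num.max (e x) 0) maxr_pMr ?mulr0// ltW.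
have negU : (r *: e)^\- = r *: q.
  by apply/funext => x; rewrite /q /funrneg -[LHS]/(Num.max (- (r * e x)) 0) -[RHS]/(r * Num.max (- e x) 0) maxr_pMr ?mulr0 ?mulrN// ltW.
exists (r *: e); split => //.
- rewrite posU => z; have := ae_zero_ip (siZ SH r Hp) z; rewrite (sib_sqrZ SH r Hp) => /eqP.
  by rewrite mulf_eq0 sqrf_eq0 (gt_eqF r0) (gt_eqF ep).
- rewrite negU => z; have := ae_zero_ip (siZ SH r Hq) z; rewrite (sib_sqrZ SH r Hq) => /eqP.
  by rewrite mulf_eq0 sqrf_eq0 (gt_eqF r0) (gt_eqF en).
- move=> v Hv; rewrite (sibZl SH r He Hv) -eqe// sqU.
  have -> : (fun x => (r *: e) x * v x) = r *: (fun x => e x * v x).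
    by apply/funext => x; rewrite -[LHS]/(r * e x * v x) -mulrA.
  have Fev := FFM He Hv.
  by rewrite (sibZl SD tau Fe (siZ SD r Fev)) (sibZr SD r Fev Fe) mulrCA -repe.
- rewrite sqU (sibZl SD tau Fe (siZ SD tau Fe)) -repe; last exact: (siZ SD tau Fe).
  by rewrite (sibC SD Ff (siZ SD tau Fe)) (sibZl SD tau Fe Ff) -repe.
Qed.

End extremal.

End choquard_kernel.

(** * Translation to the action functional and the Nehari nodal set *)

Section choquard.
Context {R : realType} {N : nat}.
Implicit Types (x y z : 'rV[R]_N) (i : 'I_N).
Local Notation mu := (@lebesgue_rV R N).
Local Notation fn := ('rV[R]_N -> R).
Local Notation sq u := (fun x : 'rV[R]_N => u x ^+ 2).
Variable alpha : R.
Hypotheses (N0 : (0 < N)%N) (halpha : Num.max (N%:R - 4) 0 < alpha < N%:R).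

Let g : R := N%:R - alpha.
Let c : R := @riesz_const R N alpha.

Let alpha0 : 0 < alpha. Proof. by move: halpha; rewrite gt_max => /andP[/andP[]]. Qed.
Let g0 : 0 < g. Proof. by move: halpha => /andP[_]; rewrite /g subr_gt0. Qed.
Let g4 : g < 4.
Proof. by move: halpha; rewrite gt_max /g => /andP[/andP[? _] _]; lra. Qed.
Let gN : g < N%:R. Proof. by rewrite /g gtrBl. Qed.

Let c0 : 0 < c.
Proof.
have [G1 _] : 0 < Euler_Gamma ((N%:R - alpha) / 2) /\ True.
  by split => //; apply: (Euler_GammaE _).1; rewrite divr_gt0.
have G2 : 0 < Euler_Gamma (alpha / 2) by apply: (Euler_GammaE _).1; rewrite divr_gt0.
by rewrite /c /riesz_const divr_gt0// !mulr_gt0// powR_gt0// pi_gt0.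
Qed.

(** The equality includes the origin, where both sides are 0 by the conventions for powers and
    inverses. *)
Lemma riesz_rk : @riesz R N alpha = rk g c.
Proof.
apply/funext => x; rewrite /riesz /rk /kz powRN; congr (_ * _^-1).
rewrite /enorm -/(sqn x) -powR12_sqrt ?sqn_ge0// -powRrM; congr (_ `^ _).
by rewrite /g mulrC.
Qed.

Let abs_sq (u : fn) : (fun y => `|u y| ^+ 2) = sq u.
Proof. by apply/funext => y; rewrite real_normK ?num_real. Qed.

Lemma actionE (u : fn) : H1 u -> action alpha u = 1 / 2 * ip u u - 1 / 4 * DD g c (sq u) (sq u).
Proof.
move=> Hu; rewrite /action riesz_rk abs_sq -(DD_conv g0 g4 gN c0 (FFsq Hu) (FFsq Hu)).
congr (_ * _ - _ * _); congr Rintegral; apply/funext => x; rewrite real_normK ?num_real//.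
Qed.

Lemma dactionE (u phi : fn) : H1 u -> H1 phi ->
  daction alpha u phi = ip u phi - DD g c (sq u) (fun x => u x * phi x).
Proof.
move=> Hu Hp; have SD := DD_si N0 g0 g4 gN c0.
rewrite /daction riesz_rk abs_sq (sibC SD (FFsq Hu) (FFM Hu Hp)) -(DD_conv g0 g4 gN c0 (FFsq Hu) (FFM Hu Hp)).
by congr (_ - _); congr Rintegral; apply/funext => x; rewrite mulrA.
Qed.

(** The two Nehari conditions say that v^+ and v^- satisfy the constraint for the density v^2 with
    equality. Their sum gives |v|^2 = DD(v^2, v^2), whence the factor 1/2 - 1/4. *)
Lemma nehari_Adm (v : fn) : nehari_nod alpha v -> Adm g c (sq v) /\ action alpha v = 4^-1 * DD g c (sq v) (sq v).
Proof.
case=> Hv [np nn] dp dn; have SD := DD_si N0 g0 g4 gN c0; have SH := @ip_si R N.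
have Hp := H1_pos Hv; have Hn := H1_neg Hv; have dis := pos_neg_disjoint v.
have Fv := FFsq Hv; have SV := V_si N0 g0 g4 gN c0 Fv (fun x => sqr_ge0 (v x)).
have dV := VV_disjoint N0 g0 g4 gN c0 Fv dis.
have Ep : ip v^\+ v^\+ = VV g c (sq v) v^\+ v^\+.
  move: dp; rewrite dactionE// => /eqP; rewrite subr_eq0 (pn_pos SH Hv (ip_pos_neg0 Hv)) => /eqP ->.
  exact: (pn_pos SV Hv dV).
have En : ip v^\- v^\- = VV g c (sq v) v^\- v^\-.
  move: dn; rewrite dactionE// => /eqP; rewrite subr_eq0 (pn_neg SH Hv (ip_pos_neg0 Hv)) => /eqP E.
  by apply/eqP; rewrite -eqr_opp E; apply/eqP; exact: (pn_neg SV Hv dV).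
split.
  apply: (Adm_pair N0 g0 g4 gN c0 Hp Hn Fv (fun x => sqr_ge0 (v x)) dis).
  - exact: ip_gt0.
  - exact: ip_gt0.
  - by rewrite Ep.
  - by rewrite En.
rewrite (actionE Hv) (pn_sum SH Hv (ip_pos_neg0 Hv)) Ep En -(pn_sum SV Hv dV) VVE; lra.
Qed.

Lemma ground_state : exists u : fn, [/\ weak_solution alpha u, ~ ae_zero u^\+, ~ ae_zero u^\- &
  (action alpha u)%:E = @c_nod R N alpha].
Proof.
have SD := DD_si N0 g0 g4 gN c0.
have [M [w HM]] := M_exists N0 g0 g4 gN c0.
have [f Af fmin] := minimizer N0 g0 g4 gN c0 HM.
have [U [HU Up Un eqU DU]] := extremal_solution N0 g0 g4 gN c0 Af fmin.
have dU v : H1 v -> daction alpha U v = 0 by move=> Hv; rewrite dactionE// eqU// subrr.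
have aU : action alpha U = 4^-1 * DD g c f f.
  by rewrite (actionE HU) (eqU _ HU) -DU; rewrite (_ : DD g c (sq U) (fun x => U x * U x) = DD g c (sq U) (sq U))//; lra.
exists U; split => //; apply/eqP; rewrite eq_le; apply/andP; split.
  apply: le_ereal_inf_tmp => _ [v nv <-]; have [Av ->] := nehari_Adm nv.
  by rewrite lee_fin aU ler_pM2l ?invr_gt0//; exact: fmin.
apply: ge_ereal_inf; exists (action alpha U)%:E => //; exists U => //; split=> //; apply: dU; [exact: H1_pos|exact: H1_neg].
Qed.

End choquard.

Theorem theorem1 (R : realType) (N : nat) (alpha : R) (hN : (1 <= N)%N)
  (halpha : Num.max (N%:R - 4) 0 < alpha < N%:R) :
  exists u : 'rV[R]_N -> R,
    [/\ weak_solution alpha u,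
        ~ ae_zero (u^\+),
        ~ ae_zero (u^\-) &
        (action alpha u)%:E = @c_nod R N alpha].
Proof. exact: ground_state. Qed.
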